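(* Let $N$ be a positive integer and let $\mu$ be a Young diagram with $m$ boxes and at most $N$ rows. Let $\mathcal U$ be a standard $\mu$-tableau with contents $c_1,\dots,c_m$ and associated idempotent $\mathcal E_{\mathcal U}$, and let $\widetilde{\mathbb T}_\mu(u)$ be the Laurent series in $u$ with coefficients in the $h$-adically completed algebra $\widetilde{\mathrm{DY}}_{-N}(\mathfrak{gl}_N)$ given by $$\widetilde{\mathbb T}_\mu(u)=\mathrm{tr}_{1,\dots,m}\ \mathcal E_{\mathcal U}\,T^+_1(u+hc_1)\cdots T^+_m(u+hc_m)\,T_m(u+hc_m-hN/2)^{-1}\cdots T_1(u+hc_1-hN/2)^{-1}.$$ Then all coefficients of $\widetilde{\mathbb T}_\mu(u)$ belong to the center of the $h$-adically completed algebra $\widetilde{\mathrm{DY}}_{-N}(\mathfrak{gl}_N)$.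
   Context: Double Yangian over $\mathbb C[[h]]$. Let $P$ be the permutation operator on $\mathbb C^N\otimes\mathbb C^N$, $R(u)=1-P\,h\,u^{-1}$ and $\overline R(u)=g(u/h)R(u)$, where $g(u)=1+\sum_{i\geqslant1}g_iu^{-i}$, $g_i\in\mathbb C$, is the unique series with $g(u+N)=g(u)(1-u^{-2})$. $\mathrm{DY}(\mathfrak{gl}_N)$ is the associative algebra over $\mathbb C[[h]]$ generated by a central element $C$ and elements $t_{ij}^{(r)},t_{ij}^{(-r)}$, $1\leqslant i,j\leqslant N$, $r\geqslant1$, subject to $$R(u-v)T_1(u)T_2(v)=T_2(v)T_1(u)R(u-v),\qquad R(u-v)T^+_1(u)T^+_2(v)=T^+_2(v)T^+_1(u)R(u-v),$$ $$\overline R(u-v+hC/2)\,T_1(u)\,T^+_2(v)=T^+_2(v)\,T_1(u)\,\overline R(u-v-hC/2),$$ where $T(u)=\sum e_{ij}\otimes t_{ij}(u)$, $T^+(u)=\sum e_{ij}\otimes t^+_{ij}(u)$, $t_{ij}(u)=\delta_{ij}+h\sum_{r\geqslant1}t_{ij}^{(r)}u^{-r}$, $t^+_{ij}(u)=\delta_{ij}-h\sum_{r\geqslant1}t_{ij}^{(-r)}u^{r-1}$, and the subscript $a$ in $T_a,T_a^+$ indicates that the matrix units are placed in the $a$-th copy of $\mathrm{End}\,\mathbb C^N$; negative powers of $u-v\pm hC/2$ are expanded in nonnegative powers of $v$. For $c\in\mathbb C$, $\mathrm{DY}_c(\mathfrak{gl}_N)$ is the quotient of $\mathrm{DY}(\mathfrak{gl}_N)$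 by the ideal generated by $C-c$, and $$\widetilde{\mathrm{DY}}_c(\mathfrak{gl}_N)=\varprojlim_{p\geqslant1}\mathrm{DY}_c(\mathfrak{gl}_N)/I_p,$$ where $I_p$ is the left ideal generated by all $t_{ij}^{(r)}$ with $r\geqslant p$. The critical level is $c=-N$. Idempotents. The content $c_a=c_a(\mathcal U)$ equals $j-i$ if $a$ occupies box $(i,j)$ of $\mathcal U$. $e_{\mathcal U}\in\mathbb C[\mathfrak S_m]$ is the primitive idempotent associated with $\mathcal U$ through the orthonormal Young bases: it acts as zero in the irreducible representations of $\mathfrak S_m$ labelled by $\lambda\neq\mu$, and in the one labelled by $\mu$ as the projection onto the line of the Young basis vector $v_{\mathcal U}$ along the other Young basis vectors. $\mathcal E_{\mathcal U}$ is the image of $e_{\mathcal U}$ under the action of $\mathfrak S_m$ permuting the tensor factors of $(\mathbb C^N)^{\otimes m}$. $\mathrm{tr}_{1,\dots,m}$ is the trace over all $m$ copies of $\mathrm{End}\,\mathbb C^N$. The series $\widetilde{\mathbb T}_\mu(u)$ does not depend on the choice of $\mathcal U$ of shape $\mu$.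
   Formalization: The defining relations of DY(gl_N) are taken coefficientwise with common powers of h cancelled (read literally they are trivial mod h^2 and the claim fails), and the completed algebra is the inverse limit of DY_c/(I_p + h^n DY_c) over p and n. *)

(* Defs.v *)
From HB Require Import structures.
From mathcomp Require Import all_boot all_order all_algebra all_fingroup.
From mathcomp Require Import generic_quotient ring_quotient mxrepresentation.
From mathcomp Require Import boolp reals complex monalg.

Set Implicit Arguments.
Unset Strict Implicit.
Unset Printing Implicit Defensive.

Import Order.TTheory GRing.Theory Num.Theory.
Local Open Scope ring_scope.
Local Open Scope quotient_scope.

Record fps (R : comNzRingType) := Fps { fcoef : nat -> R }.

Section FpsRing.
Variable R : comNzRingType.
Implicit Types f g k : fps R.

HB.instance Definition _ := gen_eqMixin (fps R).
HB.instance Definition _ := gen_choiceMixin (fps R).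

Lemma fps_ext f g : (forall n, fcoef f n = fcoef g n) -> f = g.
Proof. by case: f g => [f] [g] /= /funext ->. Qed.

Definition fps0 : fps R := Fps (fun=> 0).
Definition fps1 : fps R := Fps (fun n => (n == 0%N)%:R).
Definition fps_opp f : fps R := Fps (fun n => - fcoef f n).
Definition fps_add f g : fps R := Fps (fun n => fcoef f n + fcoef g n).
Definition fps_mul f g : fps R :=
  Fps (fun n => \sum_(i < n.+1) fcoef f i * fcoef g (n - i)).

Definition fps_trunc n f : {poly R} := \poly_(i < n.+1) fcoef f i.

Lemma coef_fps_trunc n f i : (i <= n)%N -> (fps_trunc n f)`_i = fcoef f i.
Proof. by move=> lin; rewrite coef_poly ltnS lin. Qed.

Lemma coef_fps_truncM n f g i : (i <= n)%N ->
  (fps_trunc n f * fps_trunc n g)`_i = fcoef (fps_mul f g) i.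
Proof.
move=> lin; rewrite coefM; apply: eq_bigr => j _.
by rewrite !coef_fps_trunc // (leq_trans _ lin) ?leq_subr // -ltnS.
Qed.

Lemma fps_addA : associative fps_add.
Proof. by move=> f g k; apply: fps_ext => n /=; rewrite addrA. Qed.
Lemma fps_addC : commutative fps_add.
Proof. by move=> f g; apply: fps_ext => n /=; rewrite addrC. Qed.
Lemma fps_add0 : left_id fps0 fps_add.
Proof. by move=> f; apply: fps_ext => n /=; rewrite add0r. Qed.
Lemma fps_addN : left_inverse fps0 fps_opp fps_add.
Proof. by move=> f; apply: fps_ext => n /=; rewrite addNr. Qed.

HB.instance Definition _ :=
  GRing.isZmodule.Build (fps R) fps_addA fps_addC fps_add0 fps_addN.

Lemma fps_mulA : associative fps_mul.
Proof.
move=> f g k; apply: fps_ext => n.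
transitivity ((fps_trunc n f * (fps_trunc n g * fps_trunc n k))`_n).
  rewrite coefM; apply: eq_bigr => j _.
  by rewrite coef_fps_truncM ?leq_subr // coef_fps_trunc // -ltnS.
rewrite mulrA coefM; apply: eq_bigr => j _.
have jn : (j <= n)%N by rewrite -ltnS.
by rewrite coef_fps_truncM // coef_fps_trunc ?leq_subr.
Qed.
Lemma fps_mulC : commutative fps_mul.
Proof.
by move=> f g; apply: fps_ext => n; rewrite -!(@coef_fps_truncM n) // mulrC.
Qed.
Lemma fps_mul1 : left_id fps1 fps_mul.
Proof.
move=> f; apply: fps_ext => n /=; rewrite big_ord_recl /= mul1r subn0 big1 ?addr0 //.
by move=> i _; rewrite mul0r.
Qed.
Lemma fps_mulDl : left_distributive fps_mul fps_add.
Proof.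
move=> f g k; apply: fps_ext => n /=; rewrite -big_split /=.
by apply: eq_bigr => i _; rewrite mulrDl.
Qed.
Lemma fps1_neq0 : fps1 != 0.
Proof.
apply/eqP => /(congr1 (fun f => fcoef f 0)) /= /eqP; exact/negP/oner_neq0.
Qed.

HB.instance Definition _ := GRing.Zmodule_isComNzRing.Build (fps R)
  fps_mulA fps_mulC fps_mul1 fps_mulDl fps1_neq0.

Definition fconst (x : R) : fps R := Fps (fun n => if n == 0%N then x else 0).
Definition fvar : fps R := Fps (fun n => (n == 1%N)%:R).

End FpsRing.

Section RingPresentation.
Variables (A : pzRingType) (S : A -> Prop).

Definition two_sided_ideal (J : A -> Prop) : Prop :=
  [/\ J 0, forall x y, J x -> J y -> J (x - y)
    & forall x y, J x -> J (y * x) /\ J (x * y)].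

Definition ideal_gen : {pred A} := fun x =>
  `[< forall J, two_sided_ideal J -> (forall s, S s -> J s) -> J x >].

Lemma ideal_gen_zmod : zmod_closed ideal_gen.
Proof.
split=> [|x y /asboolP Jx /asboolP Jy]; apply/asboolP => J idJ SJ.
  by case: idJ.
by case: (idJ) => _ + _; apply; [apply: Jx | apply: Jy].
Qed.
HB.instance Definition _ := GRing.isZmodClosed.Build A ideal_gen ideal_gen_zmod.

Lemma ideal_genMl y x : x \in ideal_gen -> y * x \in ideal_gen.
Proof.
move=> /asboolP Jx; apply/asboolP => J idJ SJ.
by case: (idJ) => _ _ /(_ x y (Jx _ idJ SJ)) [].
Qed.
Lemma ideal_genMr y x : x \in ideal_gen -> x * y \in ideal_gen.
Proof.
move=> /asboolP Jx; apply/asboolP => J idJ SJ.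
by case: (idJ) => _ _ /(_ x y (Jx _ idJ SJ)) [].
Qed.

Definition rquot : Type := {ideal_quot ideal_gen}.
HB.instance Definition _ := GRing.Zmodule.on rquot.

Definition rproj (x : A) : rquot := \pi_{ideal_quot ideal_gen} x.
Definition rlift (x : rquot) : A := repr (x : {ideal_quot ideal_gen}).

Lemma rliftK : cancel rlift rproj. Proof. exact: reprK. Qed.
Lemma rprojE x y : reflect (rproj x = rproj y) (x - y \in ideal_gen).
Proof. by rewrite Quotient.idealrBE; apply: eqP. Qed.
Lemma rproj0 : rproj 0 = 0. Proof. exact: pi_zeror. Qed.
Lemma rprojD : {morph rproj : x y / x + y}. Proof. exact: pi_addr. Qed.

Definition rquot_mul (x y : rquot) : rquot := rproj (rlift x * rlift y).

Lemma rprojM x y : rproj (x * y) = rquot_mul (rproj x) (rproj y).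
Proof.
apply/rprojE; set x' := rlift _; set y' := rlift _.
have -> : x * y - x' * y' = (x - x') * y + x' * (y - y').
  by rewrite mulrBl mulrBr addrA subrK.
apply: rpredD.
  by apply: ideal_genMr; apply/rprojE; rewrite rliftK.
by apply: ideal_genMl; apply/rprojE; rewrite rliftK.
Qed.

Lemma rquot_mulA : associative rquot_mul.
Proof.
by move=> x y z; rewrite -[x]rliftK -[y]rliftK -[z]rliftK -!rprojM mulrA.
Qed.
Lemma rquot_mul1 : left_id (rproj 1) rquot_mul.
Proof. by move=> x; rewrite -[x]rliftK -rprojM mul1r. Qed.
Lemma rquot_mulr1 : right_id (rproj 1) rquot_mul.
Proof. by move=> x; rewrite -[x]rliftK -rprojM mulr1. Qed.
Lemma rquot_mulDl : left_distributive rquot_mul +%R.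
Proof.
by move=> x y z; rewrite -[x]rliftK -[y]rliftK -[z]rliftK
  -rprojD -!rprojM mulrDl rprojD.
Qed.
Lemma rquot_mulDr : right_distributive rquot_mul +%R.
Proof.
by move=> x y z; rewrite -[x]rliftK -[y]rliftK -[z]rliftK
  -rprojD -!rprojM mulrDr rprojD.
Qed.

HB.instance Definition _ := GRing.Zmodule_isPzRing.Build rquot
  rquot_mulA rquot_mul1 rquot_mulr1 rquot_mulDl rquot_mulDr.

End RingPresentation.

(* Series in one variable over a ring, given by their coefficients: depending
   on the context, [f n] is the coefficient of u^-n or of u^n. *)

Section Series.
Variable B : pzRingType.
Implicit Types f g : nat -> B.

Definition sone : nat -> B := fun n => (n == 0%N)%:R.
Definition smul f g : nat -> B := fun n => \sum_(i < n.+1) f i * g (n - i)%N.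
Definition spow f k : nat -> B := iter k (smul f) sone.

(* the inverse \sum_k (1 - f)^k of a series f with constant term 1 *)
Definition sinv f : nat -> B :=
  fun n => \sum_(k < n.+1) spow (fun i => sone i - f i) k n.

Lemma smulBl f1 f2 g n :
  smul (fun i => f1 i - f2 i) g n = smul f1 g n - smul f2 g n.
Proof. by rewrite -sumrB; apply: eq_bigr => i _; rewrite mulrBl. Qed.
Lemma smulBr f1 f2 g n :
  smul g (fun i => f1 i - f2 i) n = smul g f1 n - smul g f2 n.
Proof. by rewrite -sumrB; apply: eq_bigr => i _; rewrite mulrBr. Qed.
Lemma smul1l f n : smul sone f n = f n.
Proof.
rewrite /smul big_ord_recl /= mul1r subn0 big1 ?addr0 // => i _.
by rewrite mul0r.
Qed.
Lemma smulr1 f n : smul f sone n = f n.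
Proof.
rewrite /smul big_ord_recr /= subnn mulr1 big1 ?add0r // => i _.
by rewrite /sone subn_eq0 leqNgt ltn_ord mulr0.
Qed.
Lemma smulA f g k n : smul f (smul g k) n = smul (smul f g) k n.
Proof.
rewrite /smul; under eq_bigr do rewrite big_distrr /=.
under [RHS]eq_bigr do rewrite big_distrl /=.
pose F i j := f i * (g j * k (n - i - j)%N).
transitivity (\sum_(i < n.+1) \sum_(j < n.+1 | (i + j <= n)%N) F i j).
  apply: eq_bigr => i _; rewrite (big_ord_widen_cond n.+1 xpredT (F i)) ?ltnS ?leq_subr //.
  by apply: eq_bigl => j; rewrite /= ltnS leq_subRL // -ltnS.
transitivity (\sum_(s < n.+1) \sum_(i < n.+1 | (i <= s)%N) F i (s - i)%N); last first.
  apply: eq_bigr => s _.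
  rewrite (big_ord_widen_cond n.+1 xpredT (fun i => f i * g (s - i)%N * k (n - s)%N)) //.
  apply: eq_big => [i|i le_is]; first by rewrite /= ltnS.
  by rewrite /F mulrA -subnDA subnKC.
rewrite [RHS](exchange_big_dep xpredT) //=; apply: eq_bigr => i _.
have ilt := ltn_ord i.
rewrite -(big_mkord (fun j => i + j <= n)%N (F i)).
rewrite -(big_mkord (fun s => i <= s)%N (fun s => F i (s - i)%N)).
rewrite [RHS](big_cat_nat (n := i)) //=; last exact: ltnW.
rewrite [X in _ = X + _]big1_seq ?add0r; last first.
  by move=> s /andP[le_is]; rewrite mem_index_iota /= ltnNge le_is.
have -> : index_iota i n.+1 = index_iota (0 + i) n.+1 by rewrite add0n.
rewrite big_addn.
rewrite (big_cat_nat (n := (n.+1 - i)%N)) ?leq_subr //=.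
rewrite [X in _ + X]big1_seq ?addr0; last first.
  move=> j /andP[ij]; rewrite mem_index_iota => /andP[+ _].
  by rewrite leq_subLR ltnNge ij.
rewrite big_nat_cond [RHS]big_nat_cond; apply: eq_big => j.
  rewrite leq_addl andbT /=; case: (ltnP j) => //= j_lt.
  by rewrite -ltnS -ltn_subRL.
by move=> _; rewrite addnK.
Qed.
Lemma eq_smul f1 f2 g1 g2 n :
  (forall i, (i <= n)%N -> f1 i = f2 i) ->
  (forall i, (i <= n)%N -> g1 i = g2 i) -> smul f1 g1 n = smul f2 g2 n.
Proof.
by move=> ef eg; apply: eq_bigr => i _; rewrite ef ?eg ?leq_subr // -ltnS.
Qed.

Lemma spow_lt f k n : f 0%N = 0 -> (n < k)%N -> spow f k n = 0.
Proof.
move=> f0; elim: k n => [|k IHk] n //= lt_nk.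
rewrite /smul big_ord_recl f0 mul0r add0r big1 // => i _.
by rewrite IHk ?mulr0 // lift0; case: n lt_nk i => [|n] lt_nk i; [case: i | rewrite subSS (leq_ltn_trans (leq_subr _ _))].
Qed.

Lemma sinvE f M n : f 0%N = 1 -> (n < M)%N ->
  sinv f n = \sum_(k < M) spow (fun i => sone i - f i) k n.
Proof.
move=> f0 lt_nM; rewrite /sinv (big_ord_widen M (fun k => spow _ k n)) //.
rewrite big_mkcond; apply: eq_bigr => k _; rewrite ltnS.
by case: leqP => // lt_nk; rewrite spow_lt // /sone f0 subrr.
Qed.

Lemma spowSr f k n : spow f k.+1 n = smul (spow f k) f n.
Proof.
elim: k n => [|k IHk] n; first by rewrite /= smul1l smulr1.
rewrite [spow f k.+2]/= -smulA; apply: eq_smul => // i _; exact: IHk.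
Qed.

Lemma smul_sinv f n : f 0%N = 1 -> smul f (sinv f) n = sone n.
Proof.
move=> f0; set y := fun i => sone i - f i.
have: smul y (sinv f) n = sinv f n - sone n.
  transitivity (smul y (fun i => \sum_(k < n.+1) spow y k i) n).
    by apply: eq_smul => // i lin; rewrite (@sinvE f n.+1) // ltnS.
  rewrite /smul; under eq_bigr do rewrite big_distrr /=.
  rewrite exchange_big (@sinvE f n.+2) //= [RHS]addrC [X in _ = _ + X]big_ord_recl /= addKr.
  by [].
by rewrite smulBl smul1l => /addrI/oppr_inj.
Qed.

Lemma sinv_smul f n : f 0%N = 1 -> smul (sinv f) f n = sone n.
Proof.
move=> f0; set y := fun i => sone i - f i.
have: smul (sinv f) y n = sinv f n - sone n.
  transitivity (smul (fun i => \sum_(k < n.+1) spow y k i) y n).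
    by apply: eq_smul => // i lin; rewrite (@sinvE f n.+1) // ltnS.
  rewrite /smul; under eq_bigr do rewrite big_distrl /=.
  rewrite exchange_big (@sinvE f n.+2) //= [RHS]addrC [X in _ = _ + X]big_ord_recl /= addKr.
  by apply: eq_bigr => k _; rewrite [RHS]spowSr.
by rewrite smulBr smulr1 => /addrI/oppr_inj.
Qed.
(* f(u + x) for a series f in u^-1 and x central:
   (u + x)^-r = \sum_k binomial(r + k - 1, k) (- x)^k u^-(r + k) *)
Definition sshiftN (x : B) f : nat -> B := fun n =>
  \sum_(r < n.+1) ((- x) ^+ (n - r) * f r) *+ 'C(n.-1, n - r).

(* f(u + x) for the truncation modulo u^M of a series f in u and x central *)
Definition sshiftP (M : nat) (x : B) f : nat -> B := fun n =>
  \sum_(r < M) (x ^+ (r - n) * f r) *+ 'C(r, n).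

(* Extension of the index set to int, so that [atN f k] (resp. [atP f k])
   is the coefficient of u^k of a series f in u^-1 (resp. in u). *)
Definition atN f (k : int) : B := if k <= 0 then f `|k|%N else 0.
Definition atP f (k : int) : B := if 0 <= k then f `|k|%N else 0.

End Series.

(* Tensor powers. The basis of (C^N)^{\otimes m} is indexed by functions from
   'I_m to 'I_N, numbered by enum_val. *)

Section Tensor.
Variables (N m : nat) (B : pzRingType).

Definition tdim := #|{: {ffun 'I_m -> 'I_N}}|.
Definition tidx (x : 'I_tdim) : {ffun 'I_m -> 'I_N} := enum_val x.

Definition tens_at (a : 'I_m) (X : 'M[B]_N) : 'M[B]_tdim :=
  \matrix_(x, y)
    if [forall b, (b != a) ==> (tidx x b == tidx y b)]
    then X (tidx x a) (tidx y a) else 0.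

(* the operator moving the a-th tensor factor to the place s a *)
Definition tens_perm (s : 'S_m) : 'M[B]_tdim :=
  \matrix_(x, y) ([forall a, tidx x (s a) == tidx y a])%:R.

End Tensor.

Section DoubleYangian.
Variable R : realType.
Local Notation C := R[i].
Local Notation K := (fps C).
Local Notation h := (fvar C : K).
Variable N : nat.

(* None is the central element C; (false, i, j, r) is t_ij^(r+1) and
   (true, i, j, r) is t_ij^(-r-1). *)
Definition dygen : Type := option (bool * 'I_N * 'I_N * nat).
HB.instance Definition _ := Choice.on dygen.

Definition dyfree : Type := {malg K[{fmonom dygen}]}.
HB.instance Definition _ := GRing.Lalgebra.on dyfree.

Definition gen (x : dygen) : dyfree := mkmalgU (fmu x) 1.
Definition genC : dyfree := gen None.

Definition Tfree (r : nat) : 'M[dyfree]_N :=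
  if r is r'.+1 then \matrix_(i, j) (h *: gen (Some (false, i, j, r'))) else 1.
Definition Tpfree (r : nat) : 'M[dyfree]_N :=
  (if r == 0%N then 1 else 0) - \matrix_(i, j) (h *: gen (Some (true, i, j, r))).

Variable g : nat -> C.

Local Notation M2 := 'M[dyfree]_(tdim N 2).
Local Notation P := (tens_perm N dyfree (tperm (ord0 : 'I_2) ord_max)).

(* coefficients of z^-j in R(z) and in g(z/h) R(z) *)
Definition Rcoef (j : nat) : M2 :=
  match j with 0 => 1 | 1 => - (h%:A *: P) | _ => 0 end.
Definition Rbcoef (j : nat) : M2 :=
  \sum_(i < j.+1) (fconst (g i) * h ^+ i)%:A *: Rcoef (j - i).

(* The coefficient of u^-a v^k in Q(u - v + y), where Q_j is the coefficient of
   z^-j in Q(z) and (u - v + y)^-j is expanded as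
   \sum_l binomial(j + l - 1, l) (v - y)^l u^-(j + l). *)
Definition Rexpand (Q : nat -> M2) (y : dyfree) (a k : nat) : M2 :=
  \sum_(j < a.+1 | (j + k <= a)%N)
    ((- y) ^+ (a - j - k) *+ ('C(a.-1, a - j) * 'C(a - j, k))) *: Q j.

(* The coefficient of u^x v^y in the products of an expanded R-matrix Q and a
   series W in two variables. For the products used below, every term with
   a or k greater than |x| + |y| + 1 vanishes. *)
Definition Rmull (Q : nat -> nat -> M2) (W : int -> int -> M2) (x y : int) :=
  \sum_(a < (`|x| + `|y|).+2) \sum_(k < (`|x| + `|y|).+2)
    Q a k *m W (x + a%:Z) (y - k%:Z).
Definition Rmulr (W : int -> int -> M2) (Q : nat -> nat -> M2) (x y : int) :=
  \sum_(a < (`|x| + `|y|).+2) \sum_(k < (`|x| + `|y|).+2)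
    W (x + a%:Z) (y - k%:Z) *m Q a k.

(* coefficients of u^x v^y in X_1(u) Y_2(v) and in Y_2(v) X_1(u) *)
Definition prod12 (X Y : int -> 'M[dyfree]_N) (x y : int) : M2 :=
  tens_at (ord0 : 'I_2) (X x) *m tens_at ord_max (Y y).
Definition prod21 (Y X : int -> 'M[dyfree]_N) (x y : int) : M2 :=
  tens_at (ord_max : 'I_2) (Y y) *m tens_at ord0 (X x).

Let T := atN Tfree.
Let Tp := atP Tpfree.
Let hC2 : dyfree := (fconst 2^-1 * h) *: genC.

Definition dy_series_rel (x y : int) : seq M2 :=
  [:: Rmull (Rexpand Rcoef 0) (prod12 T T) x y
      - Rmulr (prod21 T T) (Rexpand Rcoef 0) x y;
      Rmull (Rexpand Rcoef 0) (prod12 Tp Tp) x y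
      - Rmulr (prod21 Tp Tp) (Rexpand Rcoef 0) x y;
      Rmull (Rexpand Rbcoef hC2) (prod12 T Tp) x y
      - Rmulr (prod21 Tp T) (Rexpand Rbcoef (- hC2)) x y].

(* The coefficients of the series relations are all divisible by h^2 in the
   free algebra, and powers of h are cancelled in the defining relations: the
   first series relation stands for
     [t_ij^(r+1), t_kl^(s)] - [t_ij^(r), t_kl^(s+1)]
       = h (t_kj^(r) t_il^(s) - t_kj^(s) t_il^(r)),
   and not only for h^2 times this equality. Without the cancellation DY(gl_N)
   would be, modulo h^2, the free algebra on the t_ij^(r), t_ij^(-r) over the
   polynomials in C. *)
Definition dyrel (z : dyfree) : Prop :=
  (exists x : dyfree, z = genC * x - x * genC) \/
  (exists x y, exists2 E, E \in dy_series_rel x y &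
     exists i j n, h ^+ n *: z = E i j).

Definition DY : pzRingType := rquot dyrel.

Definition DYscal (k : K) : DY := rproj dyrel k%:A.

Variable c : C.

Definition DYc : pzRingType :=
  rquot (fun z : DY => z = rproj dyrel genC - DYscal (fconst c)).

Definition DYproj (x : dyfree) : DYc := rproj _ (rproj dyrel x).
Definition scal (k : K) : DYc := DYproj k%:A.

Definition Tser (r : nat) : 'M[DYc]_N := map_mx DYproj (Tfree r).
Definition Tpser (r : nat) : 'M[DYc]_N := map_mx DYproj (Tpfree r).

Definition left_ideal (J : DYc -> Prop) : Prop :=
  [/\ J 0, forall x y, J x -> J y -> J (x - y) & forall x y, J x -> J (y * x)].

Definition DYI (p : nat) (x : DYc) : Prop :=
  forall J, left_ideal J ->
    (forall i j r, (p <= r.+1)%N -> J (DYproj (gen (Some (false, i, j, r))))) ->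
    J x.

Definition DYIh (p n : nat) : {pred DYc} := fun x =>
  `[< exists y z, DYI p y /\ x = y + scal h ^+ n * z >].

Lemma DYIh_zmod p n : zmod_closed (DYIh p n).
Proof.
split; first (apply/asboolP; exists 0, 0; split; last by rewrite mulr0 addr0).
  by move=> J [].
move=> x x' /asboolP[y [z [Iy ->]]] /asboolP[y' [z' [Iy' ->]]].
apply/asboolP; exists (y - y'), (z - z'); split.
  by move=> J idJ SJ; case: (idJ) => _ + _; apply; [apply: Iy | apply: Iy'].
by rewrite mulrBr opprD addrACA.
Qed.
HB.instance Definition _ p n :=
  GRing.isZmodClosed.Build DYc (DYIh p n) (DYIh_zmod p n).

Definition DYquo (p n : nat) : Type := {ideal_quot (DYIh p n)}.
Definition quo (p n : nat) (x : DYc) : DYquo p n := \pi_{ideal_quot (DYIh p n)} x.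

(* The h-adic completion of the inverse limit of the DY_c / I_p, that is, the
   inverse limit of the DY_c / (I_p + h^n DY_c) over p and n. *)
Record DYt := {
  comp : forall p n, DYquo p n;
  comp_compat : forall p n q k x, (p <= q)%N -> (n <= k)%N ->
    quo q k x = comp q k -> quo p n x = comp p n
}.

Definition is_lim (s : nat -> DYc) (x : DYt) : Prop :=
  forall p n, exists M0, forall M, (M0 <= M)%N -> quo p n (s M) = comp x p n.

(* The product of DY_c extended by continuity: z is the product x y. *)
Definition is_prod (x y z : DYt) : Prop :=
  forall p n, exists q k, forall a b : DYc,
    quo q k a = comp x q k -> quo q k b = comp y q k ->
    quo p n (a * b) = comp z p n.

Lemma DYt_ext (x y : DYt) : (forall p n, comp x p n = comp y p n) -> x = y.
Proof.
case: x y => [x xP] [y yP] /= eq_xy.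
have {}eq_xy : x = y.
  by apply: functional_extensionality_dep => p;
     apply: functional_extensionality_dep => n.
by rewrite eq_xy in xP *; rewrite (Prop_irrelevance xP yP).
Qed.

Lemma is_lim_uniq s (x y : DYt) : is_lim s x -> is_lim s y -> x = y.
Proof.
move=> xs ys; apply: DYt_ext => p n.
have [M1 xM] := xs p n; have [M2 yM] := ys p n.
by rewrite -(xM (maxn M1 M2)) ?leq_maxl // yM // leq_maxr.
Qed.

Lemma is_prod_uniq x y (z z' : DYt) : is_prod x y z -> is_prod x y z' -> z = z'.
Proof.
move=> xyz xyz'; apply: DYt_ext => p n.
have [q [k zE]] := xyz p n; have [q' [k' z'E]] := xyz' p n.
have lift (w : DYt) :
    exists a, quo q k a = comp w q k /\ quo q' k' a = comp w q' k'.
  have aE : quo _ _ (repr (comp w (maxn q q') (maxn k k') : {ideal_quot _})) =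
      comp w (maxn q q') (maxn k k') by exact: reprK.
  eexists; split; apply: (comp_compat _ _ aE);
    by rewrite ?leq_maxl ?leq_maxr.
have [a [ax ax']] := lift x; have [b [by_ by_']] := lift y.
by rewrite -(zE a b) // (z'E a b).
Qed.

Definition DYt_central (x : DYt) : Prop :=
  forall y, exists z, is_prod x y z /\ is_prod y x z.

End DoubleYangian.

Section Young.
Variable m : nat.

Definition is_part (la : seq nat) : bool :=
  [&& sorted geq la, 0%N \notin la & sumn la == m].

(* A tableau maps the entry a.+1 to its box (row, column), rows and columns
   being numbered from 0. Injectivity together with sumn la = m makes it a
   bijection onto the boxes of la. *)
Definition is_syt (la : seq nat) (U : {ffun 'I_m -> 'I_m * 'I_m}) : bool :=
  [&& injectiveb U,
      [forall a, ((U a).2 < nth 0%N la (U a).1)%N],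
      [forall a, forall b,
        ((U a).1 == (U b).1) && ((U a).2 < (U b).2)%N ==> (a < b)%N] &
      [forall a, forall b,
        ((U a).2 == (U b).2) && ((U a).1 < (U b).1)%N ==> (a < b)%N]].

Definition syt (la : seq nat) : Type :=
  {U : {ffun 'I_m -> 'I_m * 'I_m} | is_syt la U}.
HB.instance Definition _ la := Finite.on (syt la).

Definition content la (U : syt la) (a : 'I_m) : int :=
  (val U a).2%:Z - (val U a).1%:Z.

Variable F : numClosedFieldType.

(* Young's orthonormal form: with d = c_(a+1) - c_a,
   s_a v_T = d^-1 v_T + sqrt(1 - d^-2) v_(s_a T).
   The matrices of the s_a are symmetric, hence it does not matter here that
   permutations are composed from left to right in 'S_m. *)
Definition young_orthonormal la
    (rho : mx_representation F [set: 'S_m] #|{: syt la}|) : Prop :=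
  forall a b : 'I_m, b = a.+1 :> nat -> forall V W : syt la,
    let d : F := (content V b - content V a)%:~R in
    rho (tperm a b) (enum_rank V) (enum_rank W) =
      if V == W then d^-1
      else if val W == [ffun x => val V (tperm a b x)]
           then sqrtC (1 - d ^- 2) else 0.

(* e = \sum_s e(s) s is the primitive idempotent associated with U: it acts as
   the projection onto v_U in the representation mu and as 0 in the others. *)
Definition young_idempotent mu (U : syt mu) (e : 'S_m -> F) : Prop :=
  exists rho : forall la, mx_representation F [set: 'S_m] #|{: syt la}|,
    [/\ forall la, is_part la -> young_orthonormal (rho la),
        forall la, is_part la -> la <> mu -> \sum_s e s *: rho la s = 0
      & \sum_s e s *: rho mu s = delta_mx (enum_rank U) (enum_rank U)].

End Young.

Section Ttilde.
Variable R : realType.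
Local Notation C := R[i].
Local Notation h := (fvar C : fps C).
Variable N : nat.

(* g(u) = 1 + \sum_(i >= 1) g_i u^-i with g(u + N) = g(u) (1 - u^-2) *)
Definition is_gseries (g : nat -> C) : Prop :=
  g 0%N = 1 /\
  forall n, sshiftN N%:R g n = g n - (if (2 <= n)%N then g (n - 2)%N else 0).

Variables (g : nat -> C) (m : nat) (mu : seq nat) (U : syt m mu).
Variable e : 'S_m -> C.

Local Notation c := (- N%:R : C).
Local Notation A := (DYc N g c).

Definition EU : 'M[A]_(tdim N m) :=
  \sum_s scal N g c (fconst (e s)) *: tens_perm N A s.

Definition hscal (x : C) : 'M[A]_N := (scal N g c (fconst x * h))%:M.

(* T^+_a(u + h c_a), with T^+(u) truncated modulo u^M *)
Definition Tpfactor (M : nat) (a : 'I_m) (r : nat) : 'M[A]_(tdim N m) :=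
  tens_at a (sshiftP M (hscal (content U a)%:~R) (Tpser N g c) r).

(* T_a(u + h c_a - h N / 2)^-1 *)
Definition Tinvfactor (a : 'I_m) (r : nat) : 'M[A]_(tdim N m) :=
  tens_at a
    (sshiftN (hscal ((content U a)%:~R - N%:R / 2)) (sinv (Tser N g c)) r).

Definition Tpprod (M : nat) : nat -> 'M[A]_(tdim N m) :=
  foldr (fun a => smul (Tpfactor M a)) (@sone _) (enum 'I_m).
Definition Tinvprod : nat -> 'M[A]_(tdim N m) :=
  foldr (fun a => smul (Tinvfactor a)) (@sone _) (rev (enum 'I_m)).

(* The coefficient of u^k in
     tr E_U T^+_1(u+hc_1)...T^+_m(u+hc_m)
            T_m(u+hc_m-hN/2)^-1...T_1(u+hc_1-hN/2)^-1,
   where T^+(u) is truncated modulo u^M, so that the product of the T^+_a is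
   a polynomial in u of degree at most m M. *)
Definition Ttrunc (k : int) (M : nat) : A :=
  \tr (EU *m \sum_(s < (m * M).+1) Tpprod M s *m atN Tinvprod (k - s%:Z)).

(* The coefficient of u^k in the series itself is the limit of these in the
   completed algebra. *)
Definition is_Tcoef (k : int) (x : DYt N g c) : Prop :=
  is_lim (Ttrunc k) x.

End Ttilde.

(* Main.v *)
(* Place T(z) (or T^+(z)) at an auxiliary tensor factor 0. The defining relations
   move T_0(z) through T^+_1 ... T^+_m and T_m^-1 ... T_1^-1 at the price of
   R-matrices R_(0a) and their inverses on both sides. At the level c = -N the
   R-matrices x_a between T_0(z) and the T^+_a and those y'_a left behind by the
   T_a^-1 are related by crossing symmetry, sum_i (x_a)_ij (y'_a)_ki = delta_jk,
   so they cancel under the partial trace over 1, ..., m, provided that E_U is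
   moved out of the way. This is the fusion procedure: the arguments u + h c_a
   being shifted by the contents, E_U X = E_U X E_U for each of the products
   X = T^+_1 ... T^+_m, T_m^-1 ... T_1^-1, x_1 ... x_m, because E_U is a joint
   eigenvector of the Jucys-Murphy elements. That E_U is such a polynomial in
   the Jucys-Murphy elements follows from the faithfulness of the Young
   representations.

   Spectral parameters are nilpotent elements of truncated power series rings.
   Since powers of h are cancelled in the relations of DY_c, the computation is
   done in a quotient of the free algebra in which h is nilpotent and only h^2
   times the kernel of the projection to DY_c vanishes. The result, a congruence
   modulo the left ideals I_p + h^n, passes to the completed algebra because right
   multiplications are continuous for these ideals. *)

From HB Require Import structures.
Require Import Defs.
From mathcomp Require Import all_boot all_order all_algebra all_fingroup.
From mathcomp Require Import generic_quotient ring_quotient mxrepresentation.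
From mathcomp Require Import boolp reals complex monalg ring zify.

Set Implicit Arguments.
Unset Strict Implicit.
Unset Printing Implicit Defensive.

Import Order.TTheory GRing.Theory Num.Theory.
Local Open Scope ring_scope.

(** Crossing symmetry comes from P: under the partial trace a product of two P counts as N times
    one, so factors 1 + kP and 1 - k'P cancel when 1/k' = 1/k + N. The same shift by N occurs in the
    functional equation of g, which makes the scalar factors cancel, and at C = -N it is the shift
    by hC between the two R-matrices of the mixed relation. The obstacle is that T^+ gives series in
    u and the inverses of T give series in 1/u: their product is only a limit and lies in no
    truncated ring. The relations for the two halves are therefore proved separately, the same outer
    variable standing for u in one and for 1/u in the other. The R-matrices have to be read in both.
    Since h and the auxiliary parameter are nilpotent, they are polynomials of bounded degree in u,
    or in 1/u, and [rev_at] translates one reading into the other. The halves are then multiplied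
    coefficient by coefficient; cutting off the sums costs only terms of the left ideal, because
    late coefficients of the second half stand on the right. *)

(* [tser B L] is B[x]/(x^L) with x central. *)
Definition tser (B : Type) (L : nat) : Type := {ffun 'I_L -> B}.

(** * Truncated power series in a central variable *)

Section TruncatedSeriesZmod.
Variables (B : zmodType) (L : nat).

HB.instance Definition _ := GRing.Zmodule.on (tser B L).

Implicit Types f g : tser B L.

Definition co f (n : nat) : B := if insub n is Some i then f i else 0.
Definition mk (c : nat -> B) : tser B L := [ffun i : 'I_L => c i].

Lemma co_mk c n : co (mk c) n = if (n < L)%N then c n else 0.
Proof. by rewrite /co; case: insubP => [i -> <- | /negPf->] //; rewrite ffunE. Qed.

Lemma co_ord f (i : 'I_L) : co f i = f i.
Proof. by rewrite /co insubT //= => p; congr (f _); apply: val_inj. Qed.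

Lemma co_ge f n : (L <= n)%N -> co f n = 0.
Proof. by rewrite /co leqNgt; case: insubP => // i ->. Qed.

Lemma tserP f g : (forall n, (n < L)%N -> co f n = co g n) -> f = g.
Proof. by move=> eq_fg; apply/ffunP => i; rewrite -!co_ord eq_fg. Qed.

Lemma coK f : mk (co f) = f.
Proof. by apply: tserP => n ltnL; rewrite co_mk ltnL. Qed.

Lemma eq_mk c d : (forall n, (n < L)%N -> c n = d n) -> mk c = mk d.
Proof. by move=> eq_cd; apply: tserP => n ltnL; rewrite !co_mk ltnL eq_cd. Qed.

Definition cof n f := co f n.

Lemma cof_is_zmod_morphism n : zmod_morphism (cof n).
Proof.
by move=> f g; rewrite /cof /co; case: insubP => [i _ _|_]; rewrite ?ffunE ?subr0.
Qed.
HB.instance Definition _ n :=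
  GRing.isZmodMorphism.Build (tser B L) B (cof n) (cof_is_zmod_morphism n).

Lemma coD f g n : co (f + g) n = co f n + co g n.
Proof. exact: (raddfD (cof n)). Qed.
Lemma coN f n : co (- f) n = - co f n.
Proof. exact: (raddfN (cof n)). Qed.
Lemma coB f g n : co (f - g) n = co f n - co g n.
Proof. exact: (raddfB (cof n)). Qed.
Lemma co0 n : co 0 n = 0.
Proof. exact: (raddf0 (cof n)). Qed.
Lemma co_sum (I : Type) (r : seq I) (P : pred I) (F : I -> tser B L) n :
  co (\sum_(i <- r | P i) F i) n = \sum_(i <- r | P i) co (F i) n.
Proof. exact: (raddf_sum (cof n)). Qed.

End TruncatedSeriesZmod.

Section TruncatedSeries.
Variables (B : pzRingType) (L : nat).
Implicit Types f g : tser B L.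

Definition tmul f g : tser B L := mk L (smul (co f) (co g)).
Definition tone : tser B L := mk L (@sone B).

(** Truncation is multiplicative, so the ring axioms come from those of untruncated series. L = 0 is
    allowed and gives the zero ring. *)
Lemma mk_smul (c d : nat -> B) : tmul (mk L c) (mk L d) = mk L (smul c d).
Proof.
apply: eq_mk => n ltnL; apply: eq_smul => i lein;
  by rewrite co_mk (leq_ltn_trans lein ltnL).
Qed.

Lemma tmulA : associative tmul.
Proof.
move=> f g k; rewrite -[f]coK -[g]coK -[k]coK !mk_smul.
by apply: eq_mk => n _; rewrite smulA.
Qed.
Lemma tmul1 : left_id tone tmul.
Proof.
by move=> f; rewrite -[f]coK mk_smul; apply: eq_mk => n _; rewrite smul1l.
Qed.
Lemma tmulr1 : right_id tone tmul.
Proof.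
by move=> f; rewrite -[f]coK mk_smul; apply: eq_mk => n _; rewrite smulr1.
Qed.
Lemma tmulDl : left_distributive tmul +%R.
Proof.
move=> f g k; apply: tserP => n ltnL; rewrite coD !co_mk ltnL -big_split /=.
by apply: eq_bigr => i _; rewrite coD mulrDl.
Qed.
Lemma tmulDr : right_distributive tmul +%R.
Proof.
move=> f g k; apply: tserP => n ltnL; rewrite coD !co_mk ltnL -big_split /=.
by apply: eq_bigr => i _; rewrite coD mulrDr.
Qed.

HB.instance Definition _ := GRing.Zmodule_isPzRing.Build (tser B L)
  tmulA tmul1 tmulr1 tmulDl tmulDr.

Lemma mkM (c d : nat -> B) : mk L c * mk L d = mk L (smul c d).
Proof. exact: mk_smul. Qed.

Lemma mk1 : mk L (@sone B) = 1. Proof. by []. Qed.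

Lemma coM f g n : (n < L)%N -> co (f * g) n = smul (co f) (co g) n.
Proof. by move=> ltnL; rewrite co_mk ltnL. Qed.

Lemma co1 n : (n < L)%N -> co (1 : tser B L) n = (n == 0%N)%:R.
Proof. by move=> ltnL; rewrite co_mk ltnL. Qed.

Definition tC (x : B) : tser B L := mk L (fun n => if n == 0%N then x else 0).
Definition tX : tser B L := mk L (fun n => (n == 1%N)%:R).

Lemma co_tC x n : (n < L)%N -> co (tC x) n = if n == 0%N then x else 0.
Proof. by move=> ltnL; rewrite co_mk ltnL. Qed.

Lemma coCM x f n : co (tC x * f) n = x * co f n.
Proof.
case: (ltnP n L) => [ltnL|leLn]; last by rewrite !co_ge ?mulr0.
rewrite coM // /smul big_ord_recl co_tC ?(leq_ltn_trans _ ltnL) //= subn0.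
by rewrite big1 ?addr0 // => i _; rewrite co_mk /=; case: ifP; rewrite mul0r.
Qed.

Lemma coMC x f n : co (f * tC x) n = co f n * x.
Proof.
case: (ltnP n L) => [ltnL|leLn]; last by rewrite !co_ge ?mul0r.
rewrite coM // /smul big_ord_recr /= subnn co_tC ?(leq_ltn_trans _ ltnL) //=.
rewrite big1 ?add0r // => i _; rewrite co_mk subn_eq0 [(n <= i)%N]leqNgt ltn_ord /=.
by case: ifP; rewrite mulr0.
Qed.

Lemma tC_is_zmod_morphism : zmod_morphism tC.
Proof.
move=> x y; apply: tserP => n ltnL; rewrite coB !co_tC //.
by case: eqP; rewrite ?subr0.
Qed.
HB.instance Definition _ :=
  GRing.isZmodMorphism.Build B (tser B L) tC tC_is_zmod_morphism.
Lemma tC_is_monoid_morphism : monoid_morphism tC.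
Proof.
split; first by apply: tserP => n ltnL; rewrite co_tC // co1 //; case: eqP.
move=> x y; apply: tserP => n ltnL; rewrite coCM !co_tC //.
by case: eqP; rewrite ?mulr0.
Qed.
HB.instance Definition _ :=
  GRing.isMonoidMorphism.Build B (tser B L) tC tC_is_monoid_morphism.

Lemma co0M f g : co (f * g) 0 = co f 0 * co g 0.
Proof.
case: (posnP L) => [L0|L_gt0]; last by rewrite coM // /smul big_ord1.
by rewrite !co_ge ?L0 ?mulr0.
Qed.

Lemma coXM f n : (n < L)%N -> co (tX * f) n = if n is n'.+1 then co f n' else 0.
Proof.
case: n => [|n] ltnL; first by rewrite co0M co_mk; case: ifP; rewrite mul0r.
rewrite coM // /smul 2!big_ord_recl /= !co_mk (leq_ltn_trans _ ltnL) //=.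
rewrite (leq_ltn_trans _ ltnL) //= mul0r add0r mul1r subn1 /=.
by rewrite big1 ?addr0 // => i _; rewrite co_mk /=; case: ifP; rewrite mul0r.
Qed.

Lemma coMX f n : (n < L)%N -> co (f * tX) n = if n is n'.+1 then co f n' else 0.
Proof.
case: n => [|n] ltnL; first by rewrite co0M [co tX 0]co_mk; case: ifP; rewrite mulr0.
rewrite coM // /smul 2!big_ord_recr /= subnn subSnn !co_mk (leq_ltn_trans _ ltnL) //=.
rewrite (leq_ltn_trans _ ltnL) //= mulr0 addr0 mulr1.
rewrite big1 ?add0r // => i _; rewrite co_mk /=.
rewrite subSn ?eqSS ?subn_eq0 1?[(n <= i)%N]leqNgt ?ltn_ord /=; last exact: ltnW.
by case: ifP; rewrite mulr0.
Qed.

Lemma tX_comm f : tX * f = f * tX.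
Proof. by apply: tserP => n ltnL; rewrite coXM ?coMX. Qed.

Lemma tXn_comm k f : tX ^+ k * f = f * tX ^+ k.
Proof. by apply: esym; apply: commrX; apply: esym; apply: tX_comm. Qed.

Lemma coXnM k f n : (n < L)%N ->
  co (tX ^+ k * f) n = if (k <= n)%N then co f (n - k) else 0.
Proof.
elim: k n => [|k IHk] n ltnL; first by rewrite mul1r subn0.
rewrite exprS -mulrA coXM //; case: n ltnL => [|n] ltnL //.
by rewrite IHk ?subSS // ltnW.
Qed.

Lemma coXn k n : (n < L)%N -> co (tX ^+ k) n = (n == k)%:R.
Proof.
move=> ltnL; rewrite -[_ ^+ k]mulr1 coXnM //; case: leqP => [lekn|ltnk].
  by rewrite co1 ?(leq_ltn_trans (leq_subr _ _)) // subn_eq0 eqn_leq lekn andbT.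
by rewrite ltn_eqF.
Qed.

Lemma tX_nilp k : (L <= k)%N -> tX ^+ k = 0.
Proof.
move=> leLk; apply: tserP => n ltnL.
by rewrite coXn // co0 ltn_eqF // (leq_trans ltnL).
Qed.

Lemma tser_sum f : f = \sum_(i < L) tC (co f i) * tX ^+ i.
Proof.
apply: tserP => n ltnL; rewrite co_sum (bigD1 (Ordinal ltnL)) //=.
rewrite coCM coXn // eqxx mulr1 big1 ?addr0 // => i ne_i.
by rewrite coCM coXn // eq_sym (negPf (_ : (i : nat) != n)) ?mulr0.
Qed.

End TruncatedSeries.

Section TruncatedSeriesMap.
Variables (B B' : pzRingType) (L : nat).

Definition tmap (phi : B -> B') (f : tser B L) : tser B' L :=
  mk L (fun n => phi (co f n)).

Variable phi : {rmorphism B -> B'}.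

Lemma co_tmap f n : co (tmap phi f) n = phi (co f n).
Proof. by rewrite co_mk; case: ltnP => // leLn; rewrite co_ge // rmorph0. Qed.

Lemma tmap_is_zmod_morphism : zmod_morphism (tmap phi).
Proof. by move=> f g; apply: tserP => n _; rewrite coB !co_tmap coB rmorphB. Qed.
HB.instance Definition _ :=
  GRing.isZmodMorphism.Build (tser B L) (tser B' L) (tmap phi) tmap_is_zmod_morphism.
Lemma tmap_is_monoid_morphism : monoid_morphism (tmap phi).
Proof.
split=> [|f g]; apply: tserP => n ltnL.
  by rewrite co_tmap !co1 // rmorph_nat.
rewrite co_tmap !coM // rmorph_sum; apply: eq_bigr => i _.
by rewrite rmorphM !co_tmap.
Qed.
HB.instance Definition _ :=
  GRing.isMonoidMorphism.Build (tser B L) (tser B' L) (tmap phi) tmap_is_monoid_morphism.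

Lemma tmap_tC x : tmap phi (tC L x) = tC L (phi x).
Proof.
by apply: tserP => n ltnL; rewrite co_tmap !co_tC //; case: eqP; rewrite ?rmorph0.
Qed.
Lemma tmap_tX : tmap phi (tX B L) = tX B' L.
Proof. by apply: tserP => n ltnL; rewrite co_tmap !co_mk ltnL rmorph_nat. Qed.

Lemma tmap_mk c : tmap phi (mk L c) = mk L (phi \o c).
Proof.
by apply: tserP => n ltnL; rewrite co_tmap !co_mk ltnL.
Qed.

(** Scalars stay central when a variable is adjoined; this is used twice, for the two nested
    truncated rings. *)
Lemma tmap_central :
  (forall x y, phi x * y = y * phi x) -> forall f g, tmap phi f * g = g * tmap phi f.
Proof.
move=> phiC f g; rewrite [f]tser_sum (rmorph_sum (tmap phi)) mulr_suml mulr_sumr.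
apply: eq_bigr => i _; rewrite rmorphM rmorphXn /= tmap_tX tmap_tC -mulrA.
rewrite tXn_comm !mulrA; congr (_ * _).
by apply: tserP => n _; rewrite coCM coMC phiC.
Qed.

End TruncatedSeriesMap.

Lemma tser_mulC (B : comPzRingType) L : commutative (@GRing.mul (tser B L)).
Proof.
move=> f g; apply: tserP => n ltnL; rewrite !coM // /smul (reindex_inj rev_ord_inj).
apply: eq_bigr => i _; rewrite mulrC /= subSS; congr (co g _ * _).
by rewrite subKn // -ltnS.
Qed.
HB.instance Definition _ (B : comPzRingType) L :=
  GRing.PzRing_hasCommutativeMul.Build (tser B L) (@tser_mulC B L).

(** * Cycle types and conjugacy of permutations *)

Section CycleType.
Variable T : finType.
Implicit Types s t u : {perm T}.

(** Sorting by decreasing length makes the list of lengths a partition, and makes equal cycle types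
    give cycle lists that match position by position. *)
Definition cycles s : seq (seq T) :=
  sort (relpre size geq) [seq fingraph.orbit s x | x <- enum (fingraph.roots (frel s))].
Definition cycle_type s : seq nat := map size (cycles s).

Lemma cyclesP s o : o \in cycles s -> exists x, o = fingraph.orbit s x.
Proof. by rewrite mem_sort => /mapP[x _ ->]; exists x. Qed.

Lemma count_cycles s x : count_mem x (flatten (cycles s)) = 1%N.
Proof.
rewrite count_flatten sumnE big_map /cycles.
rewrite (perm_big _ (permEl (perm_sort _ _))) big_map big_enum /=.
have sym := fconnect_sym (@perm_inj _ s).
rewrite (bigD1 (froot s x)) /=; last exact: roots_root.
rewrite count_uniq_mem ?orbit_uniq.
rewrite -fconnect_orbit sym connect_root big1 ?addn0 // => y /andP[ry ne_y].
apply/count_memPn; rewrite -fconnect_orbit; apply: contraNN ne_y.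
by rewrite (sameP (fingraph.rootP sym) eqP) => /eqP <-; rewrite (eqP ry).
by [].
Qed.

Lemma uniq_cycles s : uniq (flatten (cycles s)).
Proof.
apply: count_mem_uniq => x; rewrite count_cycles.
by have := count_cycles s x; rewrite -has_pred1 has_count => ->.
Qed.

Lemma mem_cycles s x : x \in flatten (cycles s).
Proof. by rewrite -has_pred1 has_count count_cycles. Qed.

Lemma sumn_cycle_type s : sumn (cycle_type s) = #|T|.
Proof.
rewrite -size_flatten cardE; apply/perm_size/uniq_perm.
- exact: uniq_cycles.
- exact: enum_uniq.
by move=> x; rewrite mem_cycles mem_enum.
Qed.

Lemma cycle_next s o x : o \in cycles s -> x \in o -> s x = next o x.
Proof.
move=> /cyclesP[r ->] xo.
by have /eqP := next_cycle (cycle_orbit (@perm_inj _ s) r) xo.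
Qed.

(** Write the cycles of each permutation one after the other. The conjugating permutation maps the
    n-th entry of the first list to the n-th entry of the second; as the shapes agree, it maps
    cycles to cycles and respects [next]. *)
Lemma cycle_type_conj s t :
  cycle_type s = cycle_type t -> exists u : {perm T}, forall x, u (s x) = t (u x).
Proof.
move=> eq_st; pose Ls := flatten (cycles s); pose Lt := flatten (cycles t).
have szL : size Ls = size Lt by rewrite !size_flatten /shape -!/(cycle_type _) eq_st.
pose f x := nth x Lt (index x Ls).
have ltx x : (index x Ls < size Lt)%N by rewrite -szL index_mem mem_cycles.
have f_inj : injective f.
  move=> x y; rewrite /f (set_nth_default y) // => /eqP.
  rewrite nth_uniq ?uniq_cycles // => /eqP eq_i.
  by rewrite -(nth_index x (mem_cycles s x)) eq_i nth_index // mem_cycles.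
have fL : map f Ls = Lt.
  case Ls_eq: Ls => [|x0 Ls']; first by move: szL; rewrite Ls_eq => /esym/size0nil.
  rewrite -Ls_eq; apply: (@eq_from_nth _ x0); rewrite size_map // => i lti.
  rewrite (nth_map x0) // /f index_uniq ?uniq_cycles //.
  by apply: set_nth_default; rewrite -szL.
exists (perm f_inj) => x; rewrite !permE.
have fc : map (map f) (cycles s) = cycles t.
  rewrite -[cycles s]flattenK map_reshape -/Ls fL /Lt.
  by rewrite [shape _]eq_st flattenK.
have /flattenP[o os xo] := mem_cycles s x.
rewrite (cycle_next os xo) -(next_map f_inj).
  by rewrite (@cycle_next t (map f o)) ?map_f // -fc map_f.
by have [y ->] := cyclesP os; apply: orbit_uniq.
Qed.

End CycleType.

Lemma cycle_type_part m (s : 'S_m) : is_part m (cycle_type s).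
Proof.
apply/and3P; split; last by rewrite sumn_cycle_type card_ord.
  rewrite /cycle_type sorted_map; apply: sort_sorted => x y /=.
  exact: leq_total.
apply/negP => /mapP[o /cyclesP[x ->]].
by apply/eqP; rewrite size_orbit ltn_eqF // fingraph.order_gt0.
Qed.

(** * Partitions, standard tableaux and contents *)

Section Partition.
Variables (m : nat) (la : seq nat).
Hypothesis la_part : is_part m la.

Lemma part_sumn : sumn la = m.
Proof. by case/and3P: la_part => _ _ /eqP. Qed.

Lemma part_nth i j : (i <= j)%N -> (nth 0 la j <= nth 0 la i)%N.
Proof.
move=> leij; case/and3P: la_part => s_la _ _.
case: (ltnP j (size la)) => [ltj|lej]; last by rewrite nth_default.
have lti := leq_ltn_trans leij ltj.
apply: (sorted_leq_nth (leT := geq)) s_la _ _ _ _ leij => //.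
  by move=> x y z /= xy yz; apply: leq_trans yz xy.
by move=> x /=.
Qed.

Lemma part_gt0 i : (i < size la)%N -> (0 < nth 0 la i)%N.
Proof.
by move=> lti; rewrite lt0n; case/and3P: la_part => _ + _; apply: contraNN => /eqP<-;
  rewrite mem_nth.
Qed.

End Partition.

(** Equality of contents without subtraction, so that rows and columns can be compared in [nat]. *)
Lemma content_col m la mu (V : syt m la) (W : syt m mu) a b :
  content V a = content W b ->
  ((val V a).2 + (val W b).1 = (val W b).2 + (val V a).1)%N.
Proof. by rewrite /content; lia. Qed.

Section Tableau.
Variables (m : nat) (la : seq nat).
Hypothesis la_part : is_part m la.
Implicit Types V W : syt m la.

Lemma sytP V : [/\ injective (val V),
   forall a, ((val V a).2 < nth 0 la (val V a).1)%N,
   forall a b, (val V a).1 = (val V b).1 -> ((val V a).2 < (val V b).2)%N -> (a < b)%N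
 & forall a b, (val V a).2 = (val V b).2 -> ((val V a).1 < (val V b).1)%N -> (a < b)%N].
Proof.
case: V => V /= /and4P[/injectiveP Vi /forallP Vl /forallP Vr /forallP Vc].
split=> // a b eq_ab lt_ab.
  by have /forallP/(_ b)/implyP := Vr a; apply; rewrite eq_ab eqxx.
by have /forallP/(_ b)/implyP := Vc a; apply; rewrite eq_ab eqxx.
Qed.

(** An injection into the boxes, numbered row by row through [flatten_index], is onto because there
    are m boxes. *)
Lemma syt_onto V i j : (j < nth 0 la i)%N ->
  exists a, (val V a).1 = i :> nat /\ (val V a).2 = j :> nat.
Proof.
have [Vi Vl _ _] := sytP V; move=> ltj.
have bnd a : (flatten_index la (val V a).1 (val V a).2 < m)%N.
  by have := flatten_indexP (Vl a); rewrite (part_sumn la_part).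
pose f a := Ordinal (bnd a).
have f_inj : injective f.
  move=> a b /(congr1 val)/= eq_ab; apply: Vi.
  have := congr1 (reshape_index la) eq_ab; have := congr1 (reshape_offset la) eq_ab.
  rewrite !flatten_indexKl // !flatten_indexKr // => e2 e1.
  by rewrite [LHS]surjective_pairing [RHS]surjective_pairing; congr (_, _); apply: val_inj.
have ltf : (flatten_index la i j < m)%N by have := flatten_indexP ltj; rewrite (part_sumn la_part).
have [g _ fg] := injF_bij f_inj; exists (g (Ordinal ltf)).
have /(congr1 val)/= eqf := fg (Ordinal ltf).
have := congr1 (reshape_index la) eqf; have := congr1 (reshape_offset la) eqf.
by rewrite !flatten_indexKl // !flatten_indexKr.
Qed.

(** The box in the row of a and the column of b belongs to the diagram; its entry is larger than a
    along the row and smaller than b along the column. *)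
Lemma syt_diag V a b : content V a = content V b ->
  ((val V a).1 < (val V b).1)%N -> exists c : 'I_m, (a < c < b)%N.
Proof.
move=> /content_col eq_ab lt_ab; have [_ Vl Vr Vc] := sytP V.
have lt2 : ((val V a).2 < (val V b).2)%N.
  by rewrite -(ltn_add2r (val V b).1) eq_ab ltn_add2l.
have [c [c1 c2]] : exists c, (val V c).1 = (val V a).1 :> nat /\ (val V c).2 = (val V b).2 :> nat.
  by apply: syt_onto; apply: leq_trans (Vl b) (part_nth la_part (ltnW lt_ab)).
exists c; rewrite Vr ?c2 //=; last exact/esym/val_inj.
by rewrite Vc ?c1 //; apply: val_inj.
Qed.

(** Makes the denominators c_(a+1) - c_a of Young's form nonzero: on a common diagonal some entry
    would lie strictly between a and a + 1. *)
Lemma content_adj V (a b : 'I_m) : b = a.+1 :> nat -> content V a != content V b.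
Proof.
move=> ba; apply/eqP => eq_ab; have [Vi _ _ _] := sytP V.
have no_between (c : 'I_m) : ~~ (a < c < b)%N.
  by apply/negP => /andP[+ +]; rewrite ba ltnS => ac; rewrite leqNgt ac.
have no_between' (c : 'I_m) : ~~ (b < c < a)%N.
  apply/negP => /andP[bc ca]; have := ltn_trans bc ca.
  by rewrite ba ltnNge leqnSn.
have := content_col eq_ab.
case: (ltngtP (val V a).1 (val V b).1) => [lt|lt|/val_inj eq1] e2.
- by have [c] := syt_diag eq_ab lt; rewrite (negPf (no_between c)).
- by have [c] := syt_diag (esym eq_ab) lt; rewrite (negPf (no_between' c)).
move: e2; rewrite eq1 => /addIn/val_inj e2.
have /Vi eqab : val V a = val V b by rewrite [LHS]surjective_pairing eq1 e2 -surjective_pairing.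
by move: ba; rewrite eqab => /eqP; rewrite eqn_leq leqnSn ltnn.
Qed.

(** The row reading tableau. It supplies a diagonal entry at which a matrix identity is read off in
    the proof of faithfulness. *)
Lemma syt_exists : exists V : syt m la, True.
Proof.
have la_sum := part_sumn la_part.
have szla : (size la <= m)%N.
  rewrite -la_sum -sum1_size sumnE big_seq [X in (_ <= X)%N]big_seq.
  by apply: leq_sum => x x_la; rewrite lt0n; apply: contraTneq x_la => ->; case/and3P: la_part.
have nthla i : (nth 0 la i <= m)%N.
  case: (ltnP i (size la)) => [lti|lei]; last by rewrite nth_default.
  by rewrite -la_sum sumnE (big_nth 0%N) big_mkord (bigD1 (Ordinal lti)) //= leq_addr.
have lt_la (a : 'I_m) : (a < sumn la)%N by rewrite la_sum.
(* [insubd] only casts to ['I_m]: by [szla] and [nthla] the indices are below m, so its default is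
   never taken. *)
pose U := [ffun a : 'I_m => (insubd a (reshape_index la a), insubd a (reshape_offset la a))].
have U1 a : (U a).1 = reshape_index la a :> nat.
  by rewrite ffunE val_insubd (leq_trans (reshape_indexP (lt_la a)) szla).
have U2 a : (U a).2 = reshape_offset la a :> nat.
  by rewrite ffunE val_insubd (leq_trans (reshape_offsetP (lt_la a)) (nthla _)).
suff h : is_syt la U by exists (exist _ U h).
apply/and4P; split.
- apply/injectiveP => a b eq_ab; apply: val_inj => /=.
  by rewrite -[LHS](reshape_indexK la) -[RHS](reshape_indexK la) -!U1 -!U2 eq_ab.
- by apply/forallP => a; rewrite U1 U2 reshape_offsetP.
- apply/forallP => a; apply/forallP => b; apply/implyP => /andP[/eqP eq1 lt2].
  rewrite ltnNge (reshape_leq la) /= -!U1 -!U2 eq1 ltnn eqxx /=.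
  by rewrite -ltnNge.
apply/forallP => a; apply/forallP => b; apply/implyP => /andP[/eqP eq1 lt2].
rewrite ltnNge (reshape_leq la) /= -!U1 -!U2 (gtn_eqF lt2) /= orbF.
by rewrite -leqNgt ltnW.
Qed.

End Tableau.

Section ContentsDetermine.
Variable m : nat.
Variables la mu : seq nat.
Hypothesis mu_part : is_part m mu.

(** Otherwise the box of a in V lies further up the same diagonal of W and holds there a smaller
    entry b. By the induction hypothesis V has b in that row, hence in the box of a, against
    injectivity. *)
Lemma content_row_le (V : syt m la) (W : syt m mu) (a : 'I_m) :
    (forall a, content V a = content W a) ->
    (forall b : 'I_m, (b < a)%N -> (val V b).1 = (val W b).1) ->
  ((val W a).1 <= (val V a).1)%N.
Proof.
move=> eqc IH; rewrite leqNgt; apply/negP => lt1.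
have [Vi _ _ _] := sytP V; have [Wi Wl Wr Wc] := sytP W.
have e2 := content_col (eqc a).
have lt2 : ((val V a).2 < (val W a).2)%N.
  by rewrite -(ltn_add2r (val W a).1) e2 ltn_add2l.
have [b [b1 b2]] : exists b, (val W b).1 = (val V a).1 :> nat /\ (val W b).2 = (val V a).2 :> nat.
  apply: (syt_onto mu_part).
  exact: ltn_trans lt2 (leq_trans (Wl a) (part_nth mu_part (ltnW lt1))).
have cb : content W b = content W a by rewrite -(eqc a) /content b1 b2.
have ltba : (b < a)%N.
  by have [||c /andP[bc /(ltn_trans bc)]] := @syt_diag _ _ mu_part W b a => //; rewrite b1.
have Vb1 := IH b ltba.
have Vab : val V a = val V b.
  rewrite [LHS]surjective_pairing [RHS]surjective_pairing Vb1; congr (_, _); apply: val_inj => //=.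
  have := content_col (eqc b); rewrite Vb1 b2 => /addIn ->.
  by [].
by move: ltba; rewrite (Vi _ _ Vab) ltnn.
Qed.

End ContentsDetermine.

Lemma content_row m la mu (V : syt m la) (W : syt m mu) :
    is_part m la -> is_part m mu -> (forall a, content V a = content W a) ->
  forall a, (val V a).1 = (val W a).1.
Proof.
move=> la_part mu_part eqc a; have [n] := ubnP a; elim: n a => // n IHn a ltan.
apply/val_inj/eqP; rewrite eqn_leq.
have IH (b : 'I_m) : (b < a)%N -> (val V b).1 = (val W b).1.
  by move=> ltba; apply: IHn; apply: leq_trans ltba _; rewrite -ltnS.
rewrite (content_row_le mu_part eqc IH).
by rewrite (@content_row_le m mu la la_part W V a) // => b /IH.
Qed.

(** The content of an entry gives its diagonal and [content_row] its row. So the contents, which are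
    the joint eigenvalues of the Jucys-Murphy elements, separate all standard tableaux of all
    shapes. *)
Lemma content_shape m la mu (V : syt m la) (W : syt m mu) :
    is_part m la -> is_part m mu -> (forall a, content V a = content W a) ->
  la = mu /\ val V = val W.
Proof.
move=> la_part mu_part eqc; have eq1 := content_row la_part mu_part eqc.
have eqVW : val V = val W.
  apply/ffunP => a; rewrite [LHS]surjective_pairing [RHS]surjective_pairing eq1.
  congr (_, _); apply/val_inj/eqP; rewrite -(eqr_nat int) !natz /=.
  by have /eqP := eqc a; rewrite /content eq1 (inj_eq (addIr _)).
split=> //.
have le_nth la' mu' (V' : syt m la') (W' : syt m mu') i : is_part m la' ->
    val V' = val W' -> (nth 0 la' i <= nth 0 mu' i)%N.
  move=> la'_part eq'; case en: (nth 0%N la' i) => [|n] //.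
  have [|a [a1 a2]] := @syt_onto _ _ la'_part V' i n; first by rewrite en.
  have [_ W'l _ _] := sytP W'.
  by have := W'l a; rewrite -eq' a1 a2.
have eqn i : nth 0%N la i = nth 0%N mu i.
  by apply/eqP; rewrite eqn_leq (le_nth _ _ V W) // (le_nth _ _ W V).
have szle la' mu' : is_part m la' -> (forall i, nth 0 la' i = nth 0 mu' i)%N -> (size la' <= size mu')%N.
  move=> la'_part eqn'; rewrite leqNgt; apply/negP => lt.
  by have := part_gt0 la'_part lt; rewrite eqn' nth_default.
apply: (@eq_from_nth _ 0%N) => [|i _ //].
by apply/eqP; rewrite eqn_leq !szle.
Qed.

(** * Group algebras and Jucys-Murphy elements *)

Section GroupFunctions.
Variables (gT : finGroupType) (F : fieldType).
Implicit Types (z w : gT -> F) (s t u : gT).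

Definition conv z w : gT -> F := fun s => \sum_t z t * w (t^-1 * s)%g.
Definition gone : gT -> F := fun s => (s == 1%g)%:R.

Section Evaluation.
Variables (W : pzRingType) (io : {rmorphism F -> W}) (r : gT -> W).
Hypothesis ioC : forall x y, io x * y = y * io x.

(** The image of an element of the group algebra, given by its coefficients. Both homomorphisms and
    antihomomorphisms [r] occur: the Young representations are of the first kind, [tens_perm] is of
    the second. *)
Definition gev z : W := \sum_s io (z s) * r s.

Lemma eq_gev z w : z =1 w -> gev z = gev w.
Proof. by move=> eq_zw; apply: eq_bigr => s _; rewrite eq_zw. Qed.

Lemma gevB z w : gev (fun s => z s - w s) = gev z - gev w.
Proof. by rewrite -sumrB; apply: eq_bigr => s _; rewrite rmorphB mulrBl. Qed.

Lemma gevZ x z : gev (fun s => x * z s) = io x * gev z.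
Proof. by rewrite mulr_sumr; apply: eq_bigr => s _; rewrite rmorphM mulrA. Qed.

Lemma gev_sum (I : Type) (l : seq I) (P : pred I) (f : I -> gT -> F) :
  gev (fun s => \sum_(i <- l | P i) f i s) = \sum_(i <- l | P i) gev (f i).
Proof. by rewrite exchange_big; apply: eq_bigr => s _; rewrite rmorph_sum mulr_suml. Qed.

Lemma gev_delta t : gev (fun s => (s == t)%:R) = r t.
Proof.
rewrite /gev (bigD1 t) //= eqxx rmorph1 mul1r big1 ?addr0 // => s /negPf->.
by rewrite rmorph0 mul0r.
Qed.

Lemma gev_conv z w : (forall s t, r (s * t)%g = r s * r t) ->
  gev (conv z w) = gev z * gev w.
Proof.
move=> rM; transitivity (\sum_t \sum_s io (z t) * io (w s) * r (t * s)%g).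
  rewrite /gev /conv [LHS](eq_bigr (fun s => \sum_t io (z t) * io (w (t^-1 * s)%g) * r s)).
    rewrite exchange_big /=; apply: eq_bigr => t _.
    by rewrite (reindex_inj (mulgI t)); apply: eq_bigr => s _; rewrite mulKg.
  by move=> s _; rewrite rmorph_sum mulr_suml; apply: eq_bigr => t _; rewrite rmorphM.
rewrite mulr_suml; apply: eq_bigr => t _; rewrite mulr_sumr; apply: eq_bigr => s _.
by rewrite rM -!mulrA; congr (_ * _); rewrite !mulrA ioC.
Qed.

Lemma gev_convV z w : (forall s t, r (s * t)%g = r t * r s) ->
  gev (conv z w) = gev w * gev z.
Proof.
move=> rM; transitivity (\sum_t \sum_s io (z t) * io (w s) * r (t * s)%g).
  rewrite /gev /conv [LHS](eq_bigr (fun s => \sum_t io (z t) * io (w (t^-1 * s)%g) * r s)).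
    rewrite exchange_big /=; apply: eq_bigr => t _.
    by rewrite (reindex_inj (mulgI t)); apply: eq_bigr => s _; rewrite mulKg.
  by move=> s _; rewrite rmorph_sum mulr_suml; apply: eq_bigr => t _; rewrite rmorphM.
rewrite exchange_big mulr_suml; apply: eq_bigr => s _; rewrite mulr_sumr; apply: eq_bigr => t _ /=.
by rewrite rM -!mulrA ioC -!mulrA; congr (_ * (_ * _)); rewrite ioC.
Qed.

End Evaluation.

Definition avg z : gT -> F := fun s => \sum_u z (s ^ u)%g.

Lemma avg_class z s t u : s = (t ^ u)%g -> avg z s = avg z t.
Proof.
move=> ->; rewrite /avg [RHS](reindex_inj (mulgI u)).
by apply: eq_bigr => v _; rewrite conjgM.
Qed.

Lemma gev_avg (W : pzRingType) (io : {rmorphism F -> W}) (r : gT -> W) z :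
    (forall x y, io x * y = y * io x) -> (forall s t, r (s * t)%g = r s * r t) ->
  gev io r (avg z) = \sum_u r u * gev io r z * r (u^-1)%g.
Proof.
move=> ioC rM; rewrite /gev /avg.
under eq_bigr do rewrite rmorph_sum mulr_suml.
rewrite exchange_big; apply: eq_bigr => u _.
rewrite (reindex_inj (conjg_inj (u^-1)%g)) mulr_sumr mulr_suml; apply: eq_bigr => s _ /=.
by rewrite conjgKV mulrA -ioC -!mulrA -!rM conjgE invgK mulgA.
Qed.

End GroupFunctions.

Section JucysMurphy.
Variables (F : fieldType) (m : nat).
Implicit Types (a b : 'I_m) (c : 'I_m -> F).

Definition jm b : 'S_m -> F := fun s => \sum_(a : 'I_m | (a < b)%N) (s == tperm a b)%:R.

Lemma gev_jm (W : pzRingType) (io : {rmorphism F -> W}) (r : 'S_m -> W) b :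
  gev io r (jm b) = \sum_(a : 'I_m | (a < b)%N) r (tperm a b).
Proof. by rewrite /jm gev_sum; apply: eq_bigr => a _; rewrite gev_delta. Qed.

(* [w] acts by the scalar [chi c] on each joint eigenvector of the
   Jucys-Murphy elements with eigenvalues [c]. *)
Definition jvalue (w : 'S_m -> F) (chi : ('I_m -> F) -> F) : Prop :=
  forall (W : pzRingType) (io : {rmorphism F -> W}) (r : 'S_m -> W) (z : W) c,
    (forall x y, io x * y = y * io x) -> r 1%g = 1 ->
    (forall s t, r (s * t)%g = r s * r t) \/ (forall s t, r (s * t)%g = r t * r s) ->
    (forall b, z * gev io r (jm b) = io (c b) * z) ->
  z * gev io r w = io (chi c) * z.

Lemma jvalue1 : jvalue (@gone _ F) (fun=> 1).
Proof. by move=> W io r z c ioC r1 rM zc; rewrite gev_delta r1 mulr1 rmorph1 mul1r. Qed.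

Lemma jvalueM w w' chi chi' : jvalue w chi -> jvalue w' chi' ->
  jvalue (conv w w') (fun c => chi c * chi' c).
Proof.
move=> jw jw' W io r z c ioC r1 rM zc.
have H v v' ch ch' : jvalue v ch -> jvalue v' ch' ->
    z * (gev io r v * gev io r v') = io (ch c * ch' c) * z.
  move=> jv jv'; rewrite mulrA (jv _ _ _ _ c) // -mulrA (jv' _ _ _ _ c) //.
  by rewrite mulrA rmorphM.
case: (rM) => rM'; first by rewrite gev_conv // (H _ _ _ _ jw jw').
by rewrite gev_convV // (H _ _ _ _ jw' jw) mulrC.
Qed.

Lemma jvalue_factor b (x y : F) :
  jvalue (fun s => x * (jm b s - y * gone _ s)) (fun c => x * (c b - y)).
Proof.
move=> W io r z c ioC r1 rM zc.
rewrite gevZ mulrA -ioC -mulrA gevB mulrBr zc gevZ gev_delta r1 mulr1 -ioC -mulrBl.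
by rewrite mulrA -rmorphB -rmorphM.
Qed.

(* Lagrange interpolation at the contents, which lie between -m and m. *)
Definition jproj (d : 'I_m -> int) : 'S_m -> F :=
  foldr (fun p : 'I_m * 'I_(m + m) => let k := p.2%:Z - m%:Z in
     if k == d p.1 then id else
     conv (fun s => ((d p.1)%:~R - k%:~R)^-1 * (jm p.1 s - k%:~R * gone _ s)))
    (@gone _ F) (enum {: 'I_m * 'I_(m + m)}).

(** The value of [jproj d] on a joint eigenvector with eigenvalues c. It is 1 at c = d, and 0 at
    every other vector c of integers of absolute value below m. *)
Definition jchi (d : 'I_m -> int) (c : 'I_m -> F) : F :=
  \prod_(p : 'I_m * 'I_(m + m)) let k := p.2%:Z - m%:Z in
     if k == d p.1 then 1 else ((d p.1)%:~R - k%:~R)^-1 * (c p.1 - k%:~R).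

Lemma jvalue_jproj d : jvalue (jproj d) (jchi d).
Proof.
rewrite /jproj /jchi; set l := enum _.
suff: jvalue (foldr (fun p : 'I_m * 'I_(m + m) => let k := p.2%:Z - m%:Z in
     if k == d p.1 then id else
     conv (fun s => ((d p.1)%:~R - k%:~R)^-1 * (jm p.1 s - k%:~R * gone _ s)))
    (@gone _ F) l) (fun c => \prod_(p <- l) let k := p.2%:Z - m%:Z in
     if k == d p.1 then 1 else ((d p.1)%:~R - k%:~R)^-1 * (c p.1 - k%:~R)).
  by move=> H W io r z c ioC r1 rM zc; rewrite (H _ _ _ _ c) // big_enum.
elim: l => [|p l IHl] /=.
  by move=> W io r z c ioC r1 rM zc; rewrite big_nil; apply: jvalue1 zc.
have jf : jvalue (foldr _ _ l) (fun c => \prod_(p <- l) _) := IHl.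
move=> W io r z c ioC r1 rM zc; rewrite big_cons.
case: ifP => _; first by rewrite mul1r; apply: IHl zc.
exact: (jvalueM (jvalue_factor p.1 _ _) IHl) W io r z c ioC r1 rM zc.
Qed.

End JucysMurphy.

Section JucysMurphyChar0.
Variables (F : numFieldType) (m : nat).

Lemma jchi_same (d : 'I_m -> int) : jchi d (fun b => (d b)%:~R : F) = 1.
Proof.
rewrite /jchi big1 // => p _ /=; case: eqP => // /eqP ne_d.
by rewrite mulVf // subr_eq0 eqr_int eq_sym.
Qed.

Lemma jchi_diff (d d' : 'I_m -> int) b : (forall a, `|d' a| < m%:Z) ->
  d b != d' b -> jchi d (fun b => (d' b)%:~R : F) = 0.
Proof.
move=> bnd ne_d; have := bnd b; rewrite ltr_norml => /andP[lb ub].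
(* The interpolation node equal to d' b has the index d' b + m. *)
have ltk : (`|(d' b + m%:Z)%R| < m + m)%N by lia.
rewrite /jchi (bigD1 (b, Ordinal ltk)) //=.
have -> : `|(d' b + m%:Z)%R|%N%:Z - m%:Z = d' b by lia.
by rewrite eq_sym (negPf ne_d) subrr mulr0 mul0r.
Qed.

End JucysMurphyChar0.

Lemma content_bound m la (V : syt m la) a : `|content V a| < m%:Z.
Proof. by rewrite /content; have := ltn_ord (val V a).1; have := ltn_ord (val V a).2; lia. Qed.

(** * Young's orthonormal form and its faithfulness *)

Section YoungJucysMurphy.
Variables (F : numClosedFieldType) (m : nat) (la : seq nat).
Hypothesis la_part : is_part m la.
Variable rho : mx_representation F [set: 'S_m] #|{: syt m la}|.
Hypothesis rhoP : young_orthonormal rho.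

Lemma content_first (V : syt m la) (a : 'I_m) : a = 0%N :> nat -> content V a = 0.
Proof.
move=> a0; have [Vi Vl Vr Vc] := sytP V; rewrite /content.
suff [-> ->] : (val V a).1 = 0%N :> nat /\ (val V a).2 = 0%N :> nat by [].
split; apply/eqP; rewrite -leqn0 leqNgt; apply/negP => lt0.
  have [b [b1 b2]] : exists b, (val V b).1 = (val V a).1.-1 :> nat /\ (val V b).2 = (val V a).2 :> nat.
    by apply: syt_onto la_part _ _ _ _; apply: leq_trans (Vl a) (part_nth la_part (leq_pred _)).
  have := Vc b a (val_inj b2); rewrite b1 a0 ltn0 prednK // leqnn => /(_ isT).
  by [].
have [b [b1 b2]] : exists b, (val V b).1 = (val V a).1 :> nat /\ (val V b).2 = (val V a).2.-1 :> nat.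
  by apply: syt_onto la_part _ _ _ _; apply: leq_ltn_trans (leq_pred _) (Vl a).
have := Vr b a (val_inj b1); rewrite b2 a0 ltn0 prednK // leqnn => /(_ isT).
by [].
Qed.

Let rhoM (s t : 'S_m) : rho (s * t)%g = rho s *m rho t.
Proof. by rewrite repr_mxM ?inE. Qed.

(** Induction along J_(a+1) = s_a J_a s_a + s_a. Off the diagonal s_a exchanges a and a + 1 in the
    tableau, which matches the contents; its diagonal entry, the inverse of the difference of
    contents, accounts for the last summand. *)
Lemma young_jm (b : 'I_m) :
  \sum_(a : 'I_m | (a < b)%N) rho (tperm a b) =
  diag_mx (\row_i (content (enum_val i) b)%:~R).
Proof.
have [n] : exists n : nat, b = n :> nat by exists b.
elim: n b => [|n IHn] b bn.
  rewrite big1 => [|a]; last by rewrite bn.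
  by apply/matrixP => i j; rewrite !mxE content_first // mul0rn.
have ltn : (n < m)%N by apply: leq_trans (ltn_ord b); rewrite bn.
pose a := Ordinal ltn; have ba : b = a.+1 :> nat by [].
set s := tperm a b; set D := diag_mx _.
have ss : (s * s = 1)%g by rewrite tperm2.
have sumE : \sum_(c : 'I_m | (c < b)%N) rho (tperm c b) =
    rho s *m (\sum_(c : 'I_m | (c < a)%N) rho (tperm c a)) *m rho s + rho s.
  rewrite (bigD1 a) /=; last by rewrite ba ltnS.
  rewrite addrC; congr (_ + _); rewrite mulmx_sumr mulmx_suml.
  apply: eq_big => [c|c /andP[cb ca]].
    by rewrite ba ltnS [RHS]ltn_neqAle andbC; congr (~~ _ && _).
  rewrite -!rhoM; congr (rho _).
  suff -> : tperm c b = (tperm c a ^ s)%g by rewrite conjgE tpermV mulgA.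
  rewrite tpermJ tpermL tpermD //; first by rewrite eq_sym.
  by apply: contraTneq cb => <-; rewrite ltnn.
rewrite sumE (IHn a) //.
(* Multiplied by s on the right, this identity becomes the recursion, as s^2 = 1. *)
suff e : D *m rho s = rho s *m diag_mx (\row_i (content (enum_val i) a)%:~R) + 1%:M.
  rewrite -[X in _ + X](mul1mx (rho s)) -mulmxDl -e -mulmxA -rhoM ss.
  by rewrite repr_mx1 mulmx1.
rewrite /D mul_diag_mx mul_mx_diag; apply/matrixP => i j; rewrite !mxE.
rewrite -(enum_valK i) -(enum_valK j) !enum_rankK /s (rhoP ba).
set V := enum_val i; set W := enum_val j.
have d0 : (content V b - content V a)%:~R != 0 :> F.
  by rewrite intr_eq0 subr_eq0 eq_sym content_adj.
rewrite (inj_eq enum_rank_inj).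
case: eqP => [<-|ne_VW].
  apply/eqP; rewrite [eqbRHS]addrC -subr_eq [X in _ - X]mulrC -mulrBl -rmorphB mulfV //.
case: eqP => [eqW|_]; last by rewrite mulr0 mul0r addr0.
rewrite addr0 mulrC; congr (_ * _%:~R).
by rewrite /content eqW !ffunE tpermL.
Qed.

End YoungJucysMurphy.

Section YoungFaithful.
Variables (F : numClosedFieldType) (m : nat).
Variable rho : forall la, mx_representation F [set: 'S_m] #|{: syt m la}|.
Hypothesis rhoP : forall la, is_part m la -> young_orthonormal (rho la).

Local Notation rev la := (gev (@scalar_mx F #|{: syt m la}|) (rho la)).

Lemma scalar_mxCF n (x : F) (M : 'M[F]_n) : x%:M * M = M * x%:M.
Proof. by rewrite -[LHS]/(x%:M *m M) mul_scalar_mx -[RHS]/(M *m _) mul_mx_scalar. Qed.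

Lemma youngM la (s t : 'S_m) : rho la (s * t)%g = rho la s * rho la t.
Proof. by rewrite repr_mxM ?inE. Qed.

Lemma young1 la : rho la 1%g = 1.
Proof. exact: repr_mx1. Qed.

(** The diagonal matrix unit at i is a joint eigenvector for multiplication from the right, so
    [jvalue] applies to it, one row at a time. *)
Lemma young_diag la w chi : is_part m la -> jvalue w chi ->
  rev la w = diag_mx (\row_i chi (fun b => (content (enum_val i) b)%:~R)).
Proof.
move=> la_part jw; apply/row_matrixP => i; set V := enum_val i.
have := jw _ (@scalar_mx F _) (rho la) (delta_mx i i) (fun b => (content V b)%:~R)
  (@scalar_mxCF _) (young1 la) (or_introl (@youngM la)).
have jmE b : rev la (jm F b) = diag_mx (\row_i (content (enum_val i) b)%:~R).
  by rewrite gev_jm young_jm //; apply: rhoP.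
have dl (d : 'rV[F]_#|{: syt m la}|) : delta_mx i i *m diag_mx d = (d 0 i)%:M *m delta_mx i i.
  apply/matrixP => j k; rewrite mul_mx_diag mul_scalar_mx !mxE.
  by rewrite mulrC; case: (eqVneq k i) => [->|_] //; rewrite andbF !mulr0.
have rd (M : 'M[F]_#|{: syt m la}|) : row i (delta_mx i i *m M) = row i M.
  by rewrite row_mul rowE mul_delta_mx -rowE.
move=> H; rewrite -rd -[_ *m _]/(_ * _) H; last by move=> b; rewrite jmE -[LHS]/(_ *m _) dl mxE.
by rewrite -[_ * _]/(_ *m _) -[RHS]rd dl mxE.
Qed.

Lemma young_jproj la mu (V : syt m mu) : is_part m la -> is_part m mu -> la <> mu ->
  rev la (jproj F (content V)) = 0.
Proof.
move=> la_part mu_part ne_la; rewrite (young_diag la_part (@jvalue_jproj _ _ _)).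
apply/matrixP => i j; rewrite !mxE; set W := enum_val i.
have [b neb] : exists b, content V b != content W b.
  apply/existsP; apply: contra_notT ne_la; rewrite negb_exists => /forallP eqc.
  by have [] // := content_shape la_part mu_part (V := W) (W := V) (fun b => esym (eqP (negbNE (eqc b)))).
by rewrite (jchi_diff F (d' := content W) (content_bound W) neb) mul0rn.
Qed.

Lemma young_jproj_same mu (V : syt m mu) : is_part m mu ->
  rev mu (jproj F (content V)) = delta_mx (enum_rank V) (enum_rank V).
Proof.
move=> mu_part; rewrite (young_diag mu_part (@jvalue_jproj _ _ _)).
apply/matrixP => i j; rewrite !mxE; case: (eqVneq i (enum_rank V)) => [->|ne_i].
  by rewrite enum_rankK jchi_same eq_sym /=.
have [b neb] : exists b, content V b != content (enum_val i) b.
  apply/existsP; apply: contraNT ne_i; rewrite negb_exists => /forallP eqc.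
  have [_ e] := content_shape (V := V) (W := enum_val i) mu_part mu_part (fun b => eqP (negbNE (eqc b))).
  by rewrite (val_inj e : V = _) enum_valK.
by rewrite (jchi_diff F (content_bound _) neb) mul0rn.
Qed.

(* Were [z] nonzero, averaging [z z^*] over conjugation would give a nonzero
   class function killed by all [rho la]; together with the averages of the
   central idempotents of the [rho la] it would contradict the bound on the
   number of classes by the number of cycle types. *)
Lemma young_faithful (z : 'S_m -> F) :
  (forall la, is_part m la -> rev la z = 0) -> z =1 fun=> 0.
Proof.
move=> z0 s0; apply/eqP/negPn/negP => zs0.
(* The value of w at 1 is the sum of the squared moduli of the values of z. *)
pose w := conv z (fun s => (z (s^-1)%g)^*).
pose cls (f : 'S_m -> F) := forall s t : 'S_m, cycle_type s = cycle_type t -> avg f s = avg f t.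
have clsP f : cls f.
  move=> s t /cycle_type_conj[u us]; apply: (@avg_class _ _ f s t (u^-1)%g).
  apply/permP => x; rewrite conjgE invgK !permM -us permK //.
have w1 : avg w 1%g != 0.
  have -> : avg w 1%g = w 1%g *+ #|{: 'S_m}|.
    by rewrite /avg -sumr_const; apply: eq_big => // u _; rewrite conj1g.
  rewrite mulrn_eq0 negb_or -lt0n; apply/andP; split.
    by apply/card_gt0P; exists 1%g.
  rewrite /w /conv (eq_bigr (fun t => `|z t| ^+ 2)) => [|t _]; last by rewrite mulg1 invgK normCK.
  rewrite gt_eqF // lt_def sumr_ge0 ?andbT => [|t _]; last exact: exprn_ge0.
  rewrite psumr_eq0 => [|t _]; last exact: exprn_ge0.
  apply/negP => /allP/(_ s0); rewrite mem_index_enum => /(_ isT).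
  by rewrite expf_eq0 /= normr_eq0 (negPf zs0).
have avgE la f : rev la (avg f) = \sum_u rho la u * rev la f * rho la (u^-1)%g.
  by apply: gev_avg => [x y|s t]; [apply: scalar_mxCF | apply: youngM].
have w0 la : is_part m la -> rev la (avg w) = 0.
  move=> la_part; rewrite avgE big1 // => u _.
  rewrite gev_conv ?z0 ?mul0r ?mulr0 ?mul0r //; [by move=> x y; apply: scalar_mxCF|].
  exact: youngM.
(* The sum of the idempotents of all tableaux of shape la acts as the identity in [rho la] and as 0
   in the other representations. *)
pose q la := fun s => \sum_(V : syt m la) jproj F (content V) s.
have qE la mu : is_part m la -> is_part m mu -> rev la (avg (q mu)) = ((la == mu)%:R *+ #|{: 'S_m}|)%:M.
  move=> la_part mu_part; have qe : rev la (q mu) = (la == mu)%:R%:M.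
    rewrite gev_sum; case: eqP => [->|ne_la]; last first.
      by rewrite mulr0n raddf0 big1 // => V _; apply: young_jproj.
    rewrite (eq_bigr (fun V => delta_mx (enum_rank V) (enum_rank V))) => [|V _]; last exact: young_jproj_same.
    apply/matrixP => i j; rewrite summxE (bigD1 (enum_val i)) //= !mxE enum_valK eqxx /= eq_sym.
    rewrite big1 ?addr0 // => V ne_V; rewrite mxE -(enum_valK i) (inj_eq enum_rank_inj).
    by rewrite eq_sym (negPf ne_V).
  rewrite avgE (eq_bigr (fun=> (la == mu)%:R%:M)) => [|u _].
    by rewrite -[in RHS]sumr_const raddf_sum; apply: eq_bigl.
  by rewrite qe -scalar_mxCF -mulrA -youngM mulgV young1 mulr1.
pose ty := undup [seq cycle_type s | s <- enum {: 'S_m}].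
pose k := size ty; pose la i := nth [::] ty i.
have tyP (s : 'S_m) : (index (cycle_type s) ty < k)%N.
  by rewrite index_mem mem_undup map_f // mem_enum.
have la_part i : (i < k)%N -> is_part m (la i).
  move=> ltik; have := mem_nth [::] ltik; rewrite mem_undup => /mapP[s _ e].
  by rewrite /la e cycle_type_part.
have reps i : (i < k)%N -> exists s : 'S_m, cycle_type s = la i.
  move=> ltik; have := mem_nth [::] ltik; rewrite mem_undup => /mapP[s _ e].
  by exists s; rewrite /la e.
have rep (i : 'I_k) := cid (reps i (ltn_ord i)).
(* One class function more than there are cycle types, with [avg w] as the last. Their values at
   representatives of the types form a matrix with more rows than columns, hence a linear relation
   v. *)
pose f (i : 'I_k.+1) := if (i < k)%N then avg (q (la i)) else avg w.
pose A : 'M[F]_(k.+1, k) := \matrix_(i, j) f i (sval (rep j)).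
have /rowV0Pn[v /sub_kermxP vA v0] : kermx A != 0.
  by rewrite -mxrank_eq0 mxrank_ker -lt0n subn_gt0 ltnS rank_leq_col.
pose g s := \sum_i v 0 i * f i s.
have g0 s : g s = 0.
  have j0 : sval (rep (Ordinal (tyP s))) = sval (rep (Ordinal (tyP s))) by [].
  have e : cycle_type s = cycle_type (sval (rep (Ordinal (tyP s)))).
    by rewrite (svalP (rep _)) /la nth_index // mem_undup map_f // mem_enum.
  have := congr1 (fun M : 'rV_k => M 0 (Ordinal (tyP s))) vA; rewrite !mxE => <-.
  apply: eq_bigr => i _; rewrite mxE; congr (_ * _); rewrite /f.
  by case: ifP => _; apply: clsP.
have gE mu : is_part m mu ->
    rev mu g = \sum_i (v 0 i)%:M * rev mu (f i).
  by move=> _; rewrite gev_sum; apply: eq_bigr => i _; rewrite gevZ.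
have card0 : (#|{: 'S_m}|)%:R != 0 :> F.
  by rewrite pnatr_eq0 -lt0n; apply/card_gt0P; exists 1%g.
(* Evaluated in [rho (la i)], the relation isolates its i-th coefficient. Only the coefficient of
   [avg w] can survive, but [avg w] is nonzero at 1. *)
have vi0 (i : 'I_k.+1) : (i < k)%N -> v 0 i = 0.
  move=> ltik; have lap := la_part i ltik.
  have [V _] := syt_exists lap.
  have : rev (la i) g = 0 by rewrite /gev big1 // => s _; rewrite g0 raddf0 mul0r.
  rewrite gE // (bigD1 i) //= big1 ?addr0 => [|j ne_ji].
    rewrite /f ltik qE // eqxx => /matrixP/(_ (enum_rank V) (enum_rank V)).
    rewrite -[_ * _]/(_ *m _) -scalar_mxM !mxE eqxx mulr1n => /eqP.
    by rewrite mulf_eq0 (negPf card0) orbF => /eqP.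
  rewrite /f; case: ifP => ltjk; last by rewrite w0 ?mulr0.
  rewrite qE ?la_part // (negPf (_ : la i != la j)) ?mul0rn ?scalar_mx0 ?mulr0 //.
    by rewrite raddf0 mulr0.
  rewrite nth_uniq ?undup_uniq //; apply: contraNneq ne_ji => e.
  by apply/eqP/val_inj.
have := g0 1%g; rewrite /g (bigD1 ord_max) //= big1 ?addr0 => [|i ne_i]; last first.
  rewrite vi0 ?mul0r // ltn_neqAle -ltnS ltn_ord andbT.
  by apply: contraNneq ne_i => e; apply/eqP/val_inj.
rewrite /f ltnn => /eqP; rewrite mulf_eq0 (negPf w1) orbF => /eqP vk.
case/negP: v0; apply/eqP/rowP => i; rewrite mxE.
have [/vi0 //|leki] := ltnP i k.
suff -> : i = ord_max by [].
by apply/val_inj/eqP; rewrite eqn_leq leki -ltnS ltn_ord.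
Qed.

End YoungFaithful.

Section YoungIdempotent.
Variables (F : numClosedFieldType) (m : nat) (mu : seq nat) (U : syt m mu).
Variable e : 'S_m -> F.
Hypotheses (mu_part : is_part m mu) (e_spec : young_idempotent U e).

Lemma young_idempotent_jproj : e =1 jproj F (content U).
Proof.
case: e_spec => rho [rhoP e0 eU] s; apply/eqP; rewrite -subr_eq0; apply/eqP.
apply: (young_faithful rhoP (z := fun s => e s - jproj F (content U) s)) => la la_part.
rewrite gevB; have eE la' : gev (@scalar_mx F _) (rho la') e = \sum_s e s *: rho la' s.
  by apply: eq_bigr => t _; rewrite -[LHS]/(_ *m _) mul_scalar_mx.
rewrite eE; case: (eqVneq la mu) => [->|/eqP ne_la].
  by rewrite eU young_jproj_same // subrr.
by rewrite e0 // young_jproj // subrr.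
Qed.

Lemma young_idempotent_value : jvalue e (jchi (content U)).
Proof.
move=> W io r z c ioC r1 rM zc.
by rewrite (eq_gev io r young_idempotent_jproj); apply: jvalue_jproj.
Qed.

Lemma young_idempotent_jml b : conv (jm F b) e =1 fun s => (content U b)%:~R * e s.
Proof.
case: (e_spec) => rho [rhoP e0 eU] s; apply/eqP; rewrite -subr_eq0; apply/eqP.
apply: (young_faithful rhoP (z := fun s => conv (jm F b) e s - (content U b)%:~R * e s)) => la la_part.
rewrite gevB gevZ (gev_conv (@scalar_mxCF F _) _ _ (youngM rho la)).
have eE la' : gev (@scalar_mx F _) (rho la') e = \sum_s e s *: rho la' s.
  by apply: eq_bigr => t _; rewrite -[LHS]/(_ *m _) mul_scalar_mx.
rewrite eE; case: (eqVneq la mu) => [->|/eqP ne_la]; last by rewrite e0 // !mulr0 subrr.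
rewrite eU gev_jm young_jm //; last exact: rhoP.
rewrite -[diag_mx _ * _]/(_ *m _) -[_%:M * _]/(_ *m _) mul_scalar_mx mul_diag_mx.
apply/matrixP => i j; rewrite !mxE.
case: (eqVneq i (enum_rank U)) => [->|]; last by rewrite mulr0 mulr0 subrr.
by rewrite enum_rankK subrr.
Qed.

End YoungIdempotent.

(** * Polynomial functions and the fusion procedure *)

Section PolynomialFunctions.
Variables (F : numFieldType) (W : pzRingType) (io : {rmorphism F -> W}).
Hypothesis ioC : forall x y, io x * y = y * io x.

Definition polyfun (f : F -> W) : Prop :=
  exists l : seq ({poly F} * W), forall v, f v = \sum_(x <- l) io x.1.[v] * x.2.

Lemma polyfun_const y : polyfun (fun=> y).
Proof. by exists [:: (1, y)] => v; rewrite big_seq1 /= hornerC rmorph1 mul1r. Qed.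

Lemma polyfun_id : polyfun io.
Proof. by exists [:: ('X, 1)] => v; rewrite big_seq1 /= hornerX mulr1. Qed.

Lemma polyfunM f g : polyfun f -> polyfun g -> polyfun (fun v => f v * g v).
Proof.
move=> [l fl] [l' gl']; exists [seq (x.1 * y.1, x.2 * y.2) | x <- l, y <- l'] => v.
rewrite big_allpairs_dep fl gl' mulr_suml; apply: eq_bigr => x _.
rewrite mulr_sumr; apply: eq_bigr => y _ /=.
by rewrite hornerM rmorphM -!mulrA; congr (_ * _); rewrite !mulrA ioC.
Qed.

Lemma polyfunD f g : polyfun f -> polyfun g -> polyfun (fun v => f v + g v).
Proof. by move=> [l fl] [l' gl']; exists (l ++ l') => v; rewrite big_cat /= fl gl'. Qed.

Lemma eq_polyfun f g : f =1 g -> polyfun f -> polyfun g.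
Proof. by move=> eq_fg [l fl]; exists l => v; rewrite -eq_fg. Qed.

Lemma polyfun_sum (I : Type) (r : seq I) (f : I -> F -> W) :
  (forall i, polyfun (f i)) -> polyfun (fun v => \sum_(i <- r) f i v).
Proof.
move=> pf; elim: r => [|i r IHr].
  by apply: eq_polyfun (polyfun_const 0) => v; rewrite big_nil.
by apply: eq_polyfun (polyfunD (pf i) IHr) => v; rewrite big_cons.
Qed.

Lemma polyfunX f n : polyfun f -> polyfun (fun v => f v ^+ n).
Proof.
move=> pf; elim: n => [|n IHn]; first exact: polyfun_const.
by apply: eq_polyfun (polyfunM pf IHn) => v; rewrite exprS.
Qed.

Lemma polyfunB f g : polyfun f -> polyfun g -> polyfun (fun v => f v - g v).
Proof.
move=> pf pg; have pN := polyfunM (polyfun_const (-1)) pg.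
by apply: eq_polyfun (polyfunD pf pN) => v; rewrite mulN1r.
Qed.

(** In characteristic 0 there are enough points outside a finite set to recover the coefficients.
    The Vandermonde matrix is inverted over F, so W may have zero divisors. *)
Lemma polyfun0 f (s : seq F) : polyfun f -> (forall v, v \notin s -> f v = 0) ->
  forall v, f v = 0.
Proof.
move=> [l fl] f0; pose d := \max_(x <- l) size x.1.
pose c i := \sum_(x <- l) io x.1`_i * x.2.
have fE v : f v = \sum_(i < d) io (v ^+ i) * c i.
  rewrite fl; under [RHS]eq_bigr do rewrite mulr_sumr.
  rewrite exchange_big big_seq [RHS]big_seq; apply: eq_bigr => x xl.
  have szx : (size x.1 <= d)%N by rewrite /d (big_rem x) //= leq_maxl.
  rewrite (horner_coef_wide _ szx).
  rewrite rmorph_sum mulr_suml; apply: eq_bigr => i _.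
  by rewrite mulrA -rmorphM mulrC [X in _ = X * _]rmorphM -rmorphM mulrC.
(* Among d + [size s] integers at least d remain when those in s are removed. *)
pose q : seq F := [seq n%:R | n <- iota 0 (d + size s)].
pose r := [seq x <- q | x \notin s].
have r_uniq : uniq r.
  by rewrite filter_uniq // map_inj_uniq ?iota_uniq // => i j /eqP; rewrite eqr_nat => /eqP.
have szr : (d <= size r)%N.
  rewrite -(leq_add2r (size s)).
  have <- : size q = (d + size s)%N by rewrite size_map size_iota.
  rewrite -(count_predC (mem s) q) addnC /r size_filter.
  apply: leq_add; first exact: eq_leq.
  rewrite -size_filter; apply: uniq_leq_size.
    by rewrite filter_uniq // map_inj_uniq ?iota_uniq // => i j /eqP; rewrite eqr_nat => /eqP.
  by move=> x; rewrite mem_filter => /andP[].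
pose V := Vandermonde d (\row_(j < d) r`_j).
have Vu : V \in unitmx.
  rewrite unitmxE det_Vandermonde unitfE; apply/prodf_neq0 => i _.
  apply/prodf_neq0 => j lt_ij; rewrite !mxE subr_eq0 nth_uniq ?(leq_trans _ szr) //.
  by rewrite gtn_eqF.
have c0 (i : 'I_d) : c i = 0.
  have -> : c i = \sum_(j < d) io (invmx V j i) * f r`_j.
    transitivity (\sum_(k < d) io ((V *m invmx V) k i) * c k).
      rewrite mulmxV // (bigD1 i) //= mxE eqxx rmorph1 mul1r big1 ?addr0 // => k /negPf ne_k.
      by rewrite mxE ne_k rmorph0 mul0r.
    under [RHS]eq_bigr do rewrite fE mulr_sumr.
    rewrite [RHS]exchange_big; apply: eq_bigr => k _ /=.
    rewrite mxE rmorph_sum mulr_suml; apply: eq_bigr => j _.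
    by rewrite !mxE mulrA -rmorphM mulrC.
  rewrite big1 // => j _; rewrite f0 ?mulr0 //.
  have := mem_nth 0 (leq_trans (ltn_ord j) szr); rewrite mem_filter => /andP[].
  by [].
by move=> v; rewrite fE big1 // => i _; rewrite c0 mulr0.
Qed.

End PolynomialFunctions.

(** The inductive step of [fusion_key] as an identity in an abstract ring: V is v, C the eigenvalue
    c_a of the site being added and [al] the difference v - c_a. *)
Lemma fusion_key_step (W : pzRingType) (y P S al V C : W) :
    (forall x, al * x = x * al) -> (forall x, V * x = x * V) ->
    y * P * S = C * (y * P) -> al = V - C ->
  y * (al - P) * (V - S) = y * (V - (P + S)) * al.
Proof.
move=> alC VC yPS alE; rewrite -[RHS]alC !mulrBr !mulrDr -(alC y) !mulrBl.
have -> : al * (y * P) = V * (y * P) - C * (y * P) by rewrite alE mulrBl.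
rewrite -(VC (y * P)) yPS !mulrA opprB opprD opprB !addrA; congr (_ - _).
by rewrite addrAC.
Qed.

Section Fusion.
Variables (F : numFieldType) (m : nat) (W : pzRingType).
Variables (io : {rmorphism F -> W}) (p : 'S_m -> W).
Hypotheses (ioC : forall x y, io x * y = y * io x) (p1 : p 1%g = 1).
Hypothesis pM : forall s t, p (s * t)%g = p t * p s.
Local Notation P a b := (p (tperm a b)).
Local Notation JM b := (gev io p (jm F b)).

Variables (tau : 'I_m -> F -> W) (c : 'I_m -> F).
Hypothesis tau_poly : forall a, polyfun io (tau a).
Hypothesis tau_comm : forall a b d v, a != b -> a != d ->
  P b d * tau a v = tau a v * P b d.
Hypothesis tau_rtt : forall a b x y, a != b ->
  (io (x - y) - P a b) * (tau a x * tau b y) = tau b y * tau a x * (io (x - y) - P a b).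

Let t (i : nat) : W := if insub i is Some a then tau a (c a) else 1.
Let tE (a : 'I_m) : t a = tau a (c a).
Proof. by rewrite /t valK. Qed.

Definition fusion_prod n := \prod_(i < n) t i.

Lemma fusion_prodE : fusion_prod m = \prod_a tau a (c a).
Proof. by apply: eq_bigr => a _; rewrite tE. Qed.

Let jmE b : JM b = \sum_(a : 'I_m | (a < b)%N) P a b. Proof. exact: gev_jm. Qed.

Let P_comm_prod n (a b : 'I_m) : (n <= a)%N -> (n <= b)%N ->
  P a b * fusion_prod n = fusion_prod n * P a b.
Proof.
move=> na nb; rewrite /fusion_prod; elim: n na nb => [|n IHn] na nb.
  by rewrite big_ord0 mulr1 mul1r.
rewrite big_ord_recr /= mulrA IHn 1?ltnW // -!mulrA; congr (_ * _).
have ltn : (n < m)%N := ltn_trans na (ltn_ord a).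
rewrite (_ : n = Ordinal ltn) // tE; apply: tau_comm.
  by apply: contraTneq na => <-; rewrite ltnn.
by apply: contraTneq nb => <-; rewrite ltnn.
Qed.

Section Site.
Variables (k : 'I_m) (v : F).

Let r (i : nat) : W := if insub i is Some a then io (v - c a) - P a k else 1.
Let rE (a : 'I_m) : r a = io (v - c a) - P a k.
Proof. by rewrite /r valK. Qed.

(** The product of the numerators v - c_a - P_(ak) of the R-matrices between site k and the earlier
    sites. Without denominators it is polynomial in v and can be considered at the contents. *)
Fixpoint fusion_R n := if n is n'.+1 then r n' * fusion_R n' else 1.

(** [tau_rtt] is applied one site at a time: the factor at site a commutes with the R-matrices of
    earlier sites, and P_(ak) with the factors of earlier sites. *)
Lemma fusion_exchange n : (n <= k)%N ->
  fusion_prod n * tau k v * fusion_R n = fusion_R n * tau k v * fusion_prod n.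
Proof.
elim: n => [|n IHn] ltnk; first by rewrite /fusion_prod big_ord0 !mul1r !mulr1.
have ltn : (n < m)%N := ltn_trans ltnk (ltn_ord k).
pose a := Ordinal ltn; have na : n = a by [].
have ne_ka : k != a by apply: contraTneq ltnk => ->; rewrite ltnn.
have rC y : P a k * y = y * P a k -> r n * y = y * r n.
  by move=> yC; rewrite na rE mulrBl mulrBr ioC yC.
have ex : t n * tau k v * r n = r n * tau k v * t n.
  rewrite na tE rE; have := tau_rtt v (c a) ne_ka; rewrite tpermC => <-.
  by rewrite mulrA.
have tR : t n * fusion_R n = fusion_R n * t n.
  suff H i : (i <= n)%N -> t n * fusion_R i = fusion_R i * t n by exact: H.
  rewrite na tE; elim: i => [|i IHi] //= lein; first by rewrite mulr1 mul1r.
  have lti : (i < m)%N := ltn_trans lein ltn.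
  have -> : r i = io (v - c (Ordinal lti)) - P (Ordinal lti) k by rewrite -rE.
  rewrite mulrA.
  have -> : tau a (c a) * (io (v - c (Ordinal lti)) - P (Ordinal lti) k) =
      (io (v - c (Ordinal lti)) - P (Ordinal lti) k) * tau a (c a).
    rewrite mulrBl mulrBr ioC tau_comm //.
      by apply/eqP => /(congr1 val) /= e; move: lein; rewrite e ltnn.
    by rewrite eq_sym.
  by rewrite -!mulrA IHi // ltnW.
have Rp : r n * fusion_prod n = fusion_prod n * r n.
  by apply: rC; apply: P_comm_prod => //; apply: ltnW.
rewrite /fusion_prod big_ord_recr /= -/(fusion_prod n).
rewrite -[fusion_prod n * t n * _]mulrA -!mulrA (mulrA _ _ (r n * _)) (mulrA _ (r n)) ex.
rewrite -!mulrA tR; rewrite [in LHS](mulrA (fusion_prod n)) -Rp -!mulrA; congr (_ * _).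
by rewrite !mulrA -[in RHS]IHn ?mulrA // ltnW.
Qed.

(** On a joint eigenvector the product of the 1 - P_(ak)/(v - c_a) collapses to 1 minus the sum of
    the P_(ak)/v; this is that identity without denominators. It rests on P_(ak) S = J_a P_(ak),
    where S is the sum of the earlier terms. *)
Lemma fusion_key n (y : W) : (n <= k)%N ->
    (forall b : 'I_m, (b < n)%N -> y * JM b = io (c b) * y) ->
  y * fusion_R n * io v = y * (io v - \sum_(a : 'I_m | (a < n)%N) P a k)
     * io (\prod_(a : 'I_m | (a < n)%N) (v - c a)).
Proof.
elim: n y => [|n IHn] y ltnk yJ.
  by rewrite big_pred0 // subr0 mulr1 big_pred0 // rmorph1 mulr1.
have ltn : (n < m)%N := ltn_trans ltnk (ltn_ord k).
pose a := Ordinal ltn; have na : n = a by [].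
have ne_ka : k != a by apply: contraTneq ltnk => ->; rewrite ltnn.
set S := \sum_(i : 'I_m | (i < n)%N) P i k.
have sum1 (V : nmodType) (f : 'I_m -> V) : \sum_(i : 'I_m | (i < n.+1)%N) f i = f a + \sum_(i : 'I_m | (i < n)%N) f i.
  rewrite (bigD1 a) /=; last exact: ltnSn.
  congr (_ + _); apply: eq_bigl => i; rewrite ltnS [RHS]ltn_neqAle andbC.
  by congr (_ && _).
have prod1 : \prod_(i : 'I_m | (i < n.+1)%N) (v - c i) = (v - c a) * \prod_(i : 'I_m | (i < n)%N) (v - c i).
  rewrite (bigD1 a) /=; last exact: ltnSn.
  congr (_ * _); apply: eq_bigl => i; rewrite ltnS [RHS]ltn_neqAle andbC.
  by congr (_ && _).
rewrite sum1 -/S prod1 /= na rE -na mulrA IHn ?(ltnW ltnk) //; last first.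
  move=> b ltbn; rewrite -mulrA.
  have PJ : P a k * JM b = JM b * P a k.
    rewrite jmE mulr_sumr mulr_suml; apply: eq_bigr => i ltib.
    rewrite -!pM; congr (p _); rewrite [LHS]conjgC; congr (_ * _)%g.
    have ltia : (i < a)%N := ltn_trans ltib ltbn.
    have bk : (b < k)%N := ltn_trans ltbn ltnk.
    rewrite tpermJ !tpermD //; try by apply/eqP => e; move: ltia ltbn bk (ltn_trans ltib bk); rewrite -?e ?ltnn // e ltnn.
  have aC : (io (v - c a) - P a k) * JM b = JM b * (io (v - c a) - P a k).
    by rewrite mulrBl mulrBr ioC PJ.
  by rewrite aC mulrA yJ ?mulrA // ltnW.
rewrite rmorphM !mulrA; congr (_ * _); rewrite -/S.
have PS : P a k * S = JM a * P a k.
  rewrite /S jmE mulr_sumr mulr_suml; apply: eq_bigr => i ltin.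
  rewrite -!pM; congr (p _); rewrite [LHS]conjgC; congr (_ * _)%g.
  rewrite tpermJ tpermR tpermD //; last by apply: contraTneq (ltn_trans ltin ltnk) => ->; rewrite ltnn.
  by apply: contraTneq ltin => <-; rewrite ltnn.
have yPS : y * P a k * S = io (c a) * (y * P a k).
  by rewrite -mulrA PS mulrA yJ // mulrA.
apply: fusion_key_step yPS _ => //; exact: rmorphB.
Qed.

End Site.

(** Let T be the product over the sites before k. The exchange relation, with [fusion_key] used on
    both of its sides, gives z T tau_k(v) (v - J_k) = z (v - J_k) tau_k(v) T for v away from the
    contents, hence for all v by polynomiality. At v = c_k the right-hand side is 0. *)
Lemma fusion (z : W) : (forall b, z * JM b = io (c b) * z) ->
  forall b, z * (\prod_a tau a (c a)) * JM b = io (c b) * (z * \prod_a tau a (c a)).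
Proof.
move=> zJ b; rewrite -fusion_prodE.
suff H n : (n <= m)%N -> forall b : 'I_m, (b < n)%N ->
    z * fusion_prod n * JM b = io (c b) * (z * fusion_prod n) by exact: H.
elim: n => // n IHn ltnm {}b ltbn.
pose k := Ordinal ltnm.
have IH := IHn (ltnW ltnm).
have tk : fusion_prod n.+1 = fusion_prod n * tau k (c k).
  by rewrite /fusion_prod big_ord_recr /= -tE.
have [ltbn'|] := ltnP b n.
  have JC v : tau k v * JM b = JM b * tau k v.
    rewrite jmE mulr_sumr mulr_suml; apply: eq_bigr => i ltib.
    rewrite tau_comm //; first by apply: contraTneq (ltn_trans ltib ltbn') => <-; rewrite ltnn.
    by apply: contraTneq ltbn' => <-; rewrite ltnn.
  by rewrite tk !mulrA -(mulrA _ (tau _ _)) JC mulrA IH // !mulrA.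
rewrite leq_eqVlt ltnNge -ltnS ltbn orbF => /eqP nb.
have {nb} -> : b = k by apply: val_inj.
have kJ : \sum_(a : 'I_m | (a < n)%N) P a k = JM k by rewrite jmE.
pose f v := z * (fusion_prod n * tau k v) * (io v - JM k) - z * (io v - JM k) * tau k v * fusion_prod n.
have pJ : polyfun io (fun v => io v - JM k) := polyfunB ioC (polyfun_id io) (polyfun_const io _).
have pc := polyfun_const io.
have pf : polyfun io f := polyfunB ioC
  (polyfunM ioC (polyfunM ioC (pc z) (polyfunM ioC (pc _) (tau_poly k))) pJ)
  (polyfunM ioC (polyfunM ioC (polyfunM ioC (pc z) pJ) (tau_poly k)) (pc _)).
have f0 v : v \notin [seq c a | a <- enum 'I_m] -> f v = 0.
  move=> vc; pose q := \prod_(a : 'I_m | (a < n)%N) (v - c a).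
  (* Both sides carry the scalar q, which is invertible because v is none of the contents. *)
  have q0 : q != 0.
    apply/prodf_neq0 => a _; rewrite subr_eq0; apply: contraNneq vc => ->.
    by rewrite map_f // mem_enum.
  have e := fusion_exchange v (leqnn k).
  have e1 := fusion_key v (leqnn k) (y := z) (fun b _ => zJ b).
  have zT (b' : 'I_m) : (b' < k)%N -> z * (fusion_prod n * tau k v) * JM b' = io (c b') * (z * (fusion_prod n * tau k v)).
    move=> ltb; rewrite !mulrA -mulrA.
    have -> : tau k v * JM b' = JM b' * tau k v.
      rewrite jmE mulr_sumr mulr_suml; apply: eq_bigr => i ltib.
      rewrite tau_comm //; first by apply: contraTneq (ltn_trans ltib ltb) => <-; rewrite ltnn.
      by apply: contraTneq ltb => <-; rewrite ltnn.
    by rewrite mulrA IH // !mulrA.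
  have e2 := fusion_key v (leqnn k) zT.
  have eq12 : z * (fusion_prod n * tau k v) * fusion_R k v k * io v =
      z * fusion_R k v k * io v * tau k v * fusion_prod n.
    rewrite -(mulrA z _ (fusion_R _ _ _)) e -!mulrA; congr (_ * (_ * _)).
    by rewrite [RHS]ioC !mulrA.
  move: eq12; rewrite e2 e1 /= kJ -/q => eq12.
  have : f v * io q = 0.
    rewrite /f mulrBl eq12; apply/eqP; rewrite subr_eq0 -!mulrA; apply/eqP.
    by congr (_ * (_ * _)); rewrite ioC -mulrA.
  by move/(congr1 (fun x => x * io q^-1)); rewrite mul0r -mulrA -rmorphM mulfV // rmorph1 mulr1.
have := polyfun0 pf f0 (c k).
rewrite /f tk [z * (io _ - _)]mulrBr zJ ioC subrr !mul0r subr0 mulrBr -ioC => /subr0_eq <-.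
by rewrite mulrA.
Qed.

End Fusion.

(** * Absorption by an idempotent *)

Section Absorption.
Variables (W : pzRingType) (E : W).
Hypothesis EE : E * E = E.

Definition absorbs x := E * x = E * x * E.

Lemma absorbs1 : absorbs 1. Proof. by rewrite /absorbs mulr1 EE. Qed.

Lemma absorbsM x y : absorbs x -> absorbs y -> absorbs (x * y).
Proof.
rewrite /absorbs => ex ey.
have e : E * (x * y) = E * x * (E * y) by rewrite mulrA {1}ex -mulrA.
by rewrite e -(mulrA (E * x)) -ey.
Qed.

Lemma absorbs0 : absorbs 0. Proof. by rewrite /absorbs mulr0 mul0r. Qed.

Lemma absorbsD x y : absorbs x -> absorbs y -> absorbs (x + y).
Proof. by rewrite /absorbs => ex ey; rewrite mulrDr mulrDl -ex -ey. Qed.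

Lemma absorbsB x y : absorbs x -> absorbs y -> absorbs (x - y).
Proof. by rewrite /absorbs => ex ey; rewrite mulrBr mulrBl -ex -ey. Qed.

Lemma absorbs_central s x : (forall y, s * y = y * s) -> absorbs x -> absorbs (s * x).
Proof.
rewrite /absorbs => sC ex; have -> : E * (s * x) = s * (E * x) by rewrite mulrA -sC mulrA.
by rewrite -mulrA -ex.
Qed.

Lemma absorbsX x n : absorbs x -> absorbs (x ^+ n).
Proof.
move=> ex; elim: n => [|n IHn]; first exact: absorbs1.
by rewrite exprS; apply: absorbsM.
Qed.

Lemma absorbs_sum (I : Type) (r : seq I) (P : pred I) (f : I -> W) :
  (forall i, P i -> absorbs (f i)) -> absorbs (\sum_(i <- r | P i) f i).
Proof. by move=> ef; elim/big_rec: _ => [|i x Pi]; [apply: absorbs0|apply/absorbsD/ef]. Qed.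

(** The inverse of a unipotent x is a finite geometric series in 1 - x, so absorption passes to
    it. *)
Lemma absorbs_inv x y n : (1 - x) ^+ n = 0 -> x * y = 1 -> absorbs x -> absorbs y.
Proof.
move=> x0 xy ex; pose z := 1 - x; pose s := \sum_(i < n) z ^+ i.
have xs : x * s = 1.
  by rewrite -[x in LHS](subKr 1) -opprB mulNr -subrX1 x0 sub0r opprK.
have sx : s * x = 1.
  rewrite -[RHS]xs /s mulr_sumr mulr_suml; apply: eq_bigr => i _.
  apply: esym; apply: commrX; rewrite /GRing.comm /z mulrBr mulrBl mulr1 mul1r.
  by [].
have -> : y = s by rewrite -[RHS]mulr1 -xy mulrA sx mul1r.
apply: absorbs_sum => i _; apply: absorbsX; apply: absorbsB => //.
exact: absorbs1.
Qed.

End Absorption.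

(** * Matrix units, permutation operators and partial traces *)

Section MatrixUnits.
Variables (N : nat) (X : eqType) (W : pzRingType) (e : X -> 'I_N -> 'I_N -> W).
Hypothesis eM : forall x i j k l, e x i j * e x k l = if j == k then e x i l else 0.
Hypothesis eC : forall x y i j k l, x != y -> e x i j * e y k l = e y k l * e x i j.
Hypothesis e1 : forall x, \sum_i e x i i = 1.

Definition uperm x y : W := \sum_i \sum_j e x i j * e y j i.

Lemma uperm_units x y i j k l : x != y ->
  uperm x y * (e x i j * e y k l) = e x k j * e y i l.
Proof.
move=> ne_xy; rewrite /uperm mulr_suml (bigD1 k) //= [X in _ + X]big1 ?addr0 => [|a ne_a].
  rewrite mulr_suml (bigD1 i) //= [X in _ + X]big1 ?addr0 => [|b ne_b].
    by rewrite -mulrA (mulrA (e y _ _)) -(eC _ _ _ _ ne_xy) !mulrA eM eqxx -mulrA eM eqxx.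
  by rewrite -mulrA (mulrA (e y _ _)) -(eC _ _ _ _ ne_xy) !mulrA eM (negPf ne_b) !mul0r.
rewrite mulr_suml big1 // => b _.
by rewrite -mulrA (mulrA (e y _ _)) -(eC _ _ _ _ ne_xy) -mulrA eM (negPf ne_a) !mulr0.
Qed.

Lemma units_uperm x y i j k l : x != y ->
  e x i j * e y k l * uperm x y = e x i l * e y k j.
Proof.
move=> ne_xy; rewrite /uperm mulr_sumr (bigD1 j) //= [X in _ + X]big1 ?addr0 => [|a ne_a].
  rewrite mulr_sumr (bigD1 l) //= [X in _ + X]big1 ?addr0 => [|b ne_b].
    by rewrite -mulrA (mulrA (e y _ _)) -(eC _ _ _ _ ne_xy) !mulrA eM eqxx -mulrA eM eqxx.
  by rewrite -mulrA (mulrA (e y _ _)) -(eC _ _ _ _ ne_xy) -mulrA eM eq_sym (negPf ne_b) !mulr0.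
rewrite mulr_sumr big1 // => b _.
by rewrite -mulrA (mulrA (e y _ _)) -(eC _ _ _ _ ne_xy) !mulrA eM eq_sym (negPf ne_a) !mul0r.
Qed.

Lemma uperm_sym x y : x != y -> uperm x y = uperm y x.
Proof.
move=> ne_xy; rewrite /uperm exchange_big; apply: eq_bigr => i _; apply: eq_bigr => j _.
exact: eC.
Qed.

Lemma uperm_comm x y z i j : z != x -> z != y ->
  uperm x y * e z i j = e z i j * uperm x y.
Proof.
move=> zx zy; rewrite mulr_suml mulr_sumr; apply: eq_bigr => k _.
rewrite mulr_suml mulr_sumr; apply: eq_bigr => l _.
by rewrite mulrA (eC _ _ _ _ zx) -!mulrA (eC _ _ _ _ zy).
Qed.

Lemma uperm_unit x y i j : x != y -> uperm x y * e x i j = e y i j * uperm x y.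
Proof.
move=> ne_xy.
have -> : e x i j = \sum_k e x i j * e y k k by rewrite -mulr_sumr e1 mulr1.
have -> : e y i j = \sum_k e x k k * e y i j by rewrite -mulr_suml e1 mul1r.
rewrite mulr_sumr mulr_suml; apply: eq_bigr => k _.
by rewrite uperm_units // units_uperm.
Qed.

Lemma uperm2 x y : x != y -> uperm x y * uperm x y = 1.
Proof.
move=> ne_xy; rewrite {2}/uperm mulr_sumr -(e1 y); apply: eq_bigr => i _.
rewrite mulr_sumr -[RHS]mul1r -(e1 x) mulr_suml; apply: eq_bigr => j _.
by rewrite uperm_units.
Qed.

Lemma uperm_braid x y z : x != y -> y != z -> x != z ->
  uperm x y * uperm x z = uperm y z * uperm x y.
Proof.
move=> xy yz xz; rewrite [in LHS](_ : uperm x z = \sum_i \sum_j e x i j * e z j i) //.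
rewrite mulr_sumr mulr_suml; apply: eq_bigr => i _.
rewrite mulr_sumr mulr_suml; apply: eq_bigr => j _.
by rewrite mulrA uperm_unit // -!mulrA uperm_comm // eq_sym.
Qed.

Section Collapse.
Variables (V : zmodType) (Tr : {additive W -> V}) (x y : X).
Hypothesis ne_xy : x != y.
Hypothesis Tr_cyc : forall i j w, Tr (e y i j * w) = Tr (w * e y i j).
Local Notation P := (uperm x y).

Variables (a z c : W).
Hypotheses (ay : forall i j, a * e y i j = e y i j * a).
Hypotheses (cy : forall i j, c * e y i j = e y i j * c).
Hypotheses (zx : forall i j, z * e x i j = e x i j * z).

(** In each term of P the matrix unit of site y is carried around by cyclicity of the trace, while
    that of site x passes through z. *)
Lemma collapse_r : Tr (a * z * P * c) = Tr (a * P * z * c).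
Proof.
rewrite /uperm !mulr_sumr !mulr_suml !raddf_sum; apply: eq_bigr => i _.
rewrite !mulr_sumr !mulr_suml !raddf_sum; apply: eq_bigr => j _ /=.
rewrite -!mulrA -cy !mulrA -Tr_cyc !mulrA -ay -!mulrA (mulrA z) zx.
by rewrite !mulrA -(mulrA a (e y _ _)) -(eC _ _ _ _ ne_xy) !mulrA.
Qed.

(** The partial transpose Q of the permutation operator satisfies Q^2 = N Q; this is the same fact
    under the trace, and the source of crossing symmetry. *)
Lemma collapse_lr : Tr (a * P * z * P * c) = Tr (a * P * z * c) *+ N.
Proof.
rewrite [X in Tr (_ * _ * z * X * c)]/uperm mulr_sumr mulr_suml raddf_sum /=.
transitivity (\sum_k \sum_l \sum_i \sum_j Tr (a * (e x i j * e y j i) * z * (e x k l * e y l k) * c)).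
  apply: eq_bigr => k _; rewrite mulr_sumr mulr_suml raddf_sum; apply: eq_bigr => l _ /=.
  rewrite /uperm mulr_sumr !mulr_suml raddf_sum; apply: eq_bigr => i _ /=.
  by rewrite mulr_sumr !mulr_suml raddf_sum.
have step i j k l : Tr (a * (e x i j * e y j i) * z * (e x k l * e y l k) * c) =
    if j == k then Tr (a * (e x i l * e y l i) * z * c) else 0.
  rewrite -!mulrA -cy !mulrA -Tr_cyc !mulrA -ay -!mulrA (mulrA z) zx !mulrA.
  rewrite -(mulrA a (e y _ _)) -(eC _ _ _ _ ne_xy) !mulrA -(mulrA _ (e y l k)) eM eq_sym.
  case: eqP => [->|_]; last by rewrite mulr0 !mul0r raddf0.
  by rewrite -(mulrA _ (e y l i)) -(eC _ _ _ _ ne_xy) !mulrA -(mulrA a) eM eqxx.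
transitivity (\sum_(k < N) \sum_l \sum_i Tr (a * (e x i l * e y l i) * z * c)).
  apply: eq_bigr => k _; apply: eq_bigr => l _; apply: eq_bigr => i _.
  by rewrite (eq_bigr _ (fun j _ => step i j k l)) -big_mkcond big_pred1_eq.
rewrite sumr_const card_ord; congr (_ *+ _).
rewrite exchange_big /uperm mulr_sumr !mulr_suml raddf_sum; apply: eq_bigr => i _ /=.
by rewrite mulr_sumr !mulr_suml raddf_sum.
Qed.

End Collapse.

Section Operators.
Variables (A : pzRingType) (inj : {rmorphism A -> W}).
Hypothesis injC : forall x i j a, inj a * e x i j = e x i j * inj a.

Definition uop x (T : 'M[A]_N) : W := \sum_i \sum_j inj (T i j) * e x i j.
(** A tensor with four indices placed at two sites, not necessarily a product of operators. In this
    form the relations between T and T^+ are compared entry by entry. *)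
Definition uop2 x y (Z : 'I_N -> 'I_N -> 'I_N -> 'I_N -> A) : W :=
  \sum_(q : ('I_N * 'I_N) * ('I_N * 'I_N))
     inj (Z q.1.1 q.1.2 q.2.1 q.2.2) * (e x q.1.1 q.1.2 * e y q.2.1 q.2.2).

Lemma inj_uperm x y a : inj a * uperm x y = uperm x y * inj a.
Proof.
rewrite mulr_suml mulr_sumr; apply: eq_bigr => i _; rewrite mulr_suml mulr_sumr.
by apply: eq_bigr => j _; rewrite mulrA injC -!mulrA injC.
Qed.

Lemma eq_uop2 x y Z Z' : (forall i j k l, Z i j k l = Z' i j k l) ->
  uop2 x y Z = uop2 x y Z'.
Proof. by move=> eq_Z; apply: eq_bigr => q _; rewrite eq_Z. Qed.

Lemma uop2B x y Z Z' :
  uop2 x y (fun i j k l => Z i j k l - Z' i j k l) = uop2 x y Z - uop2 x y Z'.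
Proof. by rewrite -sumrB; apply: eq_bigr => q _; rewrite rmorphB mulrBl. Qed.

Lemma uop2_sum (I : Type) (r : seq I) (Q : pred I) x y Z :
  uop2 x y (fun i j k l => \sum_(s <- r | Q s) Z s i j k l) =
  \sum_(s <- r | Q s) uop2 x y (Z s).
Proof.
by rewrite /uop2 exchange_big; apply: eq_bigr => q _; rewrite rmorph_sum mulr_suml.
Qed.

Lemma uop2Z x y a Z : uop2 x y (fun i j k l => a * Z i j k l) = inj a * uop2 x y Z.
Proof. by rewrite mulr_sumr; apply: eq_bigr => q _; rewrite rmorphM -mulrA. Qed.

Lemma uopM x y S T :
  uop x S * uop y T = uop2 x y (fun i j k l => S i j * T k l).
Proof.
rewrite /uop /uop2 !pair_big /= mulr_suml.
rewrite -(pair_big xpredT xpredT (fun p q : 'I_N * 'I_N => inj (S p.1 p.2 * T q.1 q.2) * (e x p.1 p.2 * e y q.1 q.2))) /=.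
apply: eq_bigr => p _; rewrite mulr_sumr; apply: eq_bigr => q _.
by rewrite rmorphM -!mulrA; congr (_ * _); rewrite !mulrA injC.
Qed.

Lemma uopMC x y S T : x != y ->
  uop y T * uop x S = uop2 x y (fun i j k l => T k l * S i j).
Proof.
move=> ne_xy; rewrite /uop /uop2 !pair_big /= mulr_suml.
rewrite -(pair_big xpredT xpredT (fun p q : 'I_N * 'I_N => inj (T q.1 q.2 * S p.1 p.2) * (e x p.1 p.2 * e y q.1 q.2))) /=.
rewrite exchange_big /=; apply: eq_bigr => q _; rewrite mulr_sumr; apply: eq_bigr => p _.
by rewrite rmorphM -!mulrA; congr (_ * _); rewrite mulrA -injC -mulrA (eC _ _ _ _ ne_xy).
Qed.

Lemma uperm_uop2 x y Z : x != y ->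
  uperm x y * uop2 x y Z = uop2 x y (fun i j k l => Z k j i l).
Proof.
move=> ne_xy; rewrite mulr_sumr.
pose sw (q : ('I_N * 'I_N) * ('I_N * 'I_N)) := ((q.2.1, q.1.2), (q.1.1, q.2.2)).
rewrite [RHS](reindex_inj (inv_inj (_ : involutive sw))) => [|[[i j] [k l]]] //=.
apply: eq_bigr => q _; rewrite -(uperm_units q.1.1 q.1.2 q.2.1 q.2.2 ne_xy) mulrA.
by rewrite [RHS]mulrA inj_uperm.
Qed.

Lemma uop2_uperm x y Z : x != y ->
  uop2 x y Z * uperm x y = uop2 x y (fun i j k l => Z i l k j).
Proof.
move=> ne_xy; rewrite mulr_suml.
pose sw (q : ('I_N * 'I_N) * ('I_N * 'I_N)) := ((q.1.1, q.2.2), (q.2.1, q.1.2)).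
rewrite [RHS](reindex_inj (inv_inj (_ : involutive sw))) => [|[[i j] [k l]]] //=.
by apply: eq_bigr => q _; rewrite -mulrA units_uperm.
Qed.

Lemma uperm_uop x y T : x != y -> uperm x y * uop x T = uop y T * uperm x y.
Proof.
move=> ne_xy; rewrite /uop mulr_sumr mulr_suml; apply: eq_bigr => i _.
rewrite mulr_sumr mulr_suml; apply: eq_bigr => j _.
by rewrite mulrA -inj_uperm -mulrA uperm_unit // mulrA.
Qed.

Lemma uop_comm x y T i j : x != y -> uop x T * e y i j = e y i j * uop x T.
Proof.
move=> ne_xy; rewrite /uop mulr_sumr mulr_suml; apply: eq_bigr => k _.
rewrite mulr_sumr mulr_suml; apply: eq_bigr => l _.
by rewrite -mulrA (eC _ _ _ _ ne_xy) !mulrA injC.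
Qed.

Lemma uop1 x : uop x 1 = 1.
Proof.
rewrite -[RHS](e1 x); apply: eq_bigr => i _; rewrite (bigD1 i) //= big1 ?addr0 => [|j ne_ji].
  by rewrite mxE eqxx rmorph1 mul1r.
by rewrite mxE eq_sym (negPf ne_ji) rmorph0 mul0r.
Qed.

End Operators.
End MatrixUnits.

(** * Evaluation of series at nilpotent parameters *)

Section NilpotentEvaluation.
Variables (S : comPzRingType) (Q : pzRingType) (io : {rmorphism S -> Q}).
Hypothesis ioC : forall x y, io x * y = y * io x.
Implicit Types (f g : nat -> Q) (X Y x : S).

Definition ev M f X : Q := \sum_(r < M) f r * io (X ^+ r).

Lemma eq_ev M f g X : (forall r, (r < M)%N -> f r = g r) -> ev M f X = ev M g X.
Proof. by move=> eq_fg; apply: eq_bigr => r _; rewrite eq_fg. Qed.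

Lemma evB M f g X : ev M (fun r => f r - g r) X = ev M f X - ev M g X.
Proof. by rewrite -sumrB; apply: eq_bigr => r _; rewrite mulrBl. Qed.

Lemma evMl M f X y : ev M (fun r => y * f r) X = y * ev M f X.
Proof. by rewrite mulr_sumr; apply: eq_bigr => r _; rewrite mulrA. Qed.

Lemma evMr M f X y : ev M (fun r => f r * y) X = ev M f X * y.
Proof. by rewrite mulr_suml; apply: eq_bigr => r _; rewrite -!mulrA ioC. Qed.

Lemma ev_exchange M (Z : nat -> nat -> Q) X Y :
  ev M (fun r => ev M (Z r) Y) X = ev M (fun s => ev M (Z^~ s) X) Y.
Proof.
rewrite /ev; under eq_bigr do rewrite mulr_suml.
under [RHS]eq_bigr do rewrite mulr_suml.
rewrite exchange_big; apply: eq_bigr => r _; apply: eq_bigr => s _.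
by rewrite -!mulrA -!rmorphM mulrC.
Qed.

Definition up (f : nat -> Q) r : Q := if r is r'.+1 then f r' else 0.

Lemma ev_up M f X : X ^+ M = 0 -> io X * ev M f X = ev M (up f) X.
Proof.
case: M => [|M] XM; first by rewrite /ev !big_ord0 mulr0.
rewrite /ev big_ord_recr [RHS]big_ord_recl /= mul0r add0r mulrDr.
rewrite [X in _ + X]ioC -mulrA -rmorphM -exprSr XM rmorph0 mulr0 addr0.
rewrite mulr_sumr; apply: eq_bigr => r _.
by rewrite ioC -mulrA -rmorphM -exprSr.
Qed.

(** The terms X^(a + b) with a + b >= M occur on the right only, and vanish. *)
Lemma ev_smul M f g X : X ^+ M = 0 -> ev M (smul f g) X = ev M f X * ev M g X.
Proof.
move=> XM; pose G a b := f a * g b * io (X ^+ (a + b)).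
have -> : ev M f X * ev M g X = \sum_(a < M) \sum_(b < M) G a b.
  rewrite mulr_suml; apply: eq_bigr => a _; rewrite mulr_sumr; apply: eq_bigr => b _.
  by rewrite /G exprD rmorphM !mulrA; congr (_ * _); rewrite -!mulrA ioC.
transitivity (\sum_(r < M) \sum_(a < M | (a <= r)%N) G a (r - a)%N).
  apply: eq_bigr => r _; rewrite /smul mulr_suml.
  rewrite (big_ord_widen_cond M xpredT (fun a => f a * g (r - a)%N * io (X ^+ r))) //.
  apply: eq_big => [a|a lear]; first by rewrite ltnS.
  by rewrite /G subnKC // -ltnS.
rewrite (exchange_big_dep xpredT) //=; apply: eq_bigr => a _.
rewrite -(big_mkord (fun r => a <= r)%N (fun r => G a (r - a)%N)).
rewrite (big_cat_nat (n := a)) //=; last exact: ltnW.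
rewrite big1_seq ?add0r; last first.
  by move=> r /andP[lear]; rewrite mem_index_iota /= ltnNge lear.
have -> : index_iota a M = index_iota (0 + a) M by rewrite add0n.
rewrite big_addn -(big_mkord xpredT (G a)).
rewrite [RHS](big_cat_nat (n := (M - a)%N)) ?leq_subr //=.
rewrite [X in _ = _ + X]big1_seq ?addr0; last first.
  move=> b /andP[_]; rewrite mem_index_iota leq_subLR => /andP[leM _].
  by rewrite /G -(subnK leM) exprD XM mulr0 rmorph0 mulr0.
by apply: eq_big => [b|b _]; rewrite ?leq_addl ?addnK.
Qed.

Lemma evM M f g X Y :
  ev M f X * ev M g Y = ev M (fun r => ev M (fun s => f r * g s) Y) X.
Proof. by rewrite -evMr; apply: eq_ev => r _; rewrite evMl. Qed.

Lemma evMC M f g X Y :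
  ev M g Y * ev M f X = ev M (fun r => ev M (fun s => g s * f r) Y) X.
Proof. by rewrite evM ev_exchange. Qed.

Lemma ev_smul2 M (c w : nat -> nat -> Q) X Y : X ^+ M = 0 -> Y ^+ M = 0 ->
  ev M (fun r => ev M (fun s => \sum_(a < r.+1) \sum_(k < s.+1)
     c a k * w (r - a)%N (s - k)%N) Y) X =
  ev M (fun a => ev M (c a) Y) X * ev M (fun a => ev M (w a) Y) X.
Proof.
move=> XM YM; rewrite -ev_smul //; apply: eq_ev => r _.
rewrite /smul [LHS]/ev; under eq_bigr do rewrite mulr_suml.
by rewrite exchange_big; apply: eq_bigr => a _; rewrite -ev_smul.
Qed.

Section RTT.
Variables (f g : nat -> Q) (P : Q) (h : S).
Hypotheses (Pf : forall r, P * f r = g r * P) (Pg : forall r, P * g r = f r * P).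

(** [rttW] gives the coefficients of the numerator P f(X) g(Y) - g(Y) f(X) P, and [rttD] those of
    its quotient by Y - X. As Y - X is nilpotent and cannot be cancelled after evaluation, the
    division is carried out on coefficients. *)
Definition rttW r s : Q := P * f r * g s - g s * f r * P.
Definition rttD r s : Q := \sum_(i < r.+1) rttW (r - i) (s.+1 + i).

Lemma rttWE r s : rttW r s = (g r * f s - g s * f r) * P.
Proof. by rewrite /rttW Pf -mulrA Pg mulrA mulrBl. Qed.

Lemma rttD_S r s : rttD r.+1 s = rttW r.+1 s.+1 + rttD r s.+1.
Proof.
rewrite /rttD big_ord_recl addn0; congr (_ + _); apply: eq_bigr => i _.
by rewrite lift0 subSS !addSn addnS.
Qed.

(** This is the condition of divisibility by Y - X: the antidiagonal sums of [rttW] vanish, as the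
    symmetry i -> r + 1 - i shows. *)
Lemma rttD_0 r : rttW r.+1 0 = - rttD r 0.
Proof.
apply/eqP; rewrite -addr_eq0; apply/eqP.
transitivity (\sum_(i < r.+2) rttW (r.+1 - i) i).
  by rewrite big_ord_recl; congr (_ + _); apply: eq_bigr => i _; rewrite lift0 subSS add1n.
under eq_bigr do rewrite rttWE.
rewrite -mulr_suml sumrB [X in _ - X](reindex_inj rev_ord_inj) /=.
rewrite [X in X - _](eq_bigr (fun i : 'I_r.+2 => g (r.+1 - i)%N * f i)) //.
rewrite [X in _ - X](eq_bigr (fun i : 'I_r.+2 => g (r.+1 - i)%N * f i)) ?subrr ?mul0r // => i _.
by rewrite subSS subKn // -ltnS.
Qed.

Lemma rttD_up r s : up (rttD r) s - up (rttD^~ s) r = rttW r s.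
Proof.
case: s => [|s]; case: r => [|r] /=.
- by rewrite rttWE !subrr mul0r.
- by rewrite sub0r rttD_0.
- by rewrite subr0 /rttD big_ord1 addn0.
by rewrite rttD_S addrK.
Qed.

Variables (M : nat) (X Y : S).
Hypotheses (XM : X ^+ M = 0) (YM : Y ^+ M = 0).
Let D := ev M (fun r => ev M (rttD r) Y) X.
Let Fx := ev M f X.
Let Gy := ev M g Y.

Lemma rttD_ev : io (Y - X) * D = P * Fx * Gy - Gy * Fx * P.
Proof.
have -> : P * Fx * Gy - Gy * Fx * P = ev M (fun r => ev M (rttW r) Y) X.
  rewrite /Fx /Gy -(evMl M f X P) (evM M (fun r => P * f r) g X Y) (evMC M f g X Y) -evMr -evB.
  by apply: eq_ev => r _; rewrite -evMr -evB.
have eY : io Y * D = ev M (fun r => ev M (up (rttD r)) Y) X.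
  by rewrite -evMl; apply: eq_ev => r _; rewrite ev_up.
have eX : io X * D = ev M (fun r => ev M (fun s => up (rttD^~ s) r) Y) X.
  rewrite /D ev_up //; apply: eq_ev => -[|r] _ //=.
  by rewrite /ev big1 // => s _; rewrite mul0r.
rewrite rmorphB mulrBl eX eY -evB; apply: eq_ev => r _.
by rewrite -evB; apply: eq_ev => s _; rewrite rttD_up.
Qed.

Let com r s := f r * g s - g s * f r.

Let comE : Fx * Gy - Gy * Fx = ev M (fun r => ev M (com r) Y) X.
Proof. by rewrite /Fx /Gy (evM M f g X Y) (evMC M f g X Y) -evB; apply: eq_ev => r _; rewrite -evB. Qed.

(** Here X = 1/u and Y = 1/v: the relation in u and v, multiplied by XY, says that (Y - X)[F, G] is
    h X Y times the numerator. *)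
Lemma rtt_minus : f 0%N = 1 -> g 0%N = 1 ->
    (forall r s, com r.+1 s - com r s.+1 = io h * rttW r s) ->
  Fx * Gy - Gy * Fx = io (h * X * Y) * D.
Proof.
move=> f0 g0 rel.
have com0 s : com 0 s = 0 by rewrite /com f0 mul1r mulr1 subrr.
have comr0 r : com r 0 = 0 by rewrite /com g0 mul1r mulr1 subrr.
have comD r s : com r.+1 s.+1 = io h * rttD r s.
  elim: r s => [|r IHr] s.
    by have := rel 0%N s.+1; rewrite com0 subr0 /rttD big_ord1 addn0.
  have := rel r.+1 s.+1; rewrite rttD_S (mulrDr (io h) (rttW _ _)) -(IHr s.+1) => /eqP.
  by rewrite subr_eq => /eqP.
rewrite comE -mulrA !rmorphM -!mulrA.
have -> : io Y * D = ev M (fun r => ev M (up (rttD r)) Y) X.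
  by rewrite -evMl; apply: eq_ev => r _; rewrite ev_up.
rewrite ev_up // -evMl; apply: eq_ev => -[|r] _ /=.
  by rewrite mulr0 /ev big1 // => s _; rewrite com0 mul0r.
by rewrite -evMl; apply: eq_ev => -[|s] _ /=; rewrite ?comD ?comr0 ?mulr0.
Qed.

(** Here X = u and Y = v: the relation says that (X - Y)[F, G] is h times the numerator, whence the
    sign. *)
Lemma rtt_plus :
    (forall r s, up (com^~ s) r - up (com r) s = io h * rttW r s) ->
  Fx * Gy - Gy * Fx = - (io h * D).
Proof.
move=> rel.
have comD r s : com r s = - (io h * rttD r s).
  elim: r s => [|r IHr] s.
    have := rel 0%N s.+1; rewrite /= sub0r /rttD big_ord1 addn0 => <-.
    by rewrite opprK.
  have := rel r.+1 s.+1; rewrite /= rttD_S (mulrDr (io h) (rttW _ _)) IHr => <-.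
  by rewrite addrAC addNr add0r opprK.
rewrite comE -evMl -[RHS]sub0r -[0 in RHS](_ : ev M (fun=> 0) X = 0) -?evB; last first.
  by rewrite /ev big1 // => r _; rewrite mul0r.
apply: eq_ev => r _; rewrite sub0r -evMl.
rewrite -[RHS]sub0r -[0 in RHS](_ : ev M (fun=> 0) Y = 0) -?evB; last first.
  by rewrite /ev big1 // => s _; rewrite mul0r.
by apply: eq_ev => s _; rewrite sub0r comD.
Qed.

End RTT.

Lemma ev_smul2r M (c w : nat -> nat -> Q) X Y : X ^+ M = 0 -> Y ^+ M = 0 ->
  ev M (fun r => ev M (fun s => \sum_(a < r.+1) \sum_(k < s.+1)
     w (r - a)%N (s - k)%N * c a k) Y) X =
  ev M (fun a => ev M (w a) Y) X * ev M (fun a => ev M (c a) Y) X.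
Proof.
move=> XM YM; rewrite -ev_smul2 //; apply: eq_ev => r _; apply: eq_ev => s _.
rewrite [RHS](reindex_inj rev_ord_inj); apply: eq_bigr => a _.
rewrite [RHS](reindex_inj rev_ord_inj); apply: eq_bigr => k _ /=.
by rewrite !subSS !subKn // -ltnS.
Qed.

Lemma rtt_mixed (f g : nat -> Q) (c c' : nat -> nat -> Q) M X Y :
    X ^+ M = 0 -> Y ^+ M = 0 ->
    (forall r s, \sum_(a < r.+1) \sum_(k < s.+1) c a k * (f (r - a)%N * g (s - k)%N) =
       \sum_(a < r.+1) \sum_(k < s.+1) g (s - k)%N * f (r - a)%N * c' a k) ->
  ev M (fun a => ev M (c a) Y) X * (ev M f X * ev M g Y) =
  ev M g Y * ev M f X * ev M (fun a => ev M (c' a) Y) X.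
Proof.
move=> XM YM rel; rewrite (evM M f g X Y) (evMC M f g X Y) -ev_smul2 // -ev_smul2r //.
by apply: eq_ev => r _; apply: eq_ev => s _; rewrite rel.
Qed.

End NilpotentEvaluation.

(** * Expansions of 1/(u + x) and 1/(u - v + y) *)

Section NegativeBinomial.
Variable S : comPzRingType.
Implicit Types (x y X Y Z : S).

Lemma nilp_cancel x M X y : X ^+ M = 0 -> (1 + x * X) * y = 0 -> y = 0.
Proof.
move=> XM; rewrite mulrDl mul1r => /eqP; rewrite addr_eq0 => /eqP e.
have H n : y = (- (x * X)) ^+ n * y.
  by elim: n => [|n IHn]; rewrite ?mul1r // exprSr -mulrA mulNr -e.
by rewrite (H M) exprNn exprMn XM !mulr0 mul0r.
Qed.

(** The coefficient of u^-n in (u + x)^-r. For r = 0 and n > 0 the binomial coefficient is 0, as it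
    should be. *)
Definition negbin x r n : S := if (r <= n)%N then (- x) ^+ (n - r) *+ 'C(n.-1, n - r) else 0.

Lemma negbin_rec x r n :
  negbin x r.+1 n.+1 + x * negbin x r.+1 n = negbin x r n.
Proof.
rewrite /negbin ltnS subSS /=; case: (leqP r n) => [lern|ltnr]; last first.
  by rewrite ltnNge ltnW // mulr0 addr0.
case: (ltnP r n) => [ltrn|lenr]; last first.
  have -> : r = n by apply/eqP; rewrite eqn_leq lern.
  by rewrite subnn !bin0 mulr0 addr0.
case: n lern ltrn => // n lern; rewrite ltnS => lern' /=.
rewrite subSS subSn // binS mulrnDr exprS -mulrnAr -addrA.
by rewrite [X in _ + X](_ : _ = 0) ?addr0 // mulrnAr mulNr mulNrn addNr.
Qed.

(** With X = 1/u the element Z is 1/(u + x). The recursion [negbin_rec] expresses multiplication by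
    1 + xX, which is cancelled. *)
Lemma negbin_sum x X Z M r : X ^+ M = 0 -> Z * (1 + x * X) = X ->
  Z ^+ r = \sum_(n < M) negbin x r n * X ^+ n.
Proof.
move=> XM ZX; elim: r => [|r IHr].
  case: M XM => [|M] XM; first by rewrite big_ord0; apply: XM.
  rewrite big_ord_recl /negbin /= mulr1 big1 ?addr0 // => i _.
  by rewrite /bump add1n subn0 add0n bin_small // mulr0n mul0r.
apply/eqP; rewrite -subr_eq0; apply/eqP; apply: (nilp_cancel (x := x) XM).
rewrite mulrBr exprS mulrA [_ * Z]mulrC ZX IHr.
have upS (c : nat -> S) : X * \sum_(n < M) c n * X ^+ n = \sum_(n < M) up c n * X ^+ n.
  have := @ev_up _ _ idfun (fun x y => mulrC x y) M c X XM.
  by rewrite /ev.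
rewrite mulrDl mul1r -mulrA !upS mulr_sumr -big_split -sumrB big1 // => -[[|n] ltn] _ /=.
  by rewrite /negbin !mul0r mulr0 addr0 subrr.
by rewrite [x * _]mulrA -mulrDl negbin_rec subrr.
Qed.

Definition rexp (q : nat -> S) y a k : S :=
  \sum_(j < a.+1 | (j + k <= a)%N)
    ((- y) ^+ (a - j - k) *+ ('C(a.-1, a - j) * 'C(a - j, k))) * q j.

(** With X = 1/u and Y = v the element xi is 1/(u - v + y): the left-hand side is its expansion in
    nonnegative powers of v, as in [Rexpand]. *)
Lemma rexp_sum q y X Y xi M : X ^+ M = 0 -> xi * (1 - X * Y + y * X) = X ->
  \sum_(a < M) \sum_(k < M) rexp q y a k * (X ^+ a * Y ^+ k) = \sum_(j < M) q j * xi ^+ j.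
Proof.
move=> XM xiX.
have xi' : xi * (1 + (y - Y) * X) = X by rewrite -[RHS]xiX; congr (_ * _); ring.
under [RHS]eq_bigr do rewrite (negbin_sum _ XM xi') mulr_sumr.
rewrite [RHS]exchange_big; apply: eq_bigr => a _ /=.
transitivity (\sum_(k < M) \sum_(j < M) (if (j + k <= a)%N then
    ((- y) ^+ (a - j - k) *+ ('C(a.-1, a - j) * 'C(a - j, k))) * q j * (X ^+ a * Y ^+ k) else 0)).
  apply: eq_bigr => k _; rewrite /rexp mulr_suml.
  rewrite (big_ord_widen_cond M (fun j => j + k <= a)%N (fun j => (- y) ^+ (a - j - k) *+ ('C(a.-1, a - j) * 'C(a - j, k)) * q j * (X ^+ a * Y ^+ k))) //.
  rewrite big_mkcond; apply: eq_bigr => j _ /=.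
  by case: (leqP (j + k) a) => // le; rewrite ltnS (leq_trans (leq_addr k j) le).
rewrite exchange_big; apply: eq_bigr => j _ /=.
rewrite /negbin; case: (leqP j a) => [leja|ltaj]; last first.
  rewrite mul0r mulr0 big1 // => k _.
  by rewrite leqNgt (leq_trans ltaj) // leq_addr.
have ltM : (a - j < M)%N := leq_ltn_trans (leq_subr _ _) (ltn_ord a).
rewrite opprB addrC exprDn -sumrMnl mulr_suml mulr_sumr.
rewrite (big_ord_widen_cond M xpredT (fun i => q j * ((- y) ^+ (a - j - i) * Y ^+ i *+ 'C(a - j, i) *+ 'C(a.-1, a - j) * X ^+ a))) //.
rewrite -big_mkcond; apply: eq_big => [k|k _]; first by rewrite /= ltnS leq_subRL.
rewrite !(mulrnAl, mulrnAr) -mulrnA [('C(a - j, k) * _)%N]mulnC; congr (_ *+ _).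
by move: (_ ^+ (a - j - k)) (X ^+ a) (Y ^+ k) (q j) => *; ring.
Qed.

End NegativeBinomial.

Lemma nilpD (S : comPzRingType) (x y : S) a b : x ^+ a = 0 -> y ^+ b = 0 ->
  (x + y) ^+ (a + b) = 0.
Proof.
move=> xa yb; rewrite exprDn big1 // => i _; case: (leqP b i) => [lebi|ltib].
  by rewrite -(subnK lebi) exprD yb mulr0 mulr0 mul0rn.
have le : (a <= a + b - i)%N by rewrite leq_subRL ?leq_add2l ?(leq_trans (ltnW ltib)) ?leq_addl // addnC leq_add2l ltnW.
by rewrite -(subnK le) exprD xa mulr0 mul0r mul0rn.
Qed.

Lemma nilp_leq (S : pzRingType) (x : S) a b : x ^+ a = 0 -> (a <= b)%N -> x ^+ b = 0.
Proof. by move=> xa le; rewrite -(subnK le) exprD xa mulr0. Qed.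

Section Geometric.
Variable S : comPzRingType.
Implicit Types x : S.

Definition geo n x : S := \sum_(i < n) x ^+ i.

Lemma geoE n x : x ^+ n = 0 -> (1 - x) * geo n x = 1.
Proof. by move=> xn; rewrite -opprB mulNr -subrX1 xn sub0r opprK. Qed.

End Geometric.

(** * The normalising series g *)

Section GSeries.
Variables (S : comPzRingType) (g : nat -> S) (N n : nat).
Hypothesis g0 : g 0%N = 1.
Hypothesis gP : forall r, sshiftN N%:R g r = g r - (if (2 <= r)%N then g (r - 2)%N else 0).
Implicit Types k : S.

(* [gs k] is g(1 / k), [gi k] its inverse, and [kshift k] = k / (1 + N k) is the
   parameter of the shifted argument 1 / k + N. *)
Definition gs k : S := \sum_(j < n) g j * k ^+ j.
Definition kshift k : S := k * geo n (- (N%:R * k)).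
Definition gi k : S := geo n (1 - gs k).

Section AtNilpotent.
Variable k : S.
Hypothesis kn : k ^+ n = 0.

Lemma kshiftE : kshift k * (1 + N%:R * k) = k.
Proof.
have e : (1 + N%:R * k) * geo n (- (N%:R * k)) = 1.
  by rewrite -{1}[N%:R * k]opprK geoE // exprNn exprMn kn !mulr0.
by rewrite /kshift -mulrA [geo _ _ * _]mulrC e mulr1.
Qed.

Lemma kshift_nilp : kshift k ^+ n = 0.
Proof. by rewrite exprMn kn mul0r. Qed.

Lemma gsM_gi : gs k * gi k = 1.
Proof.
rewrite /gi -{1}[gs k](subKr 1) geoE //.
(* For n = 0 the hypothesis k^n = 0 makes the ring zero. *)
have [n0|n_gt0] := posnP n.
  have one0 : 1 = 0 :> S by rewrite -(expr0 k) -[in LHS]n0 kn.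
  by rewrite -[LHS]mulr1 one0 mulr0.
have -> : 1 - gs k = k * - \sum_(j < n.-1) g j.+1 * k ^+ j.
  rewrite /gs -[in LHS](prednK n_gt0) big_ord_recl g0 mulr1 opprD addrA subrr add0r mulrN.
  congr (- _).
  by rewrite mulr_sumr; apply: eq_bigr => j _; rewrite lift0 exprS mulrCA.
by rewrite exprMn kn mul0r.
Qed.

Lemma gs_kshift : gs (kshift k) = gs k * (1 - k ^+ 2).
Proof.
transitivity (\sum_(r < n) sshiftN N%:R g r * k ^+ r).
  rewrite /gs; under eq_bigr do rewrite (negbin_sum _ kn kshiftE) mulr_sumr.
  rewrite exchange_big; apply: eq_bigr => r _; rewrite /sshiftN mulr_suml.
  rewrite (big_ord_widen n (fun j => (- N%:R) ^+ (r - j) * g j *+ 'C(r.-1, r - j) * k ^+ r)) //.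
  rewrite [RHS]big_mkcond; apply: eq_bigr => j _ /=; rewrite ltnS /negbin.
  by case: leqP => _; rewrite ?mul0r ?mulr0 // mulrA mulrnAr [g _ * _]mulrC.
have upE (c : nat -> S) : k * \sum_(r < n) c r * k ^+ r = \sum_(r < n) up c r * k ^+ r.
  by have := @ev_up _ _ idfun (fun x y => mulrC x y) n c k kn; rewrite /ev.
rewrite mulrBr mulr1 [gs k * _]mulrC expr2 -mulrA /gs !upE -sumrB.
apply: eq_bigr => r _; rewrite gP mulrBl; congr (_ - _ * _).
by case: (nat_of_ord r) => [|[|r']] //=; rewrite subSS subSS subn0.
Qed.

End AtNilpotent.

(** By the functional equation the inverse of g(u)(1 - u^-2) is that of g(u + N); it is the scalar
    factor of the inverse of the normalised R-matrix. *)
Lemma gs_inv2 k : k ^+ n = 0 -> gs k * (1 - k ^+ 2) * gi (kshift k) = 1.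
Proof. by move=> kn; rewrite -gs_kshift // gsM_gi // kshift_nilp. Qed.

End GSeries.

Lemma addr_cancel4 (V : zmodType) (C a b c d w : V) :
  C + a + d + w - (C + c + b + w) = a - b + (d - c).
Proof.
rewrite opprD [LHS]addrACA subrr addr0 -[C + a + d]addrA -[C + c + b]addrA opprD [LHS]addrACA subrr add0r opprD.
by rewrite [- c - b]addrC [LHS]addrACA.
Qed.

Section ScalarProducts.
Variables (S : comPzRingType) (Q : pzRingType) (io : {rmorphism S -> Q}).
Hypothesis ioC : forall x y, io x * y = y * io x.

Lemma prod_scal (I : Type) (r : seq I) (a : I -> S) (y : I -> Q) :
  \prod_(i <- r) (io (a i) * y i) = io (\prod_(i <- r) a i) * \prod_(i <- r) y i.
Proof.
elim: r => [|i r IHr]; first by rewrite !big_nil rmorph1 mulr1.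
by rewrite !big_cons IHr rmorphM -!mulrA; congr (_ * _); rewrite mulrA -ioC -mulrA.
Qed.

Lemma prod_rev_inv (I : Type) (r : seq I) (t s : I -> Q) :
  (forall i, t i * s i = 1) -> (\prod_(i <- r) t i) * \prod_(i <- rev r) s i = 1.
Proof.
move=> ts; elim: r => [|i r IHr]; first by rewrite !big_nil mulr1.
by rewrite big_cons rev_cons -cats1 big_cat big_seq1 /= -mulrA (mulrA _ _ (s i)) IHr mul1r ts.
Qed.

Lemma prod_unipotent (I : Type) (r : seq I) (k : S) (t y : I -> Q) :
    (forall i, t i = 1 + io k * y i) ->
  exists z, \prod_(i <- r) t i = 1 + io k * z.
Proof.
move=> tE; elim: r => [|i r [z IHr]]; first by exists 0; rewrite big_nil mulr0 addr0.
exists (y i + z + y i * (io k * z)); rewrite big_cons IHr tE mulrDl mul1r mulrDr mulr1 !mulrDr.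
by rewrite !mulrA !addrA; congr (_ + _); rewrite addrAC.
Qed.

(** The product of the t_i is 1 plus a multiple of the nilpotent scalar k, so [absorbs_inv] applies
    to it. *)
Lemma absorbs_prod_inv (E : Q) (I : Type) (r : seq I) (k : S) d (t s y : I -> Q) :
    E * E = E -> k ^+ d = 0 -> (forall i, t i = 1 + io k * y i) ->
    (forall i, t i * s i = 1) -> absorbs E (\prod_(i <- r) t i) ->
  absorbs E (\prod_(i <- rev r) s i).
Proof.
move=> EE kd tE ts; have [z zE] := prod_unipotent r tE.
apply: (absorbs_inv EE (n := d)); last exact: prod_rev_inv.
rewrite zE opprD addrA subrr add0r exprNn.
have -> : (io k * z) ^+ d = io k ^+ d * z ^+ d by apply: exprMn_comm; apply: ioC.
by rewrite -rmorphXn kd rmorph0 mul0r mulr0.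
Qed.

End ScalarProducts.

(** * The sites 0, 1, ..., m: relations, absorption and trace *)

Section Sites.
Variables (N m n M : nat) (F : numFieldType) (A Q : pzRingType) (S0 S : comPzRingType).
Variables (io : {rmorphism S -> Q}) (inj : {rmorphism A -> Q}) (aF : {rmorphism F -> S0}).
Variables (kA : {rmorphism S0 -> A}) (kS : {rmorphism S0 -> S}).
Hypothesis ioC : forall x y, io x * y = y * io x.
Hypothesis inj_kA : forall x, inj (kA x) = io (kS x).
Variable e : option 'I_m -> 'I_N -> 'I_N -> Q.
Hypothesis eM : forall x i j k l, e x i j * e x k l = if j == k then e x i l else 0.
Hypothesis eC : forall x y i j k l, x != y -> e x i j * e y k l = e y k l * e x i j.
Hypothesis e1 : forall x, \sum_i e x i i = 1.
Hypothesis injC : forall x i j a, inj a * e x i j = e x i j * inj a.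
Variable p : 'S_m -> Q.
Hypotheses (p1 : p 1%g = 1) (pM : forall s t, p (s * t)%g = p t * p s).
Hypothesis pP : forall a b, a != b -> p (tperm a b) = uperm e (Some a) (Some b).
Variables (hh : S0) (T Tp : nat -> 'M[A]_N).
Hypotheses (hn : hh ^+ n = 0) (T0 : T 0%N = 1).
Hypothesis relN : forall r s i j k l,
  T r.+1 i j * T s k l - T s k l * T r.+1 i j - (T r i j * T s.+1 k l - T s.+1 k l * T r i j)
  = kA hh * (T r k j * T s i l - T s k j * T r i l).
Hypothesis relP : forall r s i j k l,
  (if r is r'.+1 then Tp r' i j * Tp s k l - Tp s k l * Tp r' i j else 0)
  - (if s is s'.+1 then Tp r i j * Tp s' k l - Tp s' k l * Tp r i j else 0)
  = kA hh * (Tp r k j * Tp s i l - Tp s k j * Tp r i l).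
Variables (g : nat -> S0) (y : S0).
Let q j := g j * hh ^+ j.
Let q' j := if j is j'.+1 then hh * q j' else 0.
Hypothesis relX : forall r s i j k l,
  \sum_(a < r.+1) \sum_(b < s.+1)
    (kA (rexp q y a b) * (T (r - a)%N i j * Tp (s - b)%N k l)
     - kA (rexp q' y a b) * (T (r - a)%N k j * Tp (s - b)%N i l)) =
  \sum_(a < r.+1) \sum_(b < s.+1)
    (kA (rexp q (- y) a b) * (Tp (s - b)%N k l * T (r - a)%N i j)
     - kA (rexp q' (- y) a b) * (Tp (s - b)%N k j * T (r - a)%N i l)).

Local Notation P := (uperm e).
Local Notation h := (kS hh).
Definition Tx x X : Q := ev io M (fun r => uop e inj x (T r)) X.
Definition Tpx x X : Q := ev io M (fun r => uop e inj x (Tp r)) X.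

Lemma rtt_form (P' f g' : Q) s : io s * (f * g' - g' * f) = P' * f * g' - g' * f * P' ->
  (io s - P') * (f * g') = g' * f * (io s - P').
Proof.
rewrite mulrBr => /eqP; rewrite subr_eq => /eqP H.
rewrite mulrBl mulrBr -[g' * f * io s]ioC H -[P' * f * g']mulrA addrAC [_ - g' * f * P']addrC addrK.
exact: addrC.
Qed.

Let comU x z U V : x != z ->
  uop e inj x U * uop e inj z V - uop e inj z V * uop e inj x U =
  uop2 e inj x z (fun i j k l => U i j * V k l - V k l * U i j).
Proof. by move=> xz; rewrite (uopM injC) (uopMC eC injC) // -uop2B. Qed.

Let rttU x z (U V : nat -> 'M[A]_N) r s : x != z ->
  rttW (fun r => uop e inj x (U r)) (fun r => uop e inj z (V r)) (P x z) r s =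
  uop2 e inj x z (fun i j k l => U r k j * V s i l - V s k j * U r i l).
Proof.
move=> xz; rewrite /rttW -mulrA (uopM injC) (uopMC eC injC) // (uperm_uop2 eM eC injC) //.
by rewrite (uop2_uperm eM eC) // -uop2B.
Qed.

(** Stated through the quotient D, since the nilpotent Y - X cannot be divided out later.
    Multiplying D by scalars gives the RTT relation for every way of writing the parameter of R as a
    fraction. *)
Lemma site_minus x z X Y : x != z -> X ^+ M = 0 -> Y ^+ M = 0 ->
  exists D, Tx x X * Tx z Y - Tx z Y * Tx x X = io (h * X * Y) * D /\
    io (Y - X) * D = P x z * Tx x X * Tx z Y - Tx z Y * Tx x X * P x z.
Proof.
move=> xz XM YM.
have Pf r : P x z * uop e inj x (T r) = uop e inj z (T r) * P x z by exact: uperm_uop.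
have Pg r : P x z * uop e inj z (T r) = uop e inj x (T r) * P x z.
  by rewrite (uperm_sym eC xz) uperm_uop // eq_sym.
eexists; split; last exact: (rttD_ev ioC Pf Pg XM YM).
apply: rtt_minus => //; [by rewrite T0 uop1|by rewrite T0 uop1|move=> r s].
rewrite !comU // rttU // -uop2B -inj_kA -uop2Z.
by apply: eq_uop2 => i j k l; rewrite relN.
Qed.

Lemma site_plus x z X Y : x != z -> X ^+ M = 0 -> Y ^+ M = 0 ->
  exists D, Tpx x X * Tpx z Y - Tpx z Y * Tpx x X = - (io h * D) /\
    io (Y - X) * D = P x z * Tpx x X * Tpx z Y - Tpx z Y * Tpx x X * P x z.
Proof.
move=> xz XM YM.
have Pf r : P x z * uop e inj x (Tp r) = uop e inj z (Tp r) * P x z by exact: uperm_uop.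
have Pg r : P x z * uop e inj z (Tp r) = uop e inj x (Tp r) * P x z.
  by rewrite (uperm_sym eC xz) uperm_uop // eq_sym.
eexists; split; last exact: (rttD_ev ioC Pf Pg XM YM).
apply: rtt_plus => // r s.
rewrite rttU // -inj_kA -uop2Z.
have z0 : uop2 e inj x z (fun _ _ _ _ => 0) = 0.
  by rewrite /uop2 big1 // => ? _; rewrite rmorph0 mul0r.
transitivity (uop2 e inj x z (fun i j k l =>
  (if r is r'.+1 then Tp r' i j * Tp s k l - Tp s k l * Tp r' i j else 0)
  - (if s is s'.+1 then Tp r i j * Tp s' k l - Tp s' k l * Tp r i j else 0))).
  rewrite uop2B; congr (_ - _); [case: (r) => [|?] /=|case: (s) => [|?] /=];
    by rewrite ?z0 ?comU.
by apply: eq_uop2 => i j k l; rewrite relP.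
Qed.

(* the normalised R-matrix of argument h / k between the sites x and z *)
Definition Rb k x z : Q := io (gs (kS \o g) n k) * (1 - io k * P x z).

(** Here X = 1/u and Y = v, so that xi and xi' are 1/(u - v + y) and 1/(u - v - y), where y stands
    for hC/2. *)
Lemma site_mixed x z X Y xi xi' : x != z -> (n <= M)%N -> X ^+ M = 0 -> Y ^+ M = 0 ->
    xi * (1 - X * Y + kS y * X) = X -> xi' * (1 - X * Y - kS y * X) = X ->
  Rb (h * xi) x z * (Tx x X * Tpx z Y) = Tpx z Y * Tx x X * Rb (h * xi') x z.
Proof.
move=> xz nM XM YM xiX xiX'.
pose c y' (a b : nat) : Q := io (kS (rexp q y' a b)) - io (kS (rexp q' y' a b)) * P x z.
have kSrexp (q0 : nat -> S0) y' a b : kS (rexp q0 y' a b) = rexp (kS \o q0) (kS y') a b.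
  rewrite rmorph_sum; apply: eq_bigr => j _.
  by rewrite rmorphM rmorphMn rmorphXn rmorphN.
have gsE k : gs (kS \o g) n (h * k) = \sum_(j < M) (kS \o q) j * k ^+ j.
  rewrite /gs (big_ord_widen M (fun j => (kS \o g) j * (h * k) ^+ j) nM) big_mkcond.
  apply: eq_bigr => j _ /=; rewrite /q rmorphM rmorphXn exprMn mulrA.
  by case: ltnP => // lenj; rewrite -rmorphXn (nilp_leq hn lenj) rmorph0 mulr0 mul0r.
(* The sequence q' belongs to the part of R with P: it is q times the parameter h k. The last
   coefficient, lost in the shift, would come with h^M = 0. *)
have q'E k : \sum_(j < M) (kS \o q') j * k ^+ j = h * k * \sum_(j < M) (kS \o q) j * k ^+ j.
  have hM : hh ^+ M = 0 := nilp_leq hn nM.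
  case: (M) hM => [|M'] hM; first by rewrite !big_ord0 mulr0.
  rewrite big_ord_recl /= rmorph0 mul0r add0r [X in _ = _ * X]big_ord_recr /= mulrDr.
  rewrite [X in _ = _ + X](_ : _ = 0) ?addr0; last first.
    rewrite /q rmorphM; transitivity (kS (g M') * kS (hh ^+ M'.+1) * k ^+ M'.+1).
      by rewrite [hh ^+ _.+1]exprS [k ^+ M'.+1]exprS rmorphM; ring.
    by rewrite hM rmorph0 mulr0 mul0r.
  by rewrite mulr_sumr; apply: eq_bigr => j _; rewrite /bump add1n rmorphM exprS; ring.
have evc y' k : k * (1 - X * Y + kS y' * X) = X ->
    ev io M (fun a => ev io M (c y' a) Y) X = Rb (h * k) x z.
  move=> kX; transitivity (io (\sum_(a < M) \sum_(b < M) rexp (kS \o q) (kS y') a b * (X ^+ a * Y ^+ b))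
    - io (\sum_(a < M) \sum_(b < M) rexp (kS \o q') (kS y') a b * (X ^+ a * Y ^+ b)) * P x z).
    rewrite /ev !rmorph_sum mulr_suml -sumrB; apply: eq_bigr => a _.
    rewrite mulr_suml !rmorph_sum mulr_suml -sumrB; apply: eq_bigr => b _.
    rewrite /c !kSrexp -mulrA -rmorphM [Y ^+ b * _]mulrC mulrBl -[_ * P x z * _]mulrA -(ioC (X ^+ a * Y ^+ b) (P x z)) mulrA.
    by rewrite -!rmorphM.
  rewrite !(rexp_sum _ XM kX) q'E -gsE /Rb mulrBr mulr1 rmorphM mulrA.
  by rewrite [io (h * k) * _]ioC.
rewrite -(evc y xi) // -(evc (- y) xi') //; last by rewrite rmorphN mulNr.
apply: rtt_mixed => // r s.
have cE y' a b Z : c y' a b * uop2 e inj x z Z = uop2 e inj x z (fun i j k l =>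
    kA (rexp q y' a b) * Z i j k l - kA (rexp q' y' a b) * Z k j i l).
  rewrite uop2B !uop2Z !inj_kA /c mulrBl -(mulrA _ (P x z)).
  by rewrite (uperm_uop2 eM eC injC).
have cE' y' a b Z : uop2 e inj x z Z * c y' a b = uop2 e inj x z (fun i j k l =>
    kA (rexp q y' a b) * Z i j k l - kA (rexp q' y' a b) * Z i l k j).
  rewrite uop2B !uop2Z !inj_kA /c mulrBr -ioC mulrA -[_ * io _]ioC -mulrA.
  by rewrite (uop2_uperm eM eC).
under eq_bigr => a _ do under eq_bigr => b _ do rewrite (uopM injC) cE.
under [RHS]eq_bigr => a _ do under eq_bigr => b _ do rewrite (uopMC eC injC) // cE'.
under eq_bigr => a _ do rewrite -uop2_sum.
under [RHS]eq_bigr => a _ do rewrite -uop2_sum.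
rewrite -!uop2_sum; apply: eq_uop2 => i j k l; exact: relX.
Qed.

Variables (e0 : 'S_m -> F) (c : 'I_m -> F) (chi : ('I_m -> F) -> F).
Hypothesis e0J : forall b, conv (jm F b) e0 =1 fun s => c b * e0 s.
Hypotheses (e0V : jvalue e0 chi) (chi1 : chi c = 1).

Local Notation ioF := (io \o (kS \o aF)).
Let ioFC x z : ioF x * z = z * ioF x. Proof. exact: ioC. Qed.

Definition Esym : Q := gev ioF p e0.
Local Notation E := Esym.

(** [p] reverses products, so the eigenvector relation of [e0] on the left becomes one for
    multiplication of E from the right. *)
Lemma Esym_jm b : E * gev ioF p (jm F b) = ioF (c b) * E.
Proof. by rewrite /Esym -gev_convV // (eq_gev _ _ (e0J b)) gevZ. Qed.

(** The element [e0] acts on a joint eigenvector with eigenvalues c by [chi c], which is 1. *)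
Lemma Esym_absorb z : (forall b, z * gev ioF p (jm F b) = ioF (c b) * z) -> z * E = z.
Proof.
move=> zJ; rewrite /Esym (e0V ioFC p1 (or_intror pM) zJ) chi1 /=.
by rewrite !rmorph1 mul1r.
Qed.

Lemma Esym_idem : E * E = E.
Proof. exact: Esym_absorb Esym_jm. Qed.

Lemma p_tperm_comm b d z : (forall x i j, x \in [:: Some b; Some d] -> e x i j * z = z * e x i j) ->
  p (tperm b d) * z = z * p (tperm b d).
Proof.
move=> ez; case: (eqVneq b d) => [->|ne_bd]; first by rewrite tperm1 p1 mul1r mulr1.
rewrite pP // mulr_suml mulr_sumr; apply: eq_bigr => i _; rewrite mulr_suml mulr_sumr.
apply: eq_bigr => j _.
by rewrite -mulrA ez ?inE ?eqxx ?orbT // mulrA ez ?inE ?eqxx // mulrA.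
Qed.

(** E is a joint eigenvector. By [fusion] so is E times the product at the contents, and
    [Esym_absorb] inserts E on the right of it. *)
Lemma fusion_absorbs (tau : 'I_m -> F -> Q) :
    (forall a, polyfun ioF (tau a)) ->
    (forall a b v i j, a != b -> e (Some b) i j * tau a v = tau a v * e (Some b) i j) ->
    (forall a b x z, a != b -> ioF (x - z) * (tau a x * tau b z - tau b z * tau a x) =
      P (Some a) (Some b) * tau a x * tau b z - tau b z * tau a x * P (Some a) (Some b)) ->
  absorbs E (\prod_a tau a (c a)).
Proof.
move=> tau_poly tau_comm tau_rtt; apply: esym; apply: Esym_absorb.
apply: fusion => // [a b d v ab ad|a b x z ab|]; last exact: Esym_jm.
  apply: p_tperm_comm => x i j; rewrite !inE => /orP[] /eqP->; exact: tau_comm.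
by rewrite pP //; apply: rtt_form; apply: tau_rtt.
Qed.

Let pS (f : F -> S) := polyfun ioF (fun v => io (f v)).
Let pS_id : pS (fun v => kS (aF v)). Proof. exact: polyfun_id. Qed.
Let pS_const a : pS (fun=> a). Proof. exact: polyfun_const. Qed.
Let pS_M f f' : pS f -> pS f' -> pS (fun v => f v * f' v).
Proof. by move=> pf pf'; apply: eq_polyfun (polyfunM ioFC pf pf') => v; rewrite rmorphM. Qed.
Let pS_D f f' : pS f -> pS f' -> pS (fun v => f v + f' v).
Proof. by move=> pf pf'; apply: eq_polyfun (polyfunD pf pf') => v; rewrite rmorphD. Qed.
Let pS_N f : pS f -> pS (fun v => - f v).
Proof.
move=> pf; have pf' := pS_M (pS_const (-1)) pf.
by apply: eq_polyfun pf' => v; rewrite mulN1r.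
Qed.
Let pS_X f k : pS f -> pS (fun v => f v ^+ k).
Proof. by move=> pf; apply: eq_polyfun (polyfunX ioFC k pf) => v; rewrite rmorphXn. Qed.
Let pS_geo f k : pS f -> pS (fun v => geo k (f v)).
Proof.
move=> pf; have pf' i := pS_X i pf.
apply: eq_polyfun (polyfun_sum _ (fun i : 'I_k => pf' i)) => v.
by rewrite /geo rmorph_sum.
Qed.

Let ev_poly (f : nat -> Q) X : pS X -> polyfun ioF (fun v => ev io M f (X v)).
Proof.
move=> pX; apply: polyfun_sum => r; apply: polyfunM => //; first exact: polyfun_const.
exact: pS_X.
Qed.

Let ev_comm (U : nat -> 'M[A]_N) X x z i j : x != z ->
  e z i j * ev io M (fun r => uop e inj x (U r)) X = ev io M (fun r => uop e inj x (U r)) X * e z i j.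
Proof.
move=> xz; rewrite mulr_sumr mulr_suml; apply: eq_bigr => r _.
by rewrite mulrA -(uop_comm eC injC) // -!mulrA -ioC.
Qed.

Lemma Tx_comm X x z i j : x != z -> e z i j * Tx x X = Tx x X * e z i j.
Proof. exact: ev_comm. Qed.

Lemma Tpx_comm X x z i j : x != z -> e z i j * Tpx x X = Tpx x X * e z i j.
Proof. exact: ev_comm. Qed.

(** The argument u + h c_a has nilpotency order at most K + n, which accounts for the bound on M. *)
Lemma absorbs_plus u K : u ^+ K = 0 -> (K + n <= M)%N ->
  absorbs E (\prod_a Tpx (Some a) (u + h * kS (aF (c a)))).
Proof.
move=> uK KnM; pose X v := u + h * kS (aF v).
have XM v : X v ^+ M = 0.
  by apply: nilp_leq KnM; apply: nilpD => //; rewrite exprMn -rmorphXn hn rmorph0 mul0r.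
apply: (fusion_absorbs (tau := fun a v => Tpx (Some a) (X v))).
- by move=> a; apply: ev_poly; apply: pS_D => //; apply: pS_M.
- by move=> a b v i j ab; apply: Tpx_comm.
move=> a b x z ab; have [D [-> <-]] := site_plus (ab : Some a != Some b) (XM x) (XM z).
rewrite /= mulrN mulrA -rmorphM -mulNr -rmorphN; congr (io _ * _).
by rewrite /X !rmorphB; ring.
Qed.

(** With w = 1/u this is 1/(u + h(v + d)): v will be a content and d the common shift -N/2. The
    geometric series is finite because h is nilpotent. *)
Definition Xminus w (d : S0) v : S := w * geo n (- (h * kS (aF v + d) * w)).

Let hgeo (d : S0) w v : geo n (- (h * kS (aF v + d) * w)) * (1 + h * kS (aF v + d) * w) = 1.
Proof.
rewrite mulrC -{1}[h * _ * w]opprK geoE // exprNn 2!exprMn -rmorphXn hn rmorph0.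
by rewrite !mul0r mulr0.
Qed.

Lemma XminusE w d v : Xminus w d v * (1 + h * kS (aF v + d) * w) = w.
Proof. by rewrite /Xminus -mulrA hgeo mulr1. Qed.

Lemma absorbs_minus w d : w ^+ M = 0 ->
  absorbs E (\prod_a Tx (Some a) (Xminus w d (c a))).
Proof.
move=> wM; have XM v : Xminus w d v ^+ M = 0 by rewrite exprMn wM mul0r.
apply: (fusion_absorbs (tau := fun a v => Tx (Some a) (Xminus w d v))).
- move=> a; apply: ev_poly; apply: pS_M => //; apply: pS_geo; apply: pS_N; apply: pS_M => //.
  apply: pS_M => //; apply: eq_polyfun (pS_D pS_id (pS_const (kS d))) => v.
  by rewrite rmorphD.
- by move=> a b v i j ab; apply: Tx_comm.
move=> a b x z ab; have [D [-> <-]] := site_minus (ab : Some a != Some b) (XM x) (XM z).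
rewrite /= mulrA -rmorphM; congr (io _ * _); rewrite /Xminus.
have ex := hgeo d w x; have ez := hgeo d w z.
set gx := geo _ _ in ex *; set gz := geo _ _ in ez *.
(* Bring the difference of two fractions to a common denominator. *)
have -> : w * gz - w * gx = w * gz * (gx * (1 + h * kS (aF x + d) * w)) - w * gx * (gz * (1 + h * kS (aF z + d) * w)).
  by rewrite ex ez !mulr1.
by rewrite !rmorphB !rmorphD; ring.
Qed.

Lemma absorbs_minus_inv w d (s : 'I_m -> Q) : w ^+ M = 0 -> (0 < M)%N ->
    (forall a, Tx (Some a) (Xminus w d (c a)) * s a = 1) ->
  absorbs E (\prod_(a <- rev (index_enum 'I_m)) s a).
Proof.
move=> wM M_gt0 ts; have abs := absorbs_minus d wM.
(* The constant term of T is 1 and the argument is a multiple of w, so each factor is 1 plus w times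
   [y0 a]. *)
pose y0 a := io (geo n (- (h * kS (aF (c a) + d) * w))) * \sum_(r < M.-1) uop e inj (Some a) (T r.+1) * io (Xminus w d (c a) ^+ r).
apply: (absorbs_prod_inv ioC Esym_idem wM (y := y0) _ ts abs) => a.
rewrite /Tx /ev -[in LHS](prednK M_gt0) big_ord_recl T0 uop1 // rmorph1 mulr1; congr (_ + _).
rewrite /y0 mulrA -rmorphM -/(Xminus w d (c a)) mulr_sumr; apply: eq_bigr => r _.
by rewrite lift0 exprS rmorphM [RHS]mulrA [_ * uop _ _ _ _]ioC -mulrA.
Qed.

(** This is 1/(1/k - v), the parameter k after a shift of its argument 1/k. At v = c_a it belongs to
    the R-matrix between the sites 0 and a. *)
Definition kfam k v : S := k * geo n (kS (aF v) * k).

Let kgeo k v : k ^+ n = 0 -> geo n (kS (aF v) * k) * (1 - kS (aF v) * k) = 1.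
Proof. by move=> kn; rewrite mulrC geoE // exprMn kn mulr0. Qed.

Let R2 (k l : S) x z : (1 + io k * x) * (1 + io l * z) = 1 + io k * x + io l * z + io (k * l) * (x * z).
Proof.
rewrite mulrDr mulr1 mulrDl mul1r addrA; congr (_ + _).
by rewrite rmorphM -!mulrA; congr (_ * _); rewrite !mulrA -ioC.
Qed.

(** By the Yang-Baxter equation the operators 1 + k_a P_(0a) satisfy the same exchange relation as
    T, so fusion applies to them. The check is an expansion: [CA] to [BB] are relations between
    transpositions, and [st] is the partial fraction identity for 1/(1/k - v). *)
Lemma absorbs_kfam k : k ^+ n = 0 ->
  absorbs E (\prod_a (1 + io (kfam k (c a)) * P None (Some a))).
Proof.
move=> kn; apply: (fusion_absorbs (tau := fun a v => 1 + io (kfam k v) * P None (Some a))).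
- move=> a; apply: polyfunD; first exact: polyfun_const.
  apply: polyfunM => //; last exact: polyfun_const.
  by apply: pS_M => //; apply: pS_geo; apply: pS_M.
- move=> a b v i j ab; rewrite mulrDl mulrDr mul1r mulr1; congr (_ + _).
  by rewrite mulrA -ioC -!mulrA (uperm_comm eC) // eq_sym.
move=> a b x z ab; rewrite !R2.
set A' := P None (Some a); set B' := P None (Some b); set C' := P (Some a) (Some b).
have na : None != Some a by []. have nb : None != Some b by [].
have sab : Some a != Some b by [].
have CA : C' * A' = A' * B' by rewrite (uperm_braid eM eC e1).
have CB : C' * B' = B' * A'.
  by rewrite /C' (uperm_sym eC sab) (uperm_braid eM eC e1) // eq_sym.
have BC : B' * C' = A' * B'.
  rewrite /B' /C' (uperm_sym eC nb) (uperm_sym eC sab) (uperm_braid eM eC e1) //.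
  by rewrite eq_sym.
have AC : A' * C' = B' * A'.
  by rewrite /A' (uperm_sym eC na) (uperm_braid eM eC e1).
have AA : A' * A' = 1 by apply: (uperm2 eM eC e1).
have BB : B' * B' = 1 by apply: (uperm2 eM eC e1).
set s := kfam k x; set t := kfam k z.
have st : kS (aF (x - z)) * (s * t) = s - t.
  have ex := kgeo x kn; have ez := kgeo z kn; rewrite /s /t /kfam.
  set gx := geo _ _ in ex *; set gz := geo _ _ in ez *.
  have -> : k * gx - k * gz = k * gx * (gz * (1 - kS (aF z) * k)) - k * gz * (gx * (1 - kS (aF x) * k)).
    by rewrite ex ez !mulr1.
  by rewrite !rmorphB; ring.
have comE : 1 + io s * A' + io t * B' + io (s * t) * (A' * B') -
    (1 + io t * B' + io s * A' + io (t * s) * (B' * A')) = io (s * t) * (A' * B' - B' * A').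
  by rewrite [t * s]mulrC [1 + io t * B' + _]addrAC opprD addrACA subrr add0r -mulrBr.
rewrite comE /= mulrA -rmorphM st -[C' * _ * _]mulrA R2.
have cC k' z' : C' * (io k' * z') = io k' * (C' * z') by rewrite mulrA -ioC -mulrA.
rewrite !mulrDr !mulrDl mulr1 mul1r !cC CA CB -!(mulrA (io _)) BC AC.
rewrite [C' * _]mulrA CA -[A' * B' * B']mulrA BB mulr1 -[B' * A' * C']mulrA AC (mulrA B') BB mul1r.
rewrite [t * s]mulrC addr_cancel4 mulrN rmorphB !mulrBl opprB.
by rewrite [io t * (B' * A') - _]addrC addrACA [- _ + io t * _]addrC.
Qed.

(* The inverse of [Rb k x z]: (1 - k P) (1 + k P) = 1 - k^2, and
   g(1 / k + N) = g(1 / k) (1 - k^2). *)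
Definition Rinv (G : nat -> S) k x z : Q := io (gi G n (kshift N n k)) * (1 + io k * P x z).

Lemma absorbs_kfam_scal k (ga : 'I_m -> S) : k ^+ n = 0 ->
  absorbs E (\prod_a (io (ga a) * (1 + io (kfam k (c a)) * P None (Some a)))).
Proof.
by move=> kn; rewrite prod_scal //; apply: absorbs_central (absorbs_kfam kn) => y'; apply: ioC.
Qed.

(** As (1 + kP)(1 - kP) = 1 - k^2, this product is, up to central scalars, the inverse of the one in
    [absorbs_kfam], and is therefore taken in reversed order. *)
Lemma absorbs_kfam_inv k (ga : 'I_m -> S) : k ^+ n = 0 ->
  absorbs E (\prod_(a <- rev (index_enum 'I_m)) (io (ga a) * (1 - io (kfam k (c a)) * P None (Some a)))).
Proof.
move=> kn; pose s a := geo n (kfam k (c a) ^+ 2).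
have kn' a : kfam k (c a) ^+ n = 0 by rewrite exprMn kn mul0r.
have sE a : (1 - kfam k (c a) ^+ 2) * s a = 1.
  by rewrite geoE // -exprM mulnC exprM kn' expr0n.
rewrite [X in absorbs _ X](_ : _ = io (\prod_(a <- rev (index_enum 'I_m)) (ga a * (1 - kfam k (c a) ^+ 2))) *
   \prod_(a <- rev (index_enum 'I_m)) (io (s a) * (1 - io (kfam k (c a)) * P None (Some a)))); last first.
  rewrite -prod_scal //; apply: eq_bigr => a _; rewrite mulrA -rmorphM.
  by rewrite -mulrA sE mulr1.
apply: absorbs_central => [z'|]; first exact: ioC.
apply: (absorbs_prod_inv ioC Esym_idem kn (t := fun a => 1 + io (kfam k (c a)) * P None (Some a))
  (y := fun a => io (geo n (kS (aF (c a)) * k)) * P None (Some a))) (absorbs_kfam kn) => a.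
  by rewrite /kfam rmorphM mulrA.
rewrite mulrA -ioC -mulrA; have := R2 (kfam k (c a)) (- kfam k (c a)) (P None (Some a)) (P None (Some a)).
rewrite rmorphN mulNr => ->; rewrite addrK (uperm2 eM eC e1) // mulr1.
by rewrite mulrN rmorphN -[X in X - _](rmorph1 io) -rmorphB -rmorphM mulrC -expr2 sE rmorph1.
Qed.

Section Trace.
Variables (V : zmodType) (Tr : {additive Q -> V}).
Hypothesis Tr_cyc : forall a i j w, Tr (e (Some a) i j * w) = Tr (w * e (Some a) i j).
Hypothesis Tr_E : forall w, Tr (E * w) = Tr (w * E).

Lemma prod_comm (I : eqType) (r : seq I) (f : I -> Q) u :
  (forall i, i \in r -> f i * u = u * f i) -> (\prod_(i <- r) f i) * u = u * \prod_(i <- r) f i.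
Proof.
move=> fu; rewrite !(big_seq _ _ r); elim/big_rec: _ => [|i x ri IH]; first by rewrite mul1r mulr1.
by rewrite -mulrA IH mulrA fu // mulrA.
Qed.

Lemma site_comm ga k a b i j : a != b ->
  io ga * (1 + io k * P None (Some a)) * e (Some b) i j =
  e (Some b) i j * (io ga * (1 + io k * P None (Some a))).
Proof.
move=> ab; rewrite [RHS]mulrA -ioC -!mulrA; congr (_ * _).
rewrite mulrDl mulrDr mul1r mulr1 [in RHS]mulrA -ioC -!mulrA (uperm_comm eC) // eq_sym.
by [].
Qed.

(** After expansion, [collapse_r] and [collapse_lr] turn all terms containing P into multiples of
    Tr(x P z w), with total coefficient k - k' - N k k' = 0. *)
Lemma collapse_site a ga gb k k' x z w :
    ga * gb = 1 -> k - k' - N%:R * (k * k') = 0 ->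
    (forall i j, x * e (Some a) i j = e (Some a) i j * x) ->
    (forall i j, w * e (Some a) i j = e (Some a) i j * w) ->
    (forall i j, z * e None i j = e None i j * z) ->
  Tr (x * (io ga * (1 + io k * P None (Some a))) * z * (io gb * (1 - io k' * P None (Some a))) * w)
  = Tr (x * z * w).
Proof.
move=> gab kk xa wa za; set A' := P None (Some a).
have na : None != Some a by [].
have cl l := @collapse_r N _ Q e eC V Tr None (Some a) na (Tr_cyc a) (io l * x) z w.
have cll l := @collapse_lr N _ Q e eM eC V Tr None (Some a) na (Tr_cyc a) (io l * x) z w.
have la l i j : io l * x * e (Some a) i j = e (Some a) i j * (io l * x).
  by rewrite -mulrA xa !mulrA ioC.
have mv s u v : u * (io s * v) = io s * (u * v) by rewrite mulrA -ioC -mulrA.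
have -> : x * (io ga * (1 + io k * A')) * z * (io gb * (1 - io k' * A')) * w =
   x * z * w + io k * x * A' * z * w - io k' * x * z * A' * w - io (k * k') * x * A' * z * A' * w.
  rewrite -!mulrA (mv ga x) (mv gb z) (mv gb (1 + _)) (mv gb x) (mulrA (io ga)) -rmorphM gab rmorph1 mul1r.
  rewrite [(1 - _) * w]mulrBl mul1r !mulrBr mulrDl mul1r [(1 + _) * (z * (_ * w))]mulrDl mul1r !mulrDr.
  rewrite -!mulrA (mv k x) (mv k' z) (mv k' x) (mv k x) (mv k' A') (mv k' x) [io (k * k') * _](_ : _ = io k * (io k' * (x * (A' * (z * (A' * w)))))).
    by rewrite opprD addrA.
  by rewrite rmorphM -mulrA.
have fB l l' : Tr (io (l - l') * x * A' * z * w) = Tr (io l * x * A' * z * w) - Tr (io l' * x * A' * z * w).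
  by rewrite rmorphB !mulrBl raddfB.
have fN l : Tr (io l * x * A' * z * w) *+ N = Tr (io (N%:R * l) * x * A' * z * w).
  by rewrite mulr_natl rmorphMn !mulrnAl raddfMn.
rewrite 2!raddfB raddfD /= cl // cll // -/A' fN -addrA -addrA -opprD addrA -addrA.
rewrite [X in _ + X = _](_ : _ = 0) ?addr0 //.
by rewrite opprD addrA -fB -fB kk rmorph0 !mul0r raddf0.
Qed.

(** The two factors next to z belong to the same site, because the second product is reversed; they
    are removed first. *)
Lemma collapse_sites (r : seq 'I_m) (ga gb k k' : 'I_m -> S) z w :
    uniq r -> (forall a, ga a * gb a = 1) ->
    (forall a, k a - k' a - N%:R * (k a * k' a) = 0) ->
    (forall a i j, w * e (Some a) i j = e (Some a) i j * w) ->
    (forall i j, z * e None i j = e None i j * z) ->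
  Tr (\prod_(a <- r) (io (ga a) * (1 + io (k a) * P None (Some a))) * z *
      \prod_(a <- rev r) (io (gb a) * (1 - io (k' a) * P None (Some a))) * w) = Tr (z * w).
Proof.
move=> + gab kk wC zC; elim/last_ind: r => [|r a IHr]; first by rewrite !big_nil mul1r mulr1.
rewrite rcons_uniq => /andP[ar r_uniq].
have ne_a b : b \in r -> b != a by move=> br; apply: contraNneq ar => <-.
rewrite -cats1 rev_cat !big_cat !big_seq1 /=.
rewrite -[_ * _ * w]mulrA -[_ * _ * w]mulrA [_ * (_ * (_ * w))]mulrA.
rewrite collapse_site // ?mulrA ?IHr // => i j.
  by apply: prod_comm => b br; apply/site_comm/ne_a.
rewrite -mulrA wC !mulrA; congr (_ * _); apply: prod_comm => b; rewrite mem_rev => br.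
by rewrite -mulNr -rmorphN; apply/site_comm/ne_a.
Qed.

(** E does not commute with the matrix units of the sites 1, ..., m and blocks [collapse_sites].
    Absorption puts copies of E in front of z and at the far right; cyclicity moves the first E to
    the right end, where both are absorbed again. The copy in front of z is harmless, as E commutes
    with the matrix units of site 0. *)
Lemma trace_absorb (ga gb k k' : 'I_m -> S) z w :
    (forall a, ga a * gb a = 1) ->
    (forall a, k a - k' a - N%:R * (k a * k' a) = 0) ->
    (forall a i j, w * e (Some a) i j = e (Some a) i j * w) -> w * E = E * w ->
    (forall i j, z * e None i j = e None i j * z) ->
    (forall i j, E * e None i j = e None i j * E) ->
    let Xs := \prod_a (io (ga a) * (1 + io (k a) * P None (Some a))) in
    let Ys := \prod_(a <- rev (index_enum 'I_m)) (io (gb a) * (1 - io (k' a) * P None (Some a))) in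
    absorbs E Xs -> absorbs E z -> absorbs E Ys ->
  Tr (E * Xs * z * Ys * w) = Tr (E * z * w).
Proof.
move=> gab kk wC wE zC EC Xs Ys eX ez eY.
have H := absorbsM ez eY.
have -> : E * Xs * z * Ys * w = E * (Xs * (E * z) * Ys * w * E).
  have -> : E * Xs * z * Ys * w = E * Xs * (E * (z * Ys)) * w by rewrite {1}eX !mulrA.
  by rewrite H -!mulrA -wE.
rewrite Tr_E.
have -> : Xs * (E * z) * Ys * w * E * E = Xs * (E * z) * Ys * w.
  rewrite -!mulrA Esym_idem wE; congr (Xs * _).
  by move: H; rewrite /absorbs !mulrA => <-.
rewrite collapse_sites // ?index_enum_uniq // => i j.
by rewrite -mulrA zC !mulrA EC.
Qed.

End Trace.

End Sites.

(** * Polynomials and their reversal *)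

Section Reversal.
Variables (B : pzRingType) (K : nat).
Implicit Types f g : tser B K.

Definition pdeg d f := forall n, (d < n)%N -> co f n = 0.
(** The polynomial x^d f(1/x), for f of degree at most d: a polynomial in u is rewritten in terms of
    1/u. *)
Definition rev_at d f : tser B K := \sum_(i < d.+1) tC K (co f i) * tX B K ^+ (d - i).

Lemma pdeg_leq d d' f : (d <= d')%N -> pdeg d f -> pdeg d' f.
Proof. by move=> le df n ltn; apply: df; apply: leq_ltn_trans ltn. Qed.

Lemma pdegC d x : pdeg d (tC K x).
Proof. by move=> [|n] // _; rewrite co_mk; case: ifP. Qed.

Lemma pdeg1 d : pdeg d 1.
Proof. by rewrite -(rmorph1 (tC K)); apply: pdegC. Qed.

Lemma pdegX d : (0 < d)%N -> pdeg d (tX B K).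
Proof. by move=> d_gt0 n ltn; rewrite co_mk gtn_eqF ?if_same // (leq_ltn_trans d_gt0). Qed.

Lemma pdegD d f g : pdeg d f -> pdeg d g -> pdeg d (f + g).
Proof. by move=> df dg n ltn; rewrite coD df // dg // addr0. Qed.

Lemma pdegN d f : pdeg d f -> pdeg d (- f).
Proof. by move=> df n ltn; rewrite coN df // oppr0. Qed.

Lemma pdegB d f g : pdeg d f -> pdeg d g -> pdeg d (f - g).
Proof. by move=> df dg; apply/pdegD/pdegN. Qed.

Lemma pdeg_sum d (I : Type) (r : seq I) (P : pred I) (F : I -> tser B K) :
  (forall i, P i -> pdeg d (F i)) -> pdeg d (\sum_(i <- r | P i) F i).
Proof. by move=> dF n ltn; rewrite co_sum big1 // => i /dF ->. Qed.

Lemma pdegM d d' f g : pdeg d f -> pdeg d' g -> pdeg (d + d') (f * g).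
Proof.
move=> df dg n ltn; case: (ltnP n K) => [ltnK|leKn]; last by rewrite co_ge.
rewrite coM // /smul big1 // => i _; case: (ltnP d i) => [/df->|leid]; first by rewrite mul0r.
rewrite dg ?mulr0 //; rewrite ltn_subRL; apply: leq_ltn_trans ltn.
by rewrite leq_add2r.
Qed.

Lemma pdegXn d f k : pdeg d f -> pdeg (k * d) (f ^+ k).
Proof.
by move=> df; elim: k => [|k IHk]; [apply: pdeg1|rewrite exprS mulSn; apply: pdegM].
Qed.

Lemma pdeg_prod (I : Type) (r : seq I) d (F : I -> tser B K) :
  (forall i, pdeg d (F i)) -> pdeg (size r * d) (\prod_(i <- r) F i).
Proof.
move=> dF; elim: r => [|i r IHr]; first by rewrite big_nil; apply: pdeg1.
by rewrite big_cons mulSn; apply: pdegM.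
Qed.

Lemma pdeg_expand d f : (d < K)%N -> pdeg d f ->
  f = \sum_(i < d.+1) tC K (co f i) * tX B K ^+ i.
Proof.
move=> ltdK df; rewrite [LHS]tser_sum [RHS](big_ord_widen K (fun i => tC K (co f i) * tX B K ^+ i)) //.
rewrite [RHS]big_mkcond; apply: eq_bigr => i _; case: leqP => // lt.
by rewrite df // rmorph0 mul0r.
Qed.

Lemma rev_atD d f g : rev_at d (f + g) = rev_at d f + rev_at d g.
Proof. by rewrite -big_split; apply: eq_bigr => i _; rewrite coD rmorphD mulrDl. Qed.

Lemma rev_atN d f : rev_at d (- f) = - rev_at d f.
Proof. by rewrite -sumrN; apply: eq_bigr => i _; rewrite coN rmorphN mulNr. Qed.

Lemma rev_atB d f g : rev_at d (f - g) = rev_at d f - rev_at d g.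
Proof. by rewrite rev_atD rev_atN. Qed.

Lemma rev_at_sum d (I : Type) (r : seq I) (P : pred I) (F : I -> tser B K) :
  rev_at d (\sum_(i <- r | P i) F i) = \sum_(i <- r | P i) rev_at d (F i).
Proof.
elim/big_rec2: _ => [|i x y _ <-]; last by rewrite rev_atD.
by rewrite /rev_at big1 // => i _; rewrite co0 rmorph0 mul0r.
Qed.

Lemma rev_at_monomial d a i : (i <= d)%N -> (d < K)%N ->
  rev_at d (tC K a * tX B K ^+ i) = tC K a * tX B K ^+ (d - i).
Proof.
move=> leid ltdK; have ltid : (i < d.+1)%N by [].
rewrite /rev_at (bigD1 (Ordinal ltid)) //= coCM coXn ?(leq_ltn_trans leid) // eqxx mulr1.
rewrite big1 ?addr0 // => j ne_j.
rewrite coCM coXn ?(leq_trans (ltn_ord j)) // (negPf (_ : (j : nat) != i)) //.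
by rewrite mulr0 rmorph0 mul0r.
Qed.

Lemma rev_atM d d' f g : pdeg d f -> pdeg d' g -> (d + d' < K)%N ->
  rev_at (d + d') (f * g) = rev_at d f * rev_at d' g.
Proof.
move=> df dg ltK.
have ltd : (d < K)%N := leq_ltn_trans (leq_addr _ _) ltK.
have ltd' : (d' < K)%N := leq_ltn_trans (leq_addl _ _) ltK.
rewrite [in LHS](pdeg_expand ltd df) [in LHS](pdeg_expand ltd' dg) mulr_suml rev_at_sum.
rewrite /rev_at mulr_suml; apply: eq_bigr => i _.
rewrite mulr_sumr [LHS]rev_at_sum mulr_sumr; apply: eq_bigr => j _.
have lei : (i <= d)%N by rewrite -ltnS. have lej : (j <= d')%N by rewrite -ltnS.
have e : (d + d' - (i + j) = (d - i) + (d' - j))%N by lia.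
rewrite mulrA -[_ * _ * tC K _]mulrA tXn_comm mulrA -rmorphM -mulrA -exprD.
rewrite rev_at_monomial ?leq_add // [RHS]mulrA -[_ * _ * tC K _]mulrA tXn_comm mulrA -rmorphM -mulrA -exprD.
by rewrite e.
Qed.

Lemma rev_atC x : (0 < K)%N -> rev_at 0 (tC K x) = tC K x.
Proof. by move=> K_gt0; rewrite /rev_at big_ord1 subnn mulr1 co_tC. Qed.

Lemma rev_at1 d : (d < K)%N -> rev_at d 1 = tX B K ^+ d.
Proof.
move=> ltd; have := rev_at_monomial 1 (leq0n d) ltd.
by rewrite rmorph1 !mul1r expr0 subn0.
Qed.

Lemma rev_at_leq d d' f : pdeg d f -> (d <= d' < K)%N ->
  rev_at d' f = rev_at d f * tX B K ^+ (d' - d).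
Proof.
move=> df /andP[le ltK]; rewrite -[in LHS](subnKC le) -[f in LHS]mulr1 rev_atM ?subnKC //.
  by rewrite rev_at1 // (leq_ltn_trans (leq_subr _ _)).
exact: pdeg1.
Qed.

Lemma rev_at_prod (I : Type) (r : seq I) d (F : I -> tser B K) :
  (forall i, pdeg d (F i)) -> (size r * d < K)%N ->
  rev_at (size r * d) (\prod_(i <- r) F i) = \prod_(i <- r) rev_at d (F i).
Proof.
move=> dF; elim: r => [|i r IHr] /= ltK.
  by rewrite !big_nil rev_at1.
rewrite !big_cons mulSn rev_atM //; last exact: pdeg_prod.
by rewrite IHr // (leq_ltn_trans _ ltK) // mulSn leq_addl.
Qed.

End Reversal.

Lemma rev_at_tmap (B B' : pzRingType) K (phi : {rmorphism B -> B'}) d f :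
  rev_at d (tmap phi f : tser B' K) = tmap phi (rev_at d f).
Proof.
rewrite /rev_at (rmorph_sum (tmap phi)); apply: eq_bigr => i _.
by rewrite rmorphM rmorphXn /= tmap_tX tmap_tC co_tmap.
Qed.

Lemma pdeg_tmap (B B' : pzRingType) K (phi : {rmorphism B -> B'}) d (f : tser B K) :
  pdeg d f -> pdeg d (tmap phi f).
Proof. by move=> df n ltn; rewrite co_tmap df // rmorph0. Qed.

(** * The product of a series in u and a series in 1/u *)

Section Assemble.
Variables (W : pzRingType) (J : W -> Prop).
Hypotheses (J0 : J 0) (JB : forall x y, J x -> J y -> J (x - y)).
Hypothesis JM : forall x y, J y -> J (x * y).

Lemma left_idealN x : J x -> J (- x).
Proof. by move=> Jx; rewrite -sub0r; apply: JB. Qed.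
Lemma left_idealD x y : J x -> J y -> J (x + y).
Proof. by move=> Jx Jy; rewrite -[y]opprK; apply/JB/left_idealN. Qed.
Lemma left_ideal_sum (I : Type) (r : seq I) (P : pred I) (f : I -> W) :
  (forall i, P i -> J (f i)) -> J (\sum_(i <- r | P i) f i).
Proof. by move=> Jf; elim/big_rec: _ => [//|i x Pi]; apply/left_idealD/Jf. Qed.

(** A shift of the range by b adds terms with negative index at the bottom, which are 0, and terms
    at the top, which lie in J. *)
Lemma window (f : int -> W) (S b c : nat) :
    (forall s : int, s < 0 -> f s = 0) -> (forall s : int, S%:Z <= s -> J (f s)) ->
    (b <= c)%N ->
  J (\sum_(t < S + c) f (t%:Z - b%:Z) - \sum_(s < S) f s%:Z).
Proof.
move=> f0 fJ lebc; rewrite -(big_mkord xpredT (fun t : nat => f (t%:Z - b%:Z))).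
rewrite (big_cat_nat (n := b)) //=; last by rewrite (leq_trans lebc) // leq_addl.
rewrite [X in X + _ - _]big1_seq ?add0r; last first.
  by move=> t /=; rewrite mem_index_iota => lt; rewrite f0 //; lia.
rewrite (big_cat_nat (n := (S + b)%N)) ?leq_addl ?leq_add2l //=.
rewrite -{1}[b]add0n big_addn addnK big_mkord.
rewrite [X in J (X + _ - _)](eq_bigr (fun s : 'I_S => f s%:Z)) => [|s _]; last by congr f; lia.
rewrite addrAC subrr add0r big_seq; apply: left_ideal_sum => t; rewrite mem_index_iota => lt.
by apply: fJ; lia.
Qed.

Variables (T0 : W) (X Y Y' : nat -> W) (F G : int -> W) (sg : int) (d S P : nat) (k : int).
Hypothesis sgE : sg = 1 \/ sg = -1.
Hypothesis F0 : forall s : int, s < 0 -> F s = 0.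
Hypothesis FE : forall s : int, s < S%:Z + (d + d)%:Z ->
  T0 * F s = \sum_(i < d) \sum_(j < d) X i * F (s - sg * (i + j)%:Z) * T0 * Y j.
Hypothesis GE : forall r : int, r < S%:Z + d%:Z - k ->
  \sum_(j < d) T0 * Y j * G (r + sg * j%:Z) = \sum_(j < d) G (r + sg * j%:Z) * Y' j * T0.
Hypothesis GJ : forall r : int, P%:Z <= r -> J (G r).
Hypothesis SP : P%:Z <= S%:Z - (d + d)%:Z - k.

Let Z (l : int) := \sum_(s < S) F s%:Z * G (s%:Z - l).

(** F and G hold the coefficients of the halves in u and in 1/u, and Z l is the coefficient of u^l
    in their product up to J; [sg] tells whether X, Y, Y' are polynomials in u or in 1/u. T0 passes
    F by [FE], the sums are realigned by [window], and T0 passes G by [GE]. *)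
Lemma assemble :
  J (T0 * Z k - \sum_(i < d) \sum_(j < d) X i * Z (k - sg * (i + j)%:Z) * Y' j * T0).
Proof.
(* The ranges are shifted by d + d plus or minus i + j, hence by less than 4 d. *)
pose c := (d + d + (d + d))%N.
have A1 : J (\sum_(t < S + c) T0 * F (t%:Z - (d + d)%:Z) * G (t%:Z - (d + d)%:Z - k) - T0 * Z k).
  rewrite /Z mulr_sumr; under [X in _ - X]eq_bigr do rewrite mulrA.
  apply: (window (f := fun s => T0 * F s * G (s - k))) => [s s0|s leS|].
  - by rewrite F0 // mulr0 mul0r.
  - by apply/JM/GJ; lia.
  by rewrite leq_addr.
pose B (i j : nat) := \sum_(s < S) X i * F s%:Z * T0 * Y j * G (s%:Z + sg * (i + j)%:Z - k).
have A3 (i j : 'I_d) : J (\sum_(t < S + c) X i * F (t%:Z - (d + d)%:Z - sg * (i + j)%:Z) * T0 * Y j * G (t%:Z - (d + d)%:Z - k) - B i j).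
  have := ltn_ord i; have := ltn_ord j => ltj lti.
  (* The absolute value only casts to [nat]: the number is nonnegative for either sign, since i + j
     < d + d. *)
  pose b := `|((d + d)%:Z + sg * (i + j)%:Z)%R|%N.
  have bE : b%:Z = (d + d)%:Z + sg * (i + j)%:Z by case: sgE => sgE'; rewrite /b sgE'; lia.
  rewrite (eq_bigr (fun t : 'I_(S + c) => X i * F (t%:Z - b%:Z) * T0 * Y j * G (t%:Z - b%:Z + sg * (i + j)%:Z - k))).
    apply: (window (f := fun s => X i * F s * T0 * Y j * G (s + sg * (i + j)%:Z - k))) => [s s0|s leS|].
    - by rewrite F0 // mulr0 !mul0r.
    - by apply/JM/GJ; case: sgE => sgE'; rewrite sgE'; lia.
    by case: sgE => sgE'; rewrite /b /c sgE'; lia.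
  by move=> t _; rewrite bE opprD addrA subrK.
have A2 : \sum_(t < S + c) T0 * F (t%:Z - (d + d)%:Z) * G (t%:Z - (d + d)%:Z - k) =
   \sum_(i < d) \sum_(j < d) \sum_(t < S + c) X i * F (t%:Z - (d + d)%:Z - sg * (i + j)%:Z) * T0 * Y j * G (t%:Z - (d + d)%:Z - k).
  under eq_bigr => t _ do [rewrite FE; last by have := ltn_ord t; rewrite /c; lia].
  under eq_bigr => t _ do rewrite mulr_suml.
  rewrite exchange_big; apply: eq_bigr => i _.
  under eq_bigr => t _ do rewrite mulr_suml.
  by rewrite exchange_big.
have A4 : \sum_(i < d) \sum_(j < d) B i j = \sum_(i < d) \sum_(j < d) X i * Z (k - sg * (i + j)%:Z) * Y' j * T0.
  apply: eq_bigr => i _; rewrite /B exchange_big /=.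
  transitivity (\sum_(s < S) X i * F s%:Z * \sum_(j < d) T0 * Y j * G (s%:Z + sg * i%:Z - k + sg * j%:Z)).
    apply: eq_bigr => s _; rewrite mulr_sumr; apply: eq_bigr => j _.
    rewrite !mulrA; congr (_ * G _); rewrite PoszD mulrDr; lia.
  transitivity (\sum_(s < S) X i * F s%:Z * \sum_(j < d) G (s%:Z + sg * i%:Z - k + sg * j%:Z) * Y' j * T0).
    apply: eq_bigr => s _; rewrite GE //.
    by have := ltn_ord s; have := ltn_ord i; case: sgE => ->; lia.
  under [LHS]eq_bigr => s _ do rewrite mulr_sumr.
  rewrite [LHS]exchange_big; apply: eq_bigr => j _ /=; rewrite /Z mulr_sumr !mulr_suml.
  apply: eq_bigr => s _; rewrite !mulrA; congr (_ * G _ * _ * _); rewrite PoszD mulrDr; lia.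
rewrite -A4; rewrite A2 in A1.
pose C (i j : 'I_d) := \sum_(t < S + c) X i * F (t%:Z - (d + d)%:Z - sg * (i + j)%:Z) * T0 * Y j * G (t%:Z - (d + d)%:Z - k).
have -> : T0 * Z k - \sum_(i < d) \sum_(j < d) B i j =
    \sum_(i < d) \sum_(j < d) (C i j - B i j) - (\sum_(i < d) \sum_(j < d) C i j - T0 * Z k).
  under [in RHS]eq_bigr do rewrite sumrB.
  rewrite sumrB opprB; set sC := \sum_i _; set sB := \sum_i _.
  by rewrite addrC [RHS]addrC addrA subrK addrC.
apply: JB; last exact: A1.
by apply: left_ideal_sum => i _; apply: left_ideal_sum => j _; apply: A3.
Qed.

End Assemble.

Section CoefficientComparison.
Variables (B : pzRingType) (K : nat).
Implicit Types (f x y : tser B K) (n s : int).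

Definition at_ f n : B := if 0 <= n then co f `|n|%N else 0.

Lemma at_lt0 f n : n < 0 -> at_ f n = 0.
Proof. by rewrite /at_ ltNge; case: (0 <= n). Qed.

Lemma at_nat f (n : nat) : at_ f n%:Z = co f n.
Proof. by []. Qed.

Lemma at_sum (I : Type) (r : seq I) (P : pred I) (F : I -> tser B K) n :
  at_ (\sum_(i <- r | P i) F i) n = \sum_(i <- r | P i) at_ (F i) n.
Proof. by rewrite /at_; case: (0 <= n); rewrite ?co_sum // big1. Qed.

Lemma at_CM a f n : at_ (tC K a * f) n = a * at_ f n.
Proof. by rewrite /at_; case: (0 <= n); rewrite ?coCM ?mulr0. Qed.

Lemma at_MC a f n : at_ (f * tC K a) n = at_ f n * a.
Proof. by rewrite /at_; case: (0 <= n); rewrite ?coMC ?mul0r. Qed.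

Lemma at_XnM k f n : n < K%:Z -> at_ (tX B K ^+ k * f) n = at_ f (n - k%:Z).
Proof.
move=> ltnK; rewrite /at_; case: (lerP 0 n) => n_ge0; last first.
  by rewrite ifF //; apply/negbTE; lia.
rewrite coXnM; last by lia.
case: leqP => le; last by rewrite ifF //; apply/negbTE; lia.
by rewrite ifT; [congr (co f _)|]; lia.
Qed.

(** Covers a polynomial, with u i = i, and its reversal, with u i = D - i, by the same computation
    of coefficients. *)
Definition spread d (u : nat -> nat) (c : nat -> B) : tser B K :=
  \sum_(i < d) tC K (c i) * tX B K ^+ u i.

Lemma spread_nat D x : (D < K)%N -> pdeg D x -> x = spread D.+1 id (co x).
Proof. exact: pdeg_expand. Qed.

Lemma at_sandwich d u v (X Y : nat -> B) f a n : n < K%:Z ->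
  at_ (spread d u X * f * tC K a * spread d v Y) n =
  \sum_(i < d) \sum_(j < d) X i * at_ f (n - (u i + v j)%:Z) * a * Y j.
Proof.
move=> ltnK; rewrite /spread -!mulrA mulr_suml at_sum; apply: eq_bigr => i _.
rewrite !mulr_sumr at_sum; apply: eq_bigr => j _.
have -> : tC K (X i) * tX B K ^+ u i * (f * (tC K a * (tC K (Y j) * tX B K ^+ v j))) =
    tC K (X i) * (tX B K ^+ (u i + v j) * (f * tC K a * tC K (Y j))).
  by rewrite exprD -!mulrA; congr (_ * (_ * _)); rewrite [RHS]tXn_comm -!mulrA.
by rewrite at_CM at_XnM // !at_MC !mulrA.
Qed.

End CoefficientComparison.

Section Commutation.
Variables (B : pzRingType) (K : nat) (J : B -> Prop).
Hypotheses (J0 : J 0) (JB : forall x y, J x -> J y -> J (x - y)).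
Hypothesis JM : forall x y, J y -> J (x * y).
Variables (T0 : B) (Xs Ys Ys' Ft Gs : tser B K) (D S P : nat) (k : int).
Hypotheses (dX : pdeg D Xs) (dY : pdeg D Ys) (dY' : pdeg D Ys').
Hypothesis GJ : forall r, (P <= r)%N -> J (co Gs r).
Hypothesis SP : P%:Z <= S%:Z - (D.+1 + D.+1)%:Z - k.
Hypothesis SK : (S + 4 * D.+1 + `|k| < K)%N.

Definition pairing (l : int) : B := \sum_(s < S) at_ Ft s%:Z * at_ Gs (s%:Z - l).

Let atGJ r : P%:Z <= r -> J (at_ Gs r).
Proof. by rewrite /at_; case: (0 <= r) => // le; apply: GJ; lia. Qed.

Let ltDK : (D < K)%N. Proof. by lia. Qed.

Let at_spreadMr u (Y : nat -> B) n : n < K%:Z ->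
  at_ (tC K T0 * spread K D.+1 u Y * Gs) n = \sum_(j < D.+1) T0 * Y j * at_ Gs (n - (u j)%:Z).
Proof.
move=> ltnK; rewrite -mulrA at_CM /spread mulr_suml at_sum mulr_sumr.
by apply: eq_bigr => j _; rewrite -mulrA at_CM at_XnM // !mulrA.
Qed.

Let at_spreadMl u (Y : nat -> B) n : n < K%:Z ->
  at_ (Gs * spread K D.+1 u Y * tC K T0) n = \sum_(j < D.+1) at_ Gs (n - (u j)%:Z) * Y j * T0.
Proof.
move=> ltnK; rewrite at_MC /spread mulr_sumr at_sum mulr_suml; apply: eq_bigr => j _.
by rewrite mulrA -tXn_comm at_XnM // at_MC.
Qed.

(** The case of R-matrices polynomial in u: they appear as they are in the relation for [Ft], whose
    variable is u, and reversed in the relation for [Gs], whose variable is 1/u. *)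
Lemma commutation_nat :
    tC K T0 * Ft = Xs * Ft * tC K T0 * Ys ->
    tC K T0 * rev_at D Ys * Gs = Gs * rev_at D Ys' * tC K T0 ->
  J (T0 * pairing k - \sum_(i < D.+1) \sum_(j < D.+1)
    co Xs i * pairing (k - (i + j)%:Z) * co Ys' j * T0).
Proof.
move=> relF relG.
have := @assemble B J J0 JB JM T0 (co Xs) (co Ys) (co Ys') (at_ Ft) (at_ Gs) 1 D.+1 S P k.
rewrite (eq_bigr (fun i : 'I_D.+1 => \sum_(j < D.+1) co Xs i * pairing (k - (i + j)%:Z) * co Ys' j * T0)); last first.
  by move=> i _; apply: eq_bigr => j _; rewrite mul1r.
apply=> //; first by left.
- exact: at_lt0.
- move=> s lts; rewrite -at_CM relF [in LHS](spread_nat ltDK dX) [in LHS](spread_nat ltDK dY).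
  rewrite at_sandwich; last by lia.
  by apply: eq_bigr => i _; apply: eq_bigr => j _; rewrite mul1r.
move=> r ltr; have := congr1 (fun f => at_ f (r + D%:Z)) relG.
rewrite at_spreadMr; last by lia.
rewrite at_spreadMl; last by lia.
have e (j : 'I_D.+1) : r + D%:Z - (D - j)%:Z = r + 1 * j%:Z by have := ltn_ord j; lia.
under eq_bigr do rewrite e; under [X in _ = X]eq_bigr do rewrite e.
by [].
Qed.

(** The case of R-matrices polynomial in 1/u: now those in the relation for [Ft] are reversed, and
    that relation is multiplied by u^(2D) to clear denominators. *)
Lemma commutation_rev :
    tX B K ^+ (D + D) * (tC K T0 * Ft) = rev_at D Xs * Ft * tC K T0 * rev_at D Ys ->
    tC K T0 * Ys * Gs = Gs * Ys' * tC K T0 ->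
  J (T0 * pairing k - \sum_(i < D.+1) \sum_(j < D.+1)
    co Xs i * pairing (k + (i + j)%:Z) * co Ys' j * T0).
Proof.
move=> relF relG.
have := @assemble B J J0 JB JM T0 (co Xs) (co Ys) (co Ys') (at_ Ft) (at_ Gs) (-1) D.+1 S P k.
rewrite (eq_bigr (fun i : 'I_D.+1 => \sum_(j < D.+1) co Xs i * pairing (k + (i + j)%:Z) * co Ys' j * T0)); last first.
  by move=> i _; apply: eq_bigr => j _; rewrite mulN1r opprK.
apply=> //; first by right.
- exact: at_lt0.
- move=> s lts; have := congr1 (fun f => at_ f (s + (D + D)%:Z)) relF.
  rewrite at_XnM; last by lia.
  rewrite addrK at_CM => ->; rewrite at_sandwich; last by lia.
  apply: eq_bigr => i _; apply: eq_bigr => j _; congr (_ * at_ _ _ * _ * _).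
  by have := ltn_ord j; have := ltn_ord i; lia.
move=> r ltr; have := congr1 (fun f => at_ f r) relG.
rewrite [in LHS](spread_nat ltDK dY) [in RHS](spread_nat ltDK dY').
rewrite at_spreadMr; last by lia.
rewrite at_spreadMl; last by lia.
under eq_bigr do rewrite -mulN1r; under [X in _ = X]eq_bigr do rewrite -mulN1r.
by [].
Qed.

End Commutation.

(** For each fixed [z n] the hypothesis says that the coefficients of positive degree have trace 0.
    Using it in degree t with n = t handles a middle factor that varies with the degree i + j. *)
Lemma trace_collapse (B : pzRingType) (K D : nat) (V : zmodType) (Tr : {additive B -> V})
    (E T0 : B) (Xs Ys : tser B K) (z : nat -> B) :
    (D + D < K)%N -> pdeg D Xs -> pdeg D Ys ->
    (forall n t, Tr (co (tC K E * Xs * tC K (z n) * Ys * tC K T0) t) =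
                 Tr (co (tC K E * tC K (z n) * tC K T0) t)) ->
  \sum_(i < D.+1) \sum_(j < D.+1) Tr (E * (co Xs i * z (i + j)%N * co Ys j * T0)) = Tr (E * z 0%N * T0).
Proof.
move=> ltK dX dY TrE; have ltDK : (D < K)%N by lia.
pose f n t := \sum_(i < D.+1) \sum_(j < D.+1)
  (if (i + j == t)%N then Tr (E * (co Xs i * z n * co Ys j * T0)) else 0).
have fE n t : (t < K)%N -> f n t = if t == 0%N then Tr (E * z n * T0) else 0.
  move=> ltt; transitivity (Tr (co (tC K E * tC K (z n) * tC K T0) t)); last first.
    by rewrite coMC coCM co_tC //; case: eqP => _ //; rewrite mulr0 mul0r raddf0.
  rewrite -TrE coMC.
  have -> : tC K E * Xs * tC K (z n) * Ys = tC K E * (Xs * tC K (z n) * tC K 1 * Ys).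
    by rewrite rmorph1 mulr1 !mulrA.
  rewrite coCM -at_nat [Xs](spread_nat ltDK dX) [Ys](spread_nat ltDK dY).
  rewrite at_sandwich; last by lia.
  rewrite mulr_sumr mulr_suml raddf_sum.
  apply: eq_bigr => i _; rewrite mulr_sumr mulr_suml raddf_sum.
  apply: eq_bigr => j _; rewrite mulr1 -!mulrA /=.
  case: (ltngtP (i + j)%N t) => [lt|lt|<-].
  - rewrite /at_ ifT; last by lia.
    rewrite co_tC; last by lia.
    by rewrite ifF ?mul0r ?mulr0 ?raddf0 //; apply/negbTE; lia.
  - by rewrite at_lt0 ?mul0r ?mulr0 ?raddf0 //; lia.
  rewrite subrr at_nat co_tC; last by lia.
  by [].
transitivity (\sum_(t < (D + D).+1) f t t).
  rewrite /f [RHS]exchange_big; apply: eq_bigr => i _; rewrite [RHS]exchange_big; apply: eq_bigr => j _ /=.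
  have ltij : (i + j < (D + D).+1)%N by have := ltn_ord i; have := ltn_ord j; lia.
  rewrite (bigD1 (Ordinal ltij)) //= eqxx big1 ?addr0 // => t ne_t.
  by rewrite ifF //; apply: contraNF ne_t => /eqP e; apply/eqP/val_inj.
rewrite big_ord_recl /= fE; last by lia.
rewrite big1 ?addr0 // => t _; rewrite /bump add1n fE //.
by have := ltn_ord t; lia.
Qed.

(** * Moving the auxiliary series through all sites *)

Section SiteProducts.
Variables (I : eqType) (Q : pzRingType) (T0 : Q).

(** The central factor q at each site allows for relations that hold only after clearing
    denominators. *)
Lemma prod_through (r : seq I) (q : Q) (x t y : I -> Q) : uniq r ->
    (forall z, q * z = z * q) ->
    (forall a, q * (T0 * t a) = x a * t a * T0 * y a) ->
    (forall a b, a != b -> x b * t a = t a * x b) ->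
    (forall a b, a != b -> y b * t a = t a * y b) ->
  q ^+ size r * (T0 * \prod_(a <- r) t a) =
  \prod_(a <- r) x a * \prod_(a <- r) t a * T0 * \prod_(a <- rev r) y a.
Proof.
move=> + qC qE xt yt; elim: r => [|a r IHr] /=; first by rewrite !big_nil !mulr1.
move=> /andP[ar r_uniq]; have ne b : b \in r -> b != a by move=> br; apply: contraNneq ar => <-.
have prodC (f : I -> Q) (z : Q) : (forall b, b \in r -> f b * z = z * f b) ->
    (\prod_(b <- r) f b) * z = z * \prod_(b <- r) f b by exact: prod_comm.
rewrite rev_cons -cats1 big_cat big_seq1 !big_cons /=.
have -> : q ^+ (size r).+1 * (T0 * (t a * \prod_(b <- r) t b)) =
    x a * t a * (q ^+ size r * (T0 * \prod_(b <- r) t b)) * y a.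
  rewrite exprSr -mulrA (mulrA T0) (mulrA q) qE.
  have qnC z : q ^+ size r * z = z * q ^+ size r.
    have /esym : GRing.comm z (q ^+ size r) by apply: commrX; rewrite /GRing.comm qC.
    exact.
  rewrite -(mulrA _ (y a)) -(prodC t (y a)) => [|b br]; last by rewrite yt // ne.
  by rewrite qnC [X in _ = _ * X * _]qnC -!mulrA qnC.
rewrite IHr // !mulrA; congr (_ * _ * _ * _ * _).
by rewrite -!mulrA; congr (_ * _); rewrite -(prodC x) // => b br; rewrite xt // eq_sym ne.
Qed.

Lemma prod_back (r : seq I) (s y y' : I -> Q) : uniq r ->
    (forall a, T0 * y a * s a = s a * y' a * T0) ->
    (forall a b, a != b -> y b * s a = s a * y b) ->
    (forall a b, a != b -> y' b * s a = s a * y' b) ->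
  T0 * \prod_(a <- r) y a * \prod_(a <- r) s a =
  \prod_(a <- r) s a * \prod_(a <- r) y' a * T0.
Proof.
move=> + yE ys ys'; elim: r => [|a r IHr] /=; first by rewrite !big_nil !mulr1 mul1r.
move=> /andP[ar r_uniq]; have ne b : b \in r -> b != a by move=> br; apply: contraNneq ar => <-.
have prodC (f : I -> Q) (z : Q) : (forall b, b \in r -> f b * z = z * f b) ->
    (\prod_(b <- r) f b) * z = z * \prod_(b <- r) f b by exact: prod_comm.
rewrite !big_cons.
transitivity (T0 * y a * s a * \prod_(b <- r) y b * \prod_(b <- r) s b).
  rewrite -!mulrA; do 2 congr (_ * _); rewrite !mulrA (prodC y) // => b br.
  by rewrite ys // eq_sym ne.
rewrite yE -!mulrA (mulrA T0) IHr // -!mulrA; congr (_ * _); rewrite !mulrA; do 2 congr (_ * _).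
by rewrite (prodC s) // => b br; rewrite ys' // ne.
Qed.

End SiteProducts.

(** * Fractions in nilpotent parameters and their degrees *)

Section NilpotentCancellation.
Variables (S : comPzRingType) (p : S) (k : nat).
Hypothesis pk : p ^+ k = 0.

(** Serves to identify fractions: both are multiplied by a common denominator of the form 1 - p
    q. *)
Lemma nil_cancel q x y : (1 - p * q) * x = (1 - p * q) * y -> x = y.
Proof.
have pqk : (p * q) ^+ k = 0 by rewrite exprMn pk mul0r.
by move=> e; rewrite -[x]mul1r -[y]mul1r -(geoE pqk) ![_ * geo _ _]mulrC -!mulrA e.
Qed.

End NilpotentCancellation.

Section FamilyScalars.
Variables (F : numFieldType) (S0 S : comPzRingType) (aF : {rmorphism F -> S0}).
Variables (kS : {rmorphism S0 -> S}) (n : nat).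

Lemma kfamE k v : k ^+ n = 0 -> kfam n aF kS k v * (1 - kS (aF v) * k) = k.
Proof. by move=> kn; rewrite /kfam -mulrA [geo _ _ * _]mulrC geoE ?mulr1 // exprMn kn mulr0. Qed.

Lemma kfam_nilp k v : k ^+ n = 0 -> kfam n aF kS k v ^+ n = 0.
Proof. by move=> kn; rewrite exprMn kn mul0r. Qed.

Lemma kfam_frac k v d b : k ^+ n = 0 -> k * d = b ->
  kfam n aF kS k v * (d - kS (aF v) * b) = b.
Proof.
move=> kn kd; have e := kfamE v kn; set ka := kfam n aF kS k v in e *.
have -> : ka * (d - kS (aF v) * b) = ka * (1 - kS (aF v) * k) * d by rewrite -kd; ring.
by rewrite e.
Qed.

Lemma kshift_frac (N : nat) (k p q b : S) : k ^+ n = 0 -> k * (1 - p * q) = p * b ->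
  kshift N n k * (1 - p * (q - N%:R * b)) = p * b.
Proof.
move=> kn kd; have e := kshiftE N kn; set ks := kshift N n k in e *.
rewrite -kd; transitivity (ks * (1 + N%:R * k) * (1 - p * q)); last by rewrite e.
have -> : 1 - p * (q - N%:R * b) = 1 - p * q + N%:R * (p * b) by ring.
by rewrite -kd; ring.
Qed.

End FamilyScalars.

Section FamilyDegrees.
Variables (B : comPzRingType) (K : nat).
Implicit Types f k : tser B K.

Lemma pdeg_geo n d f : pdeg d f -> pdeg (n * d) (geo n f).
Proof.
move=> df; apply: pdeg_sum => i _; apply: (pdeg_leq _ (pdegXn df)).
by rewrite leq_mul2r ltnW ?orbT.
Qed.

Lemma pdeg_gs (G : nat -> tser B K) n d f : (forall j, pdeg 0 (G j)) -> pdeg d f -> pdeg (n * d) (gs G n f).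
Proof.
move=> dG df; apply: pdeg_sum => i _; rewrite -[(n * d)%N]add0n; apply: pdegM => //.
by apply: (pdeg_leq _ (pdegXn df)); rewrite leq_mul2r ltnW ?orbT.
Qed.

Lemma pdeg_gi (G : nat -> tser B K) n d f : (forall j, pdeg 0 (G j)) -> pdeg d f ->
  pdeg (n * (n * d)) (gi G n f).
Proof. by move=> dG df; apply/pdeg_geo/pdegB/pdeg_gs; first exact: pdeg1. Qed.

Lemma pdeg_nat d j : pdeg d (j%:R : tser B K).
Proof. by rewrite -(rmorph_nat (tC K)); apply: pdegC. Qed.

Lemma pdeg_kshift N n d f : pdeg d f -> pdeg (n.+1 * d) (kshift N n f).
Proof.
move=> df; rewrite mulSn; apply: pdegM => //; apply/pdeg_geo/pdegN.
by rewrite -[d]add0n; apply/pdegM/df/pdeg_nat.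
Qed.

End FamilyDegrees.

Section ReversedScalars.
Variables (B : pzRingType) (K : nat).

Lemma rev_at_const d (a : B) : (d < K)%N -> rev_at d (tC K a) = tC K a * tX B K ^+ d.
Proof.
by move=> lt; have := rev_at_monomial a (leq0n d) lt; rewrite expr0 mulr1 subn0.
Qed.

Lemma rev_at_scaled d (a : B) : (d.+1 < K)%N ->
  rev_at d.+1 (tC K a * tX B K) = tC K a * tX B K ^+ d.
Proof.
by move=> lt; have := rev_at_monomial a (ltn0Sn d) lt; rewrite expr1 subn1.
Qed.

Lemma pdeg_affine (a b : B) : pdeg 1 (tC K a - tC K b * tX B K).
Proof. by apply: pdegB; [apply: pdegC|rewrite -[1%N]add0n; apply: pdegM; [apply: pdegC|apply: pdegX]]. Qed.

Lemma rev_at_affine d f (a b : B) : (d.+1 < K)%N -> pdeg d f ->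
  rev_at d f * (tC K a * tX B K - tC K b) = rev_at d.+1 (f * (tC K a - tC K b * tX B K)).
Proof.
move=> lt df; rewrite -addn1 rev_atM ?addn1 //; last exact: pdeg_affine.
rewrite rev_atB rev_at_const; last by lia.
by rewrite rev_at_scaled ?mulr1 //; lia.
Qed.

End ReversedScalars.

(** * Moving the auxiliary series through one site *)

Section SiteAlgebra.
Variables (S : comPzRingType) (Q : pzRingType) (io : {rmorphism S -> Q}).
Hypothesis ioC : forall x y, io x * y = y * io x.
Implicit Types (P f t s z R : Q).

Lemma rtt_pull P f t (q rho : S) : io rho * (P * f * t - t * f * P) = io q * (f * t - t * f) ->
  (io q - io rho * P) * (f * t) = t * f * (io q - io rho * P).
Proof.
rewrite !mulrBr => /eqP; rewrite subr_eq addrAC eq_sym subr_eq => /eqP H.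
have -> : (io q - io rho * P) * (f * t) = io q * (f * t) - io rho * (P * f * t).
  by rewrite mulrBl -!mulrA.
have -> : t * f * io q - t * f * (io rho * P) = io q * (t * f) - io rho * (t * f * P).
  by rewrite -ioC [X in _ - X]mulrA -[t * f * io rho]ioC -!mulrA.
by apply/eqP; rewrite subr_eq addrAC eq_sym subr_eq H addrC.
Qed.

Lemma linear_comm P z (a b : S) : P * z = z * P -> (io a - io b * P) * z = z * (io a - io b * P).
Proof. by move=> Pz; rewrite mulrBl mulrBr ioC -mulrA Pz !mulrA ioC. Qed.

Lemma scal_rtt R f t (s : S) : R * (t * f) = f * t * R -> io s * R * (t * f) = f * t * (io s * R).
Proof. by move=> H; rewrite -mulrA H [RHS]mulrA -ioC !mulrA. Qed.

Lemma rtt_scaled (xh yh q f t : Q) : xh * (t * f) = f * t * xh -> xh * yh = q ->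
  (forall z, q * z = z * q) -> q * (f * t) = xh * t * f * yh.
Proof. by move=> H <- qC; rewrite qC -(mulrA xh) H !mulrA. Qed.

Lemma commute_inv t s z : t * s = 1 -> s * t = 1 -> t * z = z * t -> s * z = z * s.
Proof. by move=> ts st tz; rewrite -[LHS]mulr1 -ts -!mulrA (mulrA z) -tz !mulrA st mul1r. Qed.

Lemma scaled_inv P (ga gb k : S) : P * P = 1 -> ga * (1 - k ^+ 2) * gb = 1 ->
  io ga * (1 - io k * P) * (io gb * (1 + io k * P)) = 1 /\
  io gb * (1 + io k * P) * (io ga * (1 - io k * P)) = 1.
Proof.
move=> PP gg; have kk : io k * P * (io k * P) = io (k ^+ 2).
  by rewrite -mulrA (mulrA P) -ioC -mulrA PP mulr1 -rmorphM -expr2.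
have e1 : (1 - io k * P) * (1 + io k * P) = io (1 - k ^+ 2).
  by rewrite mulrDr mulr1 mulrBl mul1r kk addrA subrK rmorphB rmorph1.
have e2 : (1 + io k * P) * (1 - io k * P) = io (1 - k ^+ 2).
  by rewrite mulrBr mulr1 mulrDl mul1r kk opprD addrA addrK rmorphB rmorph1.
have swap (x z : S) v w : io x * v * (io z * w) = io (x * z) * (v * w).
  by rewrite -!mulrA (mulrA v) -ioC -mulrA mulrA -rmorphM.
by rewrite !swap e1 e2 -!rmorphM (mulrC gb) mulrAC gg rmorph1.
Qed.

Lemma scal_sandwich P f s (a b c : S) : f * (io a - io b * P) * s = s * (io a - io b * P) * f ->
  f * (io c * (io a - io b * P)) * s = s * (io c * (io a - io b * P)) * f.
Proof. by move=> H; rewrite !(mulrA _ (io c)) -!ioC -!mulrA; congr (_ * _); rewrite !mulrA. Qed.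

Lemma rtt_transpose R R' f t s : R * (f * t) = t * f * R' -> t * s = 1 -> s * t = 1 ->
  s * R * f = f * R' * s.
Proof. by move=> RE ts st; rewrite -[LHS]mulr1 -ts !mulrA -[s * R * f * t]mulrA -[s * R * _]mulrA RE !mulrA st mul1r. Qed.

Lemma rtt_solve R R' V f t : R * (f * t) = t * f * R' -> V * R = 1 -> f * t = V * t * f * R'.
Proof. by move=> RE VR; rewrite -!mulrA (mulrA t) -RE mulrA VR mul1r. Qed.

Lemma rtt_transpose_inv R R' V V' f t s : R * (t * f) = f * t * R' -> V * R = 1 -> R' * V' = 1 ->
  t * s = 1 -> s * t = 1 -> f * V' * s = s * V * f.
Proof.
move=> RE VR RV' ts st; transitivity (s * V * (R * (t * f)) * V' * s).
  by rewrite -!mulrA (mulrA V) VR mul1r (mulrA s t) st mul1r.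
by rewrite RE -!mulrA (mulrA R') RV' mul1r ts mulr1.
Qed.

End SiteAlgebra.

Section SiteRelations.
Variables (N m n M : nat) (A Q : pzRingType) (S0 S : comPzRingType).
Variables (io : {rmorphism S -> Q}) (inj : {rmorphism A -> Q}).
Variables (kA : {rmorphism S0 -> A}) (kS : {rmorphism S0 -> S}).
Hypothesis ioC : forall x y, io x * y = y * io x.
Hypothesis inj_kA : forall x, inj (kA x) = io (kS x).
Variable e : option 'I_m -> 'I_N -> 'I_N -> Q.
Hypothesis eM : forall x i j k l, e x i j * e x k l = if j == k then e x i l else 0.
Hypothesis eC : forall x y i j k l, x != y -> e x i j * e y k l = e y k l * e x i j.
Hypothesis e1 : forall x, \sum_i e x i i = 1.
Hypothesis injC : forall x i j a, inj a * e x i j = e x i j * inj a.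
Variables (hh : S0) (T Tp : nat -> 'M[A]_N).
Hypotheses (hn : hh ^+ n = 0) (T0 : T 0%N = 1).
Hypothesis relN : forall r s i j k l,
  T r.+1 i j * T s k l - T s k l * T r.+1 i j - (T r i j * T s.+1 k l - T s.+1 k l * T r i j)
  = kA hh * (T r k j * T s i l - T s k j * T r i l).
Hypothesis relP : forall r s i j k l,
  (if r is r'.+1 then Tp r' i j * Tp s k l - Tp s k l * Tp r' i j else 0)
  - (if s is s'.+1 then Tp r i j * Tp s' k l - Tp s' k l * Tp r i j else 0)
  = kA hh * (Tp r k j * Tp s i l - Tp s k j * Tp r i l).
Variables (g : nat -> S0) (y : S0).
Hypothesis g0 : g 0%N = 1.
Hypothesis gP : forall r, sshiftN N%:R g r = g r - (if (2 <= r)%N then g (r - 2)%N else 0).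
Let q j := g j * hh ^+ j.
Let q' j := if j is j'.+1 then hh * q j' else 0.
Hypothesis relX : forall r s i j k l,
  \sum_(a < r.+1) \sum_(b < s.+1)
    (kA (rexp q y a b) * (T (r - a)%N i j * Tp (s - b)%N k l)
     - kA (rexp q' y a b) * (T (r - a)%N k j * Tp (s - b)%N i l)) =
  \sum_(a < r.+1) \sum_(b < s.+1)
    (kA (rexp q (- y) a b) * (Tp (s - b)%N k l * T (r - a)%N i j)
     - kA (rexp q' (- y) a b) * (Tp (s - b)%N k j * T (r - a)%N i l)).
Hypothesis nM : (n <= M)%N.

Local Notation TQ := (Tx M io inj e T).
Local Notation TpQ := (Tpx M io inj e Tp).
Local Notation h := (kS hh).
Local Notation Rq k a := (Rb n io kS e g k None (Some a)).
Local Notation G := (kS \o g).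
Local Notation Rv k a := (Rinv n io e G k None (Some a)).
Local Notation P a := (uperm e None (Some a)).
Local Notation eps := (_ : S).
Implicit Types (X Y Z k rho w s : S) (a : 'I_m).

Let GP r : sshiftN N%:R G r = G r - (if (2 <= r)%N then G (r - 2)%N else 0).
Proof.
rewrite /= -[RHS](_ : kS (sshiftN N%:R g r) = _); last first.
  by rewrite gP rmorphB; case: ifP => _ //; rewrite rmorph0.
rewrite rmorph_sum; apply: eq_bigr => i _.
by rewrite rmorphMn rmorphM rmorphXn rmorphN rmorph_nat.
Qed.

Lemma Rb_Rinv k a : k ^+ n = 0 -> Rq k a * Rv k a = 1 /\ Rv k a * Rq k a = 1.
Proof.
move=> kn; apply: (scaled_inv ioC); first exact: (uperm2 eM eC e1).
by apply: gs_inv2 => //=; rewrite g0 rmorph1.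
Qed.

Let hk_nilp k : (h * k) ^+ n = 0.
Proof. by rewrite exprMn -rmorphXn hn rmorph0 mul0r. Qed.

Let Rq_sym k a : Rb n io kS e g k (Some a) None = Rq k a.
Proof. by rewrite /Rb (uperm_sym eC). Qed.

Lemma minus_through Z Y xi xi' k k' a : Z ^+ M = 0 -> Y ^+ M = 0 ->
    xi * (1 - Z * Y + kS y * Z) = Z -> xi' * (1 - Z * Y - kS y * Z) = Z ->
    h * xi = k -> h * xi' = k' ->
  TQ None Z * TpQ (Some a) Y = Rv k a * TpQ (Some a) Y * TQ None Z * Rq k' a.
Proof.
move=> ZM YM xiE xiE' <- <-; have [_ RvR] := Rb_Rinv a (hk_nilp xi).
have H := @site_mixed N m n M A Q S0 S io inj kA kS ioC inj_kA e eM eC injC hh T Tp hn g y relX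
  None (Some a) Z Y xi xi' isT nM ZM YM xiE xiE'.
exact: rtt_solve H RvR.
Qed.

(** The quotient rho/w is the parameter h/(1/Z - 1/X) of R. It is kept as a pair, as the denominator
    w will be a power of a nilpotent variable; s is the scalar factor that the RTT relation leaves
    free. *)
Lemma minus_back Z X s rho w a : Z ^+ M = 0 -> X ^+ M = 0 ->
    rho * (X - Z) = w * (h * Z * X) ->
    forall z, TQ (Some a) X * z = 1 -> z * TQ (Some a) X = 1 ->
  TQ None Z * (io s * (io w - io rho * P a)) * z = z * (io s * (io w - io rho * P a)) * TQ None Z.
Proof.
move=> ZM XM rhoE z tz zt; apply: scal_sandwich => //.
have [D [D1 D2]] := @site_minus N m M A Q S0 S io inj kA kS ioC inj_kA e eM eC e1 injC hh T T0 relN None (Some a) Z X isT ZM XM.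
apply/esym/(rtt_transpose _ tz zt)/rtt_pull => //.
by rewrite -D2 mulrA -rmorphM rhoE D1 rmorphM mulrA.
Qed.

(** The mixed relation with T at site a and T^+ at site 0: both R-matrices are inverted, and T_a is
    inverted from both sides. *)
Lemma plus_back Z X xi xi' k k' a : Z ^+ M = 0 -> X ^+ M = 0 ->
    xi * (1 - X * Z + kS y * X) = X -> xi' * (1 - X * Z - kS y * X) = X ->
    h * xi = k -> h * xi' = k' ->
    forall z, TQ (Some a) X * z = 1 -> z * TQ (Some a) X = 1 ->
  TpQ None Z * Rv k' a * z = z * Rv k a * TpQ None Z.
Proof.
move=> ZM XM xiE xiE' <- <- z tz zt.
have [_ RvR] := Rb_Rinv a (hk_nilp xi); have [RR' _] := Rb_Rinv a (hk_nilp xi').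
have := @site_mixed N m n M A Q S0 S io inj kA kS ioC inj_kA e eM eC injC hh T Tp hn g y relX
  (Some a) None X Z xi xi' isT nM XM ZM xiE xiE'.
by rewrite !Rq_sym => H; apply: rtt_transpose_inv H RvR RR' tz zt.
Qed.

Lemma plus_through Z X rho w a : Z ^+ M = 0 -> X ^+ M = 0 -> rho * (X - Z) = w * h ->
  (io w - io rho * P a) * (TpQ (Some a) X * TpQ None Z) =
  TpQ None Z * TpQ (Some a) X * (io w - io rho * P a).
Proof.
move=> ZM XM rhoE.
have [D [D1 D2]] := @site_plus N m M A Q S0 S io inj kA kS ioC inj_kA e eM eC e1 injC hh Tp relP (Some a) None X Z isT XM ZM.
apply: rtt_pull => //; rewrite (uperm_sym eC) // -D2 mulrA -rmorphM D1 mulrN mulrA -rmorphM -rhoE.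
by rewrite -mulNr -rmorphN -mulrN opprB.
Qed.

End SiteRelations.


(** * The parameters of the R-matrices in the two cases *)

Section Embedding.
Variables (B : pzRingType) (L K : nat).

Definition emb2 (x : B) : tser (tser B L) K := tC K (tC L x).
HB.instance Definition _ := GRing.RMorphism.copy emb2 (tC K \o tC L).

End Embedding.

Section CaseScalars.
Variables (N n L K : nat) (F : numFieldType) (S0 S : comPzRingType) (aF : {rmorphism F -> S0}).
Variables (kS : {rmorphism S0 -> S}) (hh : S0) (eps w : S).
Hypotheses (hn : hh ^+ n = 0) (eps_nilp : eps ^+ L = 0) (w_nilp : w ^+ K = 0).
Local Notation h := (kS hh).
Implicit Types (x v : F).

Definition shf (v : F) : S := h * kS (aF v).

Lemma shfD x v : shf (x + v) = shf x + shf v.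
Proof. by rewrite /shf !rmorphD mulrDr. Qed.
Lemma shfN x : shf (- x) = - shf x.
Proof. by rewrite /shf !rmorphN mulrN. Qed.
Lemma shf_nat : N%:R * h = shf N%:R.
Proof. by rewrite /shf !rmorph_nat mulrC. Qed.

Let h_nilp : h ^+ n = 0. Proof. by rewrite -rmorphXn hn rmorph0. Qed.

Let mul_geo (p q : S) k : p ^+ k = 0 -> p * geo k (p * q) * (1 - p * q) = p.
Proof. by move=> pk; rewrite -mulrA [geo _ _ * _]mulrC geoE ?mulr1 // exprMn pk mul0r. Qed.

(* With z = 1 / eps and u = w this is h / (z - u - h x). *)
Definition kminus x : S := eps * h * geo L (eps * (w + shf x)).

Lemma kminus_nilp x : kminus x ^+ n = 0.
Proof. by rewrite /kminus [eps * h]mulrC -mulrA exprMn h_nilp mul0r. Qed.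

Lemma kminusE x : kminus x * (1 - eps * (w + shf x)) = eps * h.
Proof.
transitivity (h * (eps * geo L (eps * (w + shf x)) * (1 - eps * (w + shf x)))); first by rewrite /kminus; ring.
by rewrite mul_geo // mulrC.
Qed.

(** This is h/(z - u - h(x + v)); v is the content of the site. *)
Definition kapm x v : S := kfam n aF kS (kminus x) v.

Lemma kapmE x v : kapm x v * (1 - eps * (w + shf (x + v))) = eps * h.
Proof.
have := kfam_frac aF kS v (kminus_nilp x) (kminusE x); rewrite -/(kapm x v) => <-.
by congr (_ * _); rewrite shfD /shf; ring.
Qed.

Lemma kapm_nilp x v : kapm x v ^+ n = 0.
Proof. exact/kfam_nilp/kminus_nilp. Qed.

(** This is 1/(z - u - h x), the expansion parameter of the mixed relation, in which division by h
    has to be avoided. *)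
Definition xim x : S := eps * geo L (eps * (w + shf x)).

Lemma ximE x : xim x * (1 - eps * (w + shf x)) = eps.
Proof. exact: mul_geo eps_nilp. Qed.

Lemma kapm_xim x v : h * xim (x + v) = kapm x v.
Proof.
apply: (nil_cancel eps_nilp (q := w + shf (x + v))).
by rewrite [RHS]mulrC kapmE mulrC -mulrA ximE mulrC.
Qed.

(** Adding N to the argument divided by h lowers x by N. Between x = N/2 and x = -N/2 this is
    crossing symmetry at the critical level. *)
Lemma kapm_shift x v : kshift N n (kapm x v) = kapm (x - N%:R) v.
Proof.
apply: (nil_cancel eps_nilp (q := w + shf (x - N%:R + v))).
rewrite [RHS]mulrC kapmE -(kshift_frac N (kapm_nilp x v) (kapmE x v)) mulrC.
by congr (_ * (1 - _ * _)); rewrite shf_nat !shfD shfN; ring.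
Qed.

(* With z = eps and u = 1 / w this is h / (z - u + h x). *)
Definition kplus x : S := - (w * h * geo (L + n) (w * (eps + shf x))).

Lemma kplus_nilp x : kplus x ^+ n = 0.
Proof. by rewrite exprNn [w * h]mulrC -mulrA exprMn h_nilp mul0r mulr0. Qed.

Lemma kplusE x : kplus x * (1 - w * (eps + shf x)) = - (w * h).
Proof.
have nilp : (w * (eps + shf x)) ^+ (L + n) = 0.
  by rewrite exprMn (nilpD eps_nilp) ?mulr0 // exprMn h_nilp mul0r.
have := geoE nilp; rewrite /kplus; set ge := geo _ _ => ee.
transitivity (- (w * h * ((1 - w * (eps + shf x)) * ge))); first by ring.
by rewrite ee mulr1.
Qed.

(** This is h/(z - u + h(x - v)), with z the inner variable and w = 1/u. *)
Definition kapp x v : S := kfam n aF kS (kplus x) v.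

Lemma kappE x v : kapp x v * (1 - w * (eps + shf (x - v))) = - (w * h).
Proof.
have := kfam_frac aF kS v (kplus_nilp x) (kplusE x); rewrite -/(kapp x v) => <-.
by congr (_ * _); rewrite shfD shfN /shf; ring.
Qed.

Lemma kapp_nilp x v : kapp x v ^+ n = 0.
Proof. exact/kfam_nilp/kplus_nilp. Qed.

Lemma kapp_shift x v : kshift N n (- kapp x v) = - kapp (x - N%:R) v.
Proof.
have nk : (- kapp x v) ^+ n = 0 by rewrite exprNn kapp_nilp mulr0.
have e : - kapp x v * (1 - w * (eps + shf (x - v))) = w * h by rewrite mulNr kappE opprK.
apply: (nil_cancel w_nilp (q := eps + shf (x - N%:R - v))).
rewrite [RHS]mulrC mulNr kappE opprK -(kshift_frac N nk e) mulrC.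
by congr (_ * (1 - _ * _)); rewrite shf_nat !shfD !shfN; ring.
Qed.

Section MinusVariable.
Variables x v : F.
Local Notation X := (Xminus n aF kS hh w (aF x) v).

Lemma Xminus_shf : X * (1 + shf (x + v) * w) = w.
Proof. by have := XminusE aF kS hn w (aF x) v; rewrite -rmorphD [v + x]addrC. Qed.

Lemma Xminus_nilp : X ^+ K = 0.
Proof. by rewrite exprMn w_nilp mul0r. Qed.

(** This is 1/(1/X - z - h t), where 1/X = u + h(x + v) is the argument of the inverse of T. *)
Definition xip (t : F) : S := X * geo K (X * (eps + shf t)).

Lemma xipE t : xip t * (1 - X * (eps + shf t)) = X.
Proof. exact: mul_geo Xminus_nilp. Qed.

Lemma kapp_xip t : h * xip t = - kapp (t - x) v.
Proof.
have XE := Xminus_shf; have e' := xipE t; set X := X in e' XE; set xi := xip t in e' *.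
apply: (nil_cancel w_nilp (q := eps + shf (t - x - v))).
rewrite [RHS]mulrC mulNr kappE opprK mulrC.
transitivity (h * (xi * (1 + shf (x + v) * w - w * (eps + shf t)))).
  by rewrite !shfD !shfN; ring.
rewrite -[w in RHS]XE -[X in RHS]e' -{2}XE; ring.
Qed.

(** After reversal [kapm] is a fraction in w = 1/u; this brings its equation to the form rho (X - Z)
    = W h Z X that [minus_back] asks for. *)
Lemma rev_fraction r W : r * ((1 - eps * shf (x + v)) * w - eps) = eps * h * (W * w) ->
  r * (X - eps) = W * (h * eps * X).
Proof.
move=> e; apply: (nil_cancel w_nilp (q := - shf (x + v))).
have XE := Xminus_shf; set X := X in XE *; set s := shf _ in e XE *.
transitivity (r * (X * (1 + s * w) - eps * (1 + s * w))); first by ring.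
rewrite XE; transitivity (r * ((1 - eps * s) * w - eps)); first by ring.
rewrite e; transitivity (W * (h * eps) * (X * (1 + s * w))); last by ring.
by rewrite XE; ring.
Qed.

End MinusVariable.

End CaseScalars.

Lemma subr_mulD (S : pzRingType) (a b c : S) : 1 - a * c - a * b = 1 - a * (b + c).
Proof. by rewrite mulrDr opprD addrA addrAC. Qed.

Section CaseDegrees.
Variables (N n L K : nat) (F : numFieldType) (S0 : comPzRingType) (aF : {rmorphism F -> S0}).
Variables (hh : S0).
Hypothesis hn : hh ^+ n = 0.
Local Notation S := (tser (tser S0 L) K).
Let kS : {rmorphism S0 -> S} := emb2 L K (B := S0).
Local Notation h := (kS hh).
Local Notation w := (tX (tser S0 L) K).
Definition inner_var : S := tC K (tX S0 L).
Local Notation eps := inner_var.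
Local Notation shf := (shf aF kS hh).
Local Notation kapm := (kapm n L aF kS hh eps w).
Local Notation kapp := (kapp n L aF kS hh eps w).

Lemma inner_var_nilp : eps ^+ L = 0.
Proof. by rewrite -rmorphXn tX_nilp ?rmorph0. Qed.
Let w_nilp : w ^+ K = 0. Proof. exact: tX_nilp. Qed.

Lemma pdeg_shf x : pdeg 0 (shf x).
Proof. by rewrite -[0%N]add0n; apply: pdegM; apply: pdegC. Qed.

(** A common degree bound: [kminus] and [kplus] have degree at most L + n + 1, and k times [geo n]
    of a multiple of k has at most n + 1 times that degree. *)
Definition degk : nat := n.+1 * (L + n).+1.

Let pdeg_kfam (k : S) v : pdeg (L + n).+1 k -> pdeg degk (kfam n aF kS k v).
Proof.
move=> dk; rewrite /degk mulSn; apply: pdegM => //; apply: pdeg_geo.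
by rewrite -[(L + n).+1]add0n; apply: pdegM => //; apply: pdegC.
Qed.

Lemma pdeg_kapm x v : pdeg degk (kapm x v).
Proof.
apply: pdeg_kfam; apply: (@pdeg_leq _ _ (0 + 0 + L * (0 + 1))); first by lia.
apply: pdegM; first by apply: pdegM; apply: pdegC.
apply: pdeg_geo; apply: pdegM; first exact: pdegC.
by apply: pdegD; [apply: pdegX|apply: pdeg_leq (pdeg_shf x)].
Qed.

Lemma pdeg_kapp x v : pdeg degk (kapp x v).
Proof.
apply: pdeg_kfam; apply: pdegN; apply: (@pdeg_leq _ _ (1 + 0 + (L + n) * (1 + 0))); first by lia.
apply: pdegM; first by apply: pdegM; [apply: pdegX|apply: pdegC].
apply: pdeg_geo; apply: pdegM; first exact: pdegX.
by apply: pdegD; [apply: pdegC|apply: pdeg_shf].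
Qed.

Lemma rev_kapm x v d : pdeg d (kapm x v) -> (d.+1 < K)%N ->
  rev_at d (kapm x v) * (Xminus n aF kS hh w (aF x) v - eps) = w ^+ d * (h * eps * Xminus n aF kS hh w (aF x) v).
Proof.
move=> dk ltK; apply: (rev_fraction hn w_nilp).
pose a : tser S0 L := 1 - tX S0 L * tC L (hh * aF (x + v)).
have aE : 1 - eps * shf (x + v) = tC K a.
  by rewrite rmorphB rmorph1 rmorphM /shf -rmorphM.
rewrite aE rev_at_affine // -aE -/inner_var.
have -> : 1 - eps * shf (x + v) - eps * w = 1 - eps * (w + shf (x + v)).
  exact: subr_mulD.
rewrite (kapmE aF kS w hn inner_var_nilp); have -> : eps * h = tC K (tX S0 L * tC L hh) by rewrite rmorphM.
by rewrite rev_at_const // exprSr.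
Qed.

Lemma rev_kapp x v d : pdeg d (kapp x v) -> (d.+1 < K)%N ->
  rev_at d (- kapp x v) * (w + shf (v - x) - eps) = w ^+ d * h.
Proof.
move=> dk ltK; pose b : tser S0 L := tX S0 L + tC L (hh * aF (x - v)).
have bE : eps + shf (x - v) = tC K b by rewrite rmorphD /shf -rmorphM.
have -> : w + shf (v - x) - eps = tC K 1 * w - tC K b.
  by rewrite rmorph1 mul1r -bE -[v - x]opprB shfN opprD [- eps - _]addrC addrA.
rewrite rev_at_affine //; last exact: pdegN.
rewrite -bE rmorph1.
have -> : - kapp x v * (1 - (eps + shf (x - v)) * w) = h * w.
  by rewrite [_ * w]mulrC mulNr (kappE aF kS w hn inner_var_nilp) opprK mulrC.
by rewrite rev_at_scaled // mulrC.
Qed.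

End CaseDegrees.

(** The reversed R-matrix is a scalar times a denominator minus a numerator times P, which is how
    [minus_back] and [plus_through] take it. *)
Lemma rev_linear_factor (S : comPzRingType) (W : pzRingType) (K : nat) (i1 : {rmorphism S -> W})
    (ga k : tser S K) (P : W) d dk D :
    pdeg d ga -> pdeg dk k -> (d + dk <= D)%N -> (D < K)%N ->
  rev_at D (tmap i1 ga * (1 - tmap i1 k * tC K P)) =
  tmap i1 (rev_at d ga * tX S K ^+ (D - (d + dk))) *
    (tmap i1 (tX S K ^+ dk) - tmap i1 (rev_at dk k) * tC K P).
Proof.
move=> dga dkk leD ltD; have dP : pdeg 0 (tC K P) by apply: pdegC.
have dk1 : pdeg dk (1 - tmap i1 k * tC K P).
  apply: pdegB; first exact: pdeg1.
  by rewrite -[dk]addn0; apply: pdegM => //; apply: pdeg_tmap.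
have dg1 : pdeg d (tmap i1 ga) by apply: pdeg_tmap.
rewrite (@rev_at_leq _ _ (d + dk)) ?leD //; last exact: pdegM.
rewrite rev_atM //; last by lia.
rewrite rev_atB rev_at1; last by lia.
rewrite -[X in rev_at X (tmap i1 k * _)]addn0 rev_atM //; [|exact: pdeg_tmap|by lia].
rewrite rev_atC; last by lia.
by rewrite !rev_at_tmap -tXn_comm mulrA rmorphM !rmorphXn /= tmap_tX tXn_comm.
Qed.

Lemma pdeg_linear_factor (S : comPzRingType) (W : pzRingType) (K : nat) (i1 : {rmorphism S -> W})
    (ga k : tser S K) (P : W) d dk :
    pdeg d ga -> pdeg dk k -> pdeg (d + dk) (tmap i1 ga * (1 + tmap i1 k * tC K P)).
Proof.
move=> dga dkk; apply: pdegM; first exact: pdeg_tmap.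
apply: pdegD; first exact: pdeg1.
by rewrite -[dk]addn0; apply: pdegM; [apply: pdeg_tmap|apply: pdegC].
Qed.

Section CentralFractions.
Variables (S : comPzRingType).
Implicit Types a b d f n : S.

Lemma fraction_plus a b d f : 1 - a * (b + d) + - f * a = 1 - a * (b + (f + d)).
Proof. by ring. Qed.

Lemma fraction_minus a b d f : 1 - a * (b + d) - - f * a = 1 - a * (b + (- f + d)).
Proof. by ring. Qed.

Lemma fraction_plus0 a b f : 1 - a * b + - f * a = 1 - a * (b + f).
Proof. by ring. Qed.

Lemma fraction_minus0 a b f : 1 - a * b - - f * a = 1 - a * (b - f).
Proof. by ring. Qed.

Lemma fraction_diff a b n : b * (1 + n * a) = a -> a - b - n * (a * b) = 0.
Proof. by move=> e; rewrite -{1}e; ring. Qed.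

Lemma fraction_diff_opp a b n : - a * (1 + n * - b) = - b -> a - b - n * (a * b) = 0.
Proof. by move=> e; rewrite -{1}e; ring. Qed.

End CentralFractions.

(** * Commutation with T and with T^+ under the trace *)

Section Cases.
Variables (N m n L K M : nat) (F : numFieldType) (A W0 : pzRingType) (S0 : comPzRingType).
Variables (i0 : {rmorphism S0 -> W0}) (inj0 : {rmorphism A -> W0}).
Variables (aF : {rmorphism F -> S0}) (kA : {rmorphism S0 -> A}).
Hypothesis i0C : forall x y, i0 x * y = y * i0 x.
Hypothesis inj_kA0 : forall x, inj0 (kA x) = i0 x.
Variable e : option 'I_m -> 'I_N -> 'I_N -> W0.
Hypothesis eM : forall x i j k l, e x i j * e x k l = if j == k then e x i l else 0.
Hypothesis eC : forall x y i j k l, x != y -> e x i j * e y k l = e y k l * e x i j.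
Hypothesis e1 : forall x, \sum_i e x i i = 1.
Hypothesis inj0C : forall x i j a, inj0 a * e x i j = e x i j * inj0 a.
Variable p : 'S_m -> W0.
Hypotheses (p1 : p 1%g = 1) (pM : forall s t, p (s * t)%g = p t * p s).
Hypothesis pP : forall a b, a != b -> p (tperm a b) = uperm e (Some a) (Some b).
Variables (hh : S0) (T Tp : nat -> 'M[A]_N).
Hypotheses (hn : hh ^+ n = 0) (T0 : T 0%N = 1).
Hypothesis relN : forall r s i j k l,
  T r.+1 i j * T s k l - T s k l * T r.+1 i j - (T r i j * T s.+1 k l - T s.+1 k l * T r i j)
  = kA hh * (T r k j * T s i l - T s k j * T r i l).
Hypothesis relP : forall r s i j k l,
  (if r is r'.+1 then Tp r' i j * Tp s k l - Tp s k l * Tp r' i j else 0)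
  - (if s is s'.+1 then Tp r i j * Tp s' k l - Tp s' k l * Tp r i j else 0)
  = kA hh * (Tp r k j * Tp s i l - Tp s k j * Tp r i l).
Variable g : nat -> S0.
Hypothesis g0 : g 0%N = 1.
Hypothesis gP : forall r, sshiftN N%:R g r = g r - (if (2 <= r)%N then g (r - 2)%N else 0).
Local Notation half := (N%:R / 2 : F).
Let y : S0 := - (hh * aF half).
Let q j := g j * hh ^+ j.
Let q' j := if j is j'.+1 then hh * q j' else 0.
Hypothesis relX : forall r s i j k l,
  \sum_(a < r.+1) \sum_(b < s.+1)
    (kA (rexp q y a b) * (T (r - a)%N i j * Tp (s - b)%N k l)
     - kA (rexp q' y a b) * (T (r - a)%N k j * Tp (s - b)%N i l)) =
  \sum_(a < r.+1) \sum_(b < s.+1)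
    (kA (rexp q (- y) a b) * (Tp (s - b)%N k l * T (r - a)%N i j)
     - kA (rexp q' (- y) a b) * (Tp (s - b)%N k j * T (r - a)%N i l)).

Local Notation S1 := (tser S0 L).
Local Notation W1 := (tser W0 L).
Local Notation S := (tser S1 K).
Local Notation Q := (tser W1 K).
Let kS : {rmorphism S0 -> S} := emb2 L K (B := S0).
Let cW : {rmorphism W0 -> Q} := emb2 L K (B := W0).
Let io : {rmorphism S -> Q} := tmap (L := K) (tmap (L := L) i0).
Let inj : {rmorphism A -> Q} := (cW \o inj0).
Let e' x i j := cW (e x i j).
Let p' s := cW (p s).

Let ioC x z : io x * z = z * io x.
Proof. by apply: tmap_central; apply: tmap_central. Qed.

Let io_kS x : io (kS x) = cW (i0 x).
Proof. by rewrite /io /kS /cW /= /emb2 tmap_tC /= tmap_tC. Qed.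

Let inj_kA x : inj (kA x) = io (kS x).
Proof. by rewrite io_kS /inj /= inj_kA0. Qed.

Let eM' x i j k l : e' x i j * e' x k l = if j == k then e' x i l else 0.
Proof. by rewrite -rmorphM eM; case: eqP => // _; rewrite rmorph0. Qed.

Let eC' x z i j k l : x != z -> e' x i j * e' z k l = e' z k l * e' x i j.
Proof. by move=> xz; rewrite -!rmorphM eC. Qed.

Let e1' x : \sum_i e' x i i = 1.
Proof. by rewrite -rmorph_sum e1 rmorph1. Qed.

Let injC x i j a : inj a * e' x i j = e' x i j * inj a.
Proof. by rewrite /inj /= -!rmorphM inj0C. Qed.

Let cW_uperm x z : cW (uperm e x z) = uperm e' x z.
Proof.
rewrite /uperm rmorph_sum; apply: eq_bigr => i _; rewrite rmorph_sum; apply: eq_bigr => j _.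
by rewrite rmorphM.
Qed.

Let p1' : p' 1%g = 1. Proof. by rewrite /p' p1 rmorph1. Qed.
Let pM' s t : p' (s * t)%g = p' t * p' s. Proof. by rewrite /p' pM rmorphM. Qed.
Let pP' a b : a != b -> p' (tperm a b) = uperm e' (Some a) (Some b).
Proof. by move=> ab; rewrite /p' pP // cW_uperm. Qed.

Variables (e0 : 'S_m -> F) (c : 'I_m -> F) (chi : ('I_m -> F) -> F).
Hypothesis e0J : forall b, conv (jm F b) e0 =1 fun s => c b * e0 s.
Hypotheses (e0V : jvalue e0 chi) (chi1 : chi c = 1).
Variables (V : zmodType) (Tr : {additive W0 -> V}).
Local Notation E0 := (gev (i0 \o aF) p e0).
Hypothesis Tr_cyc : forall a i j w, Tr (e (Some a) i j * w) = Tr (w * e (Some a) i j).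
Hypothesis Tr_E : forall w, Tr (E0 * w) = Tr (w * E0).
Hypothesis p_inner : forall s i j, p s * e None i j = e None i j * p s.
Hypothesis p_inj0 : forall s x, p s * inj0 x = inj0 x * p s.
Variable J : W0 -> Prop.
Hypotheses (J0 : J 0) (JB : forall x y, J x -> J y -> J (x - y)).
Hypothesis JM : forall x y, J y -> J (x * y).

Local Notation TQ := (Tx M io inj e' T).
Local Notation TpQ := (Tpx M io inj e' Tp).
Local Notation h := (kS hh).
Local Notation Rq k a := (Rb n io kS e' g k None (Some a)).
Local Notation G := (kS \o g).
Local Notation Rv k a := (Rinv n io e' G k None (Some a)).
Local Notation P a := (uperm e' None (Some a)).
Local Notation w := (tX S1 K).
Local Notation eps := (inner_var L K S0).
Local Notation Xm a := (Xminus n aF kS hh w (aF (- half)) (c a)).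
Local Notation shf := (shf aF kS hh).
Local Notation kapm := (kapm n L aF kS hh eps w).
Local Notation kapp := (kapp n L aF kS hh eps w).
Local Notation sites := (index_enum 'I_m).
(** The series at the sites 1, ..., m do not involve the inner variable. They are kept over W0, so
    that their coefficients can be compared with elements of W0. *)
Let lift : {rmorphism tser W0 K -> Q} := tmap (L := K) (tC L).
Variables tt ss : 'I_m -> tser W0 K.
Hypothesis ttE : forall a, lift (tt a) = TpQ (Some a) (w + shf (c a)).
Hypothesis ssE1 : forall a, TQ (Some a) (Xm a) * lift (ss a) = 1.
Hypothesis ssE2 : forall a, lift (ss a) * TQ (Some a) (Xm a) = 1.
Hypotheses (L_gt0 : (0 < L)%N) (K_gt0 : (0 < K)%N) (n_gt0 : (0 < n)%N) (LM : (L <= M)%N) (KM : (K + n <= M)%N).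
Let Ft := \prod_(a <- sites) tt a.
Let Gs := \prod_(a <- rev sites) ss a.

Let nM : (n <= M)%N. Proof. by lia. Qed.
Let M_gt0 : (0 < M)%N. Proof. by lia. Qed.
Let w_nilp : w ^+ K = 0. Proof. exact: tX_nilp. Qed.
Let w_nilpM : w ^+ M = 0. Proof. by apply: tX_nilp; lia. Qed.
Let eps_nilp : eps ^+ M = 0. Proof. exact: nilp_leq (inner_var_nilp _ _ _) LM. Qed.
Let X_nilp a : Xm a ^+ M = 0. Proof. by rewrite exprMn w_nilpM mul0r. Qed.
Let Y_nilp a : (w + shf (c a)) ^+ M = 0.
Proof. by apply: nilp_leq KM; apply: nilpD => //; rewrite exprMn -rmorphXn hn rmorph0 mul0r. Qed.

Let tC_inj : injective (tC L : W0 -> W1).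
Proof. by move=> x z /(congr1 (fun f => co f 0)); rewrite !co_tC. Qed.

Let co_lift f s : co (lift f) s = tC L (co f s).
Proof. exact: co_tmap. Qed.

Let comm_co f x s : lift f * cW x = cW x * lift f -> co f s * x = x * co f s.
Proof.
by move=> /(congr1 (fun f => co f s)); rewrite coCM coMC co_lift -!rmorphM => /tC_inj.
Qed.

Let E' := Esym io aF kS p' e0.
Let E'E : E' = cW E0.
Proof.
rewrite /E' /Esym /gev rmorph_sum; apply: eq_bigr => s _.
by rewrite rmorphM /= -io_kS.
Qed.

Let absorbs_co f s : absorbs E' (lift f) -> absorbs E0 (co f s).
Proof.
move=> /(congr1 (fun f => co f s)); rewrite E'E coCM coMC coCM co_lift -!rmorphM.
exact: tC_inj.
Qed.

Let lift_tt_comm b i j a : b != Some a -> lift (tt a) * e' b i j = e' b i j * lift (tt a).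
Proof. by move=> ba; rewrite ttE; apply/esym/(Tpx_comm M ioC eC' injC); rewrite eq_sym. Qed.

Let lift_ss_comm b i j a : b != Some a -> lift (ss a) * e' b i j = e' b i j * lift (ss a).
Proof.
move=> ba; apply: (commute_inv (ssE1 a) (ssE2 a)).
by apply/esym/(Tx_comm M ioC eC' injC); rewrite eq_sym.
Qed.

Let Ft_comm i j s : co Ft s * e None i j = e None i j * co Ft s.
Proof.
apply: comm_co; rewrite rmorph_prod; apply: prod_comm => a _; exact: lift_tt_comm.
Qed.

Let Gs_comm i j s : co Gs s * e None i j = e None i j * co Gs s.
Proof.
apply: comm_co; rewrite rmorph_prod; apply: prod_comm => a _; exact: lift_ss_comm.
Qed.

Let Ft_absorbs s : absorbs E0 (co Ft s).
Proof.
apply: absorbs_co; rewrite rmorph_prod; under eq_bigr do rewrite ttE.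
exact: (absorbs_plus aF ioC inj_kA eM' eC' e1' injC p1' pM' pP' hn relP e0J e0V chi1 w_nilp KM).
Qed.

Let Gs_absorbs s : absorbs E0 (co Gs s).
Proof.
apply: absorbs_co; rewrite rmorph_prod.
exact: (absorbs_minus_inv ioC inj_kA eM' eC' e1' injC p1' pM' pP' hn T0 relN e0J e0V chi1 w_nilpM M_gt0 ssE1).
Qed.

Local Notation Z := (pairing Ft Gs).

Let at_comm (f : tser W0 K) x : (forall s, co f s * x = x * co f s) -> forall s : int, at_ f s * x = x * at_ f s.
Proof. by move=> fx s; rewrite /at_; case: ifP => // _; rewrite mul0r mulr0. Qed.

Let Z_comm Sz l i j : Z Sz l * e None i j = e None i j * Z Sz l.
Proof.
rewrite mulr_suml mulr_sumr; apply: eq_bigr => s _.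
by rewrite -mulrA (at_comm (fun s => Gs_comm i j s)) !mulrA (at_comm (fun s => Ft_comm i j s)).
Qed.

Let Z_absorbs Sz l : absorbs E0 (Z Sz l).
Proof.
apply: absorbs_sum => s _; apply: absorbsM; first exact: Ft_absorbs.
rewrite /at_; case: (0 <= s%:Z - l); first exact: Gs_absorbs.
by rewrite /absorbs !mulr0 mul0r.
Qed.

Let J1 (f : W1) := forall r, J (co f r).
Let J1_0 : J1 0. Proof. by move=> r; rewrite co0. Qed.
Let J1_B f f' : J1 f -> J1 f' -> J1 (f - f').
Proof. by move=> Jf Jf' r; rewrite coB; apply: JB. Qed.
Let J1_M f f' : J1 f' -> J1 (f * f').
Proof.
move=> Jf' r; case: (ltnP r L) => [ltrL|leLr]; last by rewrite co_ge.
by rewrite coM //; apply: (left_ideal_sum J0 JB) => i _; apply: JM.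
Qed.

Variables (P0 Sz : nat) (k : int).
Hypothesis GJ : forall r, (P0 <= r)%N -> J (co Gs r).

Let pairing_lift l : pairing (lift Ft) (lift Gs) Sz l = tC L (Z Sz l).
Proof.
rewrite rmorph_sum; apply: eq_bigr => s _; rewrite rmorphM /=.
by congr (_ * _); rewrite /at_; case: (0 <= _); rewrite ?co_lift ?rmorph0.
Qed.

(** T(z) or T^+(z) at site 0; the inner variable stands for 1/z in the first case and for z in the
    second. *)
Definition inner_series (Tn : nat -> 'M[A]_N) : W1 := mk L (fun r => uop e inj0 None (Tn r)).

Let io_eps r : io (eps ^+ r) = tC K (tX W0 L ^+ r).
Proof.
have io_eps1 : io eps = tC K (tX W0 L) by rewrite /io /inner_var /= tmap_tC /= tmap_tX.
by rewrite rmorphXn io_eps1 rmorphXn.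
Qed.

Let uop_cW Tn : uop e' inj None Tn = cW (uop e inj0 None Tn).
Proof.
rewrite /uop rmorph_sum; apply: eq_bigr => i _; rewrite rmorph_sum.
by apply: eq_bigr => j _; rewrite rmorphM.
Qed.

Let ev_inner Tn : ev io M (fun r => uop e' inj None (Tn r)) eps = tC K (inner_series Tn).
Proof.
rewrite [inner_series Tn]tser_sum rmorph_sum /= /ev.
rewrite [RHS](big_ord_widen M (fun i => tC K (tC L (co (inner_series Tn) i) * tX W0 L ^+ i)) LM).
rewrite [RHS]big_mkcond; apply: eq_bigr => i _ /=.
rewrite uop_cW io_eps -[cW _]/(tC K (tC L _)) -rmorphM; case: ltnP => [lti|lei]; first by rewrite co_mk lti.
by rewrite tX_nilp // mulr0 rmorph0.
Qed.

Let inner_absorb Tn : tC K (inner_series Tn) * E' = E' * tC K (inner_series Tn).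
Proof.
rewrite E'E -[cW _]/(tC K (tC L _)) -!rmorphM; congr (tC K _); apply: tserP => r ltrL; rewrite coMC coCM co_mk ltrL.
have uopE s : p s * uop e inj0 None (Tn r) = uop e inj0 None (Tn r) * p s.
  rewrite /uop mulr_sumr mulr_suml; apply: eq_bigr => i _.
  rewrite mulr_sumr mulr_suml; apply: eq_bigr => j _.
  by rewrite mulrA p_inj0 -mulrA p_inner mulrA.
rewrite /gev mulr_sumr mulr_suml; apply: eq_bigr => s _.
by rewrite -mulrA uopE mulrA [_ * i0 _](esym (i0C _ _)) mulrA.
Qed.

Let E'_inner i j : E' * e' None i j = e' None i j * E'.
Proof.
rewrite E'E -!rmorphM; congr (cW _); rewrite /gev mulr_suml mulr_sumr; apply: eq_bigr => s _.
by rewrite -mulrA p_inner !mulrA; congr (_ * _); apply: i0C.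
Qed.

(** The congruence for T0 Z is multiplied by E from the left, which J allows, and then traced;
    [trace_collapse] removes the R-matrices and leaves the trace of E Z T0. *)
Let conclude (U0 : W1) (Xs Ys : Q) (zz : nat -> W0) D : (D + D < K)%N ->
    pdeg D Xs -> pdeg D Ys ->
    (forall l t r, Tr (co (co (E' * Xs * cW (zz l) * Ys * tC K U0) t) r) =
                   Tr (co (co (E' * cW (zz l) * tC K U0) t) r)) ->
    J1 (U0 * tC L (zz 0%N) - \sum_(i < D.+1) \sum_(j < D.+1)
      co Xs i * tC L (zz (i + j)%N) * co Ys j * U0) ->
  forall r, exists2 z, J z & Tr z = Tr (E0 * co U0 r * zz 0%N) - Tr (E0 * zz 0%N * co U0 r).
Proof.
move=> ltK dX dY trE JU r; set D0 := U0 * _ - _ in JU.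
exists (co (tC L E0 * D0) r); first exact: J1_M.
pose Trr : {additive W1 -> V} := (Tr \o cof (B := W0) (L := L) r).
have trE' l t : Trr (co (tC K (tC L E0) * Xs * tC K (tC L (zz l)) * Ys * tC K U0) t) =
    Trr (co (tC K (tC L E0) * tC K (tC L (zz l)) * tC K U0) t).
  by have := trE l t r; rewrite E'E.
have := trace_collapse ltK dX dY trE'.
rewrite /D0 coCM coB mulrBr raddfB coMC mulrA => e2; congr (_ - _).
transitivity (Trr (tC L E0 * (\sum_(i < D.+1) \sum_(j < D.+1) co Xs i * tC L (zz (i + j)%N) * co Ys j * U0))).
  by rewrite /Trr /= /cof coCM.
rewrite mulr_sumr raddf_sum; under eq_bigr do rewrite mulr_sumr raddf_sum.
by rewrite e2 /Trr /= /cof -mulrA !coCM mulrA.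
Qed.

Let trace_site (ga gb kk kk' : 'I_m -> S) (zz : W0) Tn : (forall a, ga a * gb a = 1) ->
    (forall a, kk a - kk' a - N%:R * (kk a * kk' a) = 0) ->
    (forall i j, zz * e None i j = e None i j * zz) -> absorbs E0 zz ->
    let Xs := \prod_(a <- sites) (io (ga a) * (1 + io (kk a) * P a)) in
    let Ys := \prod_(a <- rev sites) (io (gb a) * (1 - io (kk' a) * P a)) in
    absorbs E' Xs -> absorbs E' Ys ->
  forall t r, Tr (co (co (E' * Xs * cW zz * Ys * tC K (inner_series Tn)) t) r) =
              Tr (co (co (E' * cW zz * tC K (inner_series Tn)) t) r).
Proof.
move=> gab kkE zC zA Xs Ys aX aY t r.
pose Trr : {additive Q -> V} := (Tr \o (cof (B := W0) (L := L) r \o cof (B := W1) (L := K) t)).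
have Tr_cyc' a i j z : Trr (e' (Some a) i j * z) = Trr (z * e' (Some a) i j).
  by rewrite /Trr /= /cof coCM coMC coCM coMC Tr_cyc.
have Tr_E' z : Trr (E' * z) = Trr (z * E').
  by rewrite E'E /Trr /= /cof coCM coMC coCM coMC Tr_E.
have wC a i j : tC K (inner_series Tn) * e' (Some a) i j = e' (Some a) i j * tC K (inner_series Tn).
  by rewrite -ev_inner; apply/esym/(Tx_comm M ioC eC' injC).
have zC' i j : cW zz * e' None i j = e' None i j * cW zz by rewrite -!rmorphM zC.
have zA' : absorbs E' (cW zz) by rewrite /absorbs E'E -!rmorphM {1}zA.
exact: (@trace_absorb N m F Q S0 S io aF kS ioC e' eM' eC' p' p1' pM' e0 c chi e0J e0V chi1 V Trr
  Tr_cyc' Tr_E' ga gb kk kk' (cW zz) _ gab kkE wC (inner_absorb Tn) zC' E'_inner aX zA' aY).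
Qed.

Let P_comm b z : (forall x i j, x \in [:: None; Some b] -> z * e' x i j = e' x i j * z) ->
  P b * z = z * P b.
Proof.
move=> zC; rewrite /uperm mulr_suml mulr_sumr; apply: eq_bigr => i _.
rewrite mulr_suml mulr_sumr; apply: eq_bigr => j _.
by rewrite -mulrA -zC ?inE ?eqxx ?orbT // mulrA -zC ?inE ?eqxx // mulrA.
Qed.

Let factor_comm ga kk b z : P b * z = z * P b ->
  io ga * (1 + io kk * P b) * z = z * (io ga * (1 + io kk * P b)).
Proof.
move=> Pz; rewrite [RHS]mulrA -ioC -!mulrA; congr (_ * _).
by rewrite mulrDl mulrDr mul1r mulr1 -mulrA Pz mulrA ioC mulrA.
Qed.

Let Rq_comm kk b z : P b * z = z * P b -> Rq kk b * z = z * Rq kk b.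
Proof. by move=> Pz; have := factor_comm (gs G n kk) (- kk) Pz; rewrite rmorphN mulNr. Qed.

Let Rv_comm kk b z : P b * z = z * P b -> Rv kk b * z = z * Rv kk b.
Proof. exact: factor_comm. Qed.

Let P_tt a b : a != b -> P b * lift (tt a) = lift (tt a) * P b.
Proof.
by move=> ab; apply: P_comm => x i j; rewrite !inE => /orP[] /eqP->; apply: lift_tt_comm; rewrite // eq_sym.
Qed.

Let P_ss a b : a != b -> P b * lift (ss a) = lift (ss a) * P b.
Proof.
by move=> ab; apply: P_comm => x i j; rewrite !inE => /orP[] /eqP->; apply: lift_ss_comm; rewrite // eq_sym.
Qed.


(** Bounds the degrees of [Rq] and [Rv] together: the summands are for the parameter itself, for g
    at the parameter and for the inverse of g at the shifted parameter. *)
Let degR := (degk n L + n * degk n L + n * (n * (n.+1 * degk n L)))%N.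
Let D := (size sites * degR)%N.
Hypothesis DK : (Sz + 4 * D.+1 + `|k| + degR + degR < K)%N.
Hypothesis SP : P0%:Z <= Sz%:Z - (D.+1 + D.+1)%:Z - k.

Let pdegG j : pdeg 0 (G j : S).
Proof. exact: pdegC. Qed.

Let P_const a : P a = tC K (tC L (uperm e None (Some a))).
Proof. by rewrite -cW_uperm. Qed.

Let pdeg_Rq (kk : S) a : pdeg (degk n L) kk -> pdeg degR (Rq kk a).
Proof.
move=> dk; apply: (@pdeg_leq _ _ (n * degk n L + degk n L)); first by rewrite /degR; lia.
have := pdeg_linear_factor (tmap (L := L) i0) (tC L (uperm e None (Some a))) (pdeg_gs (n := n) pdegG dk) (pdegN dk).
by rewrite rmorphN mulNr /Rb P_const.
Qed.

Let pdeg_Rv (kk : S) a : pdeg (degk n L) kk -> pdeg degR (Rv kk a).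
Proof.
move=> dk; apply: (@pdeg_leq _ _ (n * (n * (n.+1 * degk n L)) + degk n L)); first by rewrite /degR; lia.
have := pdeg_linear_factor (tmap (L := L) i0) (tC L (uperm e None (Some a))) (pdeg_gi (n := n) pdegG (pdeg_kshift N (n := n) dk)) dk.
by rewrite /Rinv P_const.
Qed.

Let rev_Rq (kk : S) a : pdeg (degk n L) kk ->
  exists s, rev_at degR (Rq kk a) =
    io s * (io (w ^+ degk n L) - io (rev_at (degk n L) kk) * P a).
Proof.
move=> dk; eexists; rewrite /Rb P_const.
by apply: (rev_linear_factor _ _ (pdeg_gs (n := n) pdegG dk) dk); rewrite /degR; lia.
Qed.

Let degk_lt : ((degk n L).+1 < K)%N.
Proof. by move: DK; rewrite /degR; lia. Qed.

Let halfB : half - N%:R = - half.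
Proof. by rewrite {2}[N%:R](splitr (N%:R : F)) opprD addrA subrr add0r. Qed.

Let kS_y : kS y = - shf half.
Proof. by rewrite /y rmorphN rmorphM. Qed.

Let size_rev_sites : size (rev sites) = size sites. Proof. exact: size_rev. Qed.

Let DD : (D < K)%N. Proof. by move: DK; lia. Qed.

Let pdeg_prod_sites (f : 'I_m -> Q) : (forall a, pdeg degR (f a)) -> pdeg D (\prod_(a <- sites) f a).
Proof. exact: pdeg_prod. Qed.

Let pdeg_prod_rev (f : 'I_m -> Q) : (forall a, pdeg degR (f a)) -> pdeg D (\prod_(a <- rev sites) f a).
Proof. by move=> df; rewrite /D -size_rev_sites; apply: pdeg_prod. Qed.

Let rev_prod_sites (f : 'I_m -> Q) : (forall a, pdeg degR (f a)) ->
  rev_at D (\prod_(a <- sites) f a) = \prod_(a <- sites) rev_at degR (f a).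
Proof. by move=> df; apply: rev_at_prod. Qed.

Let rev_prod_rev (f : 'I_m -> Q) : (forall a, pdeg degR (f a)) ->
  rev_at D (\prod_(a <- rev sites) f a) = \prod_(a <- rev sites) rev_at degR (f a).
Proof. by move=> df; rewrite /D -size_rev_sites rev_at_prod // size_rev_sites. Qed.

Let uniq_sites : uniq sites. Proof. exact: index_enum_uniq. Qed.
Let uniq_rev_sites : uniq (rev sites). Proof. by rewrite rev_uniq. Qed.

(** At C = -N the mixed relation has the arguments z - u - hN/2 on the left and z - u + hN/2 on the
    right, whence the two values of x. *)
Let through_minus a : tC K (inner_series T) * lift (tt a) =
  Rv (kapm half (c a)) a * lift (tt a) * tC K (inner_series T) * Rq (kapm (- half) (c a)) a.
Proof.
have eE x : xim L aF kS hh eps w x * (1 - eps * (w + shf x)) = eps.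
  exact: ximE (inner_var_nilp _ _ _) _.
rewrite ttE -ev_inner.
apply: (minus_through ioC inj_kA eM' eC' e1' injC hn g0 gP relX nM a eps_nilp (Y_nilp a)
   (xi := xim L aF kS hh eps w (half + c a)) (xi' := xim L aF kS hh eps w (- half + c a))).
- by rewrite kS_y fraction_plus -shfD eE.
- by rewrite kS_y fraction_minus -shfN -shfD eE.
- exact: kapm_xim hn (inner_var_nilp _ _ _) _ _.
exact: kapm_xim hn (inner_var_nilp _ _ _) _ _.
Qed.

(** The shift by -hN/2 in the inverse of T is such that its relation with T(z) involves the same
    R-matrix that T^+ has left behind. *)
Let back_minus a : tC K (inner_series T) * rev_at degR (Rq (kapm (- half) (c a)) a) * lift (ss a) =
  lift (ss a) * rev_at degR (Rq (kapm (- half) (c a)) a) * tC K (inner_series T).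
Proof.
have dk : pdeg (degk n L) (kapm (- half) (c a)) by exact: pdeg_kapm.
have [s ->] := rev_Rq a dk; rewrite -ev_inner.
exact: (minus_back ioC inj_kA eM' eC' e1' injC T0 relN s eps_nilp (X_nilp a)
  (rev_kapm hn dk degk_lt) (ssE1 a) (ssE2 a)).
Qed.

Let dkm x a : pdeg (degk n L) (kapm x (c a)). Proof. exact: pdeg_kapm. Qed.
Let dkp x a : pdeg (degk n L) (- kapp x (c a)). Proof. by apply: pdegN; apply: pdeg_kapp. Qed.

Let P_Rq_rev kk a b : a != b -> pdeg (degk n L) kk ->
  rev_at degR (Rq kk b) * lift (ss a) = lift (ss a) * rev_at degR (Rq kk b).
Proof.
move=> ab dk; have [s ->] := rev_Rq b dk; have Pz := P_ss ab.
rewrite [RHS]mulrA -ioC -!mulrA; congr (_ * _).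
exact: linear_comm.
Qed.

Let kapm_sub a : kapm half (c a) - kapm (- half) (c a) - N%:R * (kapm half (c a) * kapm (- half) (c a)) = 0.
Proof.
have kn := kapm_nilp L aF kS eps w hn half (c a).
have := kshiftE N kn; rewrite (kapm_shift N aF kS w hn (inner_var_nilp _ _ _)) halfB.
exact: fraction_diff.
Qed.

Let kapm_scal a : gi G n (kshift N n (kapm half (c a))) * gs G n (kapm (- half) (c a)) = 1.
Proof.
have kn := kapm_nilp L aF kS eps w hn (- half) (c a).
rewrite (kapm_shift N aF kS w hn (inner_var_nilp _ _ _)) halfB mulrC.
by apply: gsM_gi => //=; rewrite g0 rmorph1.
Qed.

(** The R-matrices are polynomials in u, so [commutation_nat] applies. Those on the right are not
    changed by the inverses of T, hence [Ys] in both places. *)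
Lemma commute_minus r : exists2 z, J z &
  Tr z = Tr (E0 * co (inner_series T) r * Z Sz k) - Tr (E0 * Z Sz k * co (inner_series T) r).
Proof.
pose xs a := Rv (kapm half (c a)) a; pose ys a := Rq (kapm (- half) (c a)) a.
pose Xs := \prod_(a <- sites) xs a; pose Ys := \prod_(a <- rev sites) ys a.
have dx a : pdeg degR (xs a) by exact: pdeg_Rv.
have dy a : pdeg degR (ys a) by exact: pdeg_Rq.
have relF : tC K (inner_series T) * lift Ft = Xs * lift Ft * tC K (inner_series T) * Ys.
  have := @prod_through _ Q (tC K (inner_series T)) sites 1 xs (fun a => lift (tt a)) ys uniq_sites.
  rewrite expr1n mul1r -rmorph_prod; apply.
  - by move=> z; rewrite mul1r mulr1.
  - by move=> a; rewrite mul1r; apply: through_minus.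
  - by move=> a b ab; apply/Rv_comm/P_tt.
  by move=> a b ab; apply/Rq_comm/P_tt.
have relG : tC K (inner_series T) * rev_at D Ys * lift Gs = lift Gs * rev_at D Ys * tC K (inner_series T).
  rewrite /Ys rev_prod_rev // /Gs rmorph_prod.
  have ysC a b : a != b -> rev_at degR (ys b) * lift (ss a) = lift (ss a) * rev_at degR (ys b).
    by move=> ab; apply: P_Rq_rev.
  exact: (@prod_back _ Q (tC K (inner_series T)) (rev sites) (fun a => lift (ss a))
    (fun a => rev_at degR (ys a)) (fun a => rev_at degR (ys a)) uniq_rev_sites back_minus ysC ysC).
have J1Gs s : (P0 <= s)%N -> J1 (co (lift Gs) s).
  move=> les r'; rewrite co_lift; case: (ltnP r' L) => [lt|le]; last by rewrite co_ge.
  by rewrite co_tC //; case: eqP => _ //; apply: GJ.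
have SK : (Sz + 4 * D.+1 + `|k| < K)%N by move: DK; lia.
have JU := @commutation_nat W1 K J1 J1_0 J1_B J1_M (inner_series T) Xs Ys Ys (lift Ft) (lift Gs) D Sz P0 k
  (pdeg_prod_sites dx) (pdeg_prod_rev dy) J1Gs SP SK relF relG.
have trE l t r' := trace_site (zz := Z Sz (k - l%:Z)) T kapm_scal kapm_sub (Z_comm Sz _) (Z_absorbs Sz _)
  (absorbs_kfam_scal aF kS ioC eM' eC' e1' p1' pM' pP' e0J e0V chi1 _ (kminus_nilp L aF kS eps w hn half))
  (absorbs_kfam_inv aF kS ioC eM' eC' e1' p1' pM' pP' e0J e0V chi1 _ (kminus_nilp L aF kS eps w hn (- half))) t r'.
have ltD2 : (D + D < K)%N by move: DK; lia.
have := conclude (zz := fun l => Z Sz (k - l%:Z)) ltD2 (pdeg_prod_sites dx) (pdeg_prod_rev dy) trE _ r.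
rewrite subr0; apply; rewrite -pairing_lift.
rewrite (eq_bigr (fun i : 'I_D.+1 => \sum_(j < D.+1) co Xs i * pairing (lift Ft) (lift Gs) Sz (k - (i + j)%:Z) *
  co Ys j * inner_series T)); first exact: JU.
by move=> i _; apply: eq_bigr => j _; rewrite pairing_lift.
Qed.

(** For T^+(z) the mixed relation is met at the inverses of T: it replaces the parameter with x = 0
    by the one with x = N. *)
Let back_plus a : tC K (inner_series Tp) * Rv (- kapp 0 (c a)) a * lift (ss a) =
  lift (ss a) * Rv (- kapp N%:R (c a)) a * tC K (inner_series Tp).
Proof.
have xE x : xip n K aF kS hh eps w (- half) (c a) x * (1 - Xm a * (eps + shf x)) = Xm a.
  exact: xipE w_nilp _ _ _.
have xk x : h * xip n K aF kS hh eps w (- half) (c a) x = - kapp (x - - half) (c a).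
  exact: kapp_xip hn (inner_var_nilp _ _ _) w_nilp _ _ _.
have halfD : half - - half = N%:R by rewrite opprK -splitr.
have half0 : - half - - half = 0 :> F by rewrite opprK addNr.
have f1 : xip n K aF kS hh eps w (- half) (c a) half * (1 - Xm a * eps + kS y * Xm a) = Xm a.
  by rewrite kS_y fraction_plus0 xE.
have f2 : xip n K aF kS hh eps w (- half) (c a) (- half) * (1 - Xm a * eps - kS y * Xm a) = Xm a.
  by rewrite kS_y fraction_minus0 -shfN xE.
have k1 := xk half; rewrite halfD in k1.
have k2 := xk (- half); rewrite half0 in k2.
rewrite -ev_inner.
exact: (plus_back ioC inj_kA eM' eC' e1' injC hn g0 gP relX nM eps_nilp (X_nilp a) f1 f2 k1 k2 (ssE1 a) (ssE2 a)).
Qed.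

(** The relation for T^+ leaves the scalar factor of the R-matrix free; it is normalised by g in
    order to fit the mixed relation in [back_plus]. *)
Let through_plus a : tX W1 K ^+ (degR + degR) * (tC K (inner_series Tp) * lift (tt a)) =
  rev_at degR (Rq (- kapp 0 (c a)) a) * lift (tt a) * tC K (inner_series Tp) *
    rev_at degR (Rv (- kapp 0 (c a)) a).
Proof.
have kn : (- kapp 0 (c a)) ^+ n = 0 by rewrite exprNn (kapp_nilp L aF kS eps w hn) mulr0.
have [RR _] := Rb_Rinv kS ioC eM' eC' e1' g0 gP a kn.
(* Reversal is multiplicative, so the reversed R-matrix and its reversed inverse multiply to a power
   of the variable instead of 1. *)
have RRr : rev_at degR (Rq (- kapp 0 (c a)) a) * rev_at degR (Rv (- kapp 0 (c a)) a) = tX W1 K ^+ (degR + degR).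
  rewrite -rev_atM ?RR ?rev_at1 //; first by move: DK; lia.
  - exact: pdeg_Rq.
  - exact: pdeg_Rv.
  by move: DK; lia.
have H : rev_at degR (Rq (- kapp 0 (c a)) a) * (lift (tt a) * tC K (inner_series Tp)) =
    tC K (inner_series Tp) * lift (tt a) * rev_at degR (Rq (- kapp 0 (c a)) a).
  have [s ->] := rev_Rq a (dkp 0 a).
  have dk : pdeg (degk n L) (kapp 0 (c a)) by exact: pdeg_kapp.
  have kE := rev_kapp hn dk degk_lt; rewrite subr0 in kE.
  rewrite ttE -ev_inner; apply: (scal_rtt ioC).
  exact: (plus_through ioC inj_kA eM' eC' e1' injC relP a eps_nilp (Y_nilp a) kE).
by apply: rtt_scaled H RRr _ => z; apply: tXn_comm.
Qed.

Let kapp_kshift a : kshift N n (- kapp N%:R (c a)) = - kapp 0 (c a).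
Proof. by rewrite (kapp_shift N aF kS hn (inner_var_nilp _ _ _) w_nilp) subrr. Qed.

Let kappN_nilp x a : (- kapp x (c a)) ^+ n = 0.
Proof. by rewrite exprNn (kapp_nilp L aF kS eps w hn) mulr0. Qed.

Let kapp_sub a : kapp 0 (c a) - kapp N%:R (c a) - N%:R * (kapp 0 (c a) * kapp N%:R (c a)) = 0.
Proof.
have := kshiftE N (kappN_nilp N%:R a); rewrite kapp_kshift; exact: fraction_diff_opp.
Qed.

Let kapp_scal a : gs G n (- kapp 0 (c a)) * gi G n (kshift N n (- kapp N%:R (c a))) = 1.
Proof. by rewrite kapp_kshift; apply: gsM_gi; rewrite ?kappN_nilp //= g0 rmorph1. Qed.

Let tt_rev kk a b : a != b -> pdeg (degk n L) kk ->
  rev_at degR (Rq kk b) * lift (tt a) = lift (tt a) * rev_at degR (Rq kk b).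
Proof.
move=> ab dk; have [s ->] := rev_Rq b dk; have Pz := P_tt ab.
by rewrite [RHS]mulrA -ioC -!mulrA; congr (_ * _); apply: linear_comm.
Qed.


Let rev_Rv (kk : S) a : pdeg (degk n L) kk ->
  exists s, rev_at degR (Rv kk a) =
    io s * (io (w ^+ degk n L) - io (rev_at (degk n L) (- kk)) * P a).
Proof.
move=> dk; have dk' := pdegN dk; eexists.
have -> : Rv kk a = io (gi G n (kshift N n kk)) * (1 - io (- kk) * P a) by rewrite rmorphN mulNr opprK.
rewrite P_const.
by apply: (rev_linear_factor _ _ (pdeg_gi (n := n) pdegG (pdeg_kshift N (n := n) dk)) dk'); rewrite /degR; lia.
Qed.

Let tt_rev_Rv kk a b : a != b -> pdeg (degk n L) kk ->
  rev_at degR (Rv kk b) * lift (tt a) = lift (tt a) * rev_at degR (Rv kk b).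
Proof.
move=> ab dk; have [s ->] := rev_Rv b dk; have Pz := P_tt ab.
by rewrite [RHS]mulrA -ioC -!mulrA; congr (_ * _); apply: linear_comm.
Qed.

(** The R-matrices are polynomials in 1/u, so [commutation_rev] applies. The inverses of T turn [Ys]
    into [Ys'], and it is [Ys'] that cancels against [Xs]. *)
Lemma commute_plus r : exists2 z, J z &
  Tr z = Tr (E0 * co (inner_series Tp) r * Z Sz k) - Tr (E0 * Z Sz k * co (inner_series Tp) r).
Proof.
pose xs a := Rq (- kapp 0 (c a)) a; pose ys a := Rv (- kapp 0 (c a)) a.
pose ys' a := Rv (- kapp N%:R (c a)) a.
pose Xs := \prod_(a <- sites) xs a; pose Ys := \prod_(a <- rev sites) ys a.
pose Ys' := \prod_(a <- rev sites) ys' a.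
have dx a : pdeg degR (xs a) by exact: pdeg_Rq.
have dy a : pdeg degR (ys a) by exact: pdeg_Rv.
have dy' a : pdeg degR (ys' a) by exact: pdeg_Rv.
have relF : tX W1 K ^+ (D + D) * (tC K (inner_series Tp) * lift Ft) =
    rev_at D Xs * lift Ft * tC K (inner_series Tp) * rev_at D Ys.
  rewrite /Xs rev_prod_sites // /Ys rev_prod_rev // /Ft rmorph_prod.
  have -> : (D + D = (degR + degR) * size sites)%N by rewrite /D [RHS]mulnC mulnDr.
  rewrite exprM.
  apply: (@prod_through _ Q (tC K (inner_series Tp)) sites (tX W1 K ^+ (degR + degR))
    (fun a => rev_at degR (xs a)) (fun a => lift (tt a)) (fun a => rev_at degR (ys a)) uniq_sites).
  - by move=> z; apply: tXn_comm.
  - exact: through_plus.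
  - by move=> a b ab; apply: tt_rev.
  by move=> a b ab; apply: tt_rev_Rv.
have relG : tC K (inner_series Tp) * Ys * lift Gs = lift Gs * Ys' * tC K (inner_series Tp).
  rewrite /Gs rmorph_prod.
  have ysC kk a b : a != b -> Rv kk b * lift (ss a) = lift (ss a) * Rv kk b.
    by move=> ab; apply/Rv_comm/P_ss.
  exact: (@prod_back _ Q (tC K (inner_series Tp)) (rev sites) (fun a => lift (ss a))
    ys ys' uniq_rev_sites back_plus (fun a b => ysC _ a b) (fun a b => ysC _ a b)).
have J1Gs s : (P0 <= s)%N -> J1 (co (lift Gs) s).
  move=> les r'; rewrite co_lift; case: (ltnP r' L) => [lt|le]; last by rewrite co_ge.
  by rewrite co_tC //; case: eqP => _ //; apply: GJ.
have SK : (Sz + 4 * D.+1 + `|k| < K)%N by move: DK; lia.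
have JU := @commutation_rev W1 K J1 J1_0 J1_B J1_M (inner_series Tp) Xs Ys Ys' (lift Ft) (lift Gs) D Sz P0 k
  (pdeg_prod_rev dy) (pdeg_prod_rev dy') J1Gs SP SK relF relG.
have aX := absorbs_kfam_scal aF kS ioC eM' eC' e1' p1' pM' pP' e0J e0V chi1
  (fun a => gs G n (- kapp 0 (c a))) (kplus_nilp L aF kS eps w hn 0).
have aY := absorbs_kfam_inv aF kS ioC eM' eC' e1' p1' pM' pP' e0J e0V chi1
  (fun a => gi G n (kshift N n (- kapp N%:R (c a)))) (kplus_nilp L aF kS eps w hn N%:R).
have XsE : \prod_(a <- sites) (io (gs G n (- kapp 0 (c a))) * (1 + io (kapp 0 (c a)) * P a)) = Xs.
  by apply: eq_bigr => a _; rewrite /xs /Rb rmorphN mulNr opprK.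
have YsE : \prod_(a <- rev sites) (io (gi G n (kshift N n (- kapp N%:R (c a)))) * (1 - io (kapp N%:R (c a)) * P a)) = Ys'.
  by apply: eq_bigr => a _; rewrite /ys' /Rinv rmorphN mulNr.
have trE l t r' := trace_site (zz := Z Sz (k + l%:Z)) Tp kapp_scal kapp_sub (Z_comm Sz _) (Z_absorbs Sz _) aX aY t r'.
rewrite XsE YsE in trE.
have ltD2 : (D + D < K)%N by move: DK; lia.
have := conclude (zz := fun l => Z Sz (k + l%:Z)) ltD2 (pdeg_prod_sites dx) (pdeg_prod_rev dy') trE _ r.
rewrite addr0; apply; rewrite -pairing_lift.
rewrite (eq_bigr (fun i : 'I_D.+1 => \sum_(j < D.+1) co Xs i * pairing (lift Ft) (lift Gs) Sz (k + (i + j)%:Z) *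
  co Ys' j * inner_series Tp)); first exact: JU.
by move=> i _; apply: eq_bigr => j _; rewrite pairing_lift.
Qed.

End Cases.

(** * Operators on tensor powers *)

Section TensorLemmas.
Variables (N m : nat) (B : pzRingType).
Local Notation td := (tdim N m).
Implicit Types (x y z : 'I_td) (a b : 'I_m) (X Y : 'M[B]_N).

Definition tset x a (i : 'I_N) : 'I_td := enum_rank [ffun b => if b == a then i else tidx x b].

Lemma tidx_set x a i b : tidx (tset x a i) b = if b == a then i else tidx x b.
Proof. by rewrite /tidx /tset enum_rankK ffunE. Qed.

Lemma tidx_inj x y : (forall b, tidx x b = tidx y b) -> x = y.
Proof. by move=> xy; apply: enum_val_inj; apply/ffunP. Qed.

Lemma off_site x y a : [forall b, (b != a) ==> (tidx x b == tidx y b)] -> y = tset x a (tidx y a).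
Proof.
move=> /forallP xy; apply: tidx_inj => b; rewrite tidx_set.
by case: eqVneq => [->//|ba]; have := xy b; rewrite ba /= => /eqP->.
Qed.

Lemma off_site_set x a i : [forall b, (b != a) ==> (tidx x b == tidx (tset x a i) b)].
Proof. by apply/forallP => b; apply/implyP => /negPf ba; rewrite tidx_set ba. Qed.

Lemma tens_at_mulE p a X (Z : 'M[B]_(td, p)) x (z : 'I_p) :
  (tens_at a X *m Z) x z = \sum_i X (tidx x a) i * Z (tset x a i) z.
Proof.
rewrite mxE (bigID (fun y => [forall b, (b != a) ==> (tidx x b == tidx y b)])) /=.
rewrite [X in _ + X]big1 ?addr0 => [|y /negPf xy]; last by rewrite mxE xy mul0r.
rewrite (reindex_onto (tset x a) (fun y => tidx y a)) /=; last by move=> y /off_site <-.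
apply: eq_big => [i|i _]; first by rewrite off_site_set tidx_set eqxx eqxx.
by rewrite mxE off_site_set tidx_set eqxx.
Qed.

Lemma tens_at_setE a b X x i z : a != b ->
  tens_at b X (tset x a i) z =
  if [forall d, (d != a) && (d != b) ==> (tidx x d == tidx z d)] && (i == tidx z a)
  then X (tidx x b) (tidx z b) else 0.
Proof.
move=> ab; rewrite mxE tidx_set eq_sym (negPf ab); congr (if _ then _ else _).
apply/forallP/andP => [xz|[/forallP xz /eqP ->] d].
  split; last by have := xz a; rewrite ab /= tidx_set eqxx.
  apply/forallP => d; apply/implyP => /andP[/negPf da db].
  by have := xz d; rewrite db /= tidx_set da.
apply/implyP => db; rewrite tidx_set; case: (eqVneq d a) => [->//|da].
by have := xz d; rewrite da db.
Qed.

Lemma tens_at_pairE a b X Y x z : a != b ->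
  (tens_at a X *m tens_at b Y) x z =
  if [forall d, (d != a) && (d != b) ==> (tidx x d == tidx z d)]
  then X (tidx x a) (tidx z a) * Y (tidx x b) (tidx z b) else 0.
Proof.
move=> ab; rewrite tens_at_mulE; under eq_bigr do rewrite tens_at_setE //.
case: ifP => _; last by rewrite big1 // => i _; rewrite mulr0.
rewrite (bigD1 (tidx z a)) //= eqxx big1 ?addr0 // => i /negPf->.
by rewrite mulr0.
Qed.

Lemma tens_at_comm a b X Y : a != b -> (forall i j k l, X i j * Y k l = Y k l * X i j) ->
  tens_at a X *m tens_at b Y = tens_at b Y *m tens_at a X.
Proof.
move=> ab XY; apply/matrixP => x z; rewrite !tens_at_pairE // 1?eq_sym // XY.
by congr (if _ then _ else _); apply: eq_forallb => d; rewrite andbC.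
Qed.

Lemma tens_at_is_zmod_morphism a : zmod_morphism (@tens_at N m B a).
Proof.
move=> X Y; apply/matrixP => x y; rewrite !mxE.
by case: ifP => _; rewrite ?mxE // subr0.
Qed.

Lemma tens_at_is_monoid_morphism a : monoid_morphism (@tens_at N m B a).
Proof.
split=> [|X Y].
  apply/matrixP => x y; rewrite !mxE; case: ifP => [/off_site xy|xy].
    congr (_%:R); congr nat_of_bool; apply/eqP/eqP => [e|->//].
    rewrite xy; apply: tidx_inj => b; rewrite tidx_set; case: eqP => [->|//].
    exact: e.
  case: eqP => // xy'; move/negP: xy; case; apply/forallP => b; rewrite xy' eqxx.
  by rewrite implybT.
apply/matrixP => x z; rewrite -[RHS]/((tens_at a X *m tens_at a Y) x z) tens_at_mulE mxE.
have offE i : [forall b, (b != a) ==> (tidx (tset x a i) b == tidx z b)] =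
    [forall b, (b != a) ==> (tidx x b == tidx z b)].
  by apply: eq_forallb => b; rewrite tidx_set; case: (b == a).
under eq_bigr do rewrite mxE offE tidx_set eqxx.
case: ifP => _; first by rewrite mxE.
by rewrite big1 // => i _; rewrite mulr0.
Qed.

HB.instance Definition _ a := GRing.isZmodMorphism.Build _ _ (@tens_at N m B a)
  (tens_at_is_zmod_morphism a).
HB.instance Definition _ a := GRing.isMonoidMorphism.Build _ _ (@tens_at N m B a)
  (tens_at_is_monoid_morphism a).

Lemma tens_perm_mulE p s (Z : 'M[B]_(td, p)) x (z : 'I_p) :
  (tens_perm N B s *m Z) x z = Z (enum_rank [ffun a => tidx x (s a)]) z.
Proof.
rewrite mxE (bigD1 (enum_rank [ffun a => tidx x (s a)])) //= [X in _ + X]big1 ?addr0 => [|y ne_y].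
  rewrite mxE (_ : [forall a, _]) ?mul1r //; apply/forallP => a.
  by rewrite /tidx enum_rankK ffunE.
rewrite mxE (_ : [forall a, _] = false) ?mul0r //; apply: contraNF ne_y => /forallP xy.
apply/eqP/tidx_inj => a; have /eqP <- := xy a.
by rewrite /tidx enum_rankK ffunE.
Qed.

Lemma tens_perm1 : tens_perm N B (1%g : 'S_m) = 1.
Proof.
apply/matrixP => x y; rewrite !mxE; congr (_%:R); congr nat_of_bool.
apply/forallP/eqP => [xy|-> a]; last by rewrite perm1.
by apply: tidx_inj => a; have /eqP := xy a; rewrite perm1.
Qed.

(** Permutations are composed from left to right, hence the reversed order. *)
Lemma tens_permM (s t : 'S_m) : tens_perm N B (s * t)%g = tens_perm N B t *m tens_perm N B s.
Proof.
apply/matrixP => x z; rewrite tens_perm_mulE !mxE; congr (_%:R); congr nat_of_bool.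
by apply: eq_forallb => a; rewrite /tidx enum_rankK ffunE permM.
Qed.

Lemma tens_perm_tperm a b : a != b -> tens_perm N B (tperm a b) =
  \sum_i \sum_j tens_at a (delta_mx i j) *m tens_at b (delta_mx j i).
Proof.
move=> ab; apply/matrixP => x z; rewrite mxE summxE.
have -> : [forall d, tidx x (tperm a b d) == tidx z d] =
   [forall d, (d != a) && (d != b) ==> (tidx x d == tidx z d)] &&
   ((tidx x a == tidx z b) && (tidx x b == tidx z a)).
  apply/forallP/and3P => [xz|[/forallP xz ea eb] d].
    split; last by have := xz a; rewrite tpermL.
      apply/forallP => d; apply/implyP => /andP[da db].
      by have := xz d; rewrite tpermD // eq_sym.
    by have := xz b; rewrite tpermR.
  by case: tpermP => [->|->|/eqP da /eqP db]; rewrite ?ea ?eb //; have := xz d; rewrite da db.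
under eq_bigr do rewrite summxE; under eq_bigr do under eq_bigr do rewrite tens_at_pairE //.
case: [forall d, _]; last by rewrite big1 // => i _; rewrite big1.
rewrite (bigD1 (tidx x a)) //= [X in _ + X]big1 ?addr0 => [|i /negPf ne]; last first.
  by rewrite big1 // => j _; rewrite !mxE eq_sym ne /= mul0r.
rewrite (bigD1 (tidx z a)) //= [X in _ + X]big1 ?addr0 => [|j /negPf ne].
  by rewrite !mxE !eqxx /= mul1r eq_sym; congr (_%:R); rewrite andbC eq_sym.
by rewrite !mxE [tidx z a == j]eq_sym ne andbF mul0r.
Qed.

End TensorLemmas.

Section CentralEntries.
Variables (B : pzRingType) (k : nat).
Implicit Types X Y : 'M[B]_k.

(** Against such matrices the rules of commutative coefficients hold, in particular cyclicity of the
    trace. *)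
Definition central_entries X := forall i j y, X i j * y = y * X i j.

Lemma central_entries_trace X Y : central_entries X -> \tr (X *m Y) = \tr (Y *m X).
Proof.
move=> cX; rewrite /mxtrace; under eq_bigr do rewrite mxE; under [RHS]eq_bigr do rewrite mxE.
by rewrite exchange_big; apply: eq_bigr => i _; apply: eq_bigr => j _; rewrite cX.
Qed.

Lemma central_entries_scalar X y : central_entries X -> X *m y%:M = y%:M *m X.
Proof.
move=> cX; apply/matrixP => i j; rewrite !mxE (bigD1 j) //= [RHS](bigD1 i) //= !mxE !eqxx !mulr1n.
rewrite !big1 ?addr0 ?cX // => l ne_l; rewrite !mxE; last by rewrite (negPf ne_l) mulr0n mulr0.
by rewrite eq_sym (negPf ne_l) mulr0n mul0r.
Qed.

End CentralEntries.

Lemma coMn (B : zmodType) L (f : tser B L) k n : co (f *+ k) n = co f n *+ k.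
Proof. by elim: k => [|k IHk]; rewrite ?mulr0n ?co0 // !mulrS coD IHk. Qed.

(** * Shifted series as evaluations at nilpotent elements *)

Section SeriesShift.
Variables (B : pzRingType) (S0 : comPzRingType) (kB : {rmorphism S0 -> B}) (K M : nat).
Hypotheses (kBC : forall x y, kB x * y = y * kB x) (KM : (K <= M)%N).
Let ioB : {rmorphism tser S0 K -> tser B K} := tmap (L := K) kB.
Implicit Types (f : nat -> B) (x : S0) (Z : tser S0 K).

Let ioBC (x : tser S0 K) (z : tser B K) : ioB x * z = z * ioB x.
Proof. exact: tmap_central. Qed.

Lemma co_ev f Z s : co (ev ioB M (fun r => tC K (f r)) Z) s = \sum_(r < M) f r * kB (co (Z ^+ r) s).
Proof. by rewrite /ev co_sum; apply: eq_bigr => r _; rewrite coCM co_tmap. Qed.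

Lemma ev_tC_smul f f' Z : Z ^+ M = 0 -> ev ioB M (fun r => tC K (smul f f' r)) Z =
  ev ioB M (fun r => tC K (f r)) Z * ev ioB M (fun r => tC K (f' r)) Z.
Proof.
move=> ZM; rewrite -(ev_smul ioBC _ _ ZM); apply: eq_ev => r _.
by rewrite /smul rmorph_sum; apply: eq_bigr => i _; rewrite rmorphM.
Qed.

Lemma ev_tC_sone Z : (0 < M)%N -> ev ioB M (fun r => tC K (sone B r)) Z = 1.
Proof.
case: M => // M' _; rewrite /ev big_ord_recl expr0 !rmorph1 mulr1 big1 ?addr0 // => r _.
by rewrite /sone /= rmorph0 mul0r.
Qed.

(** The binomial theorem: the coefficients of f(u + x) are those of the evaluation of f at u + x. *)
Lemma sshiftP_ev f x : mk K (sshiftP M (kB x) f) = ev ioB M (fun r => tC K (f r)) (tX S0 K + tC K x).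
Proof.
apply: tserP => s lts; rewrite co_mk lts co_ev; apply: eq_bigr => r _.
rewrite addrC exprDn co_sum.
have -> : \sum_(i < r.+1) co (tC K x ^+ (r - i) * tX S0 K ^+ i *+ 'C(r, i)) s = x ^+ (r - s) *+ 'C(r, s).
  have term i : co (tC K x ^+ (r - i) * tX S0 K ^+ i *+ 'C(r, i)) s =
      if s == i then x ^+ (r - i) *+ 'C(r, i) else 0.
    have -> : tC K x ^+ (r - i) = tC K (x ^+ (r - i)) by rewrite rmorphXn.
    rewrite coMn coCM coXn //.
    by case: eqP => _; rewrite ?mulr1 ?mulr0 ?mul0rn.
  under eq_bigr do rewrite term.
  case: (leqP s r) => [lesr|ltrs].
    rewrite (bigD1 (Ordinal (lesr : (s < r.+1)%N))) //= eqxx big1 ?addr0 // => i ne_i.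
    by rewrite ifF //; apply: contraNF ne_i => /eqP e; apply/eqP/val_inj.
  rewrite big1 ?bin_small ?mulr0n // => i _; rewrite ifF //; apply/negbTE.
  by rewrite gtn_eqF // (leq_ltn_trans _ ltrs) // -ltnS.
by rewrite rmorphMn mulrnAr -kBC rmorphXn.
Qed.

(** The variable stands for 1/u, and Z for 1/(u + x). *)
Lemma sshiftN_ev f x Z : Z * (1 + tC K x * tX S0 K) = tX S0 K ->
  mk K (sshiftN (kB x) f) = ev ioB M (fun r => tC K (f r)) Z.
Proof.
move=> ZE; apply: tserP => s lts; rewrite co_mk lts co_ev.
have XM : tX S0 K ^+ M = 0 by exact: tX_nilp.
have coZ r : co (Z ^+ r) s = negbin x r s.
  have negE i : negbin (tC K x) r i = tC K (negbin x r i).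
    by rewrite /negbin; case: ifP => _; rewrite ?rmorph0 // rmorphMn rmorphXn rmorphN.
  rewrite (negbin_sum r XM ZE) co_sum (bigD1 (Ordinal (leq_trans lts KM))) //= negE.
  rewrite coCM coXn // eqxx mulr1 big1 ?addr0 // => i ne_i.
  rewrite negE coCM coXn // (_ : (s == i) = false) ?mulr0 //; apply: contraNF ne_i => /eqP e.
  by apply/eqP/val_inj.
under eq_bigr do rewrite coZ.
rewrite /sshiftN (big_ord_widen M (fun r => ((- kB x) ^+ (s - r) * f r) *+ 'C(s.-1, s - r))); last by lia.
rewrite big_mkcond; apply: eq_bigr => r _; rewrite ltnS /negbin; case: leqP => _; last by rewrite rmorph0 mulr0.
by rewrite -kBC rmorphMn rmorphXn rmorphN mulrnAl.
Qed.

End SeriesShift.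

Lemma ev_rmorph (S S' : comPzRingType) (Q Q' : pzRingType) (io : {rmorphism S -> Q})
    (io' : {rmorphism S' -> Q'}) (phi : {rmorphism Q -> Q'}) (psi : {rmorphism S -> S'}) M f X :
    (forall x, phi (io x) = io' (psi x)) ->
  phi (ev io M f X) = ev io' M (fun r => phi (f r)) (psi X).
Proof.
by move=> phiE; rewrite rmorph_sum; apply: eq_bigr => r _; rewrite rmorphM phiE rmorphXn.
Qed.

Lemma mk_foldr_smul (B : pzRingType) K (I : Type) (r : seq I) (f : I -> nat -> B) :
  mk K (foldr (fun a => smul (f a)) (@sone B) r) = \prod_(a <- r) mk K (f a).
Proof. by elim: r => [|a r IHr]; rewrite ?big_nil ?mk1 // big_cons -IHr mkM. Qed.

Section QuantumTrace.
Variables (F : numFieldType) (N m : nat) (A : pzRingType) (kK : fps F -> A).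
Variables (T Tp : nat -> 'M[A]_N) (e : 'S_m -> F) (c : 'I_m -> F).
Local Notation h := (fvar F).

(** The ingredients of [Ttrunc] over an arbitrary algebra, so that they can be mapped from the free
    algebra to its quotients. *)
Definition qt_idem : 'M[A]_(tdim N m) := \sum_s kK (fconst (e s)) *: tens_perm N A s.
Definition qt_plus M a r : 'M[A]_(tdim N m) :=
  tens_at a (sshiftP M (kK (fconst (c a) * h))%:M Tp r).
Definition qt_minus a r : 'M[A]_(tdim N m) :=
  tens_at a (sshiftN (kK (fconst (c a - N%:R / 2) * h))%:M (sinv T) r).
Definition qt_plus_prod M : nat -> 'M[A]_(tdim N m) :=
  foldr (fun a => smul (qt_plus M a)) (@sone _) (enum 'I_m).
Definition qt_minus_prod : nat -> 'M[A]_(tdim N m) :=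
  foldr (fun a => smul (qt_minus a)) (@sone _) (rev (enum 'I_m)).
(* [Ttrunc] with the summation bound [S] independent of the order [M] at which
   T^+ is truncated *)
Definition qt k M S : A :=
  \tr (qt_idem *m \sum_(s < S) qt_plus_prod M s *m atN qt_minus_prod (k - s%:Z)).

End QuantumTrace.

Lemma Xminus_rmorph (F : numFieldType) (S0 S S' : comPzRingType) n (aF : {rmorphism F -> S0})
    (kS : {rmorphism S0 -> S}) (kS' : {rmorphism S0 -> S'}) (psi : {rmorphism S -> S'}) hh w d v :
  (forall x, psi (kS x) = kS' x) ->
  psi (Xminus n aF kS hh w d v) = Xminus n aF kS' hh (psi w) d v.
Proof.
move=> psiE; rewrite /Xminus rmorphM; congr (_ * _); rewrite rmorph_sum; apply: eq_bigr => i _.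
by rewrite rmorphXn rmorphN !rmorphM !psiE.
Qed.

Section LiftSeries.
Variables (F : numFieldType) (BN W0 : pzRingType) (S0 : comPzRingType) (n L K M : nat).
Variables (aF : {rmorphism F -> S0}) (kB : {rmorphism S0 -> BN}) (i0 : {rmorphism S0 -> W0}).
Variables (theta : {rmorphism BN -> W0}) (hh : S0).
Hypotheses (kBC : forall x y, kB x * y = y * kB x) (thetaE : forall x, theta (kB x) = i0 x).
Hypotheses (hn : hh ^+ n = 0) (KM : (K <= M)%N).
Local Notation S := (tser (tser S0 L) K).
Local Notation Q := (tser (tser W0 L) K).
Let kS : {rmorphism S0 -> S} := emb2 L K (B := S0).
Let cW : {rmorphism W0 -> Q} := emb2 L K (B := W0).
Let io : {rmorphism S -> Q} := tmap (L := K) (tmap (L := L) i0).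
Let lift : {rmorphism tser W0 K -> Q} := tmap (L := K) (tC L).
Let ioB : {rmorphism tser S0 K -> tser BN K} := tmap (L := K) kB.
Let psi : {rmorphism tser S0 K -> S} := tmap (L := K) (tC L).
Let phi : {rmorphism tser BN K -> Q} := lift \o tmap (L := K) theta.

Let phi_io x : phi (ioB x) = io (psi x).
Proof.
apply: tserP => s _; rewrite !co_tmap; apply: tserP => r ltr.
by rewrite co_tmap !co_tC //; case: eqP => _; rewrite ?rmorph0 ?thetaE.
Qed.

Let phi_tC X : phi (tC K X) = cW (theta X).
Proof. by rewrite /phi /= tmap_tC /lift /= tmap_tC. Qed.

Let phi_ev f Z : phi (ev ioB M (fun r => tC K (f r)) Z) = ev io M (fun r => cW (theta (f r))) (psi Z).
Proof. by rewrite (ev_rmorph _ _ _ phi_io); apply: eq_ev => r _; exact: phi_tC. Qed.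

Lemma lift_sshiftP f x : lift (mk K (fun r => theta (sshiftP M (kB x) f r))) =
  ev io M (fun r => cW (theta (f r))) (tX (tser S0 L) K + kS x).
Proof.
rewrite -[mk K _](tmap_mk K theta (sshiftP M (kB x) f)) (sshiftP_ev K M kBC) -[lift _]/(phi _) phi_ev.
by congr (ev _ _ _ _); rewrite /psi rmorphD /= tmap_tX tmap_tC.
Qed.

Variables (d v : F).
Local Notation Zm := (Xminus n aF (tC K) hh (tX S0 K) (aF d) v).
Local Notation Xm := (Xminus n aF kS hh (tX (tser S0 L) K) (aF d) v).

Let Zm_rel : Zm * (1 + tC K (hh * aF (v + d)) * tX S0 K) = tX S0 K.
Proof.
have := XminusE aF (tC K) hn (tX S0 K) (aF d) v; rewrite -rmorphD.
by rewrite [tC K (hh * _)]rmorphM.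
Qed.

Let psi_Zm : psi Zm = Xm.
Proof.
have psiE x : psi (tC K x) = kS x by rewrite /psi /= tmap_tC.
by rewrite (Xminus_rmorph n aF hh (tX S0 K) (aF d) v psiE) /psi /= tmap_tX.
Qed.

Let Zm_nilp : Zm ^+ M = 0.
Proof. by rewrite exprMn tX_nilp // mul0r. Qed.

Lemma lift_sshiftN f : lift (mk K (fun r => theta (sshiftN (kB (hh * aF (v + d))) f r))) =
  ev io M (fun r => cW (theta (f r))) Xm.
Proof.
rewrite -[mk K _](tmap_mk K theta (sshiftN (kB (hh * aF (v + d))) f)).
by rewrite (sshiftN_ev kBC KM _ Zm_rel) -[lift _]/(phi _) phi_ev psi_Zm.
Qed.

Lemma ev_theta_inv f f' : (0 < M)%N -> (forall r, smul f f' r = sone BN r) ->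
  ev io M (fun r => cW (theta (f r))) Xm * ev io M (fun r => cW (theta (f' r))) Xm = 1.
Proof.
move=> M_gt0 ff; rewrite -psi_Zm -!phi_ev -rmorphM -(ev_tC_smul kBC _ _ Zm_nilp).
rewrite -[RHS](rmorph1 phi); congr (phi _); rewrite -(ev_tC_sone kB Zm M_gt0).
by apply: eq_ev => r _; rewrite ff.
Qed.

End LiftSeries.

(** * Both cases for the series T^+ and the inverse of T over an abstract algebra *)

Section AbstractCommutation.
Variables (N m n : nat) (F : numFieldType) (A W0 : pzRingType) (S0 : comPzRingType).
Variables (i0 : {rmorphism S0 -> W0}) (inj0 : {rmorphism A -> W0}).
Variables (aF : {rmorphism F -> S0}) (kA : {rmorphism S0 -> A}).
Hypothesis i0C : forall x y, i0 x * y = y * i0 x.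
Hypothesis inj_kA0 : forall x, inj0 (kA x) = i0 x.
Variable e : option 'I_m -> 'I_N -> 'I_N -> W0.
Hypothesis eM : forall x i j k l, e x i j * e x k l = if j == k then e x i l else 0.
Hypothesis eC : forall x y i j k l, x != y -> e x i j * e y k l = e y k l * e x i j.
Hypothesis e1 : forall x, \sum_i e x i i = 1.
Hypothesis inj0C : forall x i j a, inj0 a * e x i j = e x i j * inj0 a.
Variable p : 'S_m -> W0.
Hypotheses (p1 : p 1%g = 1) (pM : forall s t, p (s * t)%g = p t * p s).
Hypothesis pP : forall a b, a != b -> p (tperm a b) = uperm e (Some a) (Some b).
Variables (hh : S0) (T Tp : nat -> 'M[A]_N).
Hypotheses (hn : hh ^+ n = 0) (T0 : T 0%N = 1).
Hypothesis relN : forall r s i j k l,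
  T r.+1 i j * T s k l - T s k l * T r.+1 i j - (T r i j * T s.+1 k l - T s.+1 k l * T r i j)
  = kA hh * (T r k j * T s i l - T s k j * T r i l).
Hypothesis relP : forall r s i j k l,
  (if r is r'.+1 then Tp r' i j * Tp s k l - Tp s k l * Tp r' i j else 0)
  - (if s is s'.+1 then Tp r i j * Tp s' k l - Tp s' k l * Tp r i j else 0)
  = kA hh * (Tp r k j * Tp s i l - Tp s k j * Tp r i l).
Variable g : nat -> S0.
Hypothesis g0 : g 0%N = 1.
Hypothesis gP : forall r, sshiftN N%:R g r = g r - (if (2 <= r)%N then g (r - 2)%N else 0).
Local Notation half := (N%:R / 2 : F).
Let y : S0 := - (hh * aF half).
Let q j := g j * hh ^+ j.
Let q' j := if j is j'.+1 then hh * q j' else 0.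
Hypothesis relX : forall r s i j k l,
  \sum_(a < r.+1) \sum_(b < s.+1)
    (kA (rexp q y a b) * (T (r - a)%N i j * Tp (s - b)%N k l)
     - kA (rexp q' y a b) * (T (r - a)%N k j * Tp (s - b)%N i l)) =
  \sum_(a < r.+1) \sum_(b < s.+1)
    (kA (rexp q (- y) a b) * (Tp (s - b)%N k l * T (r - a)%N i j)
     - kA (rexp q' (- y) a b) * (Tp (s - b)%N k j * T (r - a)%N i l)).


Variables (e0 : 'S_m -> F) (c : 'I_m -> F) (chi : ('I_m -> F) -> F).
Hypothesis e0J : forall b, conv (jm F b) e0 =1 fun s => c b * e0 s.
Hypotheses (e0V : jvalue e0 chi) (chi1 : chi c = 1).
Variables (V : zmodType) (Tr : {additive W0 -> V}).
Local Notation E0 := (gev (i0 \o aF) p e0).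
Hypothesis Tr_cyc : forall a i j w, Tr (e (Some a) i j * w) = Tr (w * e (Some a) i j).
Hypothesis Tr_E : forall w, Tr (E0 * w) = Tr (w * E0).
Hypothesis p_inner : forall s i j, p s * e None i j = e None i j * p s.
Hypothesis p_inj0 : forall s x, p s * inj0 x = inj0 x * p s.
Variable J : W0 -> Prop.
Hypotheses (J0 : J 0) (JB : forall x y, J x -> J y -> J (x - y)).
Hypothesis JM : forall x y, J y -> J (x * y).
Variables (kB : {rmorphism S0 -> 'M[A]_N}) (theta : 'I_m -> {rmorphism 'M[A]_N -> W0}).
Hypotheses (kBC : forall x X, kB x * X = X * kB x) (thetaE : forall a x, theta a (kB x) = i0 x).
Hypothesis uopE : forall a X, uop e inj0 (Some a) X = theta a X.
Hypothesis n_gt0 : (0 < n)%N.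
Local Notation sites := (index_enum 'I_m).

Definition plus_series K M : tser W0 K :=
  \prod_(a <- sites) mk K (fun r => theta a (sshiftP M (kB (hh * aF (c a))) Tp r)).
Definition minus_series K : tser W0 K :=
  \prod_(a <- rev sites) mk K (fun r => theta a (sshiftN (kB (hh * aF (c a - half))) (sinv T) r)).

Section Levels.
Variables (L K M : nat).
Hypotheses (L_gt0 : (0 < L)%N) (K_gt0 : (0 < K)%N) (LM : (L <= M)%N) (KM : (K + n <= M)%N).
Let KM' : (K <= M)%N. Proof. by lia. Qed.
Let M_gt0 : (0 < M)%N. Proof. by lia. Qed.
Local Notation S1 := (tser S0 L).
Local Notation Q := (tser (tser W0 L) K).
Let cW : {rmorphism W0 -> Q} := emb2 L K (B := W0).
Let kS : {rmorphism S0 -> tser S1 K} := emb2 L K (B := S0).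
Let io : {rmorphism tser S1 K -> Q} := tmap (L := K) (tmap (L := L) i0).
Let lift : {rmorphism tser W0 K -> Q} := tmap (L := K) (tC L).
Let e' x i j := cW (e x i j).

Let uop_theta a X : uop e' (cW \o inj0) (Some a) X = cW (theta a X).
Proof.
rewrite -uopE /uop rmorph_sum; apply: eq_bigr => i _; rewrite rmorph_sum.
by apply: eq_bigr => j _; rewrite rmorphM.
Qed.

Let ev_site a f X : ev io M (fun r => uop e' (cW \o inj0) (Some a) (f r)) X =
  ev io M (fun r => cW (theta a (f r))) X.
Proof. by apply: eq_ev => r _; exact: uop_theta. Qed.

Let lift_tt a : lift (mk K (fun r => theta a (sshiftP M (kB (hh * aF (c a))) Tp r))) =
  Tpx M io (cW \o inj0) e' Tp (Some a) (tX S1 K + shf aF kS hh (c a)).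
Proof.
rewrite /Tpx ev_site (lift_sshiftP L K M kBC (thetaE a)); congr (ev _ _ _ (_ + _)).
exact: rmorphM.
Qed.

Local Notation Xm a := (Xminus n aF kS hh (tX S1 K) (aF (- half)) (c a)).
Local Notation ss a := (mk K (fun r => theta a (sshiftN (kB (hh * aF (c a - half))) (sinv T) r))).

Let lift_ss1 a : Tx M io (cW \o inj0) e' T (Some a) (Xm a) * lift (ss a) = 1.
Proof.
rewrite /Tx ev_site (lift_sshiftN L aF kBC (thetaE a) hn KM').
apply: (ev_theta_inv n L aF hh kBC (thetaE a) KM' (- half) (c a) M_gt0) => r; exact: smul_sinv.
Qed.

Let lift_ss2 a : lift (ss a) * Tx M io (cW \o inj0) e' T (Some a) (Xm a) = 1.
Proof.
rewrite /Tx ev_site (lift_sshiftN L aF kBC (thetaE a) hn KM').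
apply: (ev_theta_inv n L aF hh kBC (thetaE a) KM' (- half) (c a) M_gt0) => r; exact: sinv_smul.
Qed.

Variables (P0 Sz : nat) (k : int).
Hypothesis GJ : forall r, (P0 <= r < K)%N -> J (co (minus_series K) r).
Let D := (size sites * (degk n L + n * degk n L + n * (n * (n.+1 * degk n L))))%N.
Hypothesis DK : (Sz + 4 * D.+1 + `|k| + (degk n L + n * degk n L + n * (n * (n.+1 * degk n L)))
  + (degk n L + n * degk n L + n * (n * (n.+1 * degk n L))) < K)%N.
Hypothesis SP : P0%:Z <= Sz%:Z - (D.+1 + D.+1)%:Z - k.

Let GJ' r : (P0 <= r)%N -> J (co (minus_series K) r).
Proof. by case: (ltnP r K) => [ltr le|le _]; [apply: GJ; rewrite le|rewrite co_ge]. Qed.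

Let Zk := pairing (plus_series K M) (minus_series K) Sz k.

Lemma commute_minus_coef r : (r < L)%N -> exists2 z, J z &
  Tr z = Tr (E0 * uop e inj0 None (T r) * Zk) - Tr (E0 * Zk * uop e inj0 None (T r)).
Proof.
move=> ltr; have := commute_minus i0C inj_kA0 eM eC e1 inj0C p1 pM pP hn T0 relN relP g0 gP relX
  e0J e0V chi1 Tr_cyc Tr_E p_inner p_inj0 J0 JB JM lift_tt lift_ss1 lift_ss2 L_gt0 K_gt0 n_gt0 LM KM
  GJ' DK SP r.
by rewrite co_mk ltr.
Qed.

Lemma commute_plus_coef r : (r < L)%N -> exists2 z, J z &
  Tr z = Tr (E0 * uop e inj0 None (Tp r) * Zk) - Tr (E0 * Zk * uop e inj0 None (Tp r)).
Proof.
move=> ltr; have := commute_plus i0C inj_kA0 eM eC e1 inj0C p1 pM pP hn T0 relN relP g0 gP relX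
  e0J e0V chi1 Tr_cyc Tr_E p_inner p_inj0 J0 JB JM lift_tt lift_ss1 lift_ss2 L_gt0 K_gt0 n_gt0 LM KM
  GJ' DK SP r.
by rewrite co_mk ltr.
Qed.

End Levels.

End AbstractCommutation.

(** * Scalars modulo a power of h *)

Section PowerSeriesModulo.
Variable F : comNzRingType.
Local Notation h := (fvar F).

Lemma fcoefM (f g : fps F) n : fcoef (f * g) n = \sum_(i < n.+1) fcoef f i * fcoef g (n - i).
Proof. by []. Qed.

Lemma fcoef_hX n i : fcoef (h ^+ n) i = (i == n)%:R.
Proof.
elim: n i => [|n IHn] i //; rewrite exprS fcoefM; case: i => [|i].
  by rewrite big_ord1 /= mul0r.
rewrite big_ord_recl big_ord_recl /= mul0r add0r mul1r big1 ?addr0 => [|j _]; last by rewrite mul0r.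
by rewrite IHn subn1.
Qed.

Lemma fcoef_hXM n f i : fcoef (h ^+ n * f) i = if (n <= i)%N then fcoef f (i - n) else 0.
Proof.
rewrite fcoefM; case: leqP => [le|lt]; last first.
  rewrite big1 // => j _; rewrite fcoef_hX ltn_eqF ?mul0r // (leq_trans _ lt) //.
rewrite (bigD1 (Ordinal (le : (n < i.+1)%N))) //= fcoef_hX eqxx mul1r big1 ?addr0 // => j ne_j.
rewrite fcoef_hX (_ : (j : nat) == n = false) ?mul0r //; apply: contraNF ne_j => /eqP e.
exact/eqP/val_inj.
Qed.

Lemma fps_modX n f : (forall i, (i < n)%N -> fcoef f i = 0) -> exists f', f = h ^+ n * f'.
Proof.
move=> f0; exists (Fps (fun i => fcoef f (i + n))); apply: fps_ext => i.
by rewrite fcoef_hXM; case: leqP => [le|/f0] //=; rewrite subnK.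
Qed.

Definition ftrunc n (f : fps F) : tser F n := mk n (fcoef f).

Lemma ftrunc_is_zmod_morphism n : zmod_morphism (ftrunc n).
Proof. by move=> f f'; apply: tserP => i lt; rewrite coB !co_mk lt. Qed.
Lemma ftrunc_is_monoid_morphism n : monoid_morphism (ftrunc n).
Proof. by split=> [|f f']; [exact: mk1|rewrite mkM]. Qed.
HB.instance Definition _ n := GRing.isZmodMorphism.Build _ _ (ftrunc n) (ftrunc_is_zmod_morphism n).
HB.instance Definition _ n := GRing.isMonoidMorphism.Build _ _ (ftrunc n) (ftrunc_is_monoid_morphism n).

Lemma ftrunc_const n x : ftrunc n (fconst x) = tC n x.
Proof. by apply: tserP => i lt; rewrite !co_mk lt. Qed.

Lemma ftrunc_h n : ftrunc n h = tX F n.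
Proof. by apply: tserP => i lt; rewrite !co_mk lt. Qed.

Variables (A : pzRingType) (kK : {rmorphism fps F -> A}) (n : nat).
Hypothesis kKn : kK (h ^+ n) = 0.

(** The scalars of an algebra with h^n = 0, factored through power series modulo h^n. The proof of
    h^n = 0 is an argument, so that the morphism structure can be attached to the constant. *)
Definition kmod of kK (h ^+ n) = 0 := fun f : tser F n => kK (Fps (co f)).
Local Notation kA := (kmod kKn).

Lemma kmod_ftrunc f : kA (ftrunc n f) = kK f.
Proof.
apply/eqP; rewrite -subr_eq0 -rmorphB; apply/eqP.
have [i lt|f' ->] := @fps_modX n (Fps (co (ftrunc n f)) - f); last by rewrite rmorphM kKn mul0r.
by rewrite -[fcoef _ i]/(co (ftrunc n f) i - fcoef f i) co_mk lt subrr.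
Qed.

Lemma ftrunc_surj (f : tser F n) : f = ftrunc n (Fps (co f)).
Proof. by rewrite /ftrunc /= coK. Qed.

Lemma kmod_is_zmod_morphism : zmod_morphism kA.
Proof.
by move=> f f'; rewrite [f in LHS]ftrunc_surj [f' in LHS]ftrunc_surj -rmorphB kmod_ftrunc rmorphB.
Qed.
Lemma kmod_is_monoid_morphism : monoid_morphism kA.
Proof.
split=> [|f f']; first by rewrite -(rmorph1 (ftrunc n)) kmod_ftrunc rmorph1.
by rewrite [f in LHS]ftrunc_surj [f' in LHS]ftrunc_surj -rmorphM kmod_ftrunc rmorphM.
Qed.
HB.instance Definition _ := GRing.isZmodMorphism.Build _ _ kA kmod_is_zmod_morphism.
HB.instance Definition _ := GRing.isMonoidMorphism.Build _ _ kA kmod_is_monoid_morphism.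

End PowerSeriesModulo.

(** * Realisation of the sites by matrices over matrices *)

Section MatrixSites.
Variables (N m : nat) (A : pzRingType).
Local Notation td := (tdim N m).
Local Notation W0 := 'M['M[A]_N]_td.

(* The auxiliary tensor factor is [None]; its matrix units are those of the
   matrices which form the entries of the elements of W0. *)
Definition site_unit (x : option 'I_m) (i j : 'I_N) : W0 :=
  if x is Some a then tens_at a (delta_mx i j) else (delta_mx i j)%:M.
Definition mx_scalars (X : 'M[A]_td) : W0 := map_mx (@scalar_mx A N) X.
HB.instance Definition _ := GRing.RMorphism.copy mx_scalars (map_mx (@scalar_mx A N) : 'M_td -> 'M_td).
Definition mx_scalar : A -> W0 := (@scalar_mx ('M[A]_N) td) \o (@scalar_mx A N).
HB.instance Definition _ := GRing.RMorphism.copy mx_scalar ((@scalar_mx ('M[A]_N) td) \o (@scalar_mx A N)).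

Lemma nat_central (B : pzRingType) k (y : B) : k%:R * y = y * k%:R.
Proof. by rewrite mulr_natl mulr_natr. Qed.

Lemma central_delta k (i j : 'I_k) : central_entries (delta_mx i j : 'M[A]_k).
Proof. by move=> i' j' y; rewrite mxE nat_central. Qed.

Lemma central_tens_at a i j : central_entries (tens_at a (delta_mx i j) : W0).
Proof. by move=> x y z; rewrite mxE; case: ifP => _; rewrite ?mul0r ?mulr0 // mxE nat_central. Qed.

Lemma central_tens_perm s : central_entries (tens_perm N ('M[A]_N) s : 'M_(tdim N m)).
Proof. by move=> x y z; rewrite mxE nat_central. Qed.

Lemma scalar_mx_central (B : pzRingType) k (x : B) (X : 'M[B]_k) :
  (forall y, x * y = y * x) -> x%:M *m X = X *m x%:M.
Proof.
move=> xC; apply/matrixP => i j; rewrite !mxE (bigD1 i) //= [RHS](bigD1 j) //= !mxE !eqxx !mulr1n.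
rewrite !big1 ?addr0 ?xC // => l ne_l; rewrite !mxE.
  by rewrite (negPf ne_l) mulr0n mulr0.
by rewrite eq_sym (negPf ne_l) mulr0n mul0r.
Qed.

Lemma mul_mx_scalarE (B : pzRingType) k (x : B) (X : 'M[B]_k) i j : (X *m x%:M) i j = X i j * x.
Proof.
rewrite mxE (bigD1 j) //= mxE eqxx mulr1n big1 ?addr0 // => l ne_l.
by rewrite mxE (negPf ne_l) mulr0n mulr0.
Qed.

Lemma site_unitM x i j k l : site_unit x i j * site_unit x k l = if j == k then site_unit x i l else 0.
Proof.
case: x => [a|]; rewrite /site_unit -rmorphM /= -[_ * _]/(_ *m _) mul_delta_mx_cond.
  by case: eqP => _; rewrite ?mulr1n // mulr0n rmorph0.
by case: eqP => _; rewrite ?mulr1n // mulr0n rmorph0.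
Qed.

Lemma site_unitC x z i j k l : x != z ->
  site_unit x i j * site_unit z k l = site_unit z k l * site_unit x i j.
Proof.
case: x => [a|]; case: z => [b|] // ab.
- by apply: tens_at_comm => // i' j' k' l'; rewrite mxE nat_central.
- exact/central_entries_scalar/central_tens_at.
exact/esym/central_entries_scalar/central_tens_at.
Qed.

Lemma site_unit1 x : \sum_i site_unit x i i = 1.
Proof.
have d1 (B : pzRingType) : \sum_i delta_mx i i = 1 :> 'M[B]_N by rewrite -mx1_sum_delta.
by case: x => [a|]; rewrite /site_unit -rmorph_sum d1 rmorph1.
Qed.

Lemma mx_scalar_unit x i j a : mx_scalar a * site_unit x i j = site_unit x i j * mx_scalar a.
Proof.
case: x => [b|]; first exact/esym/central_entries_scalar/central_tens_at.
rewrite /site_unit /mx_scalar /= -!rmorphM; congr (_%:M).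
exact/esym/central_entries_scalar/central_delta.
Qed.

Lemma tens_perm_uperm a b : a != b ->
  tens_perm N ('M[A]_N) (tperm a b) = uperm site_unit (Some a) (Some b).
Proof. exact: tens_perm_tperm. Qed.

Lemma uop_site a X : uop site_unit mx_scalar (Some a) X = mx_scalars (tens_at a X).
Proof.
have XE : X = \sum_i \sum_j X i j *: delta_mx i j by exact: matrix_sum_delta.
rewrite /uop; apply/matrixP => x y; rewrite summxE !mxE.
under eq_bigr do rewrite summxE.
have term i j : (mx_scalar (X i j) * site_unit (Some a) i j) x y =
    if [forall b, (b != a) ==> (tidx x b == tidx y b)]
    then (X i j)%:M * delta_mx i j (tidx x a) (tidx y a) else 0.
  rewrite -[_ * _]/(_%:M *m _) mul_scalar_mx !mxE.
  by case: ifP => _ //; rewrite mulr0.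
under eq_bigr do under eq_bigr do rewrite term.
case: ifP => _; last by rewrite raddf0 big1 // => i _; rewrite big1.
rewrite (bigD1 (tidx x a)) //= [X in _ + X]big1 ?addr0 => [|i /negPf ne]; last first.
  by rewrite big1 // => j _; rewrite mxE eq_sym ne /= mulr0.
rewrite (bigD1 (tidx y a)) //= [X in _ + X]big1 ?addr0 => [|j /negPf ne]; last first.
  by rewrite mxE [tidx y a == j]eq_sym ne andbF mulr0.
by rewrite mxE !eqxx mulr1.
Qed.

Lemma uop_inner X : uop site_unit mx_scalar None X = X%:M.
Proof.
rewrite [in RHS](matrix_sum_delta X) /uop rmorph_sum; apply: eq_bigr => i _.
rewrite rmorph_sum; apply: eq_bigr => j _.
have -> : mx_scalar (X i j) * site_unit None i j = ((X i j)%:M *m delta_mx i j)%:M.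
  by rewrite scalar_mxM.
by rewrite mul_scalar_mx.
Qed.

Lemma mx_scalars_tens x a : mx_scalars (tens_at a x%:M) = mx_scalar x.
Proof.
apply/matrixP => y z; rewrite !mxE.
have -> : (y == z) = [forall b, (b != a) ==> (tidx y b == tidx z b)] && (tidx y a == tidx z a).
  apply/eqP/andP => [->|[/off_site zE /eqP yz]].
    by split=> //; apply/forallP => b; rewrite eqxx implybT.
  by rewrite {1}zE; apply: tidx_inj => b; rewrite tidx_set -yz; case: eqP => // ->.
case: [forall b, _] => /=; last by rewrite raddf0.
by case: (_ == _); rewrite ?mulr1n // !mulr0n raddf0.
Qed.

End MatrixSites.

Section CommuteWithTrace.
Variables (F : numFieldType) (N m n : nat) (A : pzRingType) (kK : {rmorphism fps F -> A}).
Local Notation h := (fvar F).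
Hypothesis kKC : forall x y, kK x * y = y * kK x.
Hypotheses (kKn : kK (h ^+ n) = 0) (n_gt0 : (0 < n)%N).
Variables (T Tp : nat -> 'M[A]_N) (g : nat -> F).
Hypothesis T0 : T 0%N = 1.
Hypothesis relN : forall r s i j k l,
  T r.+1 i j * T s k l - T s k l * T r.+1 i j - (T r i j * T s.+1 k l - T s.+1 k l * T r i j)
  = kK h * (T r k j * T s i l - T s k j * T r i l).
Hypothesis relP : forall r s i j k l,
  (if r is r'.+1 then Tp r' i j * Tp s k l - Tp s k l * Tp r' i j else 0)
  - (if s is s'.+1 then Tp r i j * Tp s' k l - Tp s' k l * Tp r i j else 0)
  = kK h * (Tp r k j * Tp s i l - Tp s k j * Tp r i l).
Hypothesis g_spec : g 0%N = 1 /\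
  forall r, sshiftN N%:R g r = g r - (if (2 <= r)%N then g (r - 2)%N else 0).
Let y : fps F := - (h * fconst (N%:R / 2)).
Let q j := fconst (g j) * h ^+ j.
Let q' j := if j is j'.+1 then h * q j' else 0.
Hypothesis relX : forall r s i j k l,
  \sum_(a < r.+1) \sum_(b < s.+1)
    (kK (rexp q y a b) * (T (r - a)%N i j * Tp (s - b)%N k l)
     - kK (rexp q' y a b) * (T (r - a)%N k j * Tp (s - b)%N i l)) =
  \sum_(a < r.+1) \sum_(b < s.+1)
    (kK (rexp q (- y) a b) * (Tp (s - b)%N k l * T (r - a)%N i j)
     - kK (rexp q' (- y) a b) * (Tp (s - b)%N k j * T (r - a)%N i l)).
Variables (e0 : 'S_m -> F) (c : 'I_m -> F) (chi : ('I_m -> F) -> F).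
Hypothesis e0J : forall b, conv (jm F b) e0 =1 fun s => c b * e0 s.
Hypotheses (e0V : jvalue e0 chi) (chi1 : chi c = 1).
Variables (J : A -> Prop) (P0 : nat).
Hypotheses (J0 : J 0) (JB : forall x y, J x -> J y -> J (x - y)).
Hypothesis JM : forall x y, J y -> J (x * y).
Hypothesis GJ : forall r, (P0 <= r)%N -> forall x z, J (qt_minus_prod kK T c r x z).

Local Notation S0 := (tser F n).
Let kA : {rmorphism S0 -> A} := kmod kKn.
Let aF : {rmorphism F -> S0} := tC n.
Let pr : {rmorphism fps F -> S0} := @ftrunc F n.
Let hh : S0 := tX F n.

Let kA_pr f : kA (pr f) = kK f. Proof. exact: kmod_ftrunc. Qed.
Let pr_h : pr h = hh. Proof. exact: ftrunc_h. Qed.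
Let pr_const x : pr (fconst x) = aF x. Proof. exact: ftrunc_const. Qed.

Let kAC x z : kA x * z = z * kA x.
Proof. by rewrite [x]ftrunc_surj; rewrite -/pr kA_pr kKC. Qed.

Let hn : hh ^+ n = 0. Proof. exact: tX_nilp. Qed.
Let kA_h : kA hh = kK h. Proof. by rewrite -pr_h kA_pr. Qed.

Let pr_rexp (qq : nat -> fps F) x a b : pr (rexp qq x a b) = rexp (fun j => pr (qq j)) (pr x) a b.
Proof.
rewrite /rexp rmorph_sum; apply: eq_bigr => j _.
by rewrite rmorphM rmorphMn rmorphXn rmorphN.
Qed.

Let gS j := aF (g j).
Let g0S : gS 0%N = 1. Proof. by case: g_spec => g0 _; rewrite /gS g0 rmorph1. Qed.
Let gPS r : sshiftN N%:R gS r = gS r - (if (2 <= r)%N then gS (r - 2)%N else 0).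
Proof.
case: g_spec => _ /(_ r) gr; transitivity (aF (sshiftN N%:R g r)).
  rewrite /sshiftN rmorph_sum; apply: eq_bigr => i _.
  by rewrite rmorphMn rmorphM rmorphXn rmorphN rmorph_nat.
by rewrite gr rmorphB; case: ifP => _; rewrite ?rmorph0.
Qed.

Let relX_S r s i j k l :
  let yS : S0 := - (hh * aF (N%:R / 2)) in
  let qS j := gS j * hh ^+ j in let qS' j := if j is j'.+1 then hh * qS j' else 0 in
  \sum_(a < r.+1) \sum_(b < s.+1)
    (kA (rexp qS yS a b) * (T (r - a)%N i j * Tp (s - b)%N k l)
     - kA (rexp qS' yS a b) * (T (r - a)%N k j * Tp (s - b)%N i l)) =
  \sum_(a < r.+1) \sum_(b < s.+1)
    (kA (rexp qS (- yS) a b) * (Tp (s - b)%N k l * T (r - a)%N i j)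
     - kA (rexp qS' (- yS) a b) * (Tp (s - b)%N k j * T (r - a)%N i l)).
Proof.
move=> yS qS qS'.
have prq i' : pr (q i') = qS i' by rewrite /q rmorphM rmorphXn pr_const pr_h.
have prq' i' : pr (q' i') = qS' i'.
  by case: i' => [|i'] /=; rewrite ?rmorph0 // rmorphM pr_h prq.
have pry : pr y = yS by rewrite /y rmorphN rmorphM pr_h pr_const.
have E x qq qq' : (forall i', pr (qq i') = qq' i') -> forall a b, kA (rexp qq' (pr x) a b) = kK (rexp qq x a b).
  move=> qqE a b; rewrite -kA_pr pr_rexp; congr (kA _).
  by apply: eq_bigr => i' _; rewrite qqE.
rewrite -pry -rmorphN.
under eq_bigr do under eq_bigr do rewrite (E _ _ _ prq) (E _ _ _ prq').
under [RHS]eq_bigr do under eq_bigr do rewrite (E _ _ _ prq) (E _ _ _ prq').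
exact: relX.
Qed.

Local Notation td := (tdim N m).
Local Notation W0 := 'M['M[A]_N]_td.
Let i0 : {rmorphism S0 -> W0} := (@mx_scalar N m A) \o kA.
Let inj0 : {rmorphism A -> W0} := @mx_scalar N m A.
Let e := @site_unit N m A.
Let p s : W0 := tens_perm N ('M[A]_N) s.
Let sc : {rmorphism 'M[A]_td -> W0} := @mx_scalars N m A.
(** The trace over the outer indices is the partial trace over 1, ..., m; its value is a matrix at
    the auxiliary site. *)
Let Tr : {additive W0 -> 'M[A]_N} := @mxtrace 'M[A]_N td.

Let scalar_central (x : S0) (X : 'M[A]_N) : (kA x)%:M * X = X * (kA x)%:M.
Proof. exact: (scalar_mx_central X (kAC x)). Qed.

Let i0C x z : i0 x * z = z * i0 x.
Proof. exact: (scalar_mx_central z (scalar_central x)). Qed.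

Let E1 : 'M[A]_td := qt_idem N kK e0.

Let E0E : gev (i0 \o aF) p e0 = sc E1.
Proof.
rewrite /E1 /qt_idem rmorph_sum; apply: eq_bigr => s _.
apply/matrixP => x z; rewrite -[_ * _]/(_%:M *m _) mul_scalar_mx !mxE /=.
rewrite -pr_const kA_pr -[_ * _]/(_ *m _) mul_scalar_mx.
case: [forall a, _]; rewrite ?mulr1 ?mulr0.
  by rewrite -[RHS]mulr1 -[RHS]/(_%:M *m 1%:M) mul_scalar_mx.
by rewrite -[_%:R]/(0 : 'M[A]_N) scaler0 raddf0.
Qed.

Let Tr_cyc a i j w : Tr (e (Some a) i j * w) = Tr (w * e (Some a) i j).
Proof. exact/central_entries_trace/central_tens_at. Qed.

Let E0_central : central_entries (gev (i0 \o aF) p e0).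
Proof.
move=> x z v; rewrite summxE mulr_suml mulr_sumr; apply: eq_bigr => s _.
have -> : ((i0 \o aF) (e0 s) * p s) x z = (kA (aF (e0 s)))%:M * p s x z.
  by rewrite -[_ * p s]/(_%:M *m p s) mul_scalar_mx mxE.
rewrite -mulrA central_tens_perm !mulrA.
by congr (_ * _); apply: scalar_central.
Qed.

Let Tr_E w : Tr (gev (i0 \o aF) p e0 * w) = Tr (w * gev (i0 \o aF) p e0).
Proof. exact: (central_entries_trace w E0_central). Qed.

Let p_inner s i j : p s * e None i j = e None i j * p s.
Proof. exact/central_entries_scalar/central_tens_perm. Qed.

Let p_inj0 s x : p s * inj0 x = inj0 x * p s.
Proof. exact/central_entries_scalar/central_tens_perm. Qed.

Let J2 (z : W0) := forall x v i j, J (z x v i j).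
Let J2_0 : J2 0. Proof. by move=> x v i j; rewrite !mxE. Qed.
Let J2_B z z' : J2 z -> J2 z' -> J2 (z - z').
Proof. by move=> Jz Jz' x v i j; rewrite !mxE; apply: JB. Qed.
Let J2_M z z' : J2 z' -> J2 (z * z').
Proof.
move=> Jz x v i j; rewrite mxE summxE; apply: (left_ideal_sum J0 JB) => l _.
by rewrite mxE; apply: (left_ideal_sum J0 JB) => l' _; apply/JM/Jz.
Qed.


Let kB : {rmorphism S0 -> 'M[A]_N} := (@scalar_mx A N) \o kA.
Let theta a : {rmorphism 'M[A]_N -> W0} := sc \o @tens_at N m A a.

Let kBC (x : S0) (X : 'M[A]_N) : kB x * X = X * kB x.
Proof. exact: scalar_central. Qed.

Let thetaE a x : theta a (kB x) = i0 x.
Proof. exact: mx_scalars_tens. Qed.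

Let uopE a X : uop e inj0 (Some a) X = theta a X.
Proof. exact: uop_site. Qed.

Let kB_h x : kB (hh * aF x) = (kK (fconst x * h))%:M.
Proof. by rewrite /kB /= -pr_const -pr_h -rmorphM kA_pr mulrC. Qed.

Let plus_prodE K M : plus_series aF hh Tp c kB theta K M = tmap sc (mk K (qt_plus_prod kK Tp c M)).
Proof.
rewrite mk_foldr_smul rmorph_prod /plus_series [index_enum _]unlock enumT; apply: eq_bigr => a _.
by rewrite [RHS]tmap_mk; apply: eq_mk => r _; rewrite kB_h.
Qed.

Let minus_prodE K : minus_series aF hh T c kB theta K = tmap sc (mk K (qt_minus_prod kK T c)).
Proof.
rewrite mk_foldr_smul rmorph_prod /minus_series [index_enum _]unlock enumT; apply: eq_bigr => a _.
by rewrite [RHS]tmap_mk; apply: eq_mk => r _; rewrite kB_h.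
Qed.

Lemma pairing_qt K M S k : (S + `|k| < K)%N ->
  pairing (plus_series aF hh Tp c kB theta K M) (minus_series aF hh T c kB theta K) S k =
  sc (\sum_(s < S) qt_plus_prod kK Tp c M s *m atN (qt_minus_prod kK T c) (k - s%:Z)).
Proof.
move=> SK; rewrite plus_prodE minus_prodE rmorph_sum; apply: eq_bigr => s _.
rewrite -[_ *m _]/(_ * _) rmorphM; congr (_ * _).
  by rewrite at_nat co_tmap co_mk ifT //; have := ltn_ord s; lia.
rewrite /atN subr_le0 /at_ subr_ge0; case: ifP => [le|_]; last by rewrite rmorph0.
rewrite co_tmap co_mk ifT; last by have := ltn_ord s; lia.
by rewrite distnC.
Qed.

Variables (k : int) (r : nat).
Let L := r.+1.
Let D := (size (index_enum 'I_m) * (degk n L + n * degk n L + n * (n * (n.+1 * degk n L))))%N.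
Let K S := (S + 4 * D.+1 + `|k| + (degk n L + n * degk n L + n * (n * (n.+1 * degk n L)))
  + (degk n L + n * degk n L + n * (n * (n.+1 * degk n L)))).+1.

Let J2_sc (X : 'M[A]_td) : (forall x z, J (X x z)) -> J2 (sc X).
Proof. by move=> JX x z i j; rewrite !mxE; case: (i == j); rewrite ?mulr1n // mulr0n. Qed.

Let minus_J S t : (P0 <= t < K S)%N -> J2 (co (minus_series aF hh T c kB theta (K S)) t).
Proof.
move=> /andP[le lt]; rewrite minus_prodE co_tmap co_mk lt; apply: J2_sc => x z; exact: GJ.
Qed.

Let tau M S := qt kK T Tp e0 c k M S.

(** E commutes with operators at the auxiliary site, so the two partial traces are X and the scalar
    matrix of tau multiplied in the two orders; the entries of the difference are commutators. *)
Let trace_entry (X : 'M[A]_N) S M : (S + `|k| < K S)%N ->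
  (exists2 z, J2 z & Tr z = Tr (gev (i0 \o aF) p e0 * uop e inj0 None X *
     pairing (plus_series aF hh Tp c kB theta (K S) M) (minus_series aF hh T c kB theta (K S)) S k) -
    Tr (gev (i0 \o aF) p e0 *
     pairing (plus_series aF hh Tp c kB theta (K S) M) (minus_series aF hh T c kB theta (K S)) S k *
       uop e inj0 None X)) ->
  forall i j, J (X i j * tau M S - tau M S * X i j).
Proof.
move=> SK [z Jz]; rewrite pairing_qt // uop_inner E0E; set Z := \sum_(s < S) _.
have tauE : \tr (E1 *m Z) = tau M S by [].
have -> : sc E1 * X%:M * sc Z = X%:M *m sc (E1 *m Z).
  rewrite -[sc E1 * _]/(sc E1 *m _) (central_entries_scalar (X := sc E1) X) -?E0E //.
  by rewrite E0E -[_ * sc Z]/(_ *m sc Z) -mulmxA -[sc E1 *m sc Z]/(sc E1 * sc Z) -rmorphM.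
have -> : sc E1 * sc Z * X%:M = sc (E1 *m Z) *m X%:M by rewrite -rmorphM.
have scTr (Y : 'M[A]_td) : Tr (sc Y) = (\tr Y)%:M by exact: trace_map_mx.
rewrite mul_scalar_mx [Tr (_ *: _)]mxtraceZ scTr tauE.
have -> : Tr (sc (E1 *m Z) *m X%:M) = (tau M S)%:M * X.
  rewrite /Tr /= /mxtrace; under eq_bigr do rewrite mul_mx_scalarE.
  by rewrite -mulr_suml -[\sum_i _]/(Tr (sc (E1 *m Z))) scTr tauE.
move=> TrE i j; have <- : Tr z i j = X i j * tau M S - tau M S * X i j.
  rewrite TrE !mxE; congr (_ - _).
    by have := mul_mx_scalarE (tau M S) X i j; rewrite mxE.
  by have := congr1 (fun Y : 'M_N => Y i j) (mul_scalar_mx (tau M S) X); rewrite !mxE.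
by rewrite summxE; apply: (left_ideal_sum J0 JB) => x _; apply: Jz.
Qed.

Lemma commute_qt : exists S0, forall S, (S0 <= S)%N -> exists M0, forall M, (M0 <= M)%N ->
  forall i j, J (T r i j * qt kK T Tp e0 c k M S - qt kK T Tp e0 c k M S * T r i j) /\
    J (Tp r i j * qt kK T Tp e0 c k M S - qt kK T Tp e0 c k M S * Tp r i j).
Proof.
(* S must exceed P0, where the second half enters J, by the degrees of the R-matrices. It determines
   the order K of the outer variable, and M has to reach K + n because u + h c_a has that order of
   nilpotency. *)
exists (P0 + (D.+1 + D.+1) + `|k|)%N => S leS; exists (L + K S + n)%N => M leM i j.
have LM : (L <= M)%N by lia.
have KM : (K S + n <= M)%N by lia.
have SK : (S + `|k| < K S)%N by rewrite /K; lia.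
have DK : (S + 4 * D.+1 + `|k| + (degk n L + n * degk n L + n * (n * (n.+1 * degk n L)))
  + (degk n L + n * degk n L + n * (n * (n.+1 * degk n L))) < K S)%N by [].
have SP : P0%:Z <= S%:Z - (D.+1 + D.+1)%:Z - k by lia.
have kAh r' s i' j' k' l' : T r'.+1 i' j' * T s k' l' - T s k' l' * T r'.+1 i' j' -
    (T r' i' j' * T s.+1 k' l' - T s.+1 k' l' * T r' i' j')
    = kA hh * (T r' k' j' * T s i' l' - T s k' j' * T r' i' l') by rewrite relN kA_h.
have kAhP r' s i' j' k' l' :
    (if r' is r''.+1 then Tp r'' i' j' * Tp s k' l' - Tp s k' l' * Tp r'' i' j' else 0)
    - (if s is s'.+1 then Tp r' i' j' * Tp s' k' l' - Tp s' k' l' * Tp r' i' j' else 0)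
    = kA hh * (Tp r' k' j' * Tp s i' l' - Tp s k' j' * Tp r' i' l') by rewrite relP kA_h.
have inj_kA x : inj0 (kA x) = i0 x by [].
split; apply: trace_entry => //.
  exact: (commute_minus_coef i0C inj_kA (@site_unitM N m A) (@site_unitC N m A) (@site_unit1 N m A)
    (@mx_scalar_unit N m A) (tens_perm1 N m 'M[A]_N) (@tens_permM N m 'M[A]_N) (@tens_perm_uperm N m A)
    hn T0 kAh kAhP g0S gPS relX_S e0J e0V chi1 Tr_cyc Tr_E p_inner p_inj0 J2_0 J2_B J2_M kBC thetaE uopE n_gt0
    (ltn0Sn _) (ltn0Sn _) LM KM (@minus_J S) DK SP (ltnSn _)).
exact: (commute_plus_coef i0C inj_kA (@site_unitM N m A) (@site_unitC N m A) (@site_unit1 N m A)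
    (@mx_scalar_unit N m A) (tens_perm1 N m 'M[A]_N) (@tens_permM N m 'M[A]_N) (@tens_perm_uperm N m A)
    hn T0 kAh kAhP g0S gPS relX_S e0J e0V chi1 Tr_cyc Tr_E p_inner p_inj0 J2_0 J2_B J2_M kBC thetaE uopE n_gt0
    (ltn0Sn _) (ltn0Sn _) LM KM (@minus_J S) DK SP (ltnSn _)).
Qed.

End CommuteWithTrace.

(** * The defining relations and their coefficients *)

Section SeriesRelations.
Variables (N : nat) (B : pzRingType) (hB : B) (gB : nat -> B).
Local Notation M2 := 'M[B]_(tdim N 2).
Local Notation P := (tens_perm N B (tperm (ord0 : 'I_2) ord_max)).

(* The constructions which enter the defining relations, over any ring, so that
   they can be mapped through ring morphisms. Over the free algebra they are
   convertible to the original ones. *)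
Definition rcoef (j : nat) : M2 := match j with 0 => 1 | 1 => - (hB *: P) | _ => 0 end.
Definition rbcoef (j : nat) : M2 := \sum_(i < j.+1) gB i *: rcoef (j - i).
Definition rexpand (Q : nat -> M2) (y : B) (a k : nat) : M2 :=
  \sum_(j < a.+1 | (j + k <= a)%N)
    ((- y) ^+ (a - j - k) *+ ('C(a.-1, a - j) * 'C(a - j, k))) *: Q j.
Definition rmull (Q : nat -> nat -> M2) (W : int -> int -> M2) (x y : int) :=
  \sum_(a < (`|x| + `|y|).+2) \sum_(k < (`|x| + `|y|).+2)
    Q a k *m W (x + a%:Z) (y - k%:Z).
Definition rmulr (W : int -> int -> M2) (Q : nat -> nat -> M2) (x y : int) :=
  \sum_(a < (`|x| + `|y|).+2) \sum_(k < (`|x| + `|y|).+2)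
    W (x + a%:Z) (y - k%:Z) *m Q a k.
Definition pair12 (X Y : int -> 'M[B]_N) (x y : int) : M2 :=
  tens_at (ord0 : 'I_2) (X x) *m tens_at ord_max (Y y).
Definition pair21 (Y X : int -> 'M[B]_N) (x y : int) : M2 :=
  tens_at (ord_max : 'I_2) (Y y) *m tens_at ord0 (X x).

Definition bipair (i k : 'I_N) : 'I_(tdim N 2) :=
  enum_rank [ffun a : 'I_2 => if a == ord0 then i else k].

Lemma tidx_rank (f : {ffun 'I_2 -> 'I_N}) : tidx (enum_rank f : 'I_(tdim N 2)) = f.
Proof. exact: enum_rankK. Qed.

Lemma ord2 (a : 'I_2) : a = ord0 \/ a = ord_max.
Proof. by case: a => [[|[|//]] lt]; [left|right]; apply/val_inj. Qed.

Lemma tidx_bipair i k : (tidx (bipair i k) ord0 = i) * (tidx (bipair i k) ord_max = k).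
Proof. by rewrite /bipair tidx_rank !ffunE. Qed.

Lemma bipairK (x : 'I_(tdim N 2)) : bipair (tidx x ord0) (tidx x ord_max) = x.
Proof. by apply: tidx_inj => a; case: (ord2 a) => ->; rewrite tidx_bipair. Qed.

Lemma bipair_swap i k : enum_rank [ffun a => tidx (bipair i k) (tperm (ord0 : 'I_2) ord_max a)] = bipair k i.
Proof.
apply: tidx_inj => a; rewrite tidx_rank ffunE.
by case: (ord2 a) => ->; rewrite ?tpermL ?tpermR !tidx_bipair.
Qed.

Lemma pair12E X Y x y i k j l : pair12 X Y x y (bipair i k) (bipair j l) = X x i j * Y y k l.
Proof.
rewrite tens_at_pairE // !tidx_bipair ifT //; apply/forallP => a; apply/implyP => /andP[a0 a1].
by case: a a0 a1 => [[|[|//]] lt].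
Qed.

Lemma pair21E Y X x y i k j l : pair21 Y X x y (bipair i k) (bipair j l) = Y y k l * X x i j.
Proof.
rewrite tens_at_pairE // !tidx_bipair ifT //; apply/forallP => a; apply/implyP => /andP[a0 a1].
by case: a a0 a1 => [[|[|//]] lt].
Qed.

Lemma swapMl (W : M2) i k z : (P *m W) (bipair i k) z = W (bipair k i) z.
Proof. by rewrite tens_perm_mulE bipair_swap. Qed.

Lemma swapMr (W : M2) x j l : (W *m P) x (bipair j l) = W x (bipair l j).
Proof.
have PE z : P z (bipair j l) = (z == bipair l j)%:R.
  rewrite mxE; congr (_%:R); congr nat_of_bool; apply/forallP/eqP => [zE|-> a].
    rewrite -[z]bipairK; have /eqP := zE ord0; have /eqP := zE ord_max.
    by rewrite tpermL tpermR !tidx_bipair => -> ->.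
  by case: (ord2 a) => ->; rewrite ?tpermL ?tpermR !tidx_bipair.
rewrite mxE (bigD1 (bipair l j)) //= PE eqxx mulr1 big1 ?addr0 // => z ne_z.
by rewrite PE (negPf ne_z) mulr0.
Qed.

Definition defect (Q Q' : nat -> nat -> M2) X Y x y : M2 :=
  rmull Q (pair12 X Y) x y - rmulr (pair21 Y X) Q' x y.

Lemma defectE (al be al' be' : nat -> nat -> B) Q Q' X Y x y i k j l :
  (forall a b, Q a b = al a b *: (1 : M2) - be a b *: P) ->
  (forall a b, Q' a b = al' a b *: (1 : M2) - be' a b *: P) ->
  (forall a b z, al' a b * z = z * al' a b) -> (forall a b z, be' a b * z = z * be' a b) ->
  defect Q Q' X Y x y (bipair i k) (bipair j l) =
  \sum_(a < (`|x| + `|y|).+2) \sum_(b < (`|x| + `|y|).+2)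
     (al a b * (X (x + a%:Z) i j * Y (y - b%:Z) k l) - be a b * (X (x + a%:Z) k j * Y (y - b%:Z) i l))
  - \sum_(a < (`|x| + `|y|).+2) \sum_(b < (`|x| + `|y|).+2)
     (al' a b * (Y (y - b%:Z) k l * X (x + a%:Z) i j) - be' a b * (Y (y - b%:Z) k j * X (x + a%:Z) i l)).
Proof.
have linE (p r : B) (V W : M2) u v : (p *: V - r *: W) u v = p * V u v - r * W u v by rewrite !mxE.
move=> QE QE' alC beC; rewrite [LHS]mxE [X in _ + X]mxE; congr (_ - _); rewrite summxE; apply: eq_bigr => a _;
  rewrite summxE; apply: eq_bigr => b _.
  by rewrite QE mulmxBl -!scalemxAl mul1mx linE swapMl !pair12E.
have scC c (W : M2) V : (forall z, c * z = z * c) -> W *m (c *: V) = c *: (W *m V).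
  move=> cC; apply/matrixP => u v; rewrite !mxE mulr_sumr; apply: eq_bigr => z _.
  by rewrite mxE !mulrA cC.
by rewrite QE' mulmxBr !scC // mulmx1 linE swapMr !pair21E.
Qed.

(** [rexp] over a noncommutative ring. *)
Definition gexp (q : nat -> B) (y : B) a k : B :=
  \sum_(j < a.+1 | (j + k <= a)%N)
    ((- y) ^+ (a - j - k) *+ ('C(a.-1, a - j) * 'C(a - j, k))) * q j.

Lemma rexpandE (Q : nat -> M2) (q q' : nat -> B) y a k :
  (forall j, Q j = q j *: (1 : M2) - q' j *: P) ->
  rexpand Q y a k = gexp q y a k *: (1 : M2) - gexp q' y a k *: P.
Proof.
move=> QE; rewrite /rexpand /gexp !scaler_suml -sumrB; apply: eq_bigr => j _.
by rewrite QE scalerBr !scalerA.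
Qed.

Lemma rcoefE j : rcoef j = (j == 0%N)%:R *: (1 : M2) - ((j == 1%N)%:R * hB) *: P.
Proof.
case: j => [|[|j]] /=; rewrite ?scale1r ?scale0r ?mul0r ?mul1r ?scale0r ?subr0 ?sub0r //.
Qed.

Lemma rbcoefE j : rbcoef j = gB j *: (1 : M2) - (if j is j'.+1 then gB j' * hB else 0) *: P.
Proof.
rewrite /rbcoef big_ord_recr /= subnn; case: j => [|j].
  by rewrite big_ord0 add0r scale0r subr0.
rewrite big_ord_recr /= subSnn big1 ?add0r => [|i _]; last first.
  by rewrite subSn 1?ltnW // -(@subnSK _ j) ?scaler0 // ltn_ord.
by rewrite scalerN scalerA addrC.
Qed.

(** The parameter y only matters next to q j with j > 0: for j = 0 the binomial coefficient
    ['C(a.-1, a)] is 0 unless a = 0. *)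
Lemma eq_gexp (q : nat -> B) y y' a k :
  (forall d j, (0 < j)%N -> (- y) ^+ d * q j = (- y') ^+ d * q j) -> gexp q y a k = gexp q y' a k.
Proof.
move=> yq; apply: eq_bigr => j jk; case: (posnP j) => [->|j0]; last first.
  by rewrite !mulrnAl yq.
by rewrite subn0; case: a {j jk} => [|a]; [case: k | rewrite bin_small // !mulr0n].
Qed.

Lemma gexp0 (q : nat -> B) a k :
  gexp q 0 a k = (if (k == 0%N) && (a == 0%N) then q 0%N else 0) + (if (k < a)%N then q (a - k)%N *+ 'C(a.-1, k) else 0).
Proof.
rewrite /gexp oppr0.
have term (j : 'I_a.+1) : (j + k <= a)%N -> (a - k)%N != j ->
    0 ^+ (a - j - k) *+ ('C(a.-1, a - j) * 'C(a - j, k)) * q j = 0.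
  move=> jk ne; rewrite expr0n; have -> : (a - j - k == 0)%N = false by lia.
  by rewrite mul0rn mul0r.
case: (leqP k a) => ka; last first.
  rewrite big_pred0 => [|j]; last by apply/negbTE; rewrite -ltnNge; lia.
  have -> : (k == 0%N) && (a == 0%N) = false by lia.
  by rewrite add0r ifF //; apply/negbTE; lia.
have lt : (a - k < a.+1)%N by lia.
rewrite (bigD1 (Ordinal lt)) /= ?subnK // big1 ?addr0 => [|j /andP[jk ne]]; last first.
  by apply: term => //; apply: contraNneq ne => e; apply/eqP/val_inj.
rewrite subKn // subnn expr0 binn muln1 mulrnAl mul1r.
case: ltnP => ak; first by rewrite ifF ?add0r //; apply/negbTE; lia.
have -> : k = a by lia.
by rewrite addr0 subnn; case: a {term ka lt ak} => [|a]; rewrite ?mulr1n // bin_small //.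
Qed.

(** The expansion of 1/(u - v) as the sum of the v^k u^(-k-1). *)
Lemma rcoef_expand a k :
  rexpand rcoef 0 a k = ((a == 0%N) && (k == 0%N))%:R *: (1 : M2) - ((a == k.+1)%:R * hB) *: P.
Proof.
rewrite (rexpandE _ _ _ rcoefE) !gexp0; congr (_ *: _ - _ *: _).
  rewrite [X in _ + X](_ : _ = 0) ?addr0; first by rewrite andbC; case: andb.
  by case: ltnP => // ka; rewrite (_ : (a - k == 0)%N = false) ?mul0rn //; lia.
rewrite /= mul0r if_same add0r; case: (leqP a k) => ka.
  by rewrite (_ : (a == k.+1) = false) ?mul0r //; lia.
case: (eqVneq a k.+1) => [->|ne]; first by rewrite subSnn binn mulr1n.
by rewrite (_ : (a - k == 1)%N = false) ?mul0r ?mul0rn //; lia.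
Qed.

Hypothesis hBC : forall z, hB * z = z * hB.

Lemma rcoef_defectE X Y x y i k j l :
  defect (rexpand rcoef 0) (rexpand rcoef 0) X Y x y (bipair i k) (bipair j l) =
  X x i j * Y y k l - Y y k l * X x i j
  - hB * \sum_(b < (`|x| + `|y|).+1) (X (x + b.+1%:Z) k j * Y (y - b%:Z) i l - Y (y - b%:Z) k j * X (x + b.+1%:Z) i l).
Proof.
rewrite (defectE X Y x y i k j l rcoef_expand rcoef_expand); first last.
- by move=> a b z; rewrite -mulrA hBC !mulrA mulr_natl mulr_natr.
- by move=> a b z; rewrite mulr_natl mulr_natr.
set n := (`|x| + `|y|)%N.
have dsum (f f' : nat -> nat -> B) :
    \sum_(a < n.+2) \sum_(b < n.+2) (((a == 0%N :> nat) && (b == 0%N :> nat))%:R * f a b - (a == b.+1 :> nat)%:R * hB * f' a b)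
    = f 0%N 0%N - \sum_(b < n.+1) hB * f' b.+1 b.
  under eq_bigr do rewrite sumrB.
  rewrite sumrB; congr (_ - _).
    rewrite big_ord_recl [X in _ + X]big1 ?addr0 => [|a _]; last first.
      by rewrite big1 // => b _; rewrite mul0r.
    by rewrite big_ord_recl /= mul1r big1 ?addr0 // => b _; rewrite mul0r.
  rewrite big_ord_recl [X in X + _]big1 ?add0r => [|b _]; last by rewrite !mul0r.
  apply: eq_bigr => a _; rewrite (bigD1 (widen_ord (leqnSn _) a)) //= eqxx mul1r big1 ?addr0 // => b /eqP ne.
  rewrite (_ : (_ == _) = false) ?mul0r //; apply/eqP => /= e; apply: ne; apply/val_inj => /=; move: e.
  by rewrite /bump /= add1n => -[].
rewrite (dsum (fun a b => X (x + a%:Z) i j * Y (y - b%:Z) k l) (fun a b => X (x + a%:Z) k j * Y (y - b%:Z) i l)).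
rewrite (dsum (fun a b => Y (y - b%:Z) k l * X (x + a%:Z) i j) (fun a b => Y (y - b%:Z) k j * X (x + a%:Z) i l)).
have ac (u s v t : B) : u - s - (v - t) = u - v - (s - t).
  by rewrite !opprB -!addrA [- s + _]addrCA [- v + _]addrCA [- s + _]addrC.
rewrite addr0 subr0 mulr_sumr ac -sumrB; congr (_ - _).
by apply: eq_bigr => b _; rewrite mulrBr.
Qed.

End SeriesRelations.

Section MapSeries.
Variables (N m : nat) (B B' : pzRingType) (phi : {rmorphism B -> B'}).

Lemma map_tens_at a (X : 'M[B]_N) : map_mx phi (tens_at a X : 'M_(tdim N m)) = tens_at a (map_mx phi X).
Proof. by apply/matrixP => x z; rewrite !mxE; case: ifP => _; rewrite ?mxE ?rmorph0. Qed.

Lemma map_tens_perm (s : 'S_m) : map_mx phi (tens_perm N B s) = tens_perm N B' s.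
Proof. by apply/matrixP => x z; rewrite !mxE rmorph_nat. Qed.

End MapSeries.

Section MapDefect.
Variables (N : nat) (B B' : pzRingType) (phi : {rmorphism B -> B'}).
Local Notation "X ^phi" := (map_mx phi X) (at level 2).

Lemma map_defect (Q Q' : nat -> nat -> 'M[B]_(tdim N 2)) X Y x y :
  (defect Q Q' X Y x y)^phi =
  defect (fun a b => (Q a b)^phi) (fun a b => (Q' a b)^phi) (fun a => (X a)^phi) (fun a => (Y a)^phi) x y.
Proof.
rewrite /defect map_mxB; congr (_ - _); rewrite map_mx_sum; apply: eq_bigr => a _;
  by rewrite map_mx_sum; apply: eq_bigr => b _; rewrite !map_mxM !map_tens_at.
Qed.

Lemma map_rexpand (Q : nat -> 'M[B]_(tdim N 2)) y a k :
  (rexpand Q y a k)^phi = rexpand (fun j => (Q j)^phi) (phi y) a k.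
Proof.
rewrite map_mx_sum; apply: eq_bigr => j _; rewrite map_mxZ rmorphMn rmorphXn rmorphN.
by [].
Qed.

Lemma map_rcoef hB j : (rcoef N hB j)^phi = rcoef N (phi hB) j.
Proof.
by case: j => [|[|j]]; rewrite ?map_mx1 ?map_mxN ?map_mxZ ?map_tens_perm ?map_mx0.
Qed.

Lemma map_rbcoef hB gB j : (rbcoef N hB gB j)^phi = rbcoef N (phi hB) (phi \o gB) j.
Proof. by rewrite map_mx_sum; apply: eq_bigr => i _; rewrite map_mxZ map_rcoef. Qed.

Lemma eq_rexpand (Q Q' : nat -> 'M[B]_(tdim N 2)) y : Q =1 Q' -> rexpand Q y =2 rexpand Q' y.
Proof. by move=> QQ a k; apply: eq_bigr => j _; rewrite QQ. Qed.

Lemma eq_defect (Q1 Q1' Q2 Q2' : nat -> nat -> 'M[B]_(tdim N 2)) X X' Y Y' x y :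
  Q1 =2 Q1' -> Q2 =2 Q2' -> X =1 X' -> Y =1 Y' ->
  defect Q1 Q2 X Y x y = defect Q1' Q2' X' Y' x y.
Proof.
move=> e1 e2 eX eY; congr (_ - _); apply: eq_bigr => a _; apply: eq_bigr => b _;
  by rewrite /pair12 /pair21 ?e1 ?e2 eX eY.
Qed.

End MapDefect.

Section MapRelations.
Variables (N : nat) (B B' : pzRingType) (phi : {rmorphism B -> B'}) (hB : B) (gB : nat -> B).
Variables (X Y : int -> 'M[B]_N) (X' Y' : int -> 'M[B']_N).
Hypotheses (XE : forall a, map_mx phi (X a) = X' a) (YE : forall a, map_mx phi (Y a) = Y' a).

Lemma map_rcoef_defect x y i j :
  phi (defect (rexpand (rcoef N hB) 0) (rexpand (rcoef N hB) 0) X Y x y i j) =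
  defect (rexpand (rcoef N (phi hB)) 0) (rexpand (rcoef N (phi hB)) 0) X' Y' x y i j.
Proof.
set D := defect _ _ _ _ _ _; transitivity (map_mx phi D i j); first by rewrite [RHS]mxE.
rewrite map_defect.
congr fun_of_matrix; apply: eq_defect => // a b;
  by rewrite map_rexpand rmorph0; apply: eq_rexpand => k; rewrite map_rcoef.
Qed.

Lemma map_rbcoef_defect w z x y i j :
  phi (defect (rexpand (rbcoef N hB gB) w) (rexpand (rbcoef N hB gB) z) X Y x y i j) =
  defect (rexpand (rbcoef N (phi hB) (phi \o gB)) (phi w))
    (rexpand (rbcoef N (phi hB) (phi \o gB)) (phi z)) X' Y' x y i j.
Proof.
set D := defect _ _ _ _ _ _; transitivity (map_mx phi D i j); first by rewrite [RHS]mxE.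
rewrite map_defect.
congr fun_of_matrix; apply: eq_defect => // a b;
  by rewrite map_rexpand; apply: eq_rexpand => k; rewrite map_rbcoef.
Qed.

End MapRelations.

Section RelationsFromDefects.
Variables (N : nat) (B : pzRingType) (hB : B).
Hypothesis hBC : forall z, hB * z = z * hB.
Variables (T Tp : nat -> 'M[B]_N).
Local Notation M2 := 'M[B]_(tdim N 2).
Local Notation P := (tens_perm N B (tperm (ord0 : 'I_2) ord_max)).
Local Notation Q := (rexpand (rcoef N hB) 0).

Lemma atN_neg r : atN T (- r%:Z) = T r.
Proof. by rewrite /atN oppr_le0 lez_nat leq0n abszN absz_nat. Qed.

Lemma atP_nat r : atP Tp r%:Z = Tp r.
Proof. by rewrite /atP lez_nat leq0n absz_nat. Qed.

Lemma atN_sub r a : atN T (- r%:Z + a%:Z) = if (a <= r)%N then T (r - a)%N else 0.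
Proof.
rewrite /atN; case: (leqP a r) => ar; last by rewrite ifF //; apply/negbTE; lia.
by rewrite ifT; [congr T; lia | lia].
Qed.

Lemma atP_sub r a : atP Tp (r%:Z - a%:Z) = if (a <= r)%N then Tp (r - a)%N else 0.
Proof.
rewrite /atP; case: (leqP a r) => ar; last by rewrite ifF //; apply/negbTE; lia.
by rewrite ifT; [congr Tp; lia | lia].
Qed.

Lemma sum_ord_cut (f g : nat -> B) n p : (n <= p)%N ->
  (forall b, (n <= b)%N -> f b = 0) -> (forall b, (b < n)%N -> f b = g b) ->
  \sum_(b < p) f b = \sum_(b < n) g b.
Proof.
move=> np f0 fg; rewrite [RHS](big_ord_widen p g np) [RHS]big_mkcond; apply: eq_bigr => b _.
by case: ltnP => [/fg//|/f0].
Qed.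

(** [G] is a sum along the expansion of 1/(u - v). In the difference of two neighbouring cases only
    its first term remains: this undoes the division by u - v. *)
Lemma relN_of_defect :
  (forall x y i j, defect Q Q (atN T) (atN T) x y i j = 0) -> forall r s i j k l,
  T r.+1 i j * T s k l - T s k l * T r.+1 i j - (T r i j * T s.+1 k l - T s.+1 k l * T r i j)
  = hB * (T r k j * T s i l - T s k j * T r i l).
Proof.
move=> D0; have G r s i j k l : T r i j * T s k l - T s k l * T r i j =
    hB * \sum_(b < r) (T (r - b.+1)%N k j * T (s + b)%N i l - T (s + b)%N k j * T (r - b.+1)%N i l).
  have /eqP := D0 (- r%:Z) (- s%:Z) (bipair i k) (bipair j l).
  rewrite rcoef_defectE // subr_eq0 !atN_neg => /eqP ->; congr (_ * _).
  apply: (sum_ord_cut (f := fun b => atN T (- r%:Z + b.+1%:Z) k j * atN T (- s%:Z - b%:Z) i l -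
    atN T (- s%:Z - b%:Z) k j * atN T (- r%:Z + b.+1%:Z) i l)
    (g := fun b => T (r - b.+1)%N k j * T (s + b)%N i l - T (s + b)%N k j * T (r - b.+1)%N i l)).
  - by lia.
  - by move=> b rb; rewrite atN_sub ltnNge rb mxE mul0r [X in _ * X]mxE mulr0 subr0.
  by move=> b rb; rewrite atN_sub rb -opprD -PoszD atN_neg.
move=> r s i j k l; rewrite !G -mulrBr big_ord_recl subn1 addn0; congr (_ * _).
rewrite -[RHS]addr0 -addrA; congr (_ + _).
by rewrite -sumrB big1 // => b _; rewrite lift0 subSS addnS subrr.
Qed.

Lemma relP_of_defect :
  (forall x y i j, defect Q Q (atP Tp) (atP Tp) x y i j = 0) -> forall r s i j k l,
  (if r is r'.+1 then Tp r' i j * Tp s k l - Tp s k l * Tp r' i j else 0)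
  - (if s is s'.+1 then Tp r i j * Tp s' k l - Tp s' k l * Tp r i j else 0)
  = hB * (Tp r k j * Tp s i l - Tp s k j * Tp r i l).
Proof.
move=> D0.
have G r s i j k l : (if r is r'.+1 then Tp r' i j * Tp s k l - Tp s k l * Tp r' i j else 0) =
    hB * \sum_(b < s.+1) (Tp (r + b)%N k j * Tp (s - b)%N i l - Tp (s - b)%N k j * Tp (r + b)%N i l).
  (* For r = 0 the exponent is negative and [atP] gives 0, in agreement with the [if] of the
     statement. *)
  have /eqP := D0 (r%:Z - 1) s (bipair i k) (bipair j l).
  rewrite rcoef_defectE // subr_eq0 atP_nat => /eqP e.
  transitivity (atP Tp (r%:Z - 1) i j * Tp s k l - Tp s k l * atP Tp (r%:Z - 1) i j).
    rewrite -[1]/(1%N%:Z) atP_sub; case: r {e} => [|r] /=; first by rewrite mxE mul0r mulr0 subr0.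
    by rewrite subn1.
  rewrite e; congr (_ * _).
  apply: (sum_ord_cut (f := fun b => atP Tp (r%:Z - 1 + b.+1%:Z) k j * atP Tp (s%:Z - b%:Z) i l -
    atP Tp (s%:Z - b%:Z) k j * atP Tp (r%:Z - 1 + b.+1%:Z) i l)
    (g := fun b => Tp (r + b)%N k j * Tp (s - b)%N i l - Tp (s - b)%N k j * Tp (r + b)%N i l)).
  - by lia.
  - by move=> b sb; rewrite atP_sub leqNgt sb mxE mulr0 [X in X * _]mxE mul0r subr0.
  move=> b sb; rewrite atP_sub -ltnS sb -addrA (_ : - 1 + b.+1%:Z = b%:Z) -?PoszD ?atP_nat //.
  by rewrite -addn1 PoszD addrCA addNr addr0.
have G' r s i j k l : (if s is s'.+1 then Tp r i j * Tp s' k l - Tp s' k l * Tp r i j else 0) =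
    hB * \sum_(b < s) (Tp (r + b.+1)%N k j * Tp (s - b.+1)%N i l - Tp (s - b.+1)%N k j * Tp (r + b.+1)%N i l).
  have /eqP := D0 r (s%:Z - 1) (bipair i k) (bipair j l).
  rewrite rcoef_defectE // subr_eq0 atP_nat => /eqP e.
  transitivity (Tp r i j * atP Tp (s%:Z - 1) k l - atP Tp (s%:Z - 1) k l * Tp r i j).
    rewrite -[1]/(1%N%:Z) atP_sub; case: s {e} => [|s] /=; first by rewrite mxE mul0r mulr0 subr0.
    by rewrite subn1.
  rewrite e; congr (_ * _).
  apply: (sum_ord_cut (f := fun b => atP Tp (r%:Z + b.+1%:Z) k j * atP Tp (s%:Z - 1 - b%:Z) i l -
    atP Tp (s%:Z - 1 - b%:Z) k j * atP Tp (r%:Z + b.+1%:Z) i l)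
    (g := fun b => Tp (r + b.+1)%N k j * Tp (s - b.+1)%N i l - Tp (s - b.+1)%N k j * Tp (r + b.+1)%N i l)).
  - by lia.
  - move=> b sb; rewrite (_ : s%:Z - 1 - b%:Z = s%:Z - b.+1%:Z); last by lia.
    by rewrite atP_sub ltnNge sb mxE mulr0 [X in X * _]mxE mul0r subr0.
  move=> b sb; rewrite (_ : s%:Z - 1 - b%:Z = s%:Z - b.+1%:Z); last by lia.
  by rewrite -PoszD atP_sub sb atP_nat.
move=> r s i j k l; rewrite G G' -mulrBr big_ord_recl subn0 addn0; congr (_ * _).
rewrite -[RHS]addr0 -addrA; congr (_ + _).
by rewrite -sumrB big1 // => b _; rewrite lift0 subrr.
Qed.

Variables (al be al' be' : nat -> nat -> B) (Q1 Q2 : nat -> nat -> M2).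
Hypothesis Q1E : forall a b, Q1 a b = al a b *: (1 : M2) - be a b *: P.
Hypothesis Q2E : forall a b, Q2 a b = al' a b *: (1 : M2) - be' a b *: P.
Hypotheses (alC : forall a b z, al' a b * z = z * al' a b) (beC : forall a b z, be' a b * z = z * be' a b).

Lemma relX_of_defect :
  (forall x y i j, defect Q1 Q2 (atN T) (atP Tp) x y i j = 0) -> forall r s i j k l,
  \sum_(a < r.+1) \sum_(b < s.+1)
    (al a b * (T (r - a)%N i j * Tp (s - b)%N k l) - be a b * (T (r - a)%N k j * Tp (s - b)%N i l)) =
  \sum_(a < r.+1) \sum_(b < s.+1)
    (al' a b * (Tp (s - b)%N k l * T (r - a)%N i j) - be' a b * (Tp (s - b)%N k j * T (r - a)%N i l)).
Proof.
move=> D0 r s i j k l; have /eqP := D0 (- r%:Z) s%:Z (bipair i k) (bipair j l).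
rewrite (defectE (atN T) (atP Tp) (- r%:Z) s%:Z i k j l Q1E Q2E) // subr_eq0 => /eqP e.
pose f (f1 f2 : nat -> nat -> B) (G : 'M[B]_N -> 'M[B]_N -> B -> B -> B) a b :=
  G (atN T (- r%:Z + a%:Z)) (atP Tp (s%:Z - b%:Z)) (f1 a b) (f2 a b).
have cut f1 f2 G p q : (r < p)%N -> (s < q)%N ->
    (forall X x y, G 0 X x y = 0) -> (forall X x y, G X 0 x y = 0) ->
    \sum_(a < p) \sum_(b < q) f f1 f2 G a b =
    \sum_(a < r.+1) \sum_(b < s.+1) G (T (r - a)%N) (Tp (s - b)%N) (f1 a b) (f2 a b).
  move=> rp sq G0l G0r; apply: (sum_ord_cut (f := fun a => \sum_(b < q) f f1 f2 G a b)
    (g := fun a => \sum_(b < s.+1) G (T (r - a)%N) (Tp (s - b)%N) (f1 a b) (f2 a b)) rp) => a ra.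
    by rewrite big1 // => b _; rewrite /f atN_sub leqNgt ra.
  apply: (sum_ord_cut (f := fun b => f f1 f2 G a b)
    (g := fun b => G (T (r - a)%N) (Tp (s - b)%N) (f1 a b) (f2 a b)) sq) => b sb.
    by rewrite /f atP_sub leqNgt sb.
  by rewrite /f atN_sub atP_sub -ltnS ra -ltnS sb.
have [rp sp] : (r < (`|- r%:Z| + `|s%:Z|).+2)%N /\ (s < (`|- r%:Z| + `|s%:Z|).+2)%N by lia.
have m0 i' j' : (0 : 'M[B]_N) i' j' = 0 by rewrite mxE.
have c1 := cut al be (fun X Y x y => x * (X i j * Y k l) - y * (X k j * Y i l)) _ _ rp sp.
have c2 := cut al' be' (fun X Y x y => x * (Y k l * X i j) - y * (Y k j * X i l)) _ _ rp sp.
by rewrite -c1 ?e -?c2 // => X x y; rewrite !m0 ?(mulr0, mul0r) subrr.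
Qed.

End RelationsFromDefects.

Section VanishingDefect.
Variables (N : nat) (B : pzRingType) (hB : B) (X Y : int -> 'M[B]_N) (u v : int -> B).
Hypothesis hBC : forall z, hB * z = z * hB.
Hypotheses (uC : forall a z, u a * z = z * u a) (vC : forall a z, v a * z = z * v a).
Hypothesis hX : forall a i j, hB * X a i j = hB * u a * (i == j)%:R.
Hypothesis hY : forall a i j, hB * Y a i j = hB * v a * (i == j)%:R.
Hypothesis XYC : forall a b i j k l, X a i j * Y b k l = Y b k l * X a i j.
Local Notation M2 := 'M[B]_(tdim N 2).
Local Notation P := (tens_perm N B (tperm (ord0 : 'I_2) ord_max)).

Let hXY p q i j k l : hB * (X p i j * Y q k l) = hB * (Y q i j * X p k l).
Proof.
rewrite !mulrA hX hY !mulr_natr !mulrnAl; congr (_ *+ _).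
rewrite [hB * u p]hBC [hB * v q]hBC -!mulrA hX hY !mulr_natr !mulrnAr; congr (_ *+ _).
by rewrite uC vC -!mulrA uC.
Qed.

(** The part of R with P has a factor h, next to which X and Y are scalar matrices and P can be
    moved across; the rest is the commutativity of the entries. *)
Lemma defect_vanish (al be : nat -> nat -> B) (Q Q' : nat -> nat -> M2) x y i j :
  (forall a b, Q a b = al a b *: (1 : M2) - (be a b * hB) *: P) ->
  (forall a b, Q' a b = al a b *: (1 : M2) - (be a b * hB) *: P) ->
  (forall a b z, al a b * z = z * al a b) -> (forall a b z, be a b * z = z * be a b) ->
  defect Q Q' X Y x y i j = 0.
Proof.
move=> QE QE' alC beC; rewrite -(bipairK i) -(bipairK j).
rewrite (defectE X Y x y _ _ _ _ QE QE') //; last by move=> a b z; rewrite -mulrA hBC !mulrA beC.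
rewrite -sumrB big1 // => a _; rewrite -sumrB big1 // => b _.
by rewrite XYC -!mulrA hXY subrr.
Qed.

End VanishingDefect.

(** * Quotient rings, the free algebra and multiplication by h *)

Section QuotientRing.
Variables (B : pzRingType) (J : B -> Prop).

Lemma rproj_is_zmod_morphism : zmod_morphism (rproj J).
Proof.
move=> x y; rewrite -[x in LHS](subrK y) addrK.
by apply/(canRL (addrK _)); rewrite -rprojD subrK.
Qed.

Lemma rproj_is_monoid_morphism : monoid_morphism (rproj J).
Proof. by split=> [|x y] //; apply: rprojM. Qed.

HB.instance Definition _ := GRing.isZmodMorphism.Build B (rquot J) (rproj J) rproj_is_zmod_morphism.
HB.instance Definition _ := GRing.isMonoidMorphism.Build B (rquot J) (rproj J) rproj_is_monoid_morphism.

Lemma rproj_surj y : exists x, rproj J x = y.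
Proof. by exists (rlift y); rewrite rliftK. Qed.

Lemma rproj_gen x : J x -> rproj J x = 0.
Proof.
move=> Jx; rewrite -(rproj0 J); apply/rprojE; rewrite subr0.
by apply/asboolP => I _; apply.
Qed.

Lemma rproj_ker x : two_sided_ideal J -> rproj J x = 0 -> J x.
Proof.
move=> idJ; rewrite -(rproj0 J) => /rprojE; rewrite subr0 => /asboolP; exact.
Qed.

End QuotientRing.

Section MonoidAlgebra.
Variables (I : choiceType) (K : comNzRingType).
Local Notation A := {malg K[{fmonom I}]}.

Lemma malg_scal_mul (k : K) (x : A) : k *: x = k%:A * x.
Proof. by rewrite -scalerAl mul1r. Qed.

Lemma malg_scal_central (k : K) (x : A) : k%:A * x = x * k%:A.
Proof.
rewrite -malg_scal_mul; have -> : k%:A = k%:MP :> A by rewrite -mul_malgC mulr1.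
rewrite -mul_malgC !malgM_def fgmulUg fgmulgU; apply: eq_bigr => m _.
by rewrite mulrC mul1m mulm1.
Qed.

Lemma malg_gen_ind (P : A -> Prop) :
  (forall x y, P x -> P y -> P (x + y)) -> (forall x y, P x -> P y -> P (x * y)) ->
  (forall k : K, P k%:A) -> (forall i, P (mkmalgU (fmu i) 1)) -> forall x, P x.
Proof.
move=> PD PM Pk Pg x; rewrite [x]monalgE; apply: big_ind => //.
  by rewrite -[0](scale0r 1); apply: Pk.
move=> m _; have -> : mkmalgU m x@_m = (x@_m)%:A * mkmalgU m 1 :> A.
  by rewrite -malg_scal_mul; apply/malgP => u; rewrite (mcoeffZ x@_m) !mcoeffU mulrnAr mulr1.
apply: (PM) => //; case: m => s; elim: s => [|i s IHs].
  have -> : FMonom [::] = mone :> {fmonom I} by apply/eqP; rewrite fmP fm1.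
  by have := Pk 1; rewrite scale1r.
have -> : mkmalgU (FMonom (i :: s)) 1 = mkmalgU (fmu i) 1 * mkmalgU (FMonom s) 1 :> A.
  by rewrite malgM_def fgmulUU mulr1; congr (mkmalgU _ 1); apply/val_inj; rewrite /= fmM fmU.
exact: PM.
Qed.

End MonoidAlgebra.

Section HPower.
Variable F : comNzRingType.
Local Notation h := (fvar F).

Lemma fvar_mul (f : fps F) i : fcoef (h * f) i = if i is i'.+1 then fcoef f i' else 0.
Proof.
rewrite -[h * f]/(fps_mul h f) /=; case: i => [|i]; first by rewrite big_ord1 mul0r.
rewrite big_ord_recl mul0r add0r big_ord_recl /= mul1r subSS subn0.
by rewrite big1 ?addr0 // => j _; rewrite /= mul0r.
Qed.

Lemma fvar_inj (f : fps F) : h * f = 0 -> f = 0.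
Proof. by move=> hf; apply: fps_ext => i; have := congr1 (fun f => fcoef f i.+1) hf; rewrite fvar_mul. Qed.

Lemma fconst_is_zmod_morphism : zmod_morphism (@fconst F).
Proof. by move=> x y; apply: fps_ext => -[|i] //=; rewrite ?subrr // oppr0 addr0. Qed.

Lemma fconst_is_monoid_morphism : monoid_morphism (@fconst F).
Proof.
split=> [|x y]; apply: fps_ext => -[|i] //=; first by rewrite big_ord1.
by rewrite big1 // => j _; case: (val j) => [|k] /=; rewrite ?mulr0 ?mul0r.
Qed.

End HPower.
HB.instance Definition _ (F : comNzRingType) :=
  GRing.isZmodMorphism.Build _ _ (@fconst F) (@fconst_is_zmod_morphism F).
HB.instance Definition _ (F : comNzRingType) :=
  GRing.isMonoidMorphism.Build _ _ (@fconst F) (@fconst_is_monoid_morphism F).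

Lemma malg_fvar_inj (I : choiceType) (F : comNzRingType) (x : {malg (fps F)[{fmonom I}]}) :
  fvar F *: x = 0 -> x = 0.
Proof.
move=> hx; apply/malgP => m; rewrite mcoeff0; apply: fvar_inj.
by rewrite -mcoeffZ hx mcoeff0.
Qed.

(** * Divisibility of the relations by h^2 *)

Section Presentation.
Variables (F : numFieldType) (N : nat) (Fr Y : pzRingType) (kF : {rmorphism fps F -> Fr}).
Local Notation h := (fvar F).
Hypothesis kFC : forall k x, kF k * x = x * kF k.
Hypothesis hinj : forall x, kF h * x = 0 -> x = 0.
Variables (T Tp t tp : nat -> 'M[Fr]_N) (w : Fr) (c : F) (g : nat -> F).
Hypotheses (T0 : T 0%N = 1) (TS : forall r i j, T r.+1 i j = kF h * t r i j).
Hypothesis TpE : forall r i j, Tp r i j = ((r == 0%N) && (i == j))%:R - kF h * tp r i j.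
Variables (D : {rmorphism Fr -> Y}) (C : Fr).
Hypotheses (wE : w = kF (fconst 2^-1 * h) * C) (DC : D C = D (kF (fconst c))).
Local Notation Q0 := (rexpand (rcoef N (kF h)) 0).
Let gB i := kF (fconst (g i) * h ^+ i).
Local Notation Qb y := (rexpand (rbcoef N (kF h) gB) y).
Hypothesis DrelN : forall x y i j n z,
  kF (h ^+ n) * z = defect Q0 Q0 (atN T) (atN T) x y i j -> D z = 0.
Hypothesis DrelP : forall x y i j n z,
  kF (h ^+ n) * z = defect Q0 Q0 (atP Tp) (atP Tp) x y i j -> D z = 0.
Hypothesis DrelX : forall x y i j n z,
  kF (h ^+ n) * z = defect (Qb w) (Qb (- w)) (atN T) (atP Tp) x y i j -> D z = 0.

Let sq_ideal z := exists x, z = kF (h ^+ 2) * x.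
Let B2 : pzRingType := rquot sq_ideal.
Let p2 : {rmorphism Fr -> B2} := rproj sq_ideal.

Let sq_ideal_two_sided : two_sided_ideal sq_ideal.
Proof.
split=> [|x y [x' ->] [y' ->]|x y [x' ->]]; first by exists 0; rewrite mulr0.
  by exists (x' - y'); rewrite mulrBr.
by split; [exists (y * x'); rewrite mulrA -kFC mulrA | exists (x' * y); rewrite mulrA].
Qed.

Let p2_h2 x : p2 (kF (h ^+ 2) * x) = 0.
Proof. by apply: rproj_gen; exists x. Qed.

Let p2_surj z : exists x, p2 x = z. Proof. exact: rproj_surj. Qed.
Let p2M x y : p2 (x * y) = p2 x * p2 y. Proof. exact: rmorphM. Qed.

Let H2 : B2 := p2 (kF h).
Let H2C z : H2 * z = z * H2.
Proof. by have [x <-] := p2_surj z; rewrite -!p2M kFC. Qed.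
Let H22 z : H2 * (H2 * z) = 0.
Proof.
have [x <-] := p2_surj z; have -> : H2 * (H2 * p2 x) = p2 (kF (h ^+ 2) * x) by rewrite expr2 (rmorphM kF) -mulrA !p2M.
exact: p2_h2.
Qed.

Let comm2 b b' (x x' : Fr) : p2 (b%:R + kF h * x) * p2 (b'%:R + kF h * x') =
  p2 (b'%:R + kF h * x') * p2 (b%:R + kF h * x).
Proof.
rewrite !rmorphD !rmorphM !rmorph_nat -/H2 !mulrDl !mulrDr.
rewrite -!(nat_central b) -!(nat_central b') -!natrM mulnC -!addrA; congr (_ + _).
rewrite addrCA; congr (_ + (_ + _)).
by rewrite -!mulrA ![p2 _ * (H2 * _)]mulrA -!H2C -!mulrA !H22.
Qed.

Let TE r i j : exists x, T r i j = ((r == 0%N) && (i == j))%:R + kF h * x.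
Proof.
case: r => [|r]; first by exists 0; rewrite T0 mxE mulr0 addr0; case: (i == j).
by exists (t r i j); rewrite add0r TS.
Qed.

Let TpE' r i j : exists x, Tp r i j = ((r == 0%N) && (i == j))%:R + kF h * x.
Proof. by exists (- tp r i j); rewrite TpE mulrN. Qed.

Let near f (f' : int -> 'M[Fr]_N) := forall (a : int) i j, exists x,
  f' a i j = ((f a : nat) * (i == j))%:R + kF h * x.

Let near_T : near (fun a => a == 0) (atN T).
Proof.
move=> a i j; rewrite /atN; case: ifP => a0.
  by have [x ->] := TE `|a| i j; exists x; rewrite absz_eq0 mulnb.
by exists 0; rewrite mxE mulr0 addr0; case: eqP a0 => [->//|_ _]; rewrite mul0n.
Qed.

Let near_Tp : near (fun a => a == 0) (atP Tp).
Proof.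
move=> a i j; rewrite /atP; case: ifP => a0.
  by have [x ->] := TpE' `|a| i j; exists x; rewrite absz_eq0 mulnb.
by exists 0; rewrite mxE mulr0 addr0; case: eqP a0 => [->//|_ _]; rewrite mul0n.
Qed.

Let vanish2 (al be : nat -> nat -> B2) (q q' : nat -> nat -> 'M[B2]_(tdim N 2)) X X' x y i j :
  near (fun a => a == 0) X -> near (fun a => a == 0) X' ->
  (forall a b, q a b = al a b *: (1 : 'M_(tdim N 2)) - (be a b * H2) *: tens_perm N B2 (tperm (ord0 : 'I_2) ord_max)) ->
  (forall a b, q' a b = al a b *: (1 : 'M_(tdim N 2)) - (be a b * H2) *: tens_perm N B2 (tperm (ord0 : 'I_2) ord_max)) ->
  (forall a b z, al a b * z = z * al a b) -> (forall a b z, be a b * z = z * be a b) ->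
  defect q q' (fun a => map_mx p2 (X a)) (fun a => map_mx p2 (X' a)) x y i j = 0.
Proof.
move=> nX nX' qE qE' alC beC.
have hE Z : near (fun a => a == 0) Z -> forall a i j,
    H2 * map_mx p2 (Z a) i j = H2 * (a == 0)%:R * (i == j)%:R.
  move=> nZ a u v; rewrite mxE; have [z ->] := nZ a u v.
  by rewrite rmorphD rmorphM rmorph_nat mulrDr H22 addr0 natrM mulrA.
apply: (@defect_vanish _ _ H2 _ _ (fun a => (a == 0)%:R) (fun a => (a == 0)%:R) H2C _ _ (hE X nX) (hE X' nX') _
  al be q q' x y i j qE qE' alC beC) => [a z|a z|]; rewrite ?nat_central //.
by move=> a b u v k l; rewrite !mxE; have [z ->] := nX a u v; have [z' ->] := nX' b k l; apply: comm2.
Qed.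

Let defect_h2 (q q' : nat -> nat -> 'M[Fr]_(tdim N 2)) X X' x y i j :
  p2 (defect q q' X X' x y i j) = 0 -> exists z, defect q q' X X' x y i j = kF (h ^+ 2) * z.
Proof. exact: rproj_ker. Qed.

Let natB (b : bool) (z : B2) : b%:R * z = z * b%:R.
Proof. exact: nat_central. Qed.

(** T is the identity plus a multiple of h, so modulo h^2 its entries commute and [defect_vanish]
    applies. The quotient by h^2 is itself a relation, because [dyrel] cancels powers of h. *)
Lemma defectN_h2 x y i j : exists2 z, D z = 0 & defect Q0 Q0 (atN T) (atN T) x y i j = kF (h ^+ 2) * z.
Proof.
have [|z zE] := @defect_h2 Q0 Q0 (atN T) (atN T) x y i j; last by exists z => //; exact: DrelN (esym zE).
rewrite (@map_rcoef_defect _ _ _ p2 (kF h) _ _ _ _ (fun=> erefl) (fun=> erefl)).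
by apply: (vanish2 _ _ _ _ near_T near_T (rcoef_expand N H2) (rcoef_expand N H2)).
Qed.

Lemma defectP_h2 x y i j : exists2 z, D z = 0 & defect Q0 Q0 (atP Tp) (atP Tp) x y i j = kF (h ^+ 2) * z.
Proof.
have [|z zE] := @defect_h2 Q0 Q0 (atP Tp) (atP Tp) x y i j; last by exists z => //; exact: DrelP (esym zE).
rewrite (@map_rcoef_defect _ _ _ p2 (kF h) _ _ _ _ (fun=> erefl) (fun=> erefl)).
by apply: (vanish2 _ _ _ _ near_Tp near_Tp (rcoef_expand N H2) (rcoef_expand N H2)).
Qed.

Let w2 : H2 * p2 w = 0.
Proof. have -> : H2 * p2 w = p2 (kF (h ^+ 2) * (kF (fconst 2^-1) * C)); last exact: p2_h2.
by rewrite wE -p2M !mulrA -!(rmorphM kF) mulrCA -expr2 [in RHS]mulrC. Qed.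

Let gB2 := p2 \o gB.
Let q2 (j : nat) := gB2 j.
Let q2' (j : nat) := if j is j'.+1 then gB2 j' * H2 else 0.

Let gB2S j : exists x, gB2 j.+1 = x * H2.
Proof.
by exists (p2 (kF (fconst (g j.+1) * h ^+ j))); rewrite /gB2 /gB /= exprSr mulrA 2!rmorphM.
Qed.

Let gB2C j z : gB2 j * z = z * gB2 j.
Proof. by have [x <-] := p2_surj z; rewrite /gB2 /= -!p2M /gB kFC. Qed.

(** The shift v of the argument is annihilated by h, and each q j with j > 0 contains h, so modulo
    h^2 the shift has no effect. *)
Let w2_cancel (v : B2) (q : nat -> B2) a b : H2 * v = 0 -> (forall j, exists x, q j.+1 = H2 * x) ->
  gexp q v a b = gexp q 0 a b.
Proof.
move=> v0 qS; apply: eq_gexp => d [|j] // _; have [x ->] := qS j.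
case: d => [|d]; first by rewrite !expr0.
rewrite oppr0 [X in _ = X]mulrA !exprSr mulr0 !mul0r -mulrA (_ : - v * (H2 * x) = 0) ?mulr0 //.
by rewrite mulrA -H2C mulrN v0 oppr0 mul0r.
Qed.

Lemma defectX_h2 x y i j :
  exists2 z, D z = 0 & defect (Qb w) (Qb (- w)) (atN T) (atP Tp) x y i j = kF (h ^+ 2) * z.
Proof.
have [|z zE] := @defect_h2 (Qb w) (Qb (- w)) (atN T) (atP Tp) x y i j;
  last by exists z => //; exact: DrelX (esym zE).
rewrite (@map_rbcoef_defect _ _ _ p2 (kF h) gB _ _ _ _ (fun=> erefl) (fun=> erefl)).
have Hq v : H2 * v = 0 -> forall a b, rexpand (rbcoef N H2 gB2) v a b =
    gexp q2 0 a b *: (1 : 'M_(tdim N 2)) - (gexp q2' 0 a b) *: tens_perm N B2 (tperm (ord0 : 'I_2) ord_max).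
  move=> v0 a b; rewrite (rexpandE (q := q2) (q' := q2')); last exact: rbcoefE.
  rewrite (w2_cancel _ _ v0) ?(w2_cancel _ _ v0) // => k.
    by exists (gB2 k); rewrite /q2' H2C.
  by have [z e] := gB2S k; exists z; rewrite /q2 e H2C.
have be2 a b : gexp q2' 0 a b = gexp (fun j => if j is j'.+1 then gB2 j' else 0) 0 a b * H2.
  rewrite mulr_suml; apply: eq_bigr => s _; rewrite -mulrA; congr (_ * _).
  by rewrite /q2'; case: (val s) => [|k]; rewrite ?mul0r.
have Hq2 v : H2 * v = 0 -> forall a b, rexpand (rbcoef N H2 gB2) v a b =
    gexp q2 0 a b *: (1 : 'M_(tdim N 2)) -
    (gexp (fun j => if j is j'.+1 then gB2 j' else 0) 0 a b * H2) *: tens_perm N B2 (tperm (ord0 : 'I_2) ord_max).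
  by move=> v0 a b; rewrite Hq // be2.
have gexpC q : (forall j z, q j * z = z * q j) -> forall a b z, gexp q 0 a b * z = z * gexp q 0 a b.
  move=> qC a b z; rewrite gexp0; case: ifP => _; case: ifP => _;
    by rewrite ?mulrDl ?mulrDr ?mulrnAl ?mulrnAr ?mul0r ?mulr0 ?qC.
apply: (vanish2 x y i j near_T near_Tp (Hq2 _ w2) (Hq2 (p2 (- w)) _)).
- by rewrite rmorphN mulrN w2 oppr0.
- exact: gexpC.
by apply: gexpC => -[|k] z; rewrite ?mul0r ?mulr0.
Qed.

End Presentation.

(** * The quotient in which h is nilpotent *)

Section NilpotentQuotient.
Variables (F : numFieldType) (N n : nat) (Fr Y : pzRingType) (kF : {rmorphism fps F -> Fr}).
Local Notation h := (fvar F).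
Hypothesis kFC : forall k x, kF k * x = x * kF k.
Variables (D : {rmorphism Fr -> Y}).

(* The series relations hold modulo this ideal, their coefficients being divisible
   by h^2. Taking all of the kernel of D would not allow to divide by h. *)
Definition nil_ideal z := exists z' v, D z' = 0 /\ z = kF (h ^+ 2) * z' + kF (h ^+ n) * v.

Lemma nil_ideal_two_sided : two_sided_ideal nil_ideal.
Proof.
split=> [|x y [x' [v [Dx ->]]] [y' [v' [Dy ->]]]|x y [x' [v [Dx ->]]]].
- by exists 0, 0; rewrite rmorph0 !mulr0 addr0.
- by exists (x' - y'), (v - v'); rewrite rmorphB Dx Dy subrr !mulrBr opprD addrACA.
split; [exists (y * x'), (y * v)|exists (x' * y), (v * y)].
  by rewrite rmorphM Dx mulr0 mulrDr !mulrA !kFC.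
by rewrite rmorphM Dx mul0r mulrDl !mulrA.
Qed.

Definition nilquot : pzRingType := rquot nil_ideal.
Definition nilproj : {rmorphism Fr -> nilquot} := rproj nil_ideal.
Definition nilscal : {rmorphism fps F -> nilquot} := nilproj \o kF.

Lemma nilproj_surj x : exists z, nilproj z = x. Proof. exact: rproj_surj. Qed.

Lemma nilproj_ker z : nilproj z = 0 -> nil_ideal z.
Proof. exact: rproj_ker nil_ideal_two_sided. Qed.

Lemma nilproj_h2 z : D z = 0 -> nilproj (kF (h ^+ 2) * z) = 0.
Proof. by move=> Dz; apply: rproj_gen; exists z, 0; rewrite mulr0 addr0. Qed.

Lemma nilscalC k x : nilscal k * x = x * nilscal k.
Proof. by have [z <-] := nilproj_surj x; rewrite -!(rmorphM nilproj) kFC. Qed.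

Lemma nilscal_hn : nilscal (h ^+ n) = 0.
Proof. by apply: rproj_gen; exists 0, 1; rewrite rmorph0 mulr0 add0r mulr1. Qed.

Variables (T Tp : nat -> 'M[Fr]_N) (w C : Fr) (g : nat -> F).
Hypotheses (wE : w = kF (fconst 2^-1 * h) * C) (DC : D C = D (kF (fconst (- N%:R)))).
Let gB i := kF (fconst (g i) * h ^+ i).
Local Notation Q0 := (rexpand (rcoef N (kF h)) 0).
Local Notation Qb y := (rexpand (rbcoef N (kF h) gB) y).
Hypothesis defectN : forall x y i j,
  exists2 z, D z = 0 & defect Q0 Q0 (atN T) (atN T) x y i j = kF (h ^+ 2) * z.
Hypothesis defectP : forall x y i j,
  exists2 z, D z = 0 & defect Q0 Q0 (atP Tp) (atP Tp) x y i j = kF (h ^+ 2) * z.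
Hypothesis defectX : forall x y i j,
  exists2 z, D z = 0 & defect (Qb w) (Qb (- w)) (atN T) (atP Tp) x y i j = kF (h ^+ 2) * z.

Let TA r := map_mx nilproj (T r).
Let TpA r := map_mx nilproj (Tp r).
Let hA := nilscal h.

Let nilM k l : nilscal (k * l) = nilscal k * nilscal l. Proof. exact: rmorphM. Qed.

Let mapN a : map_mx nilproj (atN T a) = atN TA a.
Proof. by rewrite /atN; case: ifP => // _; rewrite map_mx0. Qed.
Let mapP a : map_mx nilproj (atP Tp a) = atP TpA a.
Proof. by rewrite /atP; case: ifP => // _; rewrite map_mx0. Qed.

Lemma nil_relN r s i j k l :
  TA r.+1 i j * TA s k l - TA s k l * TA r.+1 i j - (TA r i j * TA s.+1 k l - TA s.+1 k l * TA r i j)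
  = hA * (TA r k j * TA s i l - TA s k j * TA r i l).
Proof.
apply: relN_of_defect => [z|x y i' j']; first exact: nilscalC.
rewrite -(map_rcoef_defect (kF h) mapN mapN); have [z Dz ->] := defectN x y i' j'; exact: nilproj_h2.
Qed.

Lemma nil_relP r s i j k l :
  (if r is r'.+1 then TpA r' i j * TpA s k l - TpA s k l * TpA r' i j else 0)
  - (if s is s'.+1 then TpA r i j * TpA s' k l - TpA s' k l * TpA r i j else 0)
  = hA * (TpA r k j * TpA s i l - TpA s k j * TpA r i l).
Proof.
apply: relP_of_defect => [z|x y i' j']; first exact: nilscalC.
rewrite -(map_rcoef_defect (kF h) mapP mapP); have [z Dz ->] := defectP x y i' j'; exact: nilproj_h2.
Qed.

Let y : fps F := - (h * fconst (N%:R/2)).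
Let q j := fconst (g j) * h ^+ j.
Let q' j := if j is j'.+1 then h * q j' else 0.

(** C + N lies in the kernel of D, but such elements vanish here only next to h^2. One factor h is
    in w, the other has to be supplied. *)
Let wy : nilproj w * hA = nilscal y * hA.
Proof.
apply/eqP; rewrite -subr_eq0 -!(rmorphM nilproj) -rmorphB; apply/eqP.
have -> : w * kF h - kF y * kF h = kF (h ^+ 2) * (kF (fconst 2^-1) * (C - kF (fconst (- N%:R)))).
  rewrite mulrA mulrBr wE -[_ * C * _]mulrA -kFC mulrA -!(rmorphM kF); congr (kF _ * _ - kF _).
    by rewrite expr2 -mulrA mulrC.
  rewrite /y (rmorphM (@fconst F)) (rmorphN (@fconst F)).
  ring.
by apply: nilproj_h2; rewrite rmorphM rmorphB DC subrr mulr0.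
Qed.

Let exp_cancel (B : pzRingType) (v v' x : B) d : (forall z, x * z = z * x) -> v * x = v' * x ->
  (- v) ^+ d * x = (- v') ^+ d * x.
Proof.
move=> xC vx; elim: d => // d IHd; rewrite !exprSr -!mulrA !mulNr vx -!mulNr -xC mulrA IHd.
by rewrite -mulrA xC.
Qed.

(** The factor h that [wy] needs is found in u j for j > 0; for j = 0 the argument does not matter,
    by [eq_gexp]. *)
Let gexp_nil v y' (u : nat -> fps F) a b : v * hA = nilscal y' * hA -> (forall j, exists x, u j.+1 = h * x) ->
  gexp (nilscal \o u) v a b = nilscal (rexp u y' a b).
Proof.
move=> vy uS; rewrite (eq_gexp (y' := nilscal y')) => [|d [|j] // _]; last first.
  have [x e] := uS j; rewrite -[(_ \o _) _]/(nilscal (u j.+1)) e nilM -/hA !mulrA; congr (_ * _).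
  by apply: exp_cancel => // z; apply: nilscalC.
rewrite /rexp rmorph_sum; apply: eq_bigr => j _.
by rewrite [RHS]rmorphM rmorphMn rmorphXn rmorphN.
Qed.

Let rb_nil v y' a b : v * hA = nilscal y' * hA ->
  rexpand (rbcoef N hA (nilproj \o gB)) v a b =
  nilscal (rexp q y' a b) *: (1 : 'M_(tdim N 2)) -
  nilscal (rexp q' y' a b) *: tens_perm N nilquot (tperm (ord0 : 'I_2) ord_max).
Proof.
move=> vy; rewrite (rexpandE (q := nilscal \o q) (q' := nilscal \o q')).
  rewrite !(gexp_nil (y' := y')) // => j; first by exists (q j).
  by exists (fconst (g j.+1) * h ^+ j); rewrite /q exprS mulrCA.
move=> j; rewrite rbcoefE; congr (_ - _ *: _).
case: j => [|j]; first by rewrite -[RHS]/(nilscal 0) rmorph0.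
by rewrite -[RHS]/(nilscal (h * q j)) nilM nilscalC.
Qed.

Lemma nil_relX r s i j k l :
  \sum_(a < r.+1) \sum_(b < s.+1)
    (nilscal (rexp q y a b) * (TA (r - a)%N i j * TpA (s - b)%N k l)
     - nilscal (rexp q' y a b) * (TA (r - a)%N k j * TpA (s - b)%N i l)) =
  \sum_(a < r.+1) \sum_(b < s.+1)
    (nilscal (rexp q (- y) a b) * (TpA (s - b)%N k l * TA (r - a)%N i j)
     - nilscal (rexp q' (- y) a b) * (TpA (s - b)%N k j * TA (r - a)%N i l)).
Proof.
have wy' : nilproj (- w) * hA = nilscal (- y) * hA by rewrite (rmorphN nilproj) (rmorphN nilscal) !mulNr wy.
apply: (relX_of_defect (T := TA) (Tp := TpA) (fun a b => rb_nil a b wy) (fun a b => rb_nil a b wy')) => [a b z|a b z|a b i' j'].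
- exact: nilscalC.
- exact: nilscalC.
rewrite -(map_rbcoef_defect (kF h) gB mapN mapP); have [z Dz ->] := defectX a b i' j'; exact: nilproj_h2.
Qed.

End NilpotentQuotient.

(** * Commutators with late coefficients of T *)

Section HDivisibility.
Variable F : numFieldType.
Local Notation h := (fvar F).
Implicit Types f y : fps F.

Definition hdvd k f := exists f', f = h ^+ k * f'.

Lemma hdvd_sum k (I : Type) (r : seq I) (P : pred I) (f : I -> fps F) :
  (forall i, P i -> hdvd k (f i)) -> hdvd k (\sum_(i <- r | P i) f i).
Proof.
move=> kf; apply: (big_ind (hdvd k)) => //; first by exists 0; rewrite mulr0.
by move=> x z [x' ->] [z' ->]; exists (x' + z'); rewrite mulrDr.
Qed.

(** The j-th term has h^j from q j and h^(a - j - b) from the power of y, together h^(a - b). The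
    term j = 0 is 0 for a > 0, so at least one factor h is present. *)
Lemma hdvd_rexp (q : nat -> fps F) y a b k : (forall j, hdvd j (q j)) -> hdvd 1 y ->
  (0 < a)%N -> (k <= a - b)%N || (k == 1)%N -> hdvd k (rexp q y a b).
Proof.
move=> qj [y1 ->] a0 kab; apply: hdvd_sum => j jb; have [u ->] := qj j.
case: (posnP j) => [-> | j0].
  by rewrite subn0 bin_small ?prednK // mul0n mulr0n mul0r; exists 0; rewrite mulr0.
rewrite expr1 -mulrN exprMn mulrnAl mulrACA -exprD.
have /subnKC <- : (k <= a - j - b + j)%N.
  by case/orP: kab => [|/eqP ->]; rewrite -subnDA [(j + b)%N]addnC subnDA; lia.
by rewrite exprD -mulrA -mulrnAr; exists (h ^+ (a - j - b + j - k) * ((- y1) ^+ (a - j - b) * u) *+ ('C(a.-1, a - j) * 'C(a - j, b))).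
Qed.

Lemma rexp0 (q : nat -> fps F) y b : rexp q y 0 b = (b == 0%N)%:R * q 0%N.
Proof.
rewrite /rexp big_mkcond big_ord1 add0n leqn0; case: eqP => [->|_]; last by rewrite mul0r.
by rewrite bin0 mulr1n.
Qed.

End HDivisibility.

Section NearCommutation.
Variables (F : numFieldType) (N n p : nat) (A : pzRingType) (kK : {rmorphism fps F -> A}).
Local Notation h := (fvar F).
Hypotheses (kKC : forall x y, kK x * y = y * kK x) (kKn : kK (h ^+ n) = 0).
Variables (T Tp : nat -> 'M[A]_N) (g : nat -> F).
Hypotheses (T0 : T 0%N = 1) (g0 : g 0%N = 1).
Hypothesis relN : forall r s i j k l,
  T r.+1 i j * T s k l - T s k l * T r.+1 i j - (T r i j * T s.+1 k l - T s.+1 k l * T r i j)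
  = kK h * (T r k j * T s i l - T s k j * T r i l).
Variable y : fps F.
Hypothesis y_h : hdvd 1 y.
Let q j := fconst (g j) * h ^+ j.
Let q' j := if j is j'.+1 then h * q j' else 0.
Hypothesis relX : forall r s i j k l,
  \sum_(a < r.+1) \sum_(b < s.+1)
    (kK (rexp q y a b) * (T (r - a)%N i j * Tp (s - b)%N k l)
     - kK (rexp q' y a b) * (T (r - a)%N k j * Tp (s - b)%N i l)) =
  \sum_(a < r.+1) \sum_(b < s.+1)
    (kK (rexp q (- y) a b) * (Tp (s - b)%N k l * T (r - a)%N i j)
     - kK (rexp q' (- y) a b) * (Tp (s - b)%N k j * T (r - a)%N i l)).
Variable J : A -> Prop.
Hypotheses (J0 : J 0) (JB : forall x y, J x -> J y -> J (x - y)).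
Hypothesis JM : forall x y, J y -> J (x * y).
Hypothesis JT : forall r i j, (p <= r.+1)%N -> J (T r.+1 i j).

Let JN x : J x -> J (- x). Proof. by rewrite -[- x]sub0r; apply: JB. Qed.
Let JD x z : J x -> J z -> J (x + z). Proof. by move=> Jx Jz; rewrite -[z]opprK; apply: JB => //; apply: JN. Qed.

(** Induction on s through [relN]. Products with T_(r+1) as right factor lie in the left ideal J;
    the one with T_(r+1) on the left is commuted by the induction hypothesis. *)
Lemma commutatorT r s i j k l : (p <= r.+1)%N ->
  exists2 x, J x & T r.+1 i j * T s k l - T s k l * T r.+1 i j = kK h * x.
Proof.
elim: s r i j k l => [|s IHs] r i j k l pr.
  by exists 0 => //; rewrite T0 mxE nat_central subrr mulr0.
have [x Jx xE] := IHs r.+1 i j k l (leqW pr).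
have [x' Jx' x'E] := IHs r k j i l pr.
have -> : T r.+1 i j * T s.+1 k l - T s.+1 k l * T r.+1 i j =
    kK h * x - kK h * (T r.+1 k j * T s i l - T s k j * T r.+1 i l).
  by rewrite -xE -relN opprB [RHS]addrC subrK.
exists (x - (T s i l * T r.+1 k j + kK h * x' - T s k j * T r.+1 i l)).
  by apply: JB => //; apply: JB; [apply: JD|]; apply: JM => //; apply: JT.
by rewrite [RHS]mulrBr; congr (_ - _ * (_ - _)); rewrite -x'E addrC subrK.
Qed.

Let near i x := exists u v, J u /\ x = kK h * u + kK h ^+ i * v.

Let near0 i : near i 0. Proof. by exists 0, 0; rewrite !mulr0 addr0. Qed.

Let nearB i x z : near i x -> near i z -> near i (x - z).
Proof.
move=> [u [v [Ju ->]]] [u' [v' [Ju' ->]]]; exists (u - u'), (v - v'); split; first exact: JB.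
by rewrite !mulrBr opprD addrACA.
Qed.

Let near_sum i (I : Type) (r : seq I) (f : I -> A) : (forall k, near i (f k)) -> near i (\sum_(k <- r) f k).
Proof.
move=> nf; apply: (big_ind (near i)) => // x z nx nz.
by rewrite -[z]opprK; apply: nearB => //; rewrite -[- z]sub0r; apply: nearB.
Qed.

(** From n + s0 on the coefficient is divisible by h^n and the term is 0. Before that, its one
    factor h improves the approximation from h^i to h^(i+1). *)
Let near_term i a b s0 (c : nat -> fps F) v x : (forall j, hdvd j (c j)) -> hdvd 1 v -> (b <= s0)%N ->
  ((a.+1 < n + s0)%N -> exists u z, J u /\ x = u + kK h ^+ i * z) ->
  near i.+1 (kK (rexp c v a.+1 b) * x).
Proof.
move=> cj v1 bs xJ; case: (ltnP a.+1 (n + s0)%N) => lt; last first.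
  have [|f ->] := @hdvd_rexp F c v a.+1 b n cj v1 (ltn0Sn _).
    by apply/orP; left; lia.
  by rewrite rmorphM kKn !mul0r.
have [u [z [Ju ->]]] := xJ lt.
have [|f ->] := @hdvd_rexp F c v a.+1 b 1 cj v1 (ltn0Sn _); first by rewrite orbT.
exists (kK f * u), (kK f * z); split; first exact: JM.
by rewrite expr1 rmorphM mulrDr exprS -!mulrA; congr (_ + _ * _); rewrite !mulrA kKC.
Qed.

(* The commutator is found modulo h^i by induction on i: in [relX] the terms with
   a > 0 have a coefficient divisible by h, which vanishes for a >= n + s. *)
Lemma commutatorTp s : exists R, forall r, (R <= r)%N -> forall i j k l,
  exists2 x, J x & T r i j * Tp s k l - Tp s k l * T r i j = kK h * x.
Proof.
suff [R HR] : exists R, forall r, (R <= r)%N -> forall s', (s' <= s)%N -> forall i j k l,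
    near n (T r i j * Tp s' k l - Tp s' k l * T r i j).
  exists R => r Rr i j k l; have [u [v [Ju ->]]] := HR r Rr s (leqnn s) i j k l.
  by exists u => //; rewrite -rmorphXn kKn mul0r addr0.
elim: {1}n => [|i0 [R HR]].
  by exists 0%N => r _ s' _ i j k l; exists 0, (T r i j * Tp s' k l - Tp s' k l * T r i j); rewrite mulr0 add0r mul1r.
exists (maxn R p + n + s).+1 => r Rr s' s's i j k l.
have qj j' : hdvd j' (q j') by exists (fconst (g j')); rewrite mulrC.
have q'j j' : hdvd j' (q' j').
  by case: j' => [|j']; [exists 0; rewrite mulr0 | exists (fconst (g j')); rewrite exprS -mulrA [_ * fconst _]mulrC].
have Ny : hdvd 1 (- y) by have [u ->] := y_h; exists (- u); rewrite mulrN.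
have rp : (0 < r)%N by lia.
have JT' a i' j' : (a.+1 < n + s)%N -> J (T (r - a.+1)%N i' j').
  move=> lt; rewrite (_ : (r - a.+1 = (r - a.+2).+1)%N); last by lia.
  by apply: JT; lia.
have TTp a b i' j' k' l' : (a < r)%N -> (a.+1 < n + s)%N ->
    exists u z, J u /\ T (r - a.+1)%N i' j' * Tp (s' - b)%N k' l' = u + kK h ^+ i0 * z.
  move=> ar lt; have Rr' : (R <= r - a.+1)%N by lia.
  have [u [z [Ju E]]] := HR _ Rr' (s' - b)%N (leq_trans (leq_subr _ _) s's) i' j' k' l'.
  exists (Tp (s' - b)%N k' l' * T (r - a.+1)%N i' j' + kK h * u), z; split; last first.
    by rewrite -addrA -E addrC subrK.
  by apply: JD; apply: JM => //; apply: JT'.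
have TpT a b i' j' k' l' : (a < r)%N -> (a.+1 < n + s)%N ->
    exists u z, J u /\ Tp (s' - b)%N k' l' * T (r - a.+1)%N i' j' = u + kK h ^+ i0 * z.
  move=> ar lt; exists (Tp (s' - b)%N k' l' * T (r - a.+1)%N i' j'), 0; split; last by rewrite mulr0 addr0.
  by apply: JM; apply: JT'.
(* For a = 0 only b = 0 contributes, with the coefficient g_0 = 1; this is the commutator to be
   found. *)
have head (v : fps F) (G G' : nat -> A) : \sum_(b < s'.+1) (kK (rexp q v 0 b) * G b - kK (rexp q' v 0 b) * G' b) = G 0%N.
  rewrite big_ord_recl !rexp0 /= mulr0 rmorph0 mul0r subr0 big1 ?addr0.
    by rewrite mul1r /q g0 expr0 mulr1 (rmorph1 (@fconst F)) rmorph1 mul1r.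
  by move=> b _; rewrite !rexp0 !mul0r rmorph0 !mul0r subrr.
have := relX r s' i j k l; rewrite big_ord_recl [in RHS]big_ord_recl.
rewrite (head y (fun b => T (r - 0)%N i j * Tp (s' - b)%N k l) (fun b => T (r - 0)%N k j * Tp (s' - b)%N i l)).
rewrite (head (- y) (fun b => Tp (s' - b)%N k l * T (r - 0)%N i j) (fun b => Tp (s' - b)%N k j * T (r - 0)%N i l)).
rewrite !subn0 => /(canRL (addrK _)) ->; rewrite -[X in X - _]addrA addrAC subrr add0r.
by apply: nearB; apply: near_sum => a; apply: near_sum => b; apply: nearB;
   apply: (@near_term _ _ _ s) => //; rewrite ?(leq_trans _ s's) -1?ltnS // => lt;
   (apply: TTp || apply: TpT).
Qed.

End NearCommutation.

(** * The left ideals I_p + h^n and continuity *)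

Section Smoothness.
Variables (F : numFieldType) (N : nat) (Fr Y : pzRingType) (kF : {rmorphism fps F -> Fr}).
Local Notation h := (fvar F).
Hypothesis kFC : forall k x, kF k * x = x * kF k.
Hypothesis hinj : forall x, kF h * x = 0 -> x = 0.
Variables (D : {rmorphism Fr -> Y}) (t : nat -> 'M[Fr]_N).
Hypothesis Dsurj : forall y, exists x, D x = y.

Definition left_closed (J : Y -> Prop) :=
  [/\ J 0, forall x y, J x -> J y -> J (x - y) & forall x y, J x -> J (y * x)].

Definition Igen p x := forall J, left_closed J ->
  (forall i j r, (p <= r.+1)%N -> J (D (t r i j))) -> J x.

Definition Ih p n x := exists y z, Igen p y /\ x = y + D (kF h) ^+ n * z.

Lemma Igen_left p : left_closed (Igen p).
Proof.
split=> [J []//|x y Ix Iy J idJ Jt|x y Ix J idJ Jt]; case: (idJ) => _ JB JM.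
  by apply: JB; [apply: Ix | apply: Iy].
by apply: JM; apply: Ix.
Qed.

Lemma Igen_t p r i j : (p <= r.+1)%N -> Igen p (D (t r i j)).
Proof. by move=> pr J _; apply. Qed.

Lemma Igen_antitone p q x : (p <= q)%N -> Igen q x -> Igen p x.
Proof. by move=> pq Ix J idJ Jt; apply: Ix => // i j r qr; apply: Jt; apply: leq_trans qr. Qed.

Let hY := D (kF h).
Let hYC x : hY * x = x * hY.
Proof. by have [z <-] := Dsurj x; rewrite /hY -!(rmorphM D) kFC. Qed.
Let hYnC n x : hY ^+ n * x = x * hY ^+ n.
Proof. by elim: n => [|n IHn]; rewrite ?mul1r ?mulr1 // exprS -mulrA IHn mulrA hYC mulrA. Qed.

Lemma Ih_left p n : left_closed (Ih p n).
Proof.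
have [I0 IB IM] := Igen_left p.
split=> [|x y [x' [z [Ix ->]]] [y' [z' [Iy ->]]]|x y [x' [z [Ix ->]]]].
- by exists 0, 0; rewrite mulr0 addr0.
- by exists (x' - y'), (z - z'); split; [apply: IB | rewrite mulrBr opprD addrACA].
by exists (y * x'), (y * z); split; [apply: IM | rewrite mulrDr !mulrA hYnC].
Qed.

Lemma Ih_add p n x y : Ih p n x -> Ih p n y -> Ih p n (x + y).
Proof.
have [I0 IB _] := Ih_left p n => Ix Iy.
by rewrite -[y]opprK; apply: (IB) => //; rewrite -[- y]sub0r; apply: IB.
Qed.

Lemma Ih_antitone p q n k x : (p <= q)%N -> (n <= k)%N -> Ih q k x -> Ih p n x.
Proof.
move=> pq nk [y [z [Iy ->]]]; exists y, (hY ^+ (k - n) * z); split; first exact: Igen_antitone Iy.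
by rewrite mulrA -exprD subnKC.
Qed.

Lemma Igen_Ih p n x : Igen p x -> Ih p n x.
Proof. by move=> Ix; exists x, 0; rewrite mulr0 addr0. Qed.

Lemma hpow_Ih p n x : Ih p n (hY ^+ n * x).
Proof. by exists 0, x; rewrite add0r; split => //; have [] := Igen_left p. Qed.

(** The counterpart of I_p in the nilpotent quotient. The factor h is that of T_(r+1) = h t_r, which
    lies in it for late r. *)
Definition AI n p (x : nilquot n kF D) := exists y, Igen p (D y) /\ x = nilproj n kF D (kF h * y).

Let pr n := nilproj n kF D.

Lemma AI0 n p : @AI n p 0.
Proof. by exists 0; rewrite mulr0 !rmorph0; split => //; have [] := Igen_left p. Qed.

Lemma AIB n p x y : @AI n p x -> @AI n p y -> @AI n p (x - y).
Proof.
move=> [x' [Ix ->]] [y' [Iy ->]]; exists (x' - y'); rewrite mulrBr !rmorphB; split=> //.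
by have [_ IB _] := Igen_left p; apply: IB.
Qed.

Lemma AIM n p x y : @AI n p y -> @AI n p (x * y).
Proof.
move=> [y' [Iy ->]]; have [x' <-] := nilproj_surj x; exists (x' * y'); split.
  by have [_ _ IM] := Igen_left p; rewrite rmorphM; apply: IM.
by rewrite -(rmorphM (nilproj n kF D)) !mulrA kFC.
Qed.

Let hcancel n x y : kF (h ^+ n) * x = kF (h ^+ n) * y -> x = y.
Proof.
move=> /eqP; rewrite -subr_eq0 -mulrBr => /eqP; elim: n => [|n IHn].
  by rewrite expr0 rmorph1 mul1r => /eqP; rewrite subr_eq0 => /eqP.
by rewrite exprS rmorphM -mulrA => /hinj /IHn.
Qed.

Let kFh n x : D (kF (h ^+ n) * x) = hY ^+ n * D x.
Proof. by rewrite rmorphM !rmorphXn. Qed.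

Lemma AI_Ih n p z : @AI n p (pr n z) -> Ih p n (D z).
Proof.
move=> [y [Iy /eqP]]; rewrite -subr_eq0 -rmorphB => /eqP/(nilproj_ker kFC)[z' [v [Dz']]].
move/(canRL (subrK _)) ->; rewrite rmorphD [D (_ + _)]rmorphD !kFh Dz' mulr0 add0r.
apply: Ih_add; first exact: hpow_Ih.
by rewrite rmorphM; have [_ _ IM] := Ih_left p n; apply: IM; apply: Igen_Ih.
Qed.

(** The division by h is done in the free algebra, which has no h-torsion; it costs one power of h
    in the modulus. *)
Lemma AI_pull n p z : @AI n.+1 p (pr n.+1 (kF h * z)) -> Ih p n (D z).
Proof.
move=> [y [Iy /eqP]]; rewrite -subr_eq0 -rmorphB => /eqP/(nilproj_ker kFC)[z' [v [Dz']]] E.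
have {E} : kF (h ^+ 1) * z = kF (h ^+ 1) * (y + (kF h * z' + kF (h ^+ n) * v)).
  by rewrite expr1; move/(canRL (subrK _)): E => ->; rewrite addrC !mulrDr !mulrA -!(rmorphM kF) -exprS.
move/hcancel ->; rewrite rmorphD [D (_ + _)]rmorphD kFh rmorphM Dz' mulr0 add0r.
by apply: Ih_add; [apply: Igen_Ih | apply: hpow_Ih].
Qed.

Lemma AI_pull2 n p z x : @AI n.+2 p x -> pr n.+2 (kF (h ^+ 2) * z) = nilscal n.+2 kF D h * x -> Ih p n (D z).
Proof.
move=> [y [Iy ->]] /eqP; rewrite -(rmorphM (pr n.+2)) mulrA -(rmorphM kF) -expr2.
rewrite -subr_eq0 -rmorphB => /eqP/(nilproj_ker kFC)[z' [v [Dz']]] E.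
have {E} : kF (h ^+ 2) * z = kF (h ^+ 2) * (y + (z' + kF (h ^+ n) * v)).
  by move/(canRL (subrK _)): E => ->; rewrite addrC !mulrDr !mulrA -!(rmorphM kF) -exprD.
move/hcancel ->; rewrite rmorphD [D (_ + _)]rmorphD kFh Dz' add0r.
by apply: Ih_add; [apply: Igen_Ih | apply: hpow_Ih].
Qed.

(* continuity of the right multiplication by [b] *)
Definition smooth b := forall p n, exists q, forall x, Ih q n x -> Ih p n (x * b).

(** Late generators generate I_q as a left ideal, and h^n is central, so nothing else has to be
    tested. *)
Lemma smooth_gen b :
  (forall p n, exists q, forall r i j, (q <= r.+1)%N -> Ih p n (D (t r i j) * b)) -> smooth b.
Proof.
move=> gb p n; have [q qb] := gb p n; exists q => x [y [z [Iy ->]]].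
have [I0 IB IM] := Ih_left p n.
rewrite mulrDl -mulrA; apply: Ih_add; last exact: hpow_Ih.
apply: (Iy (fun y => Ih p n (y * b))) => [|i j r]; last exact: qb.
by split=> [|u v Iu Iv|u v Iu]; rewrite ?mul0r // ?mulrBl -?mulrA; [apply: IB | apply: IM].
Qed.

Lemma smoothD b b' : smooth b -> smooth b' -> smooth (b + b').
Proof.
move=> sb sb' p n; have [q qb] := sb p n; have [q' qb'] := sb' p n; exists (maxn q q') => x Ix.
rewrite mulrDr; apply: Ih_add; [apply: qb | apply: qb'];
  by apply: Ih_antitone Ix; rewrite ?leq_maxl ?leq_maxr.
Qed.

Lemma smoothM b b' : smooth b -> smooth b' -> smooth (b * b').
Proof.
move=> sb sb' p n; have [q qb] := sb' p n; have [q' qb'] := sb q n; exists q' => x Ix.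
by rewrite mulrA; apply: qb; apply: qb'.
Qed.

Lemma smooth_central b : (forall x, b * x = x * b) -> smooth b.
Proof. by move=> bC p n; exists p => x Ix; rewrite -bC; have [_ _ IM] := Ih_left p n; apply: IM. Qed.

End Smoothness.

(** * Sequences tending to 0 along a family of left ideals *)

Section SmallSequences.
Variables (A : pzRingType) (J : nat -> A -> Prop).
Hypotheses (J0 : forall p, J p 0) (JB : forall p x y, J p x -> J p y -> J p (x - y)).
Hypothesis JM : forall p x y, J p y -> J p (x * y).
Hypothesis J_antitone : forall p q x, (p <= q)%N -> J q x -> J p x.
Hypothesis J_smooth : forall b p, exists q, forall x, J q x -> J p (x * b).

Let JD p x y : J p x -> J p y -> J p (x + y).
Proof. by move=> Jx Jy; rewrite -[y]opprK; apply: (JB) => //; rewrite -[- y]sub0r; apply: JB. Qed.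

Let J_sum p (I : Type) (r : seq I) (P : pred I) (f : I -> A) :
  (forall i, P i -> J p (f i)) -> J p (\sum_(i <- r | P i) f i).
Proof. by move=> Jf; apply: (big_ind (J p)) => // x y; apply: JD. Qed.

Let J_smooth_seq (bs : seq A) p : exists q, forall x, J q x -> forall b, b \in bs -> J p (x * b).
Proof.
elim: bs => [|b bs [q Hq]]; first by exists 0%N.
have [q' Hq'] := J_smooth b p; exists (maxn q q') => x Jx b'.
rewrite inE => /orP[/eqP ->|bb]; first by apply: Hq'; apply: J_antitone Jx; apply: leq_maxr.
by apply: Hq => //; apply: J_antitone Jx; apply: leq_maxl.
Qed.

Section Matrices.
Variable d : nat.
Implicit Types f : nat -> 'M[A]_d.

Definition small f := forall p, exists R, forall r, (R <= r)%N -> forall x z, J p (f r x z).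

Lemma small_ext f f' : f =1 f' -> small f -> small f'.
Proof. by move=> ff sf p; have [R HR] := sf p; exists R => r Rr x z; rewrite -ff; apply: HR. Qed.

Lemma small_sone : small (@sone _).
Proof. by move=> p; exists 1%N => -[|r] // _ x z; rewrite mxE. Qed.

Lemma smallD f f' : small f -> small f' -> small (fun r => f r + f' r).
Proof.
move=> sf sf' p; have [R HR] := sf p; have [R' HR'] := sf' p; exists (maxn R R') => r.
by rewrite geq_max => /andP[Rr R'r] x z; rewrite mxE; apply: JD; [apply: HR | apply: HR'].
Qed.

Lemma small_sum n (f : nat -> nat -> 'M[A]_d) :
  (forall k, small (f k)) -> small (fun r => \sum_(k < n) f k r).
Proof.
move=> sf; elim: n => [|n IHn].
  by move=> p; exists 0%N => r _ x z; rewrite big_ord0 mxE.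
by apply: (small_ext _ (smallD IHn (sf n))) => r; rewrite big_ord_recr.
Qed.

(** A late right factor puts the product into the left ideal. Otherwise the left factor is late and
    the right factor is one of finitely many, to which continuity of right multiplication
    applies. *)
Lemma small_smul f f' : small f -> small f' -> small (smul f f').
Proof.
move=> sf sf' p; have [R' HR'] := sf' p.
have [q Hq] := J_smooth_seq [seq f' j u.1 u.2 | j <- iota 0 R', u <- enum {: 'I_d * 'I_d}] p.
have [R HR] := sf q; exists (R + R')%N => r Rr x z; rewrite summxE; apply: J_sum => i _.
rewrite mxE; apply: J_sum => u _; case: (leqP R' (r - i)) => ri; first by apply: JM; apply: HR'.
apply: Hq; first by apply: HR; have := ltn_ord i; lia.
by apply/allpairsPdep; exists (r - i)%N, (u, z); rewrite mem_iota mem_enum add0n ri.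
Qed.

Lemma small_spow f k : small f -> small (spow f k).
Proof. by move=> sf; elim: k => [|k IHk]; [apply: small_sone | apply: small_smul]. Qed.

(** Since 1 - f is nilpotent as a series, the same finitely many powers enter the geometric series
    at every index. *)
Lemma small_sinv f n : small f -> (forall k r, (n <= k)%N -> spow (fun i => sone _ i - f i) k r = 0) ->
  small (sinv f).
Proof.
move=> sf nil; have sf1 : small (fun i => sone _ i - f i).
  move=> p; have [R HR] := sf p; exists R.+1 => -[|r] // Rr x z.
  have -> : sone _ r.+1 - f r.+1 = - f r.+1 by rewrite /sone /= sub0r.
  by rewrite mxE -sub0r; apply: JB => //; apply: HR; apply: ltnW.
have := small_sum n (fun k => small_spow k sf1); move=> H p; have [R HR] := H p.
exists (maxn R n) => r; rewrite geq_max => /andP[Rr nr] x z; have := HR r Rr x z; congr (J p (fun_of_matrix _ x z)).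
rewrite /sinv; apply/esym; apply: (@sum_ord_cut 'M[A]_d (fun k => spow (fun i => sone _ i - f i) k r)
  (fun k => spow (fun i => sone _ i - f i) k r)) => //; first exact: leqW.
by move=> k nk; apply: nil.
Qed.

Lemma small_sshiftN (v : A) n f : v ^+ n = 0 -> small f -> small (sshiftN v%:M f).
Proof.
move=> vn sf p; have [R HR] := sf p; exists (R + n)%N => r Rr x z.
rewrite summxE; apply: J_sum => i _.
case: (leqP n (r - i)) => ni.
  rewrite -(subnK ni) exprD (_ : (- v%:M) ^+ n = 0) ?mulr0 ?mul0r ?mul0rn ?mxE //.
  by rewrite exprNn -rmorphXn vn rmorph0 mulr0.
have Ji y u : J p (f i y u) by apply: HR; lia.
have JMn k y u : J p ((((- v%:M) ^+ (r - i) * f i) *+ k) y u).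
  rewrite mulmxnE; elim: k => [|k IHk]; first by rewrite mulr0n.
  by rewrite mulrS; apply: JD => //; rewrite mxE; apply: J_sum => s _; apply: JM.
exact: JMn.
Qed.

Lemma nilpotent_spow (c : A) n f (f' : nat -> 'M[A]_d) : (forall x, c * x = x * c) -> c ^+ n = 0 ->
  (forall r, f r = c *: f' r) -> forall k r, (n <= k)%N -> spow f k r = 0.
Proof.
move=> cC cn fE k r nk; suff [s ->] : exists s, spow f k r = c ^+ k *: s.
  by rewrite -(subnK nk) exprD cn mulr0 scale0r.
elim: k r {nk} => [|k IHk] r; first by exists (sone _ r); rewrite scale1r.
have /choice[s sE] := IHk; exists (\sum_(i < r.+1) f' i * s (r - i)%N).
rewrite scaler_sumr; apply: eq_bigr => i _; rewrite -[LHS]/(f i *m spow f k (r - i)%N) fE sE -scalemxAl exprS -scalerA; congr (_ *: _).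
apply/matrixP => u v; rewrite !mxE mulr_sumr; apply: eq_bigr => l _; rewrite mxE !mulrA; congr (_ * _).
by elim: k {s sE IHk} => [|k IHk]; rewrite ?mul1r ?mulr1 // exprSr mulrA IHk -!mulrA cC.
Qed.

End Matrices.

Lemma small_tens_at N m (a : 'I_m) (f : nat -> 'M[A]_N) : small f -> small (fun r => tens_at a (f r)).
Proof.
move=> sf p; have [R HR] := sf p; exists R => r Rr x z; rewrite mxE.
by case: ifP => _ //; apply: HR.
Qed.

Lemma small_qt_minus_prod (F : numFieldType) N m n (kK : {rmorphism fps F -> A}) (T : nat -> 'M[A]_N)
    (T' : nat -> 'M[A]_N) (c : 'I_m -> F) :
  (forall k x, kK k * x = x * kK k) -> kK (fvar F ^+ n) = 0 ->
  (forall r, sone _ r - T r = kK (fvar F) *: T' r) -> small T -> small (qt_minus_prod kK T c).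
Proof.
move=> kC kn TE sT; rewrite /qt_minus_prod; elim: (rev _) => [|a s IHs] /=; first exact: small_sone.
apply: small_smul => //; apply: small_tens_at; apply: (small_sshiftN (n := n)).
  by rewrite -rmorphXn exprMn rmorphM kn mulr0.
by apply: (small_sinv sT (n := n)); apply: nilpotent_spow TE; rewrite // -rmorphXn.
Qed.

End SmallSequences.

(** * Compatibility of the quantum trace with ring morphisms *)

Section MapQuantumTrace.
Variables (A B : pzRingType) (phi : {rmorphism A -> B}).

Section Series.
Variables (U V : pzRingType) (psi : {rmorphism U -> V}).

Lemma map_sone r : psi (sone _ r) = sone _ r.
Proof. exact: rmorph_nat. Qed.

Lemma map_smul (f f' : nat -> U) r : psi (smul f f' r) = smul (psi \o f) (psi \o f') r.
Proof. by rewrite rmorph_sum; apply: eq_bigr => i _; rewrite rmorphM. Qed.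

Lemma map_spow (f : nat -> U) k r : psi (spow f k r) = spow (psi \o f) k r.
Proof.
elim: k r => [|k IHk] r; first exact: map_sone.
by rewrite [LHS]map_smul; apply: eq_smul => // i _; apply: IHk.
Qed.

Lemma map_sinv (f : nat -> U) r : psi (sinv f r) = sinv (psi \o f) r.
Proof.
rewrite rmorph_sum; apply: eq_bigr => k _; rewrite map_spow; congr (spow _ k r).
by apply: funext => i /=; rewrite rmorphB map_sone.
Qed.

Lemma map_sshiftN x (f : nat -> U) r : psi (sshiftN x f r) = sshiftN (psi x) (psi \o f) r.
Proof.
by rewrite rmorph_sum; apply: eq_bigr => i _; rewrite rmorphMn rmorphM rmorphXn rmorphN.
Qed.

Lemma map_sshiftP M x (f : nat -> U) r : psi (sshiftP M x f r) = sshiftP M (psi x) (psi \o f) r.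
Proof. by rewrite rmorph_sum; apply: eq_bigr => i _; rewrite rmorphMn rmorphM rmorphXn. Qed.

Lemma map_foldr_smul (I : Type) (f : I -> nat -> U) (f' : I -> nat -> V) s r :
  (forall i r, psi (f i r) = f' i r) ->
  psi (foldr (fun i => smul (f i)) (@sone _) s r) = foldr (fun i => smul (f' i)) (@sone _) s r.
Proof.
move=> ff; elim: s r => [|i s IHs] r /=; first exact: map_sone.
by rewrite map_smul; apply: eq_smul => j _ /=.
Qed.

End Series.

Variables (F : numFieldType) (N m : nat) (kK : fps F -> A) (T Tp : nat -> 'M[A]_N).
Variables (e : 'S_m -> F) (c : 'I_m -> F).
Local Notation "X ^phi" := (map_mx phi X) (at level 2).

Lemma map_qt_minus_prod r :
  (qt_minus_prod kK T c r)^phi = qt_minus_prod (phi \o kK) (fun r => (T r)^phi) c r.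
Proof.
have E a s : (qt_minus kK T c a s)^phi = qt_minus (phi \o kK) (fun r => (T r)^phi) c a s.
  rewrite map_tens_at; congr tens_at.
  rewrite [LHS](map_sshiftN (map_mx phi)); congr (sshiftN _ _ _); first exact: map_scalar_mx.
  by apply: funext => i /=; rewrite [LHS](map_sinv (map_mx phi)).
exact: (map_foldr_smul (psi := map_mx phi) _ _ E).
Qed.

Lemma map_qt_plus_prod M r :
  (qt_plus_prod kK Tp c M r)^phi = qt_plus_prod (phi \o kK) (fun r => (Tp r)^phi) c M r.
Proof.
have E a s : (qt_plus kK Tp c M a s)^phi = qt_plus (phi \o kK) (fun r => (Tp r)^phi) c M a s.
  rewrite map_tens_at; congr tens_at.
  by rewrite [LHS](map_sshiftP (map_mx phi)); congr (sshiftP _ _ _ _); exact: map_scalar_mx.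
exact: (map_foldr_smul (psi := map_mx phi) _ _ E).
Qed.

Lemma map_qt k M S : phi (qt kK T Tp e c k M S) =
  qt (phi \o kK) (fun r => (T r)^phi) (fun r => (Tp r)^phi) e c k M S.
Proof.
rewrite -[LHS]trace_map_mx map_mxM; congr (\tr (_ *m _)).
  by rewrite map_mx_sum; apply: eq_bigr => s _; rewrite map_mxZ map_tens_perm.
rewrite map_mx_sum; apply: eq_bigr => s _; rewrite map_mxM map_qt_plus_prod; congr (_ *m _).
by rewrite /atN; case: ifP => _; rewrite ?map_mx0 // map_qt_minus_prod.
Qed.

End MapQuantumTrace.

(** * Continuity for the generators and commutators with them *)

Section GeneratorsCommute.
Variables (F : numFieldType) (N : nat) (Fr Y : pzRingType) (kF : {rmorphism fps F -> Fr}).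
Local Notation h := (fvar F).
Hypothesis kFC : forall k x, kF k * x = x * kF k.
Hypothesis hinj : forall x, kF h * x = 0 -> x = 0.
Variables (D : {rmorphism Fr -> Y}) (T Tp t tp : nat -> 'M[Fr]_N) (w C : Fr) (g : nat -> F).
Hypothesis Dsurj : forall y, exists x, D x = y.
Hypotheses (T0 : T 0%N = 1) (TS : forall r i j, T r.+1 i j = kF h * t r i j).
Hypothesis TpE : forall r i j, Tp r i j = ((r == 0%N) && (i == j))%:R - kF h * tp r i j.
Hypotheses (wE : w = kF (fconst 2^-1 * h) * C) (DC : D C = D (kF (fconst (- N%:R)))).
Hypothesis g_spec : g 0%N = 1 /\
  forall r, sshiftN N%:R g r = g r - (if (2 <= r)%N then g (r - 2)%N else 0).
Let gB i := kF (fconst (g i) * h ^+ i).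
Local Notation Q0 := (rexpand (rcoef N (kF h)) 0).
Local Notation Qb y := (rexpand (rbcoef N (kF h) gB) y).
Hypothesis defectN : forall x y i j,
  exists2 z, D z = 0 & defect Q0 Q0 (atN T) (atN T) x y i j = kF (h ^+ 2) * z.
Hypothesis defectP : forall x y i j,
  exists2 z, D z = 0 & defect Q0 Q0 (atP Tp) (atP Tp) x y i j = kF (h ^+ 2) * z.
Hypothesis defectX : forall x y i j,
  exists2 z, D z = 0 & defect (Qb w) (Qb (- w)) (atN T) (atP Tp) x y i j = kF (h ^+ 2) * z.
Hypothesis gen_ind : forall P : Fr -> Prop, (forall x y, P x -> P y -> P (x + y)) ->
  (forall x y, P x -> P y -> P (x * y)) -> (forall k, P (kF k)) -> P C ->
  (forall r i j, P (t r i j)) -> (forall r i j, P (tp r i j)) -> forall x, P x.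

Local Notation Ih := (Ih kF D t).
Local Notation AI n := (@AI F N Fr Y kF D t n).
Local Notation smooth := (smooth kF D t).
Let pr n : {rmorphism Fr -> nilquot n kF D} := nilproj n kF D.
Let TA n r := map_mx (pr n) (T r).
Let TpA n r := map_mx (pr n) (Tp r).
Let prM n x y : pr n (x * y) = pr n x * pr n y. Proof. exact: rmorphM. Qed.

Let AI_T n p r i j : (p <= r.+1)%N -> AI n p (TA n r.+1 i j).
Proof. by move=> pr'; exists (t r i j); rewrite mxE TS; split => //; apply: Igen_t. Qed.

Let TA0 n : TA n 0%N = 1. Proof. by rewrite /TA T0 map_mx1. Qed.
Let nC n k x : nilscal n kF D k * x = x * nilscal n kF D k. Proof. exact: nilscalC. Qed.
Let j0 n p : AI n p 0. Proof. exact: AI0. Qed.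
Let jB n p x y : AI n p x -> AI n p y -> AI n p (x - y). Proof. exact: AIB. Qed.
Let jM n p x y : AI n p y -> AI n p (x * y). Proof. exact: AIM. Qed.
Let Igen_in p n x : Igen D t p x -> Ih p n x. Proof. exact: Igen_Ih. Qed.
Let smoothC b : (forall x, b * x = x * b) -> smooth b. Proof. exact: smooth_central. Qed.

Let IhD p n x y : Ih p n x -> Ih p n y -> Ih p n (x + y). Proof. exact: Ih_add. Qed.
Let nat_com (B : pzRingType) (b : nat) (x z : B) : (b%:R - x) * z - z * (b%:R - x) = z * x - x * z.
Proof. by rewrite mulrBl mulrBr nat_central opprD opprK addrACA subrr add0r addrC. Qed.

Let h2_commutator (x y : Fr) : kF h * x * (kF h * y) - kF h * y * (kF h * x) = kF (h ^+ 2) * (x * y - y * x).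
Proof.
have m u v : kF h * u * (kF h * v) = kF (h ^+ 2) * (u * v).
  by rewrite expr2 rmorphM -!mulrA; congr (_ * _); rewrite !mulrA kFC.
by rewrite !m mulrBr.
Qed.

(** The commutator of two entries of T carries h^2, which is cancelled at the end; the computation
    is therefore done modulo h^(n+2). *)
Lemma smooth_t s k l : smooth (D (t s k l)).
Proof.
apply: (smooth_gen kFC Dsurj) => p n; exists p => r i j pr'.
have [x Jx xE] := commutatorT (A := nilquot n.+2 kF D) (kK := nilscal n.+2 kF D) (T := TA n.+2)
  (J := AI n.+2 p) (p := p) (TA0 _) (nil_relN n.+2 kFC defectN) (j0 _ p)
  (@jB _ p) (@jM _ p) (@AI_T n.+2 p) s.+1 i j k l pr'.
have Icom : Ih p n (D (t r i j * t s k l - t s k l * t r i j)).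
  apply: (AI_pull2 kFC hinj Dsurj Jx); rewrite -xE !mxE !TS -!prM -rmorphB h2_commutator.
  by [].
rewrite -rmorphM -(subrK (t s k l * t r i j) (t r i j * _)) rmorphD.
apply: IhD => //.
have [_ _ IM] := Ih_left kFC t Dsurj p n; rewrite rmorphM; apply: IM; apply: Igen_in; exact: Igen_t.
Qed.

Let y0 : fps F := - (h * fconst (N%:R/2)).
Let y0_h : hdvd 1 y0.
Proof. by exists (- fconst (N%:R / 2)); rewrite expr1 mulrN. Qed.

(** As in [smooth_t], but how late the generator has to be now depends on s and n as well, through
    the bound R of [commutatorTp]. *)
Lemma smooth_tp s k l : smooth (D (tp s k l)).
Proof.
apply: (smooth_gen kFC Dsurj) => p n.
have [R HR] := commutatorTp (A := nilquot n.+2 kF D) (kK := nilscal n.+2 kF D) (T := TA n.+2) (Tp := TpA n.+2)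
  (J := AI n.+2 p) (p := p) (@nC _) (nilscal_hn n.+2 kF D) g_spec.1 y0_h (nil_relX n.+2 kFC wE DC defectX) (j0 _ p)
  (@jB _ p) (@jM _ p) (@AI_T n.+2 p) s.
exists (maxn p R) => r i j; rewrite geq_max => /andP[pr' Rr].
have [x Jx xE] := HR r.+1 Rr i j k l.
have Icom : Ih p n (D (tp s k l * t r i j - t r i j * tp s k l)).
  apply: (AI_pull2 kFC hinj Dsurj Jx); rewrite -xE !mxE TS TpE -!prM -rmorphB; congr (pr _ _).
  by rewrite -[RHS]opprB nat_com opprB -h2_commutator.
rewrite -rmorphM -(subKr (tp s k l * t r i j) (t r i j * _)) rmorphB.
have [_ IB IM] := Ih_left kFC t Dsurj p n; apply: IB => //.
by rewrite rmorphM; apply: IM; apply: Igen_in; exact: Igen_t.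
Qed.

Lemma smooth_all b : smooth b.
Proof.
have [x <-] := Dsurj b.
have scC k : smooth (D (kF k)).
  by apply: smoothC => y; have [z <-] := Dsurj y; rewrite -!(rmorphM D) kFC.
apply: (gen_ind (P := fun x => smooth (D x))) => // [u v su sv|u v su sv||*|*].
- by rewrite rmorphD; apply: smoothD.
- by rewrite rmorphM; apply: smoothM.
- by rewrite DC.
- exact: smooth_t.
- exact: smooth_tp.
Qed.

Lemma AI_smooth n (b : nilquot n kF D) p : exists q, forall x, AI n q x -> AI n p (x * b).
Proof.
have [b' <-] := nilproj_surj b; have [q Hq] := smooth_all (D b') p n; exists q => x [y [Iy ->]].
have [u [v [Iu E]]] := Hq _ (Igen_in n Iy).
have [u' uE] := Dsurj u; have [v' vE] := Dsurj v.
(* Subtracting h^n v' turns membership in I_p + h^n into membership in I_p, and does not change the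
   image in the quotient. *)
exists (y * b' - kF (h ^+ n) * v'); split.
  by rewrite rmorphB !rmorphM E !rmorphXn vE addrK.
rewrite -prM mulrBr rmorphB -mulrA [X in _ = _ - X](_ : _ = 0) ?subr0 //.
by rewrite mulrA kFC -mulrA rmorphM [X in X * _](nilscal_hn n kF D) mul0r.
Qed.

Variables (m : nat) (e0 : 'S_m -> F) (c : 'I_m -> F) (chi : ('I_m -> F) -> F).
Hypothesis e0J : forall b, conv (jm F b) e0 =1 fun s => c b * e0 s.
Hypotheses (e0V : jvalue e0 chi) (chi1 : chi c = 1).

Let small_minus n : small (fun p => AI n p) (qt_minus_prod (nilscal n kF D) (TA n) c).
Proof.
apply: (@small_qt_minus_prod _ _ _ _ _ _ _ F N m n _ _ (fun r => if r is r'.+1 then - map_mx (pr n) (t r') else 0)).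
- exact: AI0.
- exact: AIB.
- exact: AIM.
- by move=> p q x pq [y [Iy ->]]; exists y; split => //; apply: Igen_antitone Iy.
- exact: AI_smooth.
- exact: nilscalC.
- exact: nilscal_hn.
- move=> [|r]; first by rewrite scaler0 /TA T0 map_mx1 subrr.
  by rewrite /sone sub0r scalerN; congr (- _); apply/matrixP => i j; rewrite !mxE TS prM.
by move=> p; exists p.+1 => -[|r] // pr' i j; apply: AI_T; apply: leqW.
Qed.

Local Notation kY := (D \o kF).
Let TY r := map_mx D (T r).
Let TpY r := map_mx D (Tp r).
Let tau k M S := qt kF T Tp e0 c k M S.
Local Notation qtY k M S := (qt kY TY TpY e0 c k M S).

Lemma qt_minus_prod_small p n : exists R, forall r, (R <= r)%N -> forall x z,
  Ih p n (qt_minus_prod kY TY c r x z).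
Proof.
have [R HR] := small_minus n p; exists R => r Rr x z; have := HR r Rr x z.
rewrite -(map_qt_minus_prod D) -(map_qt_minus_prod (pr n)) !mxE; exact: AI_Ih.
Qed.

(** [commute_qt] speaks of the entries of T and T^+, which contain one factor h; it is used modulo
    h^(n+1) and that factor is cancelled. *)
Lemma commute_generators k r p n : exists S0, forall S, (S0 <= S)%N -> exists M0, forall M, (M0 <= M)%N ->
  forall i j, Ih p n (D (t r i j) * qtY k M S - qtY k M S * D (t r i j)) /\
    Ih p n (D (tp r i j) * qtY k M S - qtY k M S * D (tp r i j)).
Proof.
have [P0 HP0] := small_minus n.+1 p.
have com r' := commute_qt (@nC _) (nilscal_hn n.+1 kF D) (ltn0Sn n)
  (T := TA n.+1) (Tp := TpA n.+1) (TA0 _) (nil_relN n.+1 kFC defectN)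
  (nil_relP n.+1 kFC defectP) g_spec (nil_relX n.+1 kFC wE DC defectX) e0J e0V chi1 (j0 _ p)
  (@jB _ p) (@jM _ p) HP0 k r'.
have pull x M S : AI n.+1 p (pr n.+1 (kF h * x) * pr n.+1 (tau k M S) - pr n.+1 (tau k M S) * pr n.+1 (kF h * x)) ->
    Ih p n (D x * qtY k M S - qtY k M S * D x).
  move=> H; rewrite -(map_qt D) -!(rmorphM D) -rmorphB; apply: (AI_pull kFC hinj Dsurj).
  have -> : kF h * (x * tau k M S - tau k M S * x) = kF h * x * tau k M S - tau k M S * (kF h * x).
    by rewrite mulrBr !mulrA; congr (_ - _ * x); apply: kFC.
  by move: H; rewrite -!prM -rmorphB.
(* t_r comes from the coefficient r + 1 of T, and tp_r from the coefficient r of T^+. *)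
have [S0 HS0] := com r.+1; have [S1 HS1] := com r.
exists (maxn S0 S1) => S; rewrite geq_max => /andP[S0S S1S].
have [M0 HM0] := HS0 S S0S; have [M1 HM1] := HS1 S S1S.
exists (maxn M0 M1) => M; rewrite geq_max => /andP[M0M M1M] i j; split; apply: pull.
  by have [+ _] := HM0 M M0M i j; rewrite -(map_qt (pr n.+1)) mxE TS.
have [_ +] := HM1 M M1M i j; rewrite -(map_qt (pr n.+1)) mxE TpE rmorphB rmorph_nat nat_com => H.
by rewrite -opprB -sub0r; apply: jB => //; apply: j0.
Qed.

End GeneratorsCommute.

(** * Convergence of the truncated traces and their commutators *)

Section Centrality.
Variables (F : numFieldType) (N : nat) (Fr Y : pzRingType) (kF : {rmorphism fps F -> Fr}).
Local Notation h := (fvar F).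
Hypothesis kFC : forall k x, kF k * x = x * kF k.
Hypothesis hinj : forall x, kF h * x = 0 -> x = 0.
Variables (D : {rmorphism Fr -> Y}) (T Tp t tp : nat -> 'M[Fr]_N) (w C : Fr) (g : nat -> F).
Hypothesis Dsurj : forall y, exists x, D x = y.
Hypotheses (T0 : T 0%N = 1) (TS : forall r i j, T r.+1 i j = kF h * t r i j).
Hypothesis TpE : forall r i j, Tp r i j = ((r == 0%N) && (i == j))%:R - kF h * tp r i j.
Hypotheses (wE : w = kF (fconst 2^-1 * h) * C) (DC : D C = D (kF (fconst (- N%:R)))).
Hypothesis g_spec : g 0%N = 1 /\
  forall r, sshiftN N%:R g r = g r - (if (2 <= r)%N then g (r - 2)%N else 0).
Let gB i := kF (fconst (g i) * h ^+ i).
Local Notation Q0 := (rexpand (rcoef N (kF h)) 0).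
Local Notation Qb y := (rexpand (rbcoef N (kF h) gB) y).
Hypothesis defectN : forall x y i j,
  exists2 z, D z = 0 & defect Q0 Q0 (atN T) (atN T) x y i j = kF (h ^+ 2) * z.
Hypothesis defectP : forall x y i j,
  exists2 z, D z = 0 & defect Q0 Q0 (atP Tp) (atP Tp) x y i j = kF (h ^+ 2) * z.
Hypothesis defectX : forall x y i j,
  exists2 z, D z = 0 & defect (Qb w) (Qb (- w)) (atN T) (atP Tp) x y i j = kF (h ^+ 2) * z.
Hypothesis gen_ind : forall P : Fr -> Prop, (forall x y, P x -> P y -> P (x + y)) ->
  (forall x y, P x -> P y -> P (x * y)) -> (forall k, P (kF k)) -> P C ->
  (forall r i j, P (t r i j)) -> (forall r i j, P (tp r i j)) -> forall x, P x.

Local Notation Ih := (Ih kF D t).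
Local Notation AI n := (@AI F N Fr Y kF D t n).
Local Notation smooth := (smooth kF D t).
Variables (m : nat) (e0 : 'S_m -> F) (c : 'I_m -> F) (chi : ('I_m -> F) -> F).
Hypothesis e0J : forall b, conv (jm F b) e0 =1 fun s => c b * e0 s.
Hypotheses (e0V : jvalue e0 chi) (chi1 : chi c = 1).


Let sm b : smooth b.
Proof. exact: (smooth_all kFC hinj Dsurj T0 TS TpE wE DC g_spec defectN defectX gen_ind). Qed.
Let I0 p n : Ih p n 0. Proof. by have [] := Ih_left kFC t Dsurj p n. Qed.
Let IB p n x y : Ih p n x -> Ih p n y -> Ih p n (x - y).
Proof. by have [_ IB _] := Ih_left kFC t Dsurj p n; apply: IB. Qed.
Let IM p n x y : Ih p n x -> Ih p n (y * x).
Proof. by have [_ _ IM] := Ih_left kFC t Dsurj p n; apply: IM. Qed.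
Let ID p n x y : Ih p n x -> Ih p n y -> Ih p n (x + y). Proof. exact: Ih_add. Qed.
Let I_sum p n (J : Type) (r : seq J) (P : pred J) (f : J -> Y) :
  (forall i, P i -> Ih p n (f i)) -> Ih p n (\sum_(i <- r | P i) f i).
Proof. by move=> If; apply: (big_ind (Ih p n)) => // x y; apply: ID. Qed.

Local Notation kY := (D \o kF).
Let TY r := map_mx D (T r).
Let TpY r := map_mx D (Tp r).
Local Notation qtY k M S := (qt kY TY TpY e0 c k M S).

Lemma sshiftP_stable (B : pzRingType) M n (v : B) f r : v ^+ n = 0 -> (n + r <= M)%N ->
  sshiftP M v f r = sshiftP (n + r) v f r.
Proof.
move=> vn nM; apply: (@sum_ord_cut B (fun i => (v ^+ (i - r) * f i) *+ 'C(i, r))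
  (fun i => (v ^+ (i - r) * f i) *+ 'C(i, r))) => // i ni.
have /subnK <- : (n <= i - r)%N by lia.
by rewrite exprD vn mulr0 mul0r mul0rn.
Qed.

(** Modulo h^n the coefficient of u^s in T^+(u + hc) involves only the coefficients of T^+ of index
    below n + s. *)
Lemma qt_stable (A : pzRingType) (kK : {rmorphism fps F -> A}) (U Up : nat -> 'M[A]_N) n k M S :
  kK (h ^+ n) = 0 -> (n + S <= M)%N ->
  qt kK U Up e0 c k M S = qt kK U Up e0 c k (n + S) S.
Proof.
move=> kn nM.
have plusE M' r : (n + S <= M')%N -> (r < S)%N ->
    qt_plus_prod kK Up c M' r = qt_plus_prod kK Up c (n + S) r.
  move=> nM'; rewrite /qt_plus_prod; elim: (enum _) r => [|a s IHs] r rS //=.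
  apply: eq_smul => i ir; last by apply: IHs; apply: leq_ltn_trans ir rS.
  have xn : ((kK (fconst (c a) * h))%:M : 'M[A]_N) ^+ n = 0.
    by rewrite -rmorphXn -rmorphXn exprMn rmorphM kn mulr0 raddf0.
  by congr tens_at; rewrite !(sshiftP_stable _ xn) //; lia.
rewrite /qt; congr (\tr (_ *m _)); apply: eq_bigr => s _.
by rewrite plusE.
Qed.

Lemma qt_stable_Ih k S p n M M' : (n + S <= M)%N -> (n + S <= M')%N -> Ih p n (qtY k M S - qtY k M' S).
Proof.
move=> nM nM'; rewrite -!(map_qt D) -rmorphB; apply: (AI_Ih kFC Dsurj).
rewrite rmorphB !(map_qt (nilproj n kF D)).
rewrite (qt_stable (kK := nilscal n kF D) _ _ _ (nilscal_hn n kF D) nM).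
rewrite (qt_stable (kK := nilscal n kF D) _ _ _ (nilscal_hn n kF D) nM') subrr.
exact: AI0.
Qed.

(** The additional terms have late coefficients of the inverses of T as right factors. *)
Lemma qt_tail k p n : exists R, forall S S' M, (R <= S)%N -> (S <= S')%N -> Ih p n (qtY k M S' - qtY k M S).
Proof.
have [R HR] := qt_minus_prod_small kFC hinj Dsurj T0 TS TpE wE DC g_spec defectN defectX gen_ind c p n.
(* For s >= R + |k| the index s - k of the second half is at least R. *)
exists (R + `|k|)%N => S S' M RS SS'; rewrite /qt -raddfB -mulmxBr.
have Imx (X Z : 'M[Y]_(tdim N m)) : (forall x z, Ih p n (Z x z)) -> forall x z, Ih p n ((X *m Z) x z).
  by move=> IZ x z; rewrite mxE; apply: I_sum => i _; apply: IM.
apply: I_sum => x _; apply: (Imx) => {}x z; rewrite -(subnKC SS') big_split_ord /= addrAC subrr add0r summxE.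
apply: I_sum => s _; apply: Imx => {}x {}z; rewrite /atN; case: ifP => _; last by rewrite mxE.
by apply: HR; lia.
Qed.

(** The two cut-offs of [qt] tied together as in [Ttrunc]. The arguments below fix S first and let M
    grow, and are transferred by [qt_seq_tail]. *)
Definition qt_seq k M := qtY k M (m * M).+1.

Lemma qt_seq_tail k p n : exists R, forall S M, (R <= S)%N -> (S <= M)%N -> Ih p n (qt_seq k M - qtY k M S).
Proof.
have [R HR] := qt_tail k p n; exists R.+1 => S M RS SM; rewrite /qt_seq.
(* For m = 0 the range (m M) + 1 does not grow with M and may be shorter than S; but then the
   products are empty and only s = 0 contributes. *)
case: (posnP m) => [m0|m_gt0]; last by apply: HR; [apply: ltnW | rewrite -[S]mul1n leqW // leq_mul].
suff -> : qtY k M S = qtY k M (m * M).+1 by rewrite subrr.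
rewrite /qt; congr (\tr (_ *m _)).
apply: (@sum_ord_cut _ (fun s : nat => qt_plus_prod kY TpY c M s *m atN (qt_minus_prod kY TY c) (k - s%:Z))
  (fun s : nat => qt_plus_prod kY TpY c M s *m atN (qt_minus_prod kY TY c) (k - s%:Z))) => [|s|//].
  by rewrite m0; apply: leq_trans RS.
case: s => // s _; rewrite (_ : qt_plus_prod _ _ _ _ _ = 0) ?mul0mx //.
by rewrite /qt_plus_prod enumT -enumT (size0nil (s := enum 'I_m)) // size_enum_ord.
Qed.

Lemma qt_seq_cauchy k p n : exists M0, forall M M', (M0 <= M)%N -> (M0 <= M')%N ->
  Ih p n (qt_seq k M - qt_seq k M').
Proof.
have [R HR] := qt_seq_tail k p n; exists (n + R)%N => M M' le le'.
have RM := leq_trans (leq_addl _ _) le; have RM' := leq_trans (leq_addl _ _) le'.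
rewrite -(subrK (qtY k M R) (qt_seq k M)) -addrA; apply: ID; first exact: HR.
rewrite -(subrK (qtY k M' R) (qtY k M R)) -addrA; apply: ID; first exact: qt_stable_Ih.
by rewrite -opprB -sub0r; apply: IB => //; apply: HR.
Qed.

(** Known for generators and extended to products by continuity of right multiplication. For a
    generator the sequence is replaced by the sum of fixed length S; the error is multiplied from
    both sides, so it is made small for the larger of p and q. *)
Lemma qt_seq_commute k b p n : exists M0, forall M, (M0 <= M)%N ->
  Ih p n (b * qt_seq k M - qt_seq k M * b).
Proof.
have [x <-] := Dsurj b; move: x p n.
have from_gen b' : (forall p n, exists S0, forall S, (S0 <= S)%N -> exists M0, forall M, (M0 <= M)%N ->
      Ih p n (b' * qtY k M S - qtY k M S * b')) ->
    forall p n, exists M0, forall M, (M0 <= M)%N -> Ih p n (b' * qt_seq k M - qt_seq k M * b').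
  move=> Hb p n; have [S0 HS0] := Hb p n; have [q Hq] := sm b' p n.
  have [R HR] := qt_seq_tail k (maxn p q) n; set S := maxn S0 R.
  have [M0 HM0] := HS0 S (leq_maxl _ _); exists (maxn M0 S) => M; rewrite geq_max => /andP[M0M SM].
  have Id := HR S M (leq_maxr _ _) SM; set d := _ - _ in Id.
  have -> : qt_seq k M = d + qtY k M S by rewrite subrK.
  rewrite mulrDr mulrDl opprD addrACA; apply: ID; last exact: HM0.
  apply: IB; first by apply: IM; apply: Ih_antitone Id; rewrite ?leq_maxl.
  by apply: Hq; apply: Ih_antitone Id; rewrite ?leq_maxr.
have scC l p n : exists M0, forall M, (M0 <= M)%N -> Ih p n (D (kF l) * qt_seq k M - qt_seq k M * D (kF l)).
  exists 0%N => M _; have [z <-] := Dsurj (qt_seq k M); rewrite -!(rmorphM D) kFC subrr; exact: I0.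
have com r := commute_generators kFC hinj Dsurj T0 TS TpE wE DC g_spec defectN defectP defectX gen_ind
  e0J e0V chi1 k r.
apply: gen_ind => [x y Hx Hy p n|x y Hx Hy p n|l p n|p n|r i j|r i j].
- have [M1 H1] := Hx p n; have [M2 H2] := Hy p n; exists (maxn M1 M2) => M; rewrite geq_max => /andP[l1 l2].
  by rewrite rmorphD mulrDl mulrDr opprD addrACA; apply: ID; [apply: H1 | apply: H2].
- have [q Hq] := sm (D y) p n; have [M1 H1] := Hx q n; have [M2 H2] := Hy p n.
  exists (maxn M1 M2) => M; rewrite geq_max => /andP[l1 l2].
  rewrite rmorphM; have -> : D x * D y * qt_seq k M - qt_seq k M * (D x * D y) =
    D x * (D y * qt_seq k M - qt_seq k M * D y) + (D x * qt_seq k M - qt_seq k M * D x) * D y.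
    by rewrite mulrBr mulrBl !mulrA addrA subrK.
  by apply: ID; [apply: IM; apply: H2 | apply: Hq; apply: H1].
- exact: scC.
- by rewrite DC; apply: scC.
- apply: from_gen => p n; have [S0 HS0] := com r p n; exists S0 => S /HS0[M0 HM0]; exists M0 => M /HM0 H.
  by have [] := H i j.
apply: from_gen => p n; have [S0 HS0] := com r p n; exists S0 => S /HS0[M0 HM0]; exists M0 => M /HM0 H.
by have [] := H i j.
Qed.

End Centrality.

(** * Limits and products in the completed algebra *)

Section CompletedAlgebra.
Variables (R : realType) (N : nat) (g : nat -> R[i]) (c : R[i]).
Local Notation A := (DYc N g c).
Local Notation I := (@DYIh R N g c).
Local Notation comp := Defs.comp.
Local Notation quo := (@quo R N g c).
Hypothesis I_antitone : forall p q n k x, (p <= q)%N -> (n <= k)%N -> x \in I q k -> x \in I p n.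
Hypothesis I_left : forall p n (x y : A), x \in I p n -> y * x \in I p n.
Hypothesis I_smooth : forall (b : A) p n, exists q, forall x, x \in I q n -> x * b \in I p n.

Lemma quoE p n x y : quo p n x = quo p n y <-> x - y \in I p n.
Proof. by rewrite Quotient.idealrBE; split=> /eqP. Qed.

Lemma quo_antitone p q n k x y : (p <= q)%N -> (n <= k)%N -> quo q k x = quo q k y -> quo p n x = quo p n y.
Proof. by move=> pq nk /quoE xy; apply/quoE; apply: I_antitone xy. Qed.

Lemma quo_surj p n (z : DYquo N g c p n) : exists x, quo p n x = z.
Proof. by exists (repr (z : {ideal_quot I p n})); exact: reprK. Qed.

Lemma DYt_from_classes (f : nat -> nat -> A) :
  (forall p n q k, (p <= q)%N -> (n <= k)%N -> quo p n (f q k) = quo p n (f p n)) ->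
  exists x : DYt N g c, forall p n, comp x p n = quo p n (f p n).
Proof.
move=> ff; unshelve eexists (Build_DYt (comp := fun p n => quo p n (f p n)) _) => //.
move=> p n q k x pq nk xE; exact: (etrans (quo_antitone pq nk xE) (ff _ _ _ _ pq nk)).
Qed.

Lemma cauchy_lim (s : nat -> A) :
  (forall p n, exists M0, forall M M', (M0 <= M)%N -> (M0 <= M')%N -> s M - s M' \in I p n) ->
  exists x, is_lim s x.
Proof.
move=> sC; have /choice[M0 HM0] : forall pn, exists M0, forall M M', (M0 <= M)%N -> (M0 <= M')%N -> s M - s M' \in I pn.1 pn.2.
  by move=> [p n]; apply: sC.
have [|x xE] := @DYt_from_classes (fun p n => s (M0 (p, n))); last first.
  by exists x => p n; exists (M0 (p, n)) => M le; rewrite xE; apply/quoE/(HM0 (p, n)).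
move=> p n q k pq nk; set M := maxn (M0 (p, n)) (M0 (q, k)).
transitivity (quo p n (s M)); last by apply/quoE/(HM0 (p, n)); rewrite ?leq_maxl.
by apply: (quo_antitone pq nk); apply/quoE/(HM0 (q, k)); rewrite ?leq_maxr.
Qed.

(** The component at (p, n) is computed from a representative of y at (p, n) and one of x at a level
    q. This level depends on the former representative, through continuity of right multiplication
    by it. *)
Lemma exists_prod (x y : DYt N g c) : exists z, is_prod x y z.
Proof.
have lift (v : DYt N g c) : exists f : nat -> nat -> A, forall p n, quo p n (f p n) = comp v p n.
  have /choice[f fE] : forall pn : nat * nat, exists a, quo pn.1 pn.2 a = comp v pn.1 pn.2.
    by move=> [p n]; apply: quo_surj.
  by exists (fun p n => f (p, n)) => p n; apply: (fE (p, n)).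
have [fy fyE] := lift y.
have [fx fxE] := lift x.
have /choice[q Hq] : forall pn : nat * nat, exists q, (pn.1 <= q)%N /\
    forall a, a \in I q pn.2 -> a * fy pn.1 pn.2 \in I pn.1 pn.2.
  move=> [p n] /=; have [q Hq] := I_smooth (fy p n) p n; exists (maxn p q); split; first exact: leq_maxl.
  by move=> a Ia; apply: Hq; apply: I_antitone Ia; rewrite ?leq_maxr.
pose f p n := fx (q (p, n)) n * fy p n.
have prodE p n a b : quo (q (p, n)) n a = comp x (q (p, n)) n -> quo p n b = comp y p n ->
    quo p n (a * b) = quo p n (f p n).
  move=> ax by_; apply/quoE; have [/= pq Hqa] := Hq (p, n).
  have -> : a * b - f p n = a * (b - fy p n) + (a - fx (q (p, n)) n) * fy p n.
    by rewrite mulrBr mulrBl addrA subrK.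
  apply: rpredD; first by apply: I_left; apply/quoE; rewrite by_ fyE.
  by apply: Hqa; apply/quoE; rewrite ax fxE.
have [|z zE] := @DYt_from_classes f.
  move=> p n q' k pq nk; have [/= pq1 _] := Hq (p, n); have [/= pq2 _] := Hq (q', k).
  set Q := maxn (q (p, n)) (q (q', k)).
  have aE := fxE Q k; have bE := fyE q' k.
  transitivity (quo p n (fx Q k * fy q' k)); last first.
    apply: prodE; first by apply: (comp_compat _ nk aE); apply: leq_maxl.
    exact: (comp_compat pq nk bE).
  apply: (quo_antitone pq nk); apply/esym/prodE => //.
  by apply: (comp_compat _ (leqnn k) aE); apply: leq_maxr.
exists z => p n; have [/= pq _] := Hq (p, n); exists (q (p, n)), n => a b ax by_.
by rewrite zE; apply: prodE => //; apply: (comp_compat pq (leqnn n) by_).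
Qed.

(** Both products are evaluated on the same representatives, s M for x and b for y, at a level high
    enough for both. *)
Lemma lim_central (s : nat -> A) (x : DYt N g c) : is_lim s x ->
  (forall b p n, exists M0, forall M, (M0 <= M)%N -> b * s M - s M * b \in I p n) -> DYt_central x.
Proof.
move=> sx sC y; have [z zP] := exists_prod x y; have [z' z'P] := exists_prod y x.
exists z; split=> //; suff -> : z = z' by [].
apply: DYt_ext => p n; have [q [k zE]] := zP p n; have [q' [k' z'E]] := z'P p n.
have [b bE] := quo_surj (comp y (maxn q q') (maxn k k')).
have [M1 H1] := sx (maxn q q') (maxn k k'); have [M2 H2] := sC b p n.
set M := maxn M1 M2.
have sE := H1 M (leq_maxl _ _).
have s1 := comp_compat (leq_maxl q q') (leq_maxl k k') sE.
have s2 := comp_compat (leq_maxr q q') (leq_maxr k k') sE.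
have b1 := comp_compat (leq_maxl q q') (leq_maxl k k') bE.
have b2 := comp_compat (leq_maxr q q') (leq_maxr k k') bE.
apply: (etrans (esym (zE _ _ s1 b1))); apply: (etrans _ (z'E _ _ b2 s2)).
by apply/esym/quoE/H2; rewrite leq_maxr.
Qed.

End CompletedAlgebra.

(** * The double Yangian as an instance of the abstract setting *)

Section DoubleYangianInstance.
Variables (R : realType) (N : nat) (g : nat -> R[i]) (c : R[i]).
Local Notation K := (fps R[i]).
Local Notation h := (fvar R[i] : K).
Local Notation Fr := (dyfree R N).

Definition fscal : {rmorphism K -> Fr} := in_alg Fr.
Definition DYmor : {rmorphism Fr -> DYc N g c} := rproj _ \o rproj (dyrel g).
Definition tfree r : 'M[Fr]_N := \matrix_(i, j) gen R (Some (false, i, j, r)).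
Definition tpfree r : 'M[Fr]_N := \matrix_(i, j) gen R (Some (true, i, j, r)).

Lemma fscalE k x : fscal k * x = k *: x.
Proof. exact/esym/malg_scal_mul. Qed.

Lemma fscalC k x : fscal k * x = x * fscal k.
Proof. exact: malg_scal_central. Qed.

Lemma fscal_h_inj x : fscal h * x = 0 -> x = 0.
Proof. by rewrite fscalE; apply: malg_fvar_inj. Qed.

Lemma DYmor_surj y : exists x, DYmor x = y.
Proof.
have [y' <-] := rproj_surj y; have [x <-] := rproj_surj y'.
by exists x.
Qed.

Lemma Tfree0 : Tfree R N 0 = 1. Proof. by []. Qed.

Lemma TfreeS r i j : Tfree R N r.+1 i j = fscal h * tfree r i j.
Proof. by rewrite !mxE fscalE. Qed.

Lemma TpfreeE r i j : Tpfree R N r i j = ((r == 0%N) && (i == j))%:R - fscal h * tpfree r i j.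
Proof. by rewrite !mxE fscalE; case: (r == 0%N); rewrite !mxE. Qed.

Lemma DYmor_C : DYmor (genC R N) = DYmor (fscal (fconst c)).
Proof.
apply/eqP; rewrite -subr_eq0 -rmorphB; apply/eqP; apply: rproj_gen.
by rewrite rmorphB.
Qed.

Let gB i := fscal (fconst (g i) * h ^+ i).
Let w : Fr := (fconst 2^-1 * h) *: genC R N.
Local Notation Q0 := (rexpand (rcoef N (fscal h)) 0).
Local Notation Qb y := (rexpand (rbcoef N (fscal h) gB) y).

Lemma DYmor_rel (E : 'M[Fr]_(tdim N 2)) x y i j n z : E \in dy_series_rel N g x y ->
  fscal (h ^+ n) * z = E i j -> DYmor z = 0.
Proof.
move=> EE; rewrite fscalE => zE; have dz : rproj (dyrel g) z = 0.
  by apply: rproj_gen; right; exists x, y, E => //; exists i, j, n.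
by rewrite /DYmor /= dz rmorph0.
Qed.

Lemma DYmor_relN x y i j n z :
  fscal (h ^+ n) * z = defect Q0 Q0 (atN (Tfree R N)) (atN (Tfree R N)) x y i j -> DYmor z = 0.
Proof. by apply: (@DYmor_rel _ x y); apply: mem_head. Qed.

Lemma DYmor_relP x y i j n z :
  fscal (h ^+ n) * z = defect Q0 Q0 (atP (Tpfree R N)) (atP (Tpfree R N)) x y i j -> DYmor z = 0.
Proof. by apply: (@DYmor_rel _ x y); rewrite in_cons mem_head orbT. Qed.

Lemma DYmor_relX x y i j n z :
  fscal (h ^+ n) * z = defect (Qb w) (Qb (- w)) (atN (Tfree R N)) (atP (Tpfree R N)) x y i j -> DYmor z = 0.
Proof.
have mem3 (U : eqType) (u v z' : U) : z' \in [:: u; v; z'] by rewrite !inE eqxx !orbT.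
apply: (@DYmor_rel _ x y); rewrite /dy_series_rel.
exact: mem3.
Qed.

Lemma dyfree_ind (P : Fr -> Prop) : (forall x y, P x -> P y -> P (x + y)) ->
  (forall x y, P x -> P y -> P (x * y)) -> (forall k, P (fscal k)) -> P (genC R N) ->
  (forall r i j, P (tfree r i j)) -> (forall r i j, P (tpfree r i j)) -> forall x, P x.
Proof.
move=> PD PM Pk PC Pt Ptp; apply: malg_gen_ind => // -[[[[b i] j] r]|] //.
by case: b; [have := Ptp r i j | have := Pt r i j]; rewrite mxE.
Qed.

Lemma DYIhE p n x : x \in DYIh p n <-> Ih fscal DYmor tfree p n x.
Proof.
have DYI_Igen q y : DYI q y <-> Igen DYmor tfree q y.
  split=> Iy J idJ Jt; apply: Iy => // i j r qr; have := Jt i j r qr; by rewrite mxE.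
by split=> [/asboolP|] [y [z [/DYI_Igen Iy ->]]]; [|apply/asboolP]; exists y, z.
Qed.

End DoubleYangianInstance.

(** * Centrality of the coefficients *)

Section Centre.
Variables (R : realType) (N : nat) (g : nat -> R[i]).
Hypothesis g_spec : is_gseries N g.
Local Notation h := (fvar R[i] : fps R[i]).
Local Notation c := (- N%:R : R[i]).
Local Notation A := (DYc N g c).
Let kF := fscal R N.
Let D := DYmor N g c.
Let t := @tfree R N.
Let w : dyfree R N := (fconst 2^-1 * h) *: genC R N.

Let kFC k x : kF k * x = x * kF k. Proof. exact: fscalC. Qed.
Let hinj x : kF h * x = 0 -> x = 0. Proof. exact: fscal_h_inj. Qed.
Let wE : w = kF (fconst 2^-1 * h) * genC R N. Proof. exact/esym/fscalE. Qed.
Let surj := @DYmor_surj R N g c.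
Let dN := defectN_h2 kFC (Tfree0 R N) (@TfreeS R N) (@DYmor_relN R N g c).
Let dP := defectP_h2 kFC (@TpfreeE R N) (@DYmor_relP R N g c).
Let dX := defectX_h2 kFC (Tfree0 R N) (@TfreeS R N) (@TpfreeE R N) wE (@DYmor_relX R N g c).

Lemma DYIh_antitone p q n k (x : A) : (p <= q)%N -> (n <= k)%N -> x \in DYIh q k -> x \in DYIh p n.
Proof. by move=> pq nk /DYIhE Ix; apply/DYIhE; apply: Ih_antitone Ix. Qed.

Lemma DYIh_left p n (x y : A) : x \in DYIh p n -> y * x \in DYIh p n.
Proof.
move=> /DYIhE Ix; apply/DYIhE.
by have [_ _ IM] := Ih_left kFC t surj p n; apply: IM.
Qed.

Lemma DYIh_smooth (b : A) p n : exists q, forall x, x \in DYIh q n -> x * b \in DYIh p n.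
Proof.
have [q Hq] := smooth_all kFC hinj surj (Tfree0 R N) (@TfreeS R N) (@TpfreeE R N) wE (DYmor_C N g c) g_spec
  dN dX (@dyfree_ind R N) b p n.
by exists q => x /DYIhE Ix; apply/DYIhE; apply: Hq.
Qed.

Variables (m : nat) (mu : seq nat) (U : syt m mu) (e : 'S_m -> R[i]).
Hypotheses (mu_part : is_part m mu) (e_spec : young_idempotent U e).

Lemma Ttrunc_qt_seq k M :
  Ttrunc N g U e k M = qt_seq kF D (Tfree R N) (Tpfree R N) e (fun a => (content U a)%:~R) k M.
Proof. by []. Qed.

Lemma Ttrunc_cauchy k p n : exists M0, forall M M', (M0 <= M)%N -> (M0 <= M')%N ->
  Ttrunc N g U e k M - Ttrunc N g U e k M' \in DYIh p n.
Proof.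
have [M0 H] := qt_seq_cauchy kFC hinj surj (Tfree0 R N) (@TfreeS R N) (@TpfreeE R N) wE (DYmor_C N g c) g_spec
  dN dX (@dyfree_ind R N) e (fun a => (content U a)%:~R) k p n.
by exists M0 => M M' le le'; apply/DYIhE; rewrite !Ttrunc_qt_seq; apply: H.
Qed.

Lemma Ttrunc_commute k (b : A) p n : exists M0, forall M, (M0 <= M)%N ->
  b * Ttrunc N g U e k M - Ttrunc N g U e k M * b \in DYIh p n.
Proof.
have [M0 H] := qt_seq_commute kFC hinj surj (Tfree0 R N) (@TfreeS R N) (@TpfreeE R N) wE (DYmor_C N g c) g_spec
  dN dP dX (@dyfree_ind R N) (young_idempotent_jml mu_part e_spec) (young_idempotent_value mu_part e_spec)
  (jchi_same _ (content U)) k b p n.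
by exists M0 => M le; apply/DYIhE; rewrite !Ttrunc_qt_seq; apply: H.
Qed.

End Centre.

Theorem theorem4p4 (R : realType) (N : nat) (N_gt0 : (0 < N)%N)
  (g : nat -> R[i]) (g_spec : is_gseries N g)
  (m : nat) (mu : seq nat) (mu_part : is_part m mu) (mu_rows : (size mu <= N)%N)
  (U : syt m mu) (e : 'S_m -> R[i]) (e_spec : young_idempotent U e) :
  forall k : int, exists x : DYt N g (- N%:R),
    is_Tcoef U e k x /\ DYt_central x.
Proof.
move=> k; have [x xlim] := cauchy_lim (@DYIh_antitone R N g) (Ttrunc_cauchy g_spec U e k).
exists x; split=> //; apply: (lim_central (@DYIh_antitone R N g) (@DYIh_left R N g) (DYIh_smooth g_spec) xlim).
exact: (Ttrunc_commute g_spec mu_part e_spec k).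
Qed.
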